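(* Let $h:[1,+\infty)\to[1,+\infty)$ be a function such that $\lim_{x\to\infty}h(x)=+\infty$. Let $E$ be a closed subset of $\mathbb{T}$ such that $\mathrm{cap}(E)=0$. Then there is $\varphi\in A(\mathbb{D})\cap\mathcal{D}$, $\varphi(\mathbb{D})\subset\mathbb{D}$, such that: (1) $E_\varphi(1)=E$; (2) $C_\varphi$ is in the Hilbert–Schmidt class in $\mathcal{D}$; (3) $\displaystyle\int^1\frac{\mathrm{cap}(E_\varphi(s))}{1-s}\,\log\frac{1}{1-s}\;h\!\left(\frac{1}{1-s}\right)ds=+\infty$.
   Context: $\mathbb{D}$ is the open unit disc in $\mathbb{C}$, $\mathbb{T}=\partial\mathbb{D}$, and $A(\mathbb{D})$ is the disc algebra (functions holomorphic on $\mathbb{D}$ and continuous on $\overline{\mathbb{D}}$). The Dirichlet space $\mathcal{D}$ consists of the holomorphic functions $f$ on $\mathbb{D}$ with $\mathcal{D}(f)=\int_{\mathbb{D}}|f'(z)|^2\,dA(z)<\infty$, where $dA=dx\,dy/\pi$, with norm $\|f\|_{\mathcal{D}}^2=|f(0)|^2+\mathcal{D}(f)$. The composition operator is $C_\varphi(f)=f\circ\varphi$, $f\in\mathcal{D}$. For $0<s\le1$, the level set is $E_\varphi(s)=\{\zeta\in\mathbb{T}:|\varphi(\zeta)|\ge s\}$. In (3), the omitted lower limit means that the integral diverges at the endpoint $s=1$. For a Borel probability measure $\mu$ on $\mathbb{T}$ with Fourier coefficients $\widehat{\mu}(n)$, let $I_0(\mu)=\sum_{n=1}^\infty\frac{|\widehat{\mu}(n)|^2}{n}$.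 For a closed set $F\subset\mathbb{T}$, the logarithmic capacity is $\mathrm{cap}(F)=1/\inf\{I_0(\mu):\mu\text{ is a probability measure on }F\}$.
   Formalization: E is assumed nonempty: for E empty (cap(E) = 0), E_φ(1) = ∅ forces max|φ| < 1 on the circle, so cap(E_φ(s)) = 0 for s near 1 and (3) fails. *)

(* Defs.v *)
From HB Require Import structures.
From mathcomp Require Import all_boot all_order all_algebra.
From mathcomp Require Import complex.
From mathcomp Require Import all_classical all_reals all_analysis.

Set Implicit Arguments.
Unset Strict Implicit.
Unset Printing Implicit Defensive.

Import Order.TTheory GRing.Theory Num.Theory.
Import numFieldNormedType.Exports.

Local Open Scope classical_set_scope.
Local Open Scope ring_scope.

(* The complex plane is [R[i]^o]: the regular module over the field [R[i]]
   carries the normed topology in which [derivable] is complex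
   differentiability. Its norm [`|z|] is [R[i]]-valued (with zero imaginary
   part); [normc z] is the same modulus as an element of [R]. *)
Notation cplane R := (R[i]^o).

Section Dirichlet.
Context {R : realType}.
Implicit Types (f g phi : cplane R -> cplane R) (F : set (cplane R)).

Definition modulus (z : cplane R) : R := Normc.normc z.

Definition unit_disc : set (cplane R) := [set z | modulus z < 1].
Definition closed_disc : set (cplane R) := [set z | modulus z <= 1].
Definition unit_circle : set (cplane R) := [set z | modulus z = 1].

Definition holomorphic f := forall z, unit_disc z -> derivable f z 1.

Definition disc_algebra f :=
  {within closed_disc, continuous f} /\ holomorphic f.

(* dA = dx dy / pi on the unit disc; [(x, y)] is identified with x + i y. *)
Definition of_pair (p : R * R) : cplane R := Complex p.1 p.2.
Definition disc_pair : set (R * R) := [set p | unit_disc (of_pair p)].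
Definition plane_measure := (@lebesgue_measure R \x @lebesgue_measure R)%E.

Definition dirichlet_integral f : \bar R :=
  ((pi^-1)%:E * \int[plane_measure]_(p in disc_pair)
                  (modulus (derive1 f (of_pair p)) ^+ 2)%:E)%E.

(* Elements of the Dirichlet space are represented by functions on the whole
   plane; only their restrictions to the unit disc matter. *)
Definition dirichlet f := holomorphic f /\ (dirichlet_integral f < +oo)%E.

Definition dirichlet_norm2 f : \bar R :=
  ((modulus (f 0) ^+ 2)%:E + dirichlet_integral f)%E.

(* The inner product polarizing [dirichlet_norm2]:
   <f, g> = f(0) conj(g(0)) + \int f' conj(g') dA. *)
Definition dirichlet_inner f g : cplane R :=
  let k (p : R * R) : R[i] :=
    derive1 f (of_pair p) * conjc (derive1 g (of_pair p)) in
  f 0 * conjc (g 0) +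
  Complex (pi^-1 * \int[plane_measure]_(p in disc_pair) complex.Re (k p))
          (pi^-1 * \int[plane_measure]_(p in disc_pair) complex.Im (k p)).

Definition orthonormal_basis (e : nat -> cplane R -> cplane R) :=
  [/\ forall n, dirichlet (e n),
      forall n m, dirichlet_inner (e n) (e m) = (n == m)%:R
    & forall f, dirichlet f -> (forall n, dirichlet_inner f (e n) = 0) ->
        forall z, unit_disc z -> f z = 0].

Definition bounded_operator
    (T : (cplane R -> cplane R) -> (cplane R -> cplane R)) :=
  [/\ forall f, dirichlet f -> dirichlet (T f),
      forall (a : R[i]) f g, dirichlet f -> dirichlet g ->
        forall z, unit_disc z ->
          T (fun w => a * f w + g w) z = a * T f z + T g z
    & exists M : R, forall f, dirichlet f ->
        (dirichlet_norm2 (T f) <= (M ^+ 2)%:E * dirichlet_norm2 f)%E].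

Definition hilbert_schmidt
    (T : (cplane R -> cplane R) -> (cplane R -> cplane R)) :=
  bounded_operator T /\
  exists2 e, orthonormal_basis e &
    (\sum_(0 <= n <oo) dirichlet_norm2 (T (e n)) < +oo)%E.

Definition composition_operator phi f := f \o phi.

Definition level_set phi (s : R) : set (cplane R) :=
  [set z | unit_circle z /\ s <= modulus (phi z)].

(* The plane with its Borel sigma-algebra. A Borel probability measure on a
   closed set [F] is a Borel probability on the plane giving mass 1 to [F]. *)
Definition borel_plane := g_sigma_algebraType (@open (cplane R)).

(* \int conj(z)^n dmu(z) = \int e^{-int} dmu *)
Definition fourier_coef (mu : probability borel_plane R) (n : nat) : cplane R :=
  Complex (\int[mu]_(z in unit_circle) complex.Re (conjc (z : R[i]) ^+ n))
          (\int[mu]_(z in unit_circle) complex.Im (conjc (z : R[i]) ^+ n)).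

Definition log_energy (mu : probability borel_plane R) : \bar R :=
  (\sum_(1 <= n <oo) (modulus (fourier_coef mu n) ^+ 2 / n%:R)%:E)%E.

(* [0^-1 = +oo] and [+oo^-1 = 0] in [\bar R]. *)
Definition log_capacity F : \bar R :=
  ((ereal_inf [set log_energy mu | mu in
      [set mu : probability borel_plane R | mu F = 1%E]])^-1)%E.

End Dirichlet.

(* Main.v *)
Require Import Defs.
From HB Require Import structures.
From mathcomp Require Import all_boot all_order all_algebra.
From mathcomp Require Import complex.
From mathcomp Require Import all_classical all_reals all_analysis.
From mathcomp Require Import measurable_realfun ring lra.

(** The function is [phi = 1 - exp (- g)] off [E] and [phi = 1] on [E], where [g] is
a series of logarithmic potentials that is infinite exactly on [E].

As [E] has capacity zero, it carries potentials of any height. For a height [V]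
there is a function [G], the potential of a nearly optimal probability measure
on a small neighbourhood of [E], with [Re G >= V - 2] on [E], real part bounded
below, bounded imaginary part, values bounded in terms of the distance to [E],
and Dirichlet energy at most a constant times [V]
([good_potential_exists]). The measure lives where [Re G >= V - 18] and has
energy at most [V + 1], so this set has capacity at least [1 / (V + 1)].
Such potentials exist because the energies of configurations of points of [E],
smeared along short arcs, cannot stay bounded ([energy_large], a compactness
argument), and because the potential of a near minimizer is almost
maximal on [E] ([near_minimizer], the variation of one point).
The potentials are polynomials, so no boundary values have to be studied.

Put [g = sum_j 2 ^ - j G_j / sqrt V_j] with [V_j] growing fast. The series
converges locally uniformly on the closed disc off [E], because [G_j] is bounded
at a fixed distance from [E] ([limit_exists]); its real part tends to infinity
at [E], because [2 ^ - j V_j / sqrt V_j] does. So [phi] belongs to the disc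
algebra ([peak_continuous], [peak_holomorphic]), and its level set for [s = 1]
is [E]. The energies satisfy [sum_j 2 ^ j (2 ^ - j / sqrt V_j) ^ 2 V_j < oo], so
[g] has finite Dirichlet integral ([g_energy]).

For the Hilbert-Schmidt property, real parts of [g] are nearly nonnegative and
imaginary parts are small, so [w = exp (- g)] satisfies
[1 - |1 - w| ^ 2 >= |w| / 2] ([one_sub_cexp]). Hence
[|phi'| / (1 - |phi| ^ 2) <= 2 |g'|] is square integrable over the disc.
Summing the norms of the images of the normalized monomials shows that this is
enough ([comp_hilbert_schmidt]); boundedness of the operator follows from the
pointwise Bergman estimate ([bergman]). That the normalized monomials are a
basis needs some function theory, developed from Goursat's theorem: Fourier
coefficients on circles, continuity of the derivative, and the fact that Taylor
coefficients determine a function.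

For the divergence, on the set where [Re G_j >= V_j - 18] one has
[|phi| >= 1 - exp (- X_j)] with [X_j = 2 ^ - j sqrt V_j / 2]
([peak_level_large]). So for [s] between [1 - exp (- X_j / 2)] and
[1 - exp (- X_j)] the level set has capacity at least [1 / (V_j + 1)], and this
interval contributes at least about [X_j ^ 2 / (4 V_j)], that is [4 ^ - j / 16],
times the values of [h]. The heights are chosen, depending on [h], so large
that [h] is at least [32 j 4 ^ j] there; the integral is then at least [j] for
every large [j]. *)

Set Implicit Arguments.
Unset Strict Implicit.
Unset Printing Implicit Defensive.

Import Order.TTheory GRing.Theory Num.Theory.
Import numFieldNormedType.Exports.

Local Open Scope classical_set_scope.
Local Open Scope ring_scope.

(** * Moduli, limits and derivatives in the complex plane *)

Section ComplexBasics.
Context {R : realType}.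
Implicit Types (z w : cplane R) (F : cplane R -> cplane R).

Lemma modM z w : modulus (z * w : cplane R) = modulus z * modulus w.
Proof. exact: Normc.normcM. Qed.

Lemma modN z : modulus (- z) = modulus z.
Proof. exact: normcN. Qed.

Lemma modD z w : modulus (z + w) <= modulus z + modulus w.
Proof. exact: le_normcD. Qed.

Lemma mod0 : modulus (0 : cplane R) = 0.
Proof. exact: Normc.normc0. Qed.

Lemma mod1 : modulus (1 : cplane R) = 1.
Proof. exact: Normc.normc1. Qed.

Lemma mod_sqr z : modulus z ^+ 2 = complex.Re z ^+ 2 + complex.Im z ^+ 2.
Proof. by case: z => a b; rewrite /modulus /= sqr_sqrtr// addr_ge0 ?sqr_ge0. Qed.

Lemma mod_ge0 z : 0 <= modulus z.
Proof. by case: z => a b; rewrite /modulus /= sqrtr_ge0. Qed.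

Lemma mod_eq0 z : modulus z = 0 -> z = 0.
Proof. exact: Normc.eq0_normc. Qed.

Lemma mod_gt0 z : (0 < modulus z) = (z != 0).
Proof.
rewrite lt_def mod_ge0 andbT; apply/idP/idP; apply: contra => /eqP.
  by move=> ->; rewrite mod0.
by move=> /mod_eq0 ->.
Qed.

Lemma modB z w : modulus (z - w) = modulus (w - z).
Proof. by rewrite -modN opprB. Qed.

Lemma modX z n : modulus (z ^+ n : cplane R) = modulus z ^+ n.
Proof. by elim: n => [|n IH]; rewrite ?expr0 ?mod1// !exprS modM IH. Qed.

Lemma modC (x : R) : modulus (Complex x 0 : cplane R) = `|x|.
Proof. by rewrite /modulus /= expr0n addr0 sqrtr_sqr. Qed.

Lemma normcplane z : `|z| = Complex (modulus z) 0.
Proof. by case: z. Qed.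

Lemma Re_le z : `|complex.Re z| <= modulus z.
Proof.
rewrite -ler_sqr ?nnegrE ?mod_ge0// mod_sqr real_normK ?num_real//.
by rewrite lerDl sqr_ge0.
Qed.

Lemma Im_le z : `|complex.Im z| <= modulus z.
Proof.
rewrite -ler_sqr ?nnegrE ?mod_ge0// mod_sqr real_normK ?num_real//.
by rewrite lerDr sqr_ge0.
Qed.

Lemma mod_le z : modulus z <= `|complex.Re z| + `|complex.Im z|.
Proof.
rewrite -ler_sqr ?nnegrE ?mod_ge0// ?addr_ge0// mod_sqr sqrrD !real_normK ?num_real//.
by rewrite -addrA lerD2l lerDr mulrn_wge0 // mulr_ge0.
Qed.

Lemma ReD z w : complex.Re (z + w) = complex.Re z + complex.Re w.
Proof. by case: z; case: w. Qed.
Lemma ImD z w : complex.Im (z + w) = complex.Im z + complex.Im w.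
Proof. by case: z; case: w. Qed.
Lemma ReN z : complex.Re (- z) = - complex.Re z.
Proof. by case: z. Qed.
Lemma ImN z : complex.Im (- z) = - complex.Im z.
Proof. by case: z. Qed.
Lemma ReM z w : complex.Re (z * w : cplane R) =
  complex.Re z * complex.Re w - complex.Im z * complex.Im w.
Proof. by case: z; case: w. Qed.
Lemma ImM z w : complex.Im (z * w : cplane R) =
  complex.Re z * complex.Im w + complex.Im z * complex.Re w.
Proof. by case: z; case: w. Qed.
Lemma ReJ z : complex.Re (conjc z) = complex.Re z.
Proof. by case: z. Qed.
Lemma ImJ z : complex.Im (conjc z) = - complex.Im z.
Proof. by case: z. Qed.
Lemma eqC z w : complex.Re z = complex.Re w -> complex.Im z = complex.Im w -> z = w.
Proof. by case: z => a b; case: w => c d /= -> ->. Qed.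

Lemma modJ z : modulus (conjc z) = modulus z.
Proof. by case: z => a b; rewrite /modulus/= sqrrN. Qed.

Lemma mod_sum (I : Type) (r : seq I) (P : pred I) (f : I -> cplane R) :
  modulus (\sum_(i <- r | P i) f i) <= \sum_(i <- r | P i) modulus (f i).
Proof.
elim/big_ind2: _ => [|x y a b xa yb|//]; first by rewrite mod0.
by apply: le_trans (modD _ _) _; exact: lerD.
Qed.

Lemma Re_sum (I : Type) (r : seq I) (P : pred I) (f : I -> cplane R) :
  complex.Re (\sum_(i <- r | P i) f i) = \sum_(i <- r | P i) complex.Re (f i).
Proof. by elim/big_ind2: _ => // x y a b; rewrite ReD => -> ->. Qed.

Lemma Im_sum (I : Type) (r : seq I) (P : pred I) (f : I -> cplane R) :
  complex.Im (\sum_(i <- r | P i) f i) = \sum_(i <- r | P i) complex.Im (f i).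
Proof. by elim/big_ind2: _ => // x y a b; rewrite ImD => -> ->. Qed.

Lemma nbhs_cplaneP z (A : set (cplane R)) :
  nbhs z A <-> exists2 e : R, 0 < e & forall y, modulus (y - z) < e -> A y.
Proof.
split.
  move=> /nbhs_ballP[e /= e0 eA].
  move: e0; rewrite ltcE/= => /andP[/eqP ei er].
  exists (complex.Re e) => // y yz; apply: eA.
  rewrite -ball_normE /ball_/= distrC normcplane ltcE/= yz andbT; exact/eqP.
move=> [e e0 eA]; apply/nbhs_ballP; exists (Complex e 0) => /=.
  by rewrite ltcE/= eqxx.
move=> y; rewrite -ball_normE /ball_/= distrC normcplane ltcE/= => /andP[_].
exact: eA.
Qed.

Lemma cvg_cplaneP {T : Type} (G : set_system T) {FG : Filter G} (f : T -> cplane R)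
  (l : cplane R) :
  f @ G --> l <-> forall e : R, 0 < e -> \forall x \near G, modulus (f x - l) < e.
Proof.
split.
  move=> fl e e0; apply: (fl [set y | modulus (y - l) < e]).
  by apply/nbhs_cplaneP; exists e.
move=> H A /nbhs_cplaneP[e e0 eA].
near=> x; apply: eA; near: x; exact: H.
Unshelve. all: by end_near. Qed.

Lemma cvg_near_lt {T : Type} (G : set_system T) {FG : Filter G} (f : T -> cplane R)
  (l : cplane R) (e : R) : 0 < e -> f @ G --> l ->
  \forall x \near G, modulus (f x - l) < e.
Proof. by move=> e0 /cvg_cplaneP /(_ _ e0). Qed.

Lemma cvg_modulus {T : Type} (G : set_system T) {FG : Filter G} (f : T -> cplane R)
  (l : cplane R) : f @ G --> l -> modulus (f x) @[x --> G] --> modulus l.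
Proof.
move=> /cvg_cplaneP H; apply/cvgrPdist_lt => e e0.
near=> x; apply: (@le_lt_trans _ _ (modulus (f x - l))); last by near: x; exact: H.
rewrite ler_norml; apply/andP; split.
  by rewrite lerNl opprB lerBlDr; apply: le_trans (modD _ _); rewrite subrK.
by rewrite lerBlDr modB; apply: le_trans (modD _ _); rewrite subrK.
Unshelve. all: by end_near. Qed.

Lemma cvg_Re {T : Type} (G : set_system T) {FG : Filter G} (f : T -> cplane R)
  (l : cplane R) : f @ G --> l -> complex.Re (f x) @[x --> G] --> complex.Re l.
Proof.
move=> /cvg_cplaneP H; apply/cvgrPdist_lt => e e0.
near=> x; apply: (@le_lt_trans _ _ (modulus (f x - l))); last by near: x; exact: H.
by rewrite distrC; apply: le_trans (Re_le _); rewrite ReD ReN.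
Unshelve. all: by end_near. Qed.

Lemma cvg_Im {T : Type} (G : set_system T) {FG : Filter G} (f : T -> cplane R)
  (l : cplane R) : f @ G --> l -> complex.Im (f x) @[x --> G] --> complex.Im l.
Proof.
move=> /cvg_cplaneP H; apply/cvgrPdist_lt => e e0.
near=> x; apply: (@le_lt_trans _ _ (modulus (f x - l))); last by near: x; exact: H.
by rewrite distrC; apply: le_trans (Im_le _); rewrite ImD ImN.
Unshelve. all: by end_near. Qed.

Lemma cvg_Complex {T : Type} (G : set_system T) {FG : Filter G} (f g : T -> R)
  (a b : R) : f @ G --> a -> g @ G --> b ->
  (Complex (f x) (g x) : cplane R) @[x --> G] --> (Complex a b : cplane R).
Proof.
move=> /cvgrPdist_lt fa /cvgrPdist_lt gb; apply/cvg_cplaneP => e e0.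
have e2 : 0 < e / 2 by rewrite divr_gt0.
near=> x; apply: le_lt_trans (mod_le _) _ => /=.
rewrite [ltRHS](splitr e); apply: ltrD; rewrite ?ReD ?ImD ?ReN ?ImN distrC; near: x; [exact: fa|exact: gb].
Unshelve. all: by end_near. Qed.

Lemma cvg_ReIm {T : Type} (G : set_system T) {FG : Filter G} (f : T -> cplane R)
  (l : cplane R) : complex.Re (f x) @[x --> G] --> complex.Re l ->
  complex.Im (f x) @[x --> G] --> complex.Im l -> f @ G --> l.
Proof.
move=> fr fi; have := @cvg_Complex T G FG _ _ _ _ fr fi.
have eta z : Complex (complex.Re z) (complex.Im z) = z :> cplane R by case: z.
by rewrite eta; under [X in X @ _ --> _]eq_fun do rewrite eta.
Qed.

Lemma cvg_cplaneD {T : Type} (G : set_system T) {FG : Filter G} (f g : T -> cplane R)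
  (a b : cplane R) : f @ G --> a -> g @ G --> b -> (f x + g x) @[x --> G] --> a + b.
Proof.
move=> fa gb; apply: cvg_ReIm.
  rewrite ReD; under eq_fun do rewrite ReD.
  by apply: cvgD; [exact: cvg_Re|exact: cvg_Re].
rewrite ImD; under eq_fun do rewrite ImD.
by apply: cvgD; [exact: cvg_Im|exact: cvg_Im].
Qed.

Lemma cvg_cplaneN {T : Type} (G : set_system T) {FG : Filter G} (f : T -> cplane R)
  (a : cplane R) : f @ G --> a -> (- f x) @[x --> G] --> - a.
Proof.
move=> fa; apply: cvg_ReIm.
  by rewrite ReN; under eq_fun do rewrite ReN; apply: cvgN; exact: cvg_Re.
by rewrite ImN; under eq_fun do rewrite ImN; apply: cvgN; exact: cvg_Im.
Qed.

Lemma cvg_cplaneB {T : Type} (G : set_system T) {FG : Filter G} (f g : T -> cplane R)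
  (a b : cplane R) : f @ G --> a -> g @ G --> b -> (f x - g x) @[x --> G] --> a - b.
Proof. by move=> fa gb; exact: (cvg_cplaneD fa (cvg_cplaneN gb)). Qed.

Lemma cvg_cplaneM {T : Type} (G : set_system T) {FG : Filter G} (f g : T -> cplane R)
  (a b : cplane R) : f @ G --> a -> g @ G --> b ->
  (f x * g x : cplane R) @[x --> G] --> (a * b : cplane R).
Proof.
move=> fa gb; apply: cvg_ReIm.
  rewrite ReM; under eq_fun do rewrite ReM.
  by apply: cvgB; apply: cvgM; (exact: cvg_Re || exact: cvg_Im).
rewrite ImM; under eq_fun do rewrite ImM.
by apply: cvgD; apply: cvgM; (exact: cvg_Re || exact: cvg_Im).
Qed.

(** The norm of the complex plane takes its values in the complex numbers; all
estimates below are about the real modulus, so differentiability is restated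
with real radii, and without a quotient, which lets the increment vanish. *)
Lemma derivable_cplaneP F z (l : cplane R) :
  (forall e : R, 0 < e -> exists2 d : R, 0 < d & forall h, modulus h < d ->
     modulus (F (z + h) - F z - l * h) <= e * modulus h) <->
  derivable F z 1 /\ derive1 F z = l.
Proof.
have quot h : h != 0 ->
    modulus (h^-1 *: ((F \o shift z) h - F z) - l) =
    modulus (F (z + h) - F z - l * h) / modulus h.
  move=> h0; rewrite /= /shift/= (addrC h).
  have -> : F (z + h) - F z - l * h = (h^-1 * (F (z + h) - F z) - l) * h :> cplane R.
    by rewrite mulrBl mulrAC mulVf// mul1r.
  by rewrite modM mulfK// gt_eqF// mod_gt0.
have scal : (fun h : R[i] => h^-1 *: ((F \o shift z) (h *: (1 : cplane R)) - F z)) =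
            (fun h => h^-1 *: ((F \o shift z) h - F z)).
  by apply/funext => h; rewrite -[h *: _]/(h * 1) mulr1.
split.
  move=> H.
  have cv : h^-1 *: ((F \o shift z) h - F z) @[h --> 0^'] --> l.
    apply/cvg_cplaneP => e e0.
    have [d d0 Hd] := H _ (divr_gt0 e0 (ltr0n _ 2)).
    apply/nbhs_cplaneP; exists d => // h; rewrite subr0 => hd h0.
    rewrite quot // ltr_pdivrMr ?mod_gt0//.
    apply: le_lt_trans (Hd _ hd) _.
    by rewrite ltr_pM2r ?mod_gt0// ltr_pdivrMr// ltr_pMr// ltr1n.
  split; last by rewrite /derive1; apply: cvg_lim.
  by rewrite /derivable scal; apply/cvg_ex; exists l.
move=> [dF Fl] e e0.
have cv : h^-1 *: ((F \o shift z) h - F z) @[h --> 0^'] --> l.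
  by move: dF; rewrite /derivable scal -Fl.
move/cvg_cplaneP : cv => /(_ _ e0)/nbhs_cplaneP[d d0 Hd].
exists d => // h hd.
have [->|h0] := eqVneq h 0; first by rewrite addr0 subrr mulr0 subr0 mod0 mulr0.
have := Hd h; rewrite subr0 => /(_ hd h0).
by rewrite quot// ltr_pdivrMr ?mod_gt0// => /ltW.
Qed.

Lemma derivable_cplane_cvg F z : derivable F z 1 -> F x @[x --> z] --> F z.
Proof.
move=> dF; have [_ H] := derivable_cplaneP F z (derive1 F z).
have {}H := H (conj dF erefl).
apply/(@cvg_cplaneP _ (nbhs z) (nbhs_filter z) F (F z)) => e e0.
have [d d0 Hd] := H 1 ltr01.
set l := derive1 F z.
have M0 : 0 < modulus l + 1 by rewrite ltr_wpDl// mod_ge0.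
apply/nbhs_cplaneP; exists (Num.min d (e / (modulus l + 1))).
  by rewrite lt_min d0 divr_gt0.
move=> y; rewrite lt_min => /andP[yd ye].
have := Hd _ yd; rewrite [z + _]addrC subrK mul1r => Hy.
have -> : F y - F z = (F y - F z - l * (y - z)) + l * (y - z) by rewrite subrK.
apply: le_lt_trans (modD _ _) _; rewrite modM.
apply: (@le_lt_trans _ _ ((modulus l + 1) * modulus (y - z))).
  by rewrite mulrDl mul1r addrC lerD2l.
by rewrite mulrC -ltr_pdivlMr.
Qed.

End ComplexBasics.

Arguments modulus : simpl never.

(** * Integrals of real and complex functions on a segment *)

Section RealIntegral.
Context {R : realType}.
Implicit Types (f g : R -> R) (a b c : R).
Local Notation leb := (@lebesgue_measure R).

Definition cont_on a b f := forall x, a <= x <= b -> {for x, continuous f}.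

Definition rint f a b : R := \int[leb]_(x in `[a, b]) f x.

Lemma cont_on_integrable a b f : cont_on a b f ->
  leb.-integrable `[a, b] (EFin \o f).
Proof.
move=> cf; apply: continuous_compact_integrable; first exact: segment_compact.
apply: continuous_in_subspaceT => x; rewrite inE/= in_itv/=; exact: cf.
Qed.

Lemma cont_onD a b f g : cont_on a b f -> cont_on a b g ->
  cont_on a b (fun x => f x + g x).
Proof. by move=> cf cg x xab; apply: continuousD; [exact: cf|exact: cg]. Qed.

Lemma cont_onM a b f g : cont_on a b f -> cont_on a b g ->
  cont_on a b (fun x => f x * g x).
Proof. by move=> cf cg x xab; apply: continuousM; [exact: cf|exact: cg]. Qed.

Lemma cont_onN a b f : cont_on a b f -> cont_on a b (fun x => - f x).
Proof. by move=> cf x xab; apply: continuousN; exact: cf. Qed.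

Lemma cont_on_cst a b (k : R) : cont_on a b (fun=> k).
Proof. by move=> x _; exact: cst_continuous. Qed.

Lemma eq_rint f g a b : (forall x, a <= x <= b -> f x = g x) -> rint f a b = rint g a b.
Proof. by move=> fg; apply: eq_Rintegral => x; rewrite inE/= in_itv/=; exact: fg. Qed.

Lemma rintD f g a b : cont_on a b f -> cont_on a b g ->
  rint (fun x => f x + g x) a b = rint f a b + rint g a b.
Proof. by move=> cf cg; apply: RintegralD => //; exact: cont_on_integrable. Qed.

Lemma rintZ k f a b : cont_on a b f ->
  rint (fun x => k * f x) a b = k * rint f a b.
Proof. by move=> cf; apply: RintegralZl => //; exact: cont_on_integrable. Qed.

Lemma rintN f a b : cont_on a b f -> rint (fun x => - f x) a b = - rint f a b.
Proof.
move=> cf; rewrite -mulN1r -rintZ//; apply: eq_rint => x _; by rewrite mulN1r.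
Qed.

Lemma rint_cst k a b : a <= b -> rint (fun=> k) a b = k * (b - a).
Proof.
move=> ab; rewrite /rint Rintegral_cst//= lebesgue_measure_itv/= lte_fin.
by case: ltgtP ab => // -> _; rewrite subrr.
Qed.

Lemma rint_le f g a b : cont_on a b f -> cont_on a b g ->
  (forall x, a <= x <= b -> f x <= g x) -> rint f a b <= rint g a b.
Proof.
move=> cf cg fg; apply: le_Rintegral => //; exact: cont_on_integrable.
Qed.

Lemma rint_bound f a b M : a <= b -> cont_on a b f ->
  (forall x, a <= x <= b -> `|f x| <= M) -> `|rint f a b| <= M * (b - a).
Proof.
move=> ab cf fM; rewrite ler_norml; apply/andP; split.
  rewrite -mulNr -rint_cst//; apply: rint_le => //; first exact: cont_on_cst.
  by move=> x /fM; rewrite ler_norml => /andP[].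
rewrite -rint_cst//; apply: rint_le => //; first exact: cont_on_cst.
by move=> x /fM; rewrite ler_norml => /andP[].
Qed.

Lemma rint_split f a b c : a <= c <= b -> cont_on a b f ->
  rint f a b = rint f a c + rint f c b.
Proof.
move=> /andP[ac cb] cf.
have := @Rintegral_itvB R f (BLeft a) (BRight b) c (cont_on_integrable cf).
rewrite !bnd_simp => /(_ ac cb) H.
rewrite /rint -(@Rintegral_itv_obnd_cbnd R c (BRight b)); first by rewrite -H addrC subrK.
apply: (@integrableS _ _ _ leb `[a, b]) => //; last exact: cont_on_integrable.
by apply: subset_itvr; rewrite bnd_simp.
Qed.

Lemma rint_FTC (F f : R -> R) a b : a <= b -> cont_on a b f ->
  (forall x, a <= x <= b -> is_derive x 1 F (f x)) -> rint f a b = F b - F a.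
Proof.
rewrite le_eqVlt => /predU1P[->|ab] cf dF.
  by rewrite /rint set_itv1 Rintegral_set1 subrr.
have cF x : a <= x <= b -> {for x, continuous F}.
  move=> xab; apply/differentiable_continuous/derivable1_diffP.
  exact: (@ex_derive _ _ _ _ _ _ _ (dF x xab)).
rewrite /rint /Rintegral (@continuous_FTC2 _ f F a b ab)//.
- apply: continuous_in_subspaceT => x; rewrite inE/= in_itv/=; exact: cf.
- split.
  + move=> x; rewrite in_itv/= => /andP[ax xb].
    by apply: (@ex_derive _ _ _ _ _ _ _ (dF x _)); rewrite !ltW.
  + by apply: cvg_at_right_filter; apply: cF; rewrite lexx ltW.
  + by apply: cvg_at_left_filter; apply: cF; rewrite lexx ltW.
- move=> x; rewrite in_itv/= => /andP[ax xb]; rewrite derive1E.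
  by apply: (@derive_val _ _ _ _ _ _ _ (dF x _)); rewrite !ltW.
Qed.

End RealIntegral.

Section RealDerivative.
Context {R : realType}.
Implicit Types (f g : R -> R).

Lemma derD f g (x k l : R) : is_derive x 1 f k -> is_derive x 1 g l ->
  is_derive x 1 (fun t => f t + g t) (k + l).
Proof. by move=> df dg; exact: (@is_deriveD _ _ _ f g). Qed.

Lemma derN f (x k : R) : is_derive x 1 f k -> is_derive x 1 (fun t => - f t) (- k).
Proof. by move=> df; exact: (@is_deriveN _ _ _ f). Qed.

Lemma derM f g (x k l : R) : is_derive x 1 f k -> is_derive x 1 g l ->
  is_derive x 1 (fun t => f t * g t) (f x * l + g x * k).
Proof. by move=> df dg; exact: (@is_deriveM _ _ f g). Qed.

Lemma der_eq f (x k l : R) : is_derive x 1 f k -> k = l -> is_derive x 1 f l.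
Proof. by move=> ? <-. Qed.

Lemma der_comp f g (x k l : R) : is_derive x 1 f k -> is_derive (f x) 1 g l ->
  is_derive x 1 (fun t => g (f t)) (k * l).
Proof.
move=> df dg; have := @is_derive1_comp R g f x l k dg df.
by rewrite mulrC.
Qed.

Lemma der_cst (c x : R) : is_derive x 1 (fun=> c) 0.
Proof. exact: is_derive_cst. Qed.

Lemma der_id (x : R) : is_derive x 1 (fun t : R => t) 1.
Proof. exact: is_derive_id. Qed.

End RealDerivative.

Section ComplexIntegral.
Context {R : realType}.
Implicit Types (f g : R -> cplane R) (a b c : R).

Definition ccont_on a b f :=
  cont_on a b (fun x => complex.Re (f x)) /\ cont_on a b (fun x => complex.Im (f x)).

Definition cint f a b : cplane R :=
  Complex (rint (fun x => complex.Re (f x)) a b) (rint (fun x => complex.Im (f x)) a b).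

Lemma ccont_onP a b f : (forall x, a <= x <= b -> f y @[y --> x] --> f x) ->
  ccont_on a b f.
Proof.
by move=> H; split => x /H fx; [exact: (cvg_Re fx)|exact: (cvg_Im fx)].
Qed.

Lemma ccont_onD a b f g : ccont_on a b f -> ccont_on a b g ->
  ccont_on a b (fun x => f x + g x).
Proof.
move=> [fr fi] [gr gi]; split.
  by under eq_fun do rewrite ReD; exact: cont_onD.
by under eq_fun do rewrite ImD; exact: cont_onD.
Qed.

Lemma ccont_onN a b f : ccont_on a b f -> ccont_on a b (fun x => - f x).
Proof.
move=> [fr fi]; split.
  by under eq_fun do rewrite ReN; exact: cont_onN.
by under eq_fun do rewrite ImN; exact: cont_onN.
Qed.

Lemma ccont_onM a b f g : ccont_on a b f -> ccont_on a b g ->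
  ccont_on a b (fun x => f x * g x).
Proof.
move=> [fr fi] [gr gi]; split.
  under eq_fun do rewrite ReM; apply: cont_onD; first exact: cont_onM.
  by apply: cont_onN; exact: cont_onM.
by under eq_fun do rewrite ImM; apply: cont_onD; exact: cont_onM.
Qed.

Lemma ccont_on_cst a b (k : cplane R) : ccont_on a b (fun=> k).
Proof. by split; exact: cont_on_cst. Qed.

Lemma eq_cint f g a b : (forall x, a <= x <= b -> f x = g x) -> cint f a b = cint g a b.
Proof. by move=> fg; congr Complex; apply: eq_rint => x /fg ->. Qed.

Lemma cintD f g a b : ccont_on a b f -> ccont_on a b g ->
  cint (fun x => f x + g x) a b = cint f a b + cint g a b.
Proof.
move=> [fr fi] [gr gi]; rewrite /cint; apply: eqC => /=.
  by rewrite -rintD//; apply: eq_rint => x _; rewrite ReD.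
by rewrite -rintD//; apply: eq_rint => x _; rewrite ImD.
Qed.

Lemma cintZ (k : cplane R) f a b : ccont_on a b f ->
  cint (fun x => k * f x) a b = k * cint f a b.
Proof.
move=> [fr fi]; apply: eqC.
  rewrite ReM/= -!rintZ// -rintN; last by apply: cont_onM => //; exact: cont_on_cst.
  rewrite -rintD; first by apply: eq_rint => x _; rewrite ReM.
    by apply: cont_onM => //; exact: cont_on_cst.
  by apply: cont_onN; apply: cont_onM => //; exact: cont_on_cst.
rewrite ImM/= -!rintZ// -rintD; first by apply: eq_rint => x _; rewrite ImM.
  by apply: cont_onM => //; exact: cont_on_cst.
by apply: cont_onM => //; exact: cont_on_cst.
Qed.

Lemma cintN f a b : ccont_on a b f -> cint (fun x => - f x) a b = - cint f a b.
Proof.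
move=> cf; rewrite -mulN1r -cintZ//; apply: eq_cint => x _; by rewrite mulN1r.
Qed.

Lemma cint_cst (k : cplane R) a b : a <= b ->
  cint (fun=> k) a b = k * (Complex (b - a) 0 : cplane R).
Proof.
move=> ab; apply: eqC; rewrite ?ReM ?ImM/= rint_cst// mulr0 ?subr0 ?add0r//.
Qed.

(** Bounding the two coordinates separately gives the factor 2, which is
harmless in every use. *)
Lemma cint_bound f a b M : a <= b -> ccont_on a b f ->
  (forall x, a <= x <= b -> modulus (f x) <= M) ->
  modulus (cint f a b) <= 2 * M * (b - a).
Proof.
move=> ab [fr fi] fM; apply: le_trans (mod_le _) _ => /=.
rewrite -mulrA mulr_natl mulr2n lerD// rint_bound// => x /fM; apply: le_trans.
  exact: Re_le.
exact: Im_le.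
Qed.

Lemma cint_split f a b c : a <= c <= b -> ccont_on a b f ->
  cint f a b = cint f a c + cint f c b.
Proof. by move=> acb [fr fi]; apply: eqC; rewrite ?ReD ?ImD/= -rint_split. Qed.

(** Differentiability of the two coordinates: the calculus of functions of one
real variable then applies to curves in the plane. *)
Definition cder (f : R -> cplane R) (x : R) (l : cplane R) :=
  is_derive x 1 (fun t => complex.Re (f t)) (complex.Re l) /\
  is_derive x 1 (fun t => complex.Im (f t)) (complex.Im l).

Lemma cint_FTC (F f : R -> cplane R) a b : a <= b -> ccont_on a b f ->
  (forall x, a <= x <= b -> cder F x (f x)) -> cint f a b = F b - F a.
Proof.
move=> ab [fr fi] dF; apply: eqC; rewrite ?ReD ?ImD ?ReN ?ImN/=.
  by apply: (@rint_FTC R (fun t => complex.Re (F t)) _ _ _ ab fr) => x /dF[].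
by apply: (@rint_FTC R (fun t => complex.Im (F t)) _ _ _ ab fi) => x /dF[].
Qed.

Lemma cderD f g x k l : cder f x k -> cder g x l ->
  cder (fun t => f t + g t) x (k + l).
Proof.
move=> [fr fi] [gr gi]; split; rewrite ?ReD ?ImD.
  by under eq_fun do rewrite ReD; exact: is_deriveD.
by under eq_fun do rewrite ImD; exact: is_deriveD.
Qed.

Lemma cderM f g x k l : cder f x k -> cder g x l ->
  cder (fun t => f t * g t) x (f x * l + g x * k).
Proof.
move=> [fr fi] [gr gi]; split.
  under eq_fun do rewrite ReM.
  apply: (der_eq (derD (derM fr gr) (derN (derM fi gi)))).
  rewrite ReD !ReM; ring.
under eq_fun do rewrite ImM.
apply: (der_eq (derD (derM fr gi) (derM fi gr))).
rewrite ImD !ImM; ring.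
Qed.

Lemma cder_cst (k : cplane R) x : cder (fun=> k) x 0.
Proof. by split => /=; exact: is_derive_cst. Qed.

Lemma cder_sum (I : Type) (s : seq I) (f : I -> R -> cplane R) x (l : I -> cplane R) :
  (forall i, cder (f i) x (l i)) ->
  cder (fun t => \sum_(i <- s) f i t) x (\sum_(i <- s) l i).
Proof.
move=> H; elim: s => [|i s IH].
  by rewrite big_nil; under eq_fun do rewrite big_nil; exact: cder_cst.
by rewrite big_cons; under eq_fun do rewrite big_cons; exact: cderD.
Qed.

Lemma cder_cont f x l : cder f x l -> f y @[y --> x] --> f x.
Proof.
move=> [fr fi].
have cr : {for x, continuous (fun t => complex.Re (f t))}.
  apply/differentiable_continuous/derivable1_diffP.
  exact: (@ex_derive _ _ _ _ _ _ _ fr).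
have ci : {for x, continuous (fun t => complex.Im (f t))}.
  apply/differentiable_continuous/derivable1_diffP.
  exact: (@ex_derive _ _ _ _ _ _ _ fi).
exact: cvg_ReIm cr ci.
Qed.

(** There is no exact mean value theorem for curves; applying it to each
coordinate costs the factor 2. Subtracting a constant velocity [c] makes the
estimate usable for remainders. *)
Lemma cder_MVT f (df : R -> cplane R) a b (c : cplane R) M : a <= b ->
  (forall x, a <= x <= b -> cder f x (df x)) ->
  (forall x, a <= x <= b -> modulus (df x - c) <= M) ->
  modulus (f b - f a - c * (Complex (b - a) 0 : cplane R)) <= 2 * M * (b - a).
Proof.
rewrite le_eqVlt => /predU1P[->|ab] dF dM.
  have -> : (Complex (b - b) 0 : cplane R) = 0 by rewrite subrr.
  by rewrite !subrr !mulr0 subr0 mod0.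
have real (p q : R -> R) (d : R) : (forall x, a <= x <= b -> is_derive x 1 p (q x)) ->
    (forall x, a <= x <= b -> `|q x - d| <= M) -> `|p b - p a - d * (b - a)| <= M * (b - a).
  move=> dp qM.
  have [||x xab ->] := @MVT R p q a b ab.
  - by move=> x; rewrite in_itv/= => /andP[ax xb]; apply: dp; rewrite !ltW.
  - apply: derivable_within_continuous => x; rewrite in_itv/= => xab.
    exact: (@ex_derive _ _ _ _ _ _ _ (dp x xab)).
  have ba : 0 <= b - a by rewrite subr_ge0 ltW.
  rewrite -mulrBl normrM (ger0_norm ba) ler_wpM2r//; apply: qM.
  by move: xab; rewrite in_itv/= => /andP[ax xb]; rewrite !ltW.
apply: le_trans (mod_le _) _.
rewrite !(ReD, ImD, ReN, ImN, ReM, ImM)/= !mulr0 subr0 add0r.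
rewrite -mulrA mulr_natl mulr2n lerD//.
  apply: (real (fun t => complex.Re (f t)) (fun t => complex.Re (df t))).
    by move=> x /dF[].
  by move=> x /dM; apply: le_trans; rewrite -ReN -ReD; exact: Re_le.
apply: (real (fun t => complex.Im (f t)) (fun t => complex.Im (df t))).
  by move=> x /dF[].
by move=> x /dM; apply: le_trans; rewrite -ImN -ImD; exact: Im_le.
Qed.

End ComplexIntegral.

Arguments rint : simpl never.
Arguments cint : simpl never.

(** * Goursat's theorem on rectangles *)

Section Goursat.
Context {R : realType}.
Implicit Types (F : cplane R -> cplane R) (a b c d x y : R).

Definition ii : cplane R := Complex 0 1.
Definition rc (t : R) : cplane R := Complex t 0.

Lemma mod_ii : modulus ii = 1.
Proof. by rewrite /modulus/= expr0n add0r expr1n sqrtr1. Qed.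

Lemma mod_rc t : modulus (rc t) = `|t|.
Proof. exact: modC. Qed.

Lemma cder_horizontal c x : cder (fun x => Complex x c : cplane R) x 1.
Proof. by split => /=; [exact: is_derive_id|exact: is_derive_cst]. Qed.

Lemma cder_vertical a y : cder (fun y => Complex a y : cplane R) y ii.
Proof. by split => /=; [exact: is_derive_cst|exact: is_derive_id]. Qed.

(** The integral of [F] along the boundary of the rectangle of corners
[(a, c)] and [(b, d)], traversed counterclockwise. *)
Definition bdint F a b c d : cplane R :=
  cint (fun x => F (Complex x c)) a b + ii * cint (fun y => F (Complex b y)) c d
  - cint (fun x => F (Complex x d)) a b - ii * cint (fun y => F (Complex a y)) c d.

Arguments bdint : simpl never.

Definition rect_cont F a b c d := forall x y, a <= x <= b -> c <= y <= d ->
  F w @[w --> (Complex x y : cplane R)] --> F (Complex x y).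

Lemma rect_cont_h F a b c d y : rect_cont F a b c d -> c <= y <= d ->
  ccont_on a b (fun x => F (Complex x y)).
Proof.
move=> cF ycd; apply: ccont_onP => x xab.
exact: (cvg_comp _ _ (cder_cont (cder_horizontal y x)) (cF _ _ xab ycd)).
Qed.

Lemma rect_cont_v F a b c d x : rect_cont F a b c d -> a <= x <= b ->
  ccont_on c d (fun y => F (Complex x y)).
Proof.
move=> cF xab; apply: ccont_onP => y ycd.
exact: (cvg_comp _ _ (cder_cont (cder_vertical x y)) (cF _ _ xab ycd)).
Qed.

Lemma bdint_quarter F a b c d m n : a <= m <= b -> c <= n <= d ->
  rect_cont F a b c d ->
  bdint F a b c d = bdint F a m c n + bdint F m b c n +
                    bdint F a m n d + bdint F m b n d.
Proof.
move=> amb cnd cF.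
have [ab cd] : a <= b /\ c <= d.
  by split; [case/andP: amb|case/andP: cnd]; exact: le_trans.
have H y : c <= y <= d -> cint (fun x => F (Complex x y)) a b =
    cint (fun x => F (Complex x y)) a m + cint (fun x => F (Complex x y)) m b.
  by move=> ycd; apply: cint_split => //; exact: rect_cont_h ycd.
have V x : a <= x <= b -> cint (fun y => F (Complex x y)) c d =
    cint (fun y => F (Complex x y)) c n + cint (fun y => F (Complex x y)) n d.
  by move=> xab; apply: cint_split => //; exact: rect_cont_v xab.
rewrite /bdint (H c) ?lexx ?cd// (H d) ?lexx ?cd// (V a) ?lexx ?ab// (V b) ?lexx ?ab//.
ring.
Qed.

Lemma bdintB F G a b c d : a <= b -> c <= d ->
  rect_cont F a b c d -> rect_cont G a b c d ->
  bdint (fun z => F z - G z) a b c d = bdint F a b c d - bdint G a b c d.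
Proof.
move=> ab cd cF cG.
have H y : c <= y <= d -> cint (fun x => F (Complex x y) - G (Complex x y)) a b =
    cint (fun x => F (Complex x y)) a b - cint (fun x => G (Complex x y)) a b.
  move=> ycd; rewrite cintD ?cintN//; [exact: rect_cont_h cG ycd|exact: rect_cont_h cF ycd|].
  by apply: ccont_onN; exact: rect_cont_h cG ycd.
have V x : a <= x <= b -> cint (fun y => F (Complex x y) - G (Complex x y)) c d =
    cint (fun y => F (Complex x y)) c d - cint (fun y => G (Complex x y)) c d.
  move=> xab; rewrite cintD ?cintN//; [exact: rect_cont_v cG xab|exact: rect_cont_v cF xab|].
  by apply: ccont_onN; exact: rect_cont_v cG xab.
rewrite /bdint (H c) ?lexx ?cd// (H d) ?lexx ?cd// (V a) ?lexx ?ab// (V b) ?lexx ?ab//.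
ring.
Qed.

Lemma bdint_bound F a b c d M : a <= b -> c <= d -> rect_cont F a b c d ->
  (forall x y, a <= x <= b -> c <= y <= d -> modulus (F (Complex x y)) <= M) ->
  modulus (bdint F a b c d) <= 4 * M * ((b - a) + (d - c)).
Proof.
move=> ab cd cF FM.
have H y : c <= y <= d -> modulus (cint (fun x => F (Complex x y)) a b) <= 2 * M * (b - a).
  by move=> ycd; apply: cint_bound => //; [exact: rect_cont_h ycd|move=> x xab; exact: FM].
have V x : a <= x <= b -> modulus (cint (fun y => F (Complex x y)) c d) <= 2 * M * (d - c).
  by move=> xab; apply: cint_bound => //; [exact: rect_cont_v xab|move=> y ycd; exact: FM].
have := H c; have := H d; have := V a; have := V b.
rewrite !lexx ab cd => /(_ isT) Vb /(_ isT) Va /(_ isT) Hd /(_ isT) Hc.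
apply: le_trans (modD _ _) _; rewrite modN modM mod_ii mul1r.
have : modulus (cint (fun x => F (Complex x c)) a b + ii * cint (fun y => F (Complex b y)) c d
  - cint (fun x => F (Complex x d)) a b) <= 2 * M * (b - a) + 2 * M * (d - c) + 2 * M * (b - a).
  apply: le_trans (modD _ _) _; rewrite modN; apply: lerD => //.
  apply: le_trans (modD _ _) _; apply: lerD => //.
  by rewrite modM mod_ii mul1r.
by move: Va; lra.
Qed.

Lemma affine_cont (A l : cplane R) a b c d :
  rect_cont (fun z : cplane R => A + l * z) a b c d.
Proof.
move=> x y _ _.
apply: (@derivable_cplane_cvg _ (fun z : cplane R => A + l * z)).
have [H _] := derivable_cplaneP (fun z : cplane R => A + l * z) (Complex x y) l.
apply: (H _).1 => e e0; exists 1 => // h _.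
have -> : A + l * ((Complex x y : cplane R) + h) - (A + l * (Complex x y : cplane R)) - l * h = 0.
  by ring.
by rewrite mod0 mulr_ge0 ?mod_ge0// ltW.
Qed.

(** An affine function has a quadratic primitive, so its integral along each
side is a difference of values at the corners. *)
Lemma bdint_affine (A l : cplane R) a b c d : a <= b -> c <= d ->
  bdint (fun z => A + l * z) a b c d = 0.
Proof.
move=> ab cd.
pose P (z : cplane R) : cplane R := A * z + (l / 2) * (z * z).
have dP (g : R -> cplane R) (k : cplane R) x : cder g x k ->
    cder (fun t => P (g t)) x (k * (A + l * g x)).
  move=> dg.
  have H := cderD (cderM (cder_cst A x) dg) (cderM (cder_cst (l / 2 : cplane R) x) (cderM dg dg)).
  have -> : k * (A + l * g x) = A * k + g x * 0 + (l / 2 * (g x * k + g x * k) + g x * g x * 0) :> cplane R.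
    by field.
  exact: H.
have H y : c <= y <= d -> cint (fun x => A + l * (Complex x y : cplane R)) a b =
    P (Complex b y) - P (Complex a y).
  move=> ycd; apply: (@cint_FTC _ (fun x => P (Complex x y))) => //.
    exact: (rect_cont_h (@affine_cont A l a b c d) ycd).
  by move=> x _; have := dP _ _ _ (cder_horizontal y x); rewrite mul1r.
have V x : a <= x <= b -> ii * cint (fun y => A + l * (Complex x y : cplane R)) c d =
    P (Complex x d) - P (Complex x c).
  move=> xab; rewrite -cintZ; last first.
    exact: (rect_cont_v (@affine_cont A l a b c d) xab).
  apply: (@cint_FTC _ (fun y => P (Complex x y))) => //.
    apply: ccont_onM; first exact: ccont_on_cst.
    exact: (rect_cont_v (@affine_cont A l a b c d) xab).
  by move=> y _; exact: (dP _ _ _ (cder_vertical x y)).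
rewrite /bdint (H c) ?lexx ?cd// (H d) ?lexx ?cd// (V a) ?lexx ?ab// (V b) ?lexx ?ab//.
ring.
Qed.

(** Bisection. If the boundary integral had modulus [K > 0], some quarter of
each rectangle would carry at least a quarter of it, so the [k]-th nested
rectangle carries at least [K / 4 ^ k]. At the common point [F] is affine up to
[e] times the distance; the affine part integrates to 0 and the rest is at most
a constant times [e / 4 ^ k], a contradiction for small [e]. *)
Lemma goursat F a b c d : a <= b -> c <= d ->
  (forall x y, a <= x <= b -> c <= y <= d -> derivable F (Complex x y : cplane R) 1) ->
  bdint F a b c d = 0.
Proof.
move=> ab cd dF; apply: contrapT => /eqP; rewrite -mod_gt0.
set K := modulus _ => K0.
pose w k := (b - a) / 2 ^+ k; pose h k := (d - c) / 2 ^+ k.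
have w0 k : 0 <= w k by rewrite /w mulr_ge0 ?subr_ge0// invr_ge0 exprn_ge0.
have h0 k : 0 <= h k by rewrite /h mulr_ge0 ?subr_ge0// invr_ge0 exprn_ge0.
have pow0 k : (2 ^+ k : R) != 0 by rewrite expf_neq0.
have wS k : w k.+1 + w k.+1 = w k by rewrite /w exprS; field.
have hS k : h k.+1 + h k.+1 = h k by rewrite /h exprS; field.
pose B k (p : R * R) := bdint F p.1 (p.1 + w k) p.2 (p.2 + h k).
pose inside k (p : R * R) := [/\ a <= p.1, p.1 + w k <= b, c <= p.2 & p.2 + h k <= d].
have cF x1 x2 y1 y2 : a <= x1 -> x2 <= b -> c <= y1 -> y2 <= d -> rect_cont F x1 x2 y1 y2.
  move=> ax xb cy yd x y /andP[x1x xx2] /andP[y1y yy2].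
  apply: derivable_cplane_cvg; apply: dF; first by rewrite (le_trans ax)//= (le_trans xx2).
  by rewrite (le_trans cy)//= (le_trans yy2).
have step k p : inside k p -> exists q, [/\ p.1 <= q.1, p.2 <= q.2,
    q.1 + w k.+1 <= p.1 + w k, q.2 + h k.+1 <= p.2 + h k &
    modulus (B k p) <= 4 * modulus (B k.+1 q)].
  case: p => x y [/= ax xb cy yd].
  apply: contrapT => nq.
  have N (s t : R) : (s = 0 \/ s = w k.+1) -> (t = 0 \/ t = h k.+1) ->
      4 * modulus (B k.+1 (x + s, y + t)) < modulus (B k (x, y)).
    move=> Hs Ht; rewrite ltNge; apply/negP => Hle; apply: nq.
    exists (x + s, y + t); split => //=.
    - by rewrite lerDl; case: Hs => ->.
    - by rewrite lerDl; case: Ht => ->.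
    - by rewrite -addrA lerD2l -(wS k) lerD2r; case: Hs => ->.
    - by rewrite -addrA lerD2l -(hS k) lerD2r; case: Ht => ->.
  have := N 0 0 (or_introl erefl) (or_introl erefl).
  have := N (w k.+1) 0 (or_intror erefl) (or_introl erefl).
  have := N 0 (h k.+1) (or_introl erefl) (or_intror erefl).
  have := N (w k.+1) (h k.+1) (or_intror erefl) (or_intror erefl).
  rewrite /B/= !addr0.
  have -> : x + w k.+1 + w k.+1 = x + w k by rewrite -addrA wS.
  have -> : y + h k.+1 + h k.+1 = y + h k by rewrite -addrA hS.
  rewrite (@bdint_quarter F x (x + w k) y (y + h k) (x + w k.+1) (y + h k.+1)); last 3 first.
  - by rewrite lerDl w0/= lerD2l -(wS k) lerDl w0.
  - by rewrite lerDl h0/= lerD2l -(hS k) lerDl h0.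
  - exact: cF.
  set A1 := bdint F x (x + w k.+1) y (y + h k.+1).
  set A2 := bdint F (x + w k.+1) (x + w k) y (y + h k.+1).
  set A3 := bdint F x (x + w k.+1) (y + h k.+1) (y + h k).
  set A4 := bdint F (x + w k.+1) (x + w k) (y + h k.+1) (y + h k).
  have : modulus (A1 + A2 + A3 + A4) <= modulus A1 + modulus A2 + modulus A3 + modulus A4.
    by do 3 (apply: le_trans (modD _ _) _; rewrite lerD2r).
  by lra.
have /choice[nx Hnx] : forall kp : nat * (R * R), exists q, inside kp.1 kp.2 ->
   [/\ kp.2.1 <= q.1, kp.2.2 <= q.2,
    q.1 + w kp.1.+1 <= kp.2.1 + w kp.1, q.2 + h kp.1.+1 <= kp.2.2 + h kp.1 &
    modulus (B kp.1 kp.2) <= 4 * modulus (B kp.1.+1 q)].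
  move=> [k p]; have [/step[q Hq]|ni] := pselect (inside k p); first by exists q.
  by exists p => /ni.
pose P := fix P k := if k is k'.+1 then nx (k', P k') else (a, c).
have PP k : inside k (P k) /\ K <= 4 ^+ k * modulus (B k (P k)).
  elim: k => [|k [Hi HK]].
    rewrite expr0 mul1r /B /inside/= /w /h expr0 !divr1.
    by rewrite ![_ + (_ - _)]addrC !subrK /inside/= !lexx; split.
  have := Hnx (k, P k) Hi => /= -[H1 H2 H3 H4 H5]; split.
    case: Hi => a1 a2 a3 a4; split.
    - exact: le_trans H1.
    - exact: le_trans a2.
    - exact: le_trans H2.
    - exact: le_trans a4.
  apply: (le_trans HK); rewrite exprSr -mulrA ler_wpM2l// exprn_ge0//.
have mono k j : (P k).1 <= (P (j + k)%N).1 /\ (P (j + k)%N).1 + w (j + k)%N <= (P k).1 + w k.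
  elim: j => [|j [IH1 IH2]]; first by rewrite add0n.
  have [Hi _] := PP (j + k)%N; have := Hnx ((j + k)%N, P (j + k)%N) Hi.
  move=> /= -[H1 _ H3 _ _]; rewrite addSn; split; first exact: le_trans H1.
  exact: le_trans IH2.
have mono2 k j : (P k).2 <= (P (j + k)%N).2 /\ (P (j + k)%N).2 + h (j + k)%N <= (P k).2 + h k.
  elim: j => [|j [IH1 IH2]]; first by rewrite add0n.
  have [Hi _] := PP (j + k)%N; have := Hnx ((j + k)%N, P (j + k)%N) Hi.
  move=> /= -[_ H1 _ H3 _]; rewrite addSn; split; first exact: le_trans H1.
  exact: le_trans IH2.
have nested (u v : nat -> R) : (forall k, 0 <= v k) ->
    (forall k j, u k <= u (j + k)%N /\ u (j + k)%N + v (j + k)%N <= u k + v k) ->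
    exists l, forall k, u k <= l <= u k + v k.
  move=> v0 uv.
  have ub k : ubound (range u) (u k + v k).
    move=> _ [j _ <-]; have [jk|/ltnW kj] := leqP j k.
      by have := (uv j (k - j)%N).1; rewrite subnK// => /le_trans; apply; rewrite lerDl.
    have := (uv k (j - k)%N).2; rewrite subnK//; apply: le_trans; by rewrite lerDl.
  exists (sup (range u)) => k; apply/andP; split.
    by apply: sup_upper_bound; [split; [exists (u 0%N); exists 0%N|exists (u 0%N + v 0%N)]|exists k].
  by apply: ge_sup; [exists (u 0%N); exists 0%N|exact: ub].
have [px Hpx] := nested (fun k => (P k).1) w w0 mono.
have [py Hpy] := nested (fun k => (P k).2) h h0 mono2.
pose z0 : cplane R := Complex px py.
have dFz : derivable F z0 1.
  have := Hpx 0%N; have := Hpy 0%N; rewrite /= /w /h !expr0 !divr1.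
  rewrite ![_ + (_ - _)]addrC !subrK => pyd pxb; exact: dF.
have [_ /(_ (conj dFz erefl)) Hd] := derivable_cplaneP F z0 (derive1 F z0).
set l := derive1 F z0 in Hd.
pose S := (b - a) + (d - c).
have S0 : 0 <= S by rewrite addr_ge0// subr_ge0.
(* the final estimate is [4 e S ^ 2], which this choice makes smaller than [K] *)
pose e := K / (8 * (S + 1) ^+ 2).
have S1 : 0 < S + 1 by rewrite ltr_wpDl.
have e0 : 0 < e by rewrite divr_gt0// mulr_gt0// exprn_gt0.
have [dl dl0 Hdl] := Hd _ e0.
have [k Sk] : exists k, S / 2 ^+ k < dl.
  have := @near_infty_natSinv_lt R (PosNum (divr_gt0 dl0 S1)) => -[k _ Hk].
  exists k; rewrite ltr_pdivrMr ?exprn_gt0//.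
  have /= := Hk k (leqnn k); rewrite invf_plt ?posrE ?divr_gt0// invf_div => Hk'.
  have : (k.+1%:R : R) <= 2 ^+ k.
    by rewrite -natrX ler_nat; exact: ltn_expl.
  move=> /(lt_le_trans Hk'); rewrite ltr_pdivrMr// => H.
  by rewrite mulrC (le_lt_trans _ H)// lerDl.
have [[i1 i2 i3 i4] HK] := PP k.
move: HK; rewrite /B.
set x1 := (P k).1; set y1 := (P k).2.
have cFk : rect_cont F x1 (x1 + w k) y1 (y1 + h k) by exact: cF.
pose G z := (F z0 - l * z0) + l * z.
have xw : x1 <= x1 + w k by rewrite lerDl.
have yh : y1 <= y1 + h k by rewrite lerDl.
have := bdintB xw yh cFk (@affine_cont (F z0 - l * z0) l x1 (x1 + w k) y1 (y1 + h k)).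
rewrite bdint_affine// subr0 => <-.
have Swh : w k + h k = S / 2 ^+ k by rewrite /w /h /S [RHS]mulrDl.
have : modulus (bdint (fun z => F z - (F z0 - l * z0 + l * z)) x1 (x1 + w k) y1 (y1 + h k)) <=
    4 * (e * (S / 2 ^+ k)) * (S / 2 ^+ k).
  rewrite -[leRHS](_ : 4 * (e * (S / 2 ^+ k)) * ((x1 + w k - x1) + (y1 + h k - y1)) = _); last first.
    by congr (_ * _); rewrite -Swh; ring.
  apply: (bdint_bound xw yh).
    move=> x y xx yy; apply: (cvg_cplaneB (cFk x y xx yy)).
    exact: (@affine_cont (F z0 - l * z0) l x1 (x1 + w k) y1 (y1 + h k) x y xx yy).
  move=> x y xx yy.
  have dist : modulus ((Complex x y : cplane R) - z0) <= S / 2 ^+ k.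
    apply: le_trans (mod_le _) _ => /=; rewrite -Swh.
    have := Hpx k; have := Hpy k; rewrite -/x1 -/y1 => /andP[p1 p2] /andP[p3 p4].
    move: xx yy => /andP[q1 q2] /andP[q3 q4].
    apply: lerD; rewrite ler_norml; apply/andP; split; lra.
  have := Hdl _ (le_lt_trans dist Sk).
  have -> : z0 + ((Complex x y : cplane R) - z0) = Complex x y by rewrite addrC subrK.
  have -> : F (Complex x y) - (F z0 - l * z0 + l * (Complex x y : cplane R)) =
    F (Complex x y) - F z0 - l * ((Complex x y : cplane R) - z0) by ring.
  by move/le_trans; apply; rewrite ler_wpM2l// ltW.
move=> H1 H2.
have : K <= 4 ^+ k * (4 * (e * (S / 2 ^+ k)) * (S / 2 ^+ k)).
  by apply: le_trans H2 _; rewrite ler_wpM2l// exprn_ge0.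
have -> : 4 ^+ k * (4 * (e * (S / 2 ^+ k)) * (S / 2 ^+ k)) = 4 * e * S ^+ 2.
  have -> : (4 : R) ^+ k = 2 ^+ k * 2 ^+ k by rewrite -exprMn -natrM.
  by field.
apply/negP; rewrite -ltNge.
have SS : S ^+ 2 <= (S + 1) ^+ 2 by rewrite sqrrD1 -addrA lerDl addr_ge0// mulrn_wge0.
apply: (@le_lt_trans _ _ (4 * e * (S + 1) ^+ 2)).
  by rewrite ler_wpM2l// mulr_ge0// ltW.
have -> : 4 * e * (S + 1) ^+ 2 = K / 2 by rewrite /e; field; rewrite gt_eqF.
by rewrite ltr_pdivrMr// ltr_pMr// ltr1n.
Qed.

End Goursat.

(** * Complex derivatives and the exponential *)

Section ComplexDerivative.
Context {R : realType}.
Implicit Types (F G : cplane R -> cplane R) (z k l : cplane R).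

Definition cderiv F z l := forall e : R, 0 < e -> exists2 d : R, 0 < d &
  forall h, modulus h < d -> modulus (F (z + h) - F z - l * h) <= e * modulus h.

Lemma cderivP F z l : cderiv F z l <-> derivable F z 1 /\ derive1 F z = l.
Proof. exact: derivable_cplaneP. Qed.

Lemma derivable_cderiv F z : derivable F z 1 -> cderiv F z (derive1 F z).
Proof. by move=> dF; apply/cderivP. Qed.

Lemma cderiv_derivable F z l : cderiv F z l -> derivable F z 1.
Proof. by move=> /cderivP[]. Qed.

Lemma cderiv_derive1 F z l : cderiv F z l -> derive1 F z = l.
Proof. by move=> /cderivP[]. Qed.

Lemma cderiv_cvg F z l : cderiv F z l -> F x @[x --> z] --> F z.
Proof. by move=> /cderiv_derivable; exact: derivable_cplane_cvg. Qed.

Lemma cderiv_comp F G z k l : cderiv G z k -> cderiv F (G z) l ->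
  cderiv (fun w => F (G w)) z (l * k).
Proof.
move=> dG dF e e0.
have k1 : 0 < modulus k + 1 by rewrite ltr_wpDl ?mod_ge0.
have l1 : 0 < modulus l + 1 by rewrite ltr_wpDl ?mod_ge0.
have [d1 d10 H1] := dF (e / (2 * (modulus k + 1))) (divr_gt0 e0 (mulr_gt0 (ltr0n _ 2) k1)).
pose e2 := Num.min 1 (e / (2 * (modulus l + 1))).
have e20 : 0 < e2 by rewrite lt_min ltr01 divr_gt0// mulr_gt0.
have [d2 d20 H2] := dG e2 e20.
exists (Num.min d2 (d1 / (modulus k + 1))); first by rewrite lt_min d20 divr_gt0.
move=> h; rewrite lt_min => /andP[hd2 hd1].
have {}H2 := H2 h hd2.
set K := G (z + h) - G z in H2 *.
have Kh : modulus K <= (modulus k + 1) * modulus h.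
  have -> : K = (K - k * h) + k * h by rewrite subrK.
  apply: le_trans (modD _ _) _; rewrite modM mulrDl addrC lerD2l.
  by apply: (le_trans H2); rewrite ler_wpM2r ?mod_ge0// ge_min lexx.
have Kd1 : modulus K < d1.
  by apply: (le_lt_trans Kh); rewrite mulrC -ltr_pdivlMr.
have := H1 K Kd1; have -> : G z + K = G (z + h) by rewrite addrC subrK.
move=> {}H1.
have -> : F (G (z + h)) - F (G z) - l * k * h =
  (F (G (z + h)) - F (G z) - l * K) + l * (K - k * h) by ring.
apply: le_trans (modD _ _) _; rewrite modM.
have : e / (2 * (modulus k + 1)) * modulus K <= e / 2 * modulus h.
  apply: (@le_trans _ _ (e / (2 * (modulus k + 1)) * ((modulus k + 1) * modulus h))).
    by rewrite ler_wpM2l// divr_ge0 ?ltW// mulr_gt0.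
  by rewrite le_eqVlt; apply/orP; left; apply/eqP; field; rewrite gt_eqF.
have : modulus l * modulus (K - k * h) <= e / 2 * modulus h.
  apply: (@le_trans _ _ ((modulus l + 1) * (e / (2 * (modulus l + 1)) * modulus h))).
    apply: ler_pM; rewrite ?mod_ge0 ?lerDl//.
    by apply: (le_trans H2); rewrite ler_wpM2r ?mod_ge0// ge_min lexx orbT.
  by rewrite le_eqVlt; apply/orP; left; apply/eqP; field; rewrite gt_eqF.
move: H1; set a := modulus _; set b := _ * modulus (K - _).
set c := _ / _ * modulus K; set m := modulus h; lra.
Qed.

Lemma cderiv_cst z (c : cplane R) : cderiv (fun=> c) z 0.
Proof.
move=> e e0; exists 1 => // h _; rewrite subrr mul0r subr0 mod0.
by rewrite mulr_ge0 ?mod_ge0// ltW.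
Qed.

Lemma cderiv_id z : cderiv (fun w => w) z 1.
Proof.
move=> e e0; exists 1 => // h _.
have -> : z + h - z - 1 * h = 0 by ring.
by rewrite mod0 mulr_ge0 ?mod_ge0// ltW.
Qed.

Lemma cderivD F G z k l : cderiv F z k -> cderiv G z l ->
  cderiv (fun w => F w + G w) z (k + l).
Proof.
move=> dF dG e e0.
have e2 : 0 < e / 2 by rewrite divr_gt0.
have [d1 d10 H1] := dF _ e2; have [d2 d20 H2] := dG _ e2.
exists (Num.min d1 d2); first by rewrite lt_min d10.
move=> h; rewrite lt_min => /andP[/H1 {}H1 /H2 {}H2].
have -> : F (z + h) + G (z + h) - (F z + G z) - (k + l) * h =
  (F (z + h) - F z - k * h) + (G (z + h) - G z - l * h) by ring.
apply: le_trans (modD _ _) _; rewrite [e]splitr mulrDl; exact: lerD.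
Qed.

Lemma cderivM F G z k l : cderiv F z k -> cderiv G z l ->
  cderiv (fun w => F w * G w) z (k * G z + F z * l).
Proof.
move=> dF dG e e0.
set a := modulus (F z); set b := modulus (G z); set c := modulus k.
set d := modulus l.
have [a0 b0 c0 d0] : [/\ 0 <= a, 0 <= b, 0 <= c & 0 <= d] by rewrite !mod_ge0.
pose M := a + b + 1 + c.
have M0 : 0 < M by rewrite /M; lra.
pose t := Num.min 1 (e / (3 * M)).
have t0 : 0 < t by rewrite lt_min ltr01 divr_gt0// mulr_gt0.
have [t1 tM] : t <= 1 /\ t * (3 * M) <= e.
  split; first by rewrite ge_min lexx.
  by rewrite -ler_pdivlMr ?mulr_gt0// ge_min lexx orbT.
have [d1 d10 H1] := dF _ t0; have [d2 d20 H2] := dG _ t0.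
pose q := t / (d + 1).
have q0 : 0 < q by rewrite divr_gt0// ltr_wpDl.
exists (Num.min (Num.min d1 d2) q); first by rewrite !lt_min d10 d20.
move=> h; rewrite !lt_min => /andP[/andP[/H1 {}H1 /H2 {}H2] hq].
set m := modulus h in H1 H2 hq *.
have m0 : 0 <= m by exact: mod_ge0.
have GG : modulus (G (z + h) - G z) <= t.
  have -> : G (z + h) - G z = (G (z + h) - G z - l * h) + l * h by rewrite subrK.
  apply: le_trans (modD _ _) _; rewrite modM -/m -/d.
  have : m * (d + 1) <= t by rewrite -ler_pdivlMr ?ltr_wpDl// ltW.
  have : t * m <= m by rewrite ler_piMl.
  lra.
have Gb : modulus (G (z + h)) <= b + 1.
  have -> : G (z + h) = (G (z + h) - G z) + G z by rewrite subrK.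
  apply: le_trans (modD _ _) _; rewrite -/b; lra.
have -> : F (z + h) * G (z + h) - F z * G z - (k * G z + F z * l) * h =
  (F (z + h) - F z - k * h) * G (z + h) + k * h * (G (z + h) - G z) +
  F z * (G (z + h) - G z - l * h) by ring.
apply: le_trans (modD _ _) _; apply: (le_trans (lerD (modD _ _) (lexx _))).
rewrite !modM -/a -/c -/m.
have E1 : modulus (F (z + h) - F z - k * h) * modulus (G (z + h)) <= t * m * (b + 1).
  by apply: ler_pM; rewrite ?mod_ge0.
have E2 : c * m * modulus (G (z + h) - G z) <= c * m * t.
  by rewrite ler_wpM2l// mulr_ge0.
have E3 : a * modulus (G (z + h) - G z - l * h) <= a * (t * m) by rewrite ler_wpM2l.
apply: (@le_trans _ _ (t * (3 * M) * m)); last by rewrite ler_wpM2r.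
apply: (@le_trans _ _ (t * M * m)).
  by apply: (le_trans (lerD (lerD E1 E2) E3)); rewrite /M; lra.
have : 0 <= t * M * m by rewrite !mulr_ge0// ltW.
have -> : t * (3 * M) * m = 3 * (t * M * m) by ring.
lra.
Qed.

Lemma cderiv_eq F z k l : cderiv F z k -> k = l -> cderiv F z l.
Proof. by move=> + <-. Qed.

Lemma cderivX z n : cderiv (fun w => w ^+ n) z (n%:R * z ^+ n.-1).
Proof.
elim: n => [|n IH].
  rewrite mul0r; exact: cderiv_cst.
have H := cderivM (cderiv_id z) IH.
under eq_fun do rewrite exprS.
apply: (cderiv_eq H); rewrite mul1r /=.
case: n {IH H} => [|n]; first by rewrite mul0r mulr0 expr0 addr0 mul1r.
by rewrite /= -natr1 mulrCA -exprS; ring.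
Qed.

Lemma der_eps (u : R -> R) (x k : R) :
  (forall e : R, 0 < e -> exists2 d : R, 0 < d & forall h, `|h| < d ->
    `|u (x + h) - u x - k * h| <= e * `|h|) <-> is_derive x 1 u k.
Proof.
have quot h : h != 0 ->
    `|h^-1 *: ((u \o shift x) h - u x) - k| = `|u (x + h) - u x - k * h| / `|h|.
  move=> h0; rewrite /= /shift/= (addrC h).
  have -> : u (x + h) - u x - k * h = (h^-1 * (u (x + h) - u x) - k) * h.
    by rewrite mulrBl mulrAC mulVf// mul1r.
  by rewrite normrM mulfK// normr_eq0.
have scal : (fun h : R => h^-1 *: ((u \o shift x) (h *: (1 : R)) - u x)) =
            (fun h => h^-1 *: ((u \o shift x) h - u x)).
  by apply/funext => h; rewrite -[h *: _]/(h * 1) mulr1.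
split.
  move=> H.
  have cv : h^-1 *: ((u \o shift x) h - u x) @[h --> 0^'] --> k.
    apply/cvgrPdist_le => e e0.
    have [d d0 Hd] := H _ e0.
    exists d => // h /=; rewrite distrC subr0 => hd h0.
    by rewrite distrC quot// ler_pdivrMr ?normr_gt0//; exact: Hd.
  apply: DeriveDef; first by rewrite /derivable scal; apply/cvg_ex; exists k.
  by rewrite /derive scal; apply: cvg_lim.
move=> [du uk] e e0.
have cv : h^-1 *: ((u \o shift x) h - u x) @[h --> 0^'] --> k.
  by move: du uk; rewrite /derivable /derive scal => du <-.
move/cvgrPdist_le : cv => /(_ _ e0)[d d0 Hd].
exists d => // h hd.
have [->|h0] := eqVneq h 0; first by rewrite addr0 subrr mulr0 subr0 normr0 mulr0.
have := Hd h; rewrite /= distrC subr0 => /(_ hd h0).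
by rewrite distrC quot// ler_pdivrMr ?normr_gt0.
Qed.

Lemma cder_eps (g : R -> cplane R) (x : R) k :
  (forall e : R, 0 < e -> exists2 d : R, 0 < d & forall h : R, `|h| < d ->
    modulus (g (x + h) - g x - k * rc h) <= e * `|h|) <-> cder g x k.
Proof.
split.
  move=> H; split; apply/der_eps => e /H[d d0 Hd]; exists d => // h /Hd; apply: le_trans.
    have -> : complex.Re (g (x + h)) - complex.Re (g x) - complex.Re k * h =
      complex.Re (g (x + h) - g x - k * rc h).
      by rewrite !(ReD, ReN, ReM)/= mulr0 subr0.
    exact: Re_le.
  have -> : complex.Im (g (x + h)) - complex.Im (g x) - complex.Im k * h =
      complex.Im (g (x + h) - g x - k * rc h).
    by rewrite !(ImD, ImN, ImM)/= mulr0 add0r.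
  exact: Im_le.
move=> [/der_eps Hr /der_eps Hi] e e0.
have e2 : 0 < e / 2 by rewrite divr_gt0.
have [d1 d10 H1] := Hr _ e2; have [d2 d20 H2] := Hi _ e2.
exists (Num.min d1 d2); first by rewrite lt_min d10.
move=> h; rewrite lt_min => /andP[/H1 {}H1 /H2 {}H2].
apply: le_trans (mod_le _) _; rewrite [e]splitr mulrDl.
rewrite !(ReD, ReN, ReM, ImD, ImN, ImM)/= !mulr0 subr0 add0r.
exact: lerD.
Qed.

Lemma cder_eq (g : R -> cplane R) x k l : cder g x k -> k = l -> cder g x l.
Proof. by move=> + <-. Qed.

Lemma cder_comp F (g : R -> cplane R) (x : R) k l : cder g x k -> cderiv F (g x) l ->
  cder (fun t => F (g t)) x (l * k).
Proof.
move=> dg dF.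
have /cder_eps {}dg := dg.
apply/cder_eps => e e0.
have k1 : 0 < modulus k + 1 by rewrite ltr_wpDl ?mod_ge0.
have l1 : 0 < modulus l + 1 by rewrite ltr_wpDl ?mod_ge0.
have [d1 d10 H1] := dF (e / (2 * (modulus k + 1))) (divr_gt0 e0 (mulr_gt0 (ltr0n _ 2) k1)).
pose e2 := Num.min 1 (e / (2 * (modulus l + 1))).
have e20 : 0 < e2 by rewrite lt_min ltr01 divr_gt0// mulr_gt0.
have [d2 d20 H2] := dg e2 e20.
exists (Num.min d2 (d1 / (modulus k + 1))); first by rewrite lt_min d20 divr_gt0.
move=> h; rewrite lt_min => /andP[hd2 hd1].
have {}H2 := H2 h hd2.
set K := g (x + h) - g x in H2 *.
have Kh : modulus K <= (modulus k + 1) * `|h|.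
  have -> : K = (K - k * rc h) + k * rc h by rewrite subrK.
  apply: le_trans (modD _ _) _; rewrite modM mod_rc mulrDl addrC lerD2l.
  by apply: (le_trans H2); rewrite ler_wpM2r// ge_min lexx.
have Kd1 : modulus K < d1.
  by apply: (le_lt_trans Kh); rewrite mulrC -ltr_pdivlMr.
have := H1 K Kd1; have -> : g x + K = g (x + h) by rewrite addrC subrK.
move=> {}H1.
have -> : F (g (x + h)) - F (g x) - l * k * rc h =
  (F (g (x + h)) - F (g x) - l * K) + l * (K - k * rc h) by ring.
apply: le_trans (modD _ _) _; rewrite modM.
have : e / (2 * (modulus k + 1)) * modulus K <= e / 2 * `|h|.
  apply: (@le_trans _ _ (e / (2 * (modulus k + 1)) * ((modulus k + 1) * `|h|))).
    by rewrite ler_wpM2l// divr_ge0 ?ltW// mulr_gt0.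
  by rewrite le_eqVlt; apply/orP; left; apply/eqP; field; rewrite gt_eqF.
have : modulus l * modulus (K - k * rc h) <= e / 2 * `|h|.
  apply: (@le_trans _ _ ((modulus l + 1) * (e / (2 * (modulus l + 1)) * `|h|))).
    apply: ler_pM; rewrite ?mod_ge0 ?lerDl//.
    by apply: (le_trans H2); rewrite ler_wpM2r// ge_min lexx orbT.
  by rewrite le_eqVlt; apply/orP; left; apply/eqP; field; rewrite gt_eqF.
move: H1; set a := modulus _; set b := _ * modulus (K - _).
set c := _ / _ * modulus K; set m := `|h|; lra.
Qed.

(** If the derivative of a function along each segment through [z] is given by
a continuous complex multiplier, the mean value inequality on the segment turns
this into complex differentiability. This is how the exponential, defined by
coordinates, is shown to be differentiable. *)
Lemma path_cderiv F F' z (r : R) : 0 < r ->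
  (forall h, modulus h < r -> forall t : R, 0 <= t <= 1 ->
     cder (fun t => F (z + rc t * h)) t (F' (z + rc t * h) * h)) ->
  F' x @[x --> z] --> F' z -> cderiv F z (F' z).
Proof.
move=> r0 dF /(@cvg_cplaneP _ _ (nbhs z) (nbhs_filter z)) cF e e0.
have e2 : 0 < e / 2 by rewrite divr_gt0.
have /nbhs_cplaneP[d d0 Hd] := cF _ e2.
exists (Num.min r d); first by rewrite lt_min r0.
move=> h; rewrite lt_min => /andP[hr hd].
have := @cder_MVT R (fun t => F (z + rc t * h)) (fun t => F' (z + rc t * h) * h) 0 1
  (F' z * h) (e / 2 * modulus h) ler01 (dF _ hr).
have -> : rc 1 = 1 :> cplane R by [].
have -> : rc 0 = 0 :> cplane R by [].
rewrite mul1r mul0r addr0 subr0 !mulr1 => H; apply: le_trans (H _) _; last first.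
  by rewrite le_eqVlt; apply/orP; left; apply/eqP; field.
move=> t /andP[t0 t1]; rewrite -mulrBl modM ler_wpM2r ?mod_ge0//.
apply: ltW; apply: Hd; rewrite addrC addKr modM mod_rc ger0_norm//.
by apply: le_lt_trans hd; rewrite ler_piMl ?mod_ge0.
Qed.

End ComplexDerivative.

Section Exponential.
Context {R : realType}.
Implicit Types (z w : cplane R).

Definition cis (t : R) : cplane R := Complex (cos t) (sin t).
Definition cexp z : cplane R :=
  Complex (expR (complex.Re z) * cos (complex.Im z)) (expR (complex.Re z) * sin (complex.Im z)).

Lemma cisD s t : cis (s + t) = cis s * cis t.
Proof. by apply: eqC; rewrite ?ReM ?ImM/= ?cosD ?sinD; ring. Qed.

Lemma cis0 : cis 0 = 1.
Proof. by apply: eqC; rewrite /= ?cos0 ?sin0. Qed.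

Lemma mod_cis t : modulus (cis t) = 1.
Proof. by rewrite /modulus/= cos2Dsin2 sqrtr1. Qed.

Lemma cisN t : cis (- t) = conjc (cis t).
Proof. by apply: eqC; rewrite ?ReJ ?ImJ/= ?cosN ?sinN. Qed.

Lemma cisNM t : cis (- t) * cis t = 1.
Proof. by rewrite -cisD addNr cis0. Qed.

Lemma cisX t n : cis t ^+ n = cis (n%:R * t).
Proof.
elim: n => [|n IH]; first by rewrite expr0 mul0r cis0.
by rewrite exprS IH -cisD -natr1 mulrDl mul1r addrC.
Qed.

Lemma cis2pi : cis (2 * pi) = 1.
Proof.
have -> : 2 * pi = pi + pi :> R by rewrite mulr_natl mulr2n.
have cp : cis pi = Complex (- 1) 0 by rewrite /cis cospi sinpi.
by rewrite cisD cp; apply: eqC; rewrite ?ReM ?ImM/=; ring.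
Qed.

Lemma cexp0 : cexp 0 = 1.
Proof. by apply: eqC; rewrite /= expR0 ?cos0 ?sin0 ?mulr1 ?mulr0. Qed.

Lemma mod_cexp z : modulus (cexp z) = expR (complex.Re z).
Proof.
have -> : cexp z = rc (expR (complex.Re z)) * cis (complex.Im z).
  by apply: eqC; rewrite ?ReM ?ImM/=; ring.
by rewrite modM mod_cis mod_rc mulr1 ger0_norm// expR_ge0.
Qed.

Lemma cexp_rect s t : cexp (Complex s t) = rc (expR s) * cis t.
Proof. by apply: eqC; rewrite ?ReM ?ImM/=; ring. Qed.

Lemma cder_cexp (g : R -> cplane R) x k : cder g x k ->
  cder (fun t => cexp (g t)) x (cexp (g x) * k).
Proof.
move=> [dr di].
have E := der_comp dr (is_derive_expR (complex.Re (g x))).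
have C := der_comp di (is_derive_cos (complex.Im (g x))).
have S := der_comp di (is_derive_sin (complex.Im (g x))).
split => /=.
  by apply: (der_eq (derM E C)); rewrite ReM/=; ring.
by apply: (der_eq (derM E S)); rewrite ImM/=; ring.
Qed.

Lemma cvg_cexp z : cexp w @[w --> z] --> cexp z.
Proof.
have r := @cvg_Re R _ (nbhs z) (nbhs_filter z) (fun w => w) z cvg_id.
have i := @cvg_Im R _ (nbhs z) (nbhs_filter z) (fun w => w) z cvg_id.
have E := cvg_comp _ _ r (@continuous_expR R (complex.Re z)).
have C := cvg_comp _ _ i (@continuous_cos R (complex.Im z)).
have S := cvg_comp _ _ i (@continuous_sin R (complex.Im z)).
exact: (cvg_Complex (cvgM E C) (cvgM E S)).
Qed.

Lemma cder_line z (h : cplane R) t : cder (fun t => z + rc t * h) t h.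
Proof.
have dt : cder (fun t : R => rc t) t 1 by split => /=; [exact: is_derive_id|exact: is_derive_cst].
have H := cderD (cder_cst z t) (cderM dt (cder_cst h t)).
by apply: (cder_eq H); ring.
Qed.

Lemma cderiv_cexp z : cderiv cexp z (cexp z).
Proof.
apply: (@path_cderiv R cexp cexp z 1 ltr01); last exact: cvg_cexp.
by move=> h _ t _; exact: (cder_cexp (cder_line z h t)).
Qed.

Lemma cder_cis (k t : R) : cder (fun t => cis (k * t)) t (rc k * ii * cis (k * t)).
Proof.
have dk : is_derive t 1 (fun t : R => k * t) k.
  by apply: (der_eq (derM (der_cst k t) (der_id t))); ring.
have C := der_comp dk (is_derive_cos (k * t)).
have S := der_comp dk (is_derive_sin (k * t)).
by split => /=; [apply: (der_eq C)|apply: (der_eq S)]; rewrite ?ReM ?ImM/=; ring.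
Qed.

End Exponential.

(** * Fourier coefficients on circles and Cauchy's formula *)

Section CauchyCircle.
Context {R : realType}.
Implicit Types (f : cplane R -> cplane R) (c z : cplane R) (r k s t : R).

Lemma twopi_ge0 : 0 <= 2 * pi :> R.
Proof. by rewrite mulr_ge0// pi_ge0. Qed.

Lemma cder_cis1 t : cder cis t (ii * cis t : cplane R).
Proof.
have := cder_cis 1 t; under eq_fun do rewrite mul1r.
by move=> H; apply: (cder_eq H); rewrite mul1r -[rc 1]/(1 : cplane R); ring.
Qed.

Lemma cder_circle c r t : cder (fun t => c + rc r * cis t) t (rc r * (ii * cis t)).
Proof.
apply: (cder_eq (cderD (cder_cst c t) (cderM (cder_cst (rc r) t) (cder_cis1 t)))).
by ring.
Qed.

Lemma cder_cisN k t : cder (fun t => cis (- (k * t))) t (- rc k * ii * cis (- (k * t))).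
Proof.
have H := cder_cis (- k) t; rewrite mulNr in H.
under eq_fun do rewrite -mulNr.
apply: (cder_eq H); have -> : rc (- k) = - rc k :> cplane R by apply: eqC; rewrite ?ReN ?ImN/= ?oppr0.
by [].
Qed.

Lemma cint_cis k : k != 0 -> cis (k * (2 * pi)) = 1 :> cplane R ->
  cint (fun t => cis (k * t)) 0 (2 * pi) = 0 :> cplane R.
Proof.
move=> k0 ck.
have k0' : rc k * ii != 0 :> cplane R.
  by rewrite -mod_gt0 modM mod_ii mulr1 mod_rc normr_gt0.
rewrite (@cint_FTC R (fun t => (rc k * ii)^-1 * cis (k * t))).
- rewrite ck mulr0 cis0; exact: subrr.
- exact: twopi_ge0.
- by apply: ccont_onP => x _; exact: (cder_cont (cder_cis k x)).
- move=> x _; apply: (cder_eq (cderM (cder_cst _ x) (cder_cis k x))).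
  by rewrite mulr0 addr0 mulKf.
Qed.

(** [2 pi] times the [k]-th Fourier coefficient of [f] on the circle of centre
[c] and radius [r]; the frequency [k] is real so that negative and shifted
frequencies need no casts. *)
Definition circ f c r k : cplane R :=
  cint (fun t => f (c + rc r * cis t) * cis (- (k * t))) 0 (2 * pi).

Lemma mod_circle c r t : 0 <= r -> modulus (c + rc r * cis t - c) = r.
Proof. by move=> r0; rewrite addrC addKr modM mod_rc mod_cis mulr1 ger0_norm. Qed.

Section Disc.
Variables (f : cplane R -> cplane R) (c : cplane R) (rho : R).
Hypothesis hf : forall z, modulus (z - c) < rho -> derivable f z 1.

Lemma ccont_circle r k a b : 0 <= r < rho ->
  ccont_on a b (fun t => f (c + rc r * cis t) * cis (- (k * t))).
Proof.
move=> /andP[r0 rr]; apply: ccont_onM; apply: ccont_onP => t _.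
  have d : derivable f (c + rc r * cis t) 1 by apply: hf; rewrite mod_circle.
  exact: (cder_cont (cder_comp (cder_circle c r t) (derivable_cderiv d))).
exact: (cder_cont (cder_cisN k t)).
Qed.

(** The function [f (c + exp w) exp (- k w)] is holomorphic on a strip and has
period [2 pi i] there. Goursat's theorem on the rectangle
[s1, s2] x [0, 2 pi] makes the two horizontal sides cancel, so the integrals
over the two vertical sides, which are the two sides of the identity, agree. *)
Lemma circ_shift s1 s2 k : s1 <= s2 -> expR s2 < rho ->
  cis (k * (2 * pi)) = 1 :> cplane R ->
  rc (expR (- (k * s1))) * circ f c (expR s1) k =
  rc (expR (- (k * s2))) * circ f c (expR s2) k.
Proof.
move=> s12 s2r kp.
pose F w : cplane R := f (c + cexp w) * cexp (- rc k * w).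
have FE x y : F (Complex x y) =
    rc (expR (- (k * x))) * (f (c + rc (expR x) * cis y) * cis (- (k * y))).
  rewrite /F cexp_rect mulrCA; congr (_ * _).
  have -> : - rc k * (Complex x y : cplane R) = Complex (- (k * x)) (- (k * y)) :> cplane R.
    by apply: eqC; rewrite ?ReM ?ImM ?ReN ?ImN/=; ring.
  by rewrite cexp_rect.
have lt_rho x : x <= s2 -> expR x < rho.
  by move=> xs; apply: le_lt_trans s2r; rewrite ler_expR.
have dF x y : s1 <= x <= s2 -> 0 <= y <= 2 * pi -> derivable F (Complex x y : cplane R) 1.
  move=> /andP[_ xs2] _.
  have d : derivable f (c + cexp (Complex x y)) 1.
    apply: hf; rewrite cexp_rect mod_circle ?expR_ge0//; exact: lt_rho.
  have g := cderivD (cderiv_cst (Complex x y) c) (cderiv_cexp (Complex x y)).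
  have l := cderivM (cderiv_cst (Complex x y) (- rc k)) (cderiv_id (Complex x y)).
  have e := cderiv_comp l (cderiv_cexp (- rc k * (Complex x y : cplane R))).
  exact: (cderiv_derivable (cderivM (cderiv_comp g (derivable_cderiv d)) e)).
have J x : s1 <= x <= s2 -> cint (fun y => F (Complex x y)) 0 (2 * pi) =
    rc (expR (- (k * x))) * circ f c (expR x) k.
  move=> /andP[_ xs]; rewrite /circ -cintZ; first by apply: eq_cint => y _; exact: FE.
  by apply: ccont_circle; rewrite expR_ge0 lt_rho.
have key (A B C : cplane R) : A + ii * C - A - ii * B = 0 -> B = C.
  have i0 : ii != 0 :> cplane R by rewrite -mod_gt0 mod_ii.
  have -> : A + ii * C - A - ii * B = ii * (C - B) by ring.
  by move=> /eqP; rewrite mulf_eq0 (negbTE i0)/= subr_eq0 => /eqP.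
have s11 : s1 <= s1 <= s2 by rewrite lexx.
have s22 : s1 <= s2 <= s2 by rewrite lexx s12.
have := goursat s12 twopi_ge0 dF; rewrite /bdint (J _ s11) (J _ s22).
have -> : cint (fun x => F (Complex x 0)) s1 s2 = cint (fun x => F (Complex x (2 * pi))) s1 s2.
  apply: eq_cint => x _; rewrite !FE cis0 cis2pi mulr0 oppr0 cis0.
  by rewrite cisN kp; congr (_ * (_ * _)); apply: eqC; rewrite ?ReJ ?ImJ/= ?oppr0.
by move=> /key.
Qed.

Lemma circ_scale r1 r2 k : 0 < r1 -> r1 <= r2 -> r2 < rho ->
  cis (k * (2 * pi)) = 1 :> cplane R ->
  rc (expR (- (k * ln r1))) * circ f c r1 k = rc (expR (- (k * ln r2))) * circ f c r2 k.
Proof.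
move=> r10 r12 r2r kp; have r20 := lt_le_trans r10 r12.
have E1 : expR (ln r1) = r1 by rewrite lnK ?posrE.
have E2 : expR (ln r2) = r2 by rewrite lnK ?posrE.
have l12 : ln r1 <= ln r2 by rewrite ler_ln ?posrE.
by have := @circ_shift (ln r1) (ln r2) k l12; rewrite E1 E2 => H; exact: (H r2r kp).
Qed.

(** The normalized coefficient does not depend on the radius by
[circ_scale]; letting the radius tend to 0, the first order expansion of [f] at
[c] gives its value. *)
Lemma cauchy_deriv r : 0 < r < rho ->
  circ f c r 1 = rc (2 * pi * r) * derive1 f c.
Proof.
move=> /andP[r0 rr].
have d : derivable f c 1 by apply: hf; rewrite subrr mod0 (lt_trans r0).
set D := derive1 f c.
have H := derivable_cderiv d.
suff small e : 0 < e -> modulus (circ f c r 1 - rc (2 * pi * r) * D) <= e * (4 * pi * r).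
  apply/eqP; rewrite -subr_eq0; apply/eqP/mod_eq0/le_anti; rewrite mod_ge0 andbT.
  apply/ler_addgt0Pr => e e0; rewrite add0r.
  have P : 0 < 4 * pi * r by rewrite !mulr_gt0// pi_gt0.
  by have := small _ (divr_gt0 e0 P); rewrite divfK// gt_eqF.
move=> e0; have [dl dl0 Hd] := H e e0.
pose q := Num.min r (dl / 2).
have q0 : 0 < q by rewrite lt_min r0 divr_gt0.
have qr : q <= r by rewrite ge_min lexx.
have qd : q < dl by rewrite gt_min [dl / 2 < _]gtr_pMr// invf_lt1// ltr1n orbT.
have qrho := le_lt_trans qr rr.
have c1 : cis (1 * (2 * pi)) = 1 :> cplane R by rewrite mul1r cis2pi.
have := circ_scale q0 qr rr c1.
rewrite !mul1r -!lnV ?posrE// !lnK ?posrE ?invr_gt0// => S.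
have CR : circ f c r 1 = rc (r / q) * circ f c q 1.
  have -> : rc (r / q) = rc r * rc q^-1 :> cplane R by apply: eqC; rewrite ?ReM ?ImM/=; ring.
  rewrite -mulrA S mulrA.
  have -> : rc r * rc r^-1 = 1 :> cplane R.
    by apply: eqC; rewrite ?ReM ?ImM/= ?mulfV ?gt_eqF//; ring.
  by rewrite mul1r.
have main : modulus (circ f c q 1 - rc (2 * pi * q) * D) <= 2 * (e * q) * (2 * pi).
  have cA : ccont_on 0 (2 * pi) (fun t => f (c + rc q * cis t) * cis (- (1 * t))).
    by apply: ccont_circle; rewrite qrho ltW.
  have cB : ccont_on 0 (2 * pi) (fun t : R => f c * cis (-1 * t)).
    apply: ccont_onM; first exact: ccont_on_cst.
    by apply: ccont_onP => t _; exact: (cder_cont (cder_cis (-1) t)).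
  have IB : cint (fun t : R => f c * cis (-1 * t)) 0 (2 * pi) = 0.
    rewrite cintZ; first rewrite cint_cis; first exact: mulr0.
    - by rewrite oppr_eq0 oner_eq0.
    - by rewrite mulN1r cisN cis2pi; apply: eqC; rewrite ?ReJ ?ImJ/= ?oppr0.
    by apply: ccont_onP => t _; exact: (cder_cont (cder_cis (-1) t)).
  have cC := @ccont_on_cst R 0 (2 * pi) (D * rc q).
  have IC : cint (fun=> D * rc q) 0 (2 * pi) = rc (2 * pi * q) * D.
    rewrite cint_cst ?twopi_ge0// subr0; apply: eqC; rewrite ?ReM ?ImM/=; ring.
  have -> : circ f c q 1 - rc (2 * pi * q) * D = cint (fun t =>
     (f (c + rc q * cis t) * cis (- (1 * t)) - f c * cis (-1 * t)) - D * rc q) 0 (2 * pi).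
    rewrite cintD; [|exact: (ccont_onD cA (ccont_onN cB))|exact: (ccont_onN cC)].
    rewrite cintD; [|exact: cA|exact: (ccont_onN cB)].
    by rewrite (cintN cB) (cintN cC) IB IC oppr0 addr0.
  rewrite -[X in _ <= _ * X](subr0 (2 * pi)); apply: cint_bound; first exact: twopi_ge0.
    exact: (ccont_onD (ccont_onD cA (ccont_onN cB)) (ccont_onN cC)).
  move=> t _.
  have -> : f (c + rc q * cis t) * cis (- (1 * t)) - f c * cis (-1 * t) - D * rc q =
    (f (c + rc q * cis t) - f c - D * (rc q * cis t)) * cis (- t).
    rewrite mulN1r mul1r.
    have -> : D * rc q = D * (rc q * cis t) * cis (- t).
      by rewrite -!mulrA [cis t * _]mulrC cisNM mulr1.
    by ring.
  rewrite modM mod_cis mulr1.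
  have mq : modulus (rc q * cis t) = q by rewrite modM mod_rc mod_cis mulr1 gtr0_norm.
  by have := Hd (rc q * cis t); rewrite mq; apply.
have -> : circ f c r 1 - rc (2 * pi * r) * D = rc (r / q) * (circ f c q 1 - rc (2 * pi * q) * D).
  rewrite CR mulrBr mulrA; congr (_ - _ * _).
  by apply: eqC; rewrite ?ReM ?ImM/=; field; rewrite gt_eqF.
rewrite modM mod_rc ger0_norm; last by rewrite divr_ge0 ?ltW.
apply: (@le_trans _ _ (r / q * (2 * (e * q) * (2 * pi)))).
  by rewrite ler_wpM2l// divr_ge0 ?ltW.
by rewrite le_eqVlt; apply/orP; left; apply/eqP; field; rewrite gt_eqF.
Qed.

End Disc.

(** Cauchy's formula expresses [derive1 f x], for [x] near [c], by an integral
of [f] over a circle of fixed radius around [x]; the integrand depends on [x]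
continuously, uniformly on the circle by compactness. *)
Lemma derive1_cvg f c (rho : R) : 0 < rho ->
  (forall z, modulus (z - c) < rho -> derivable f z 1) ->
  derive1 f x @[x --> c] --> derive1 f c.
Proof.
move=> rho0 hf; apply/(@cvg_cplaneP _ _ (nbhs c) (nbhs_filter c)) => e e0.
pose r := rho / 2.
have r0 : 0 < r by rewrite divr_gt0.
pose e' := e * r / 4.
have e'0 : 0 < e' by rewrite !mulr_gt0// invr_gt0.
have unif : \forall x \near c, forall t, `[0, 2 * pi]%classic t ->
    modulus (f (x + rc r * cis t) - f (c + rc r * cis t)) < e'.
  have /compact_near_coveringP cov := @segment_compact R 0 (2 * pi).
  apply: (cov _ (nbhs c) (fun x t =>
    modulus (f (x + rc r * cis t) - f (c + rc r * cis t)) < e')) => t _.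
  have fp : f y @[y --> c + rc r * cis t] --> f (c + rc r * cis t).
    apply: derivable_cplane_cvg; apply: hf.
    by rewrite mod_circle ?ltW// /r ltr_pdivrMr// ltr_pMr// ltr1n.
  pose P : set_system (R * cplane R) := filter_prod (nbhs t) (nbhs c).
  have PF : Filter P by exact: filter_prod_filter.
  have c1 : (fun y : R * cplane R => cis y.1) @ P --> cis t.
    by apply: (cvg_comp _ _ _ (cder_cont (cder_cis1 t))); exact: cvg_fst.
  have c2 : (fun y : R * cplane R => y.2) @ P --> c by exact: cvg_snd.
  have cr (k : cplane R) : (fun y : R * cplane R => k) @ P --> k by exact: cvg_cst.
  have c3 : (fun y : R * cplane R => c + rc r * cis y.1) @ P --> c + rc r * cis t.
    exact: (@cvg_cplaneD _ _ P PF _ _ _ _ (cr c) (@cvg_cplaneM _ _ P PF _ _ _ _ (cr (rc r)) c1)).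
  have c4 : (fun y : R * cplane R => y.2 + rc r * cis y.1) @ P --> c + rc r * cis t.
    exact: (@cvg_cplaneD _ _ P PF _ _ _ _ c2 (@cvg_cplaneM _ _ P PF _ _ _ _ (cr (rc r)) c1)).
  have H := @cvg_near_lt _ _ P PF _ _ _ e'0
    (@cvg_cplaneB _ _ P PF _ _ _ _ (cvg_comp _ _ c4 fp) (cvg_comp _ _ c3 fp)).
  apply: (@filterS _ P PF _ _ _ H) => y /=.
  by rewrite [f (c + rc r * cis t) - _]subrr subr0.
near=> x.
have xc : modulus (x - c) < rho / 4.
  by near: x; apply/nbhs_cplaneP; exists (rho / 4) => //; rewrite divr_gt0.
have U : forall t, `[0, 2 * pi]%classic t ->
  modulus (f (x + rc r * cis t) - f (c + rc r * cis t)) < e' by near: x.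
have hfx z : modulus (z - x) < 3 * rho / 4 -> derivable f z 1.
  move=> zx; apply: hf; have -> : z - c = (z - x) + (x - c) by ring.
  apply: le_lt_trans (modD _ _) _; lra.
have rrho : 0 < r < rho by rewrite r0 /r; lra.
have rrhox : 0 < r < 3 * rho / 4 by rewrite r0 /r; lra.
have := cauchy_deriv hf rrho; have := cauchy_deriv hfx rrhox => Ex Ec.
have E : rc (2 * pi * r) * (derive1 f x - derive1 f c) = circ f x r 1 - circ f c r 1.
  by rewrite Ex Ec -mulrBr.
have cx : ccont_on 0 (2 * pi) (fun t => f (x + rc r * cis t) * cis (- (1 * t))).
  by apply: (ccont_circle hfx); rewrite ltW//=; case/andP: rrhox.
have cc : ccont_on 0 (2 * pi) (fun t => f (c + rc r * cis t) * cis (- (1 * t))).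
  by apply: (ccont_circle hf); rewrite ltW//=; case/andP: rrho.
have : modulus (circ f x r 1 - circ f c r 1) <= 2 * e' * (2 * pi - 0).
  rewrite /circ -(cintN cc) -cintD; [|exact: cx|exact: (ccont_onN cc)].
  apply: cint_bound; [exact: twopi_ge0|exact: (ccont_onD cx (ccont_onN cc))|].
  move=> t tt; rewrite -mulrBl modM mod_cis mulr1; apply: ltW; apply: U.
  by rewrite /= in_itv.
have P : 0 < 2 * pi * r by rewrite !mulr_gt0// pi_gt0.
rewrite -E modM mod_rc (gtr0_norm P) subr0 => H.
rewrite -(ltr_pM2l P); apply: (le_lt_trans H).
have -> : 2 * e' * (2 * pi) = (2 * pi * r * e) / 2 by rewrite /e'; field.
by rewrite ltr_pdivrMr// ltr_pMr ?ltr1n// mulr_gt0.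
Unshelve. all: by end_near. Qed.

Section DiscParts.
Variables (f : cplane R -> cplane R) (c : cplane R) (rho : R).
Hypothesis hf : forall z, modulus (z - c) < rho -> derivable f z 1.

Lemma derive1_cvg_in z : modulus (z - c) < rho -> derive1 f x @[x --> z] --> derive1 f z.
Proof.
move=> zc; apply: (@derive1_cvg f z (rho - modulus (z - c))); first by rewrite subr_gt0.
move=> w wz; apply: hf; have -> : w - c = (w - z) + (z - c) by ring.
by apply: le_lt_trans (modD _ _) _; rewrite -ltrBrDr.
Qed.

Lemma ccont_circle_derive r k a b : 0 <= r < rho ->
  ccont_on a b (fun t => derive1 f (c + rc r * cis t) * cis (- (k * t))).
Proof.
move=> /andP[r0 rr]; apply: ccont_onM; apply: ccont_onP => t _.
  have d := @derive1_cvg_in (c + rc r * cis t).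
  rewrite mod_circle// in d.
  exact: (cvg_comp _ _ (cder_cont (cder_circle c r t)) (d rr)).
exact: (cder_cont (cder_cisN k t)).
Qed.

(** Integration by parts on the circle: the derivative of
[f (c + r e^{it}) e^{-ikt}] integrates to 0 over a period. *)
Lemma circ_parts r k : 0 < r < rho -> cis (k * (2 * pi)) = 1 :> cplane R ->
  rc r * circ (derive1 f) c r (k - 1) = rc k * circ f c r k.
Proof.
move=> /andP[r0 rr] kp.
have r01 : 0 <= r < rho by rewrite ltW.
have c1 := @ccont_circle_derive r (k - 1) 0 (2 * pi) r01.
have c2 := @ccont_circle f c rho hf r k 0 (2 * pi) r01.
have cc : ccont_on 0 (2 * pi) (fun t =>
    (rc r * ii) * (derive1 f (c + rc r * cis t) * cis (- ((k - 1) * t))) +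
    (- rc k * ii) * (f (c + rc r * cis t) * cis (- (k * t)))).
  exact: (ccont_onD (ccont_onM (ccont_on_cst _ _ _) c1) (ccont_onM (ccont_on_cst _ _ _) c2)).
have := cint_FTC (F := fun t => f (c + rc r * cis t) * cis (- (k * t))) twopi_ge0 cc.
rewrite (_ : f (c + rc r * cis (2 * pi)) * cis (- (k * (2 * pi))) -
   f (c + rc r * cis 0) * cis (- (k * 0)) = 0); last first.
  rewrite cis2pi mulr0 oppr0 cis0 cisN kp.
  have -> : conjc 1 = 1 :> cplane R by apply: eqC; rewrite ?ReJ ?ImJ/= ?oppr0.
  exact: subrr.
rewrite cintD; [|exact: (ccont_onM (ccont_on_cst _ _ _) c1)|exact: (ccont_onM (ccont_on_cst _ _ _) c2)].
rewrite (cintZ _ c1) (cintZ _ c2) -/(circ (derive1 f) c r (k - 1)) -/(circ f c r k) => H.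
have i0 : ii != 0 :> cplane R by rewrite -mod_gt0 mod_ii.
apply: (mulfI i0); apply/eqP; rewrite -subr_eq0.
have -> : ii * (rc r * circ (derive1 f) c r (k - 1)) - ii * (rc k * circ f c r k) =
  rc r * ii * circ (derive1 f) c r (k - 1) + - rc k * ii * circ f c r k by ring.
rewrite H// => t _.
have d : derivable f (c + rc r * cis t) 1 by apply: hf; rewrite mod_circle// ltW.
apply: (cder_eq (cderM (cder_comp (cder_circle c r t) (derivable_cderiv d)) (cder_cisN k t))).
have -> : cis (- ((k - 1) * t)) = cis (- (k * t)) * cis t :> cplane R.
  by rewrite -cisD; congr cis; ring.
by ring.
Qed.

Lemma mean_derive1 r : 0 < r < rho -> circ (derive1 f) c r 0 = rc (2 * pi) * derive1 f c.
Proof.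
move=> rr; have r0 : 0 < r by case/andP: rr.
have := circ_parts rr; move=> /(_ 1); rewrite mul1r cis2pi subrr => /(_ erefl).
rewrite (cauchy_deriv hf rr).
have r0' : rc r != 0 :> cplane R by rewrite -mod_gt0 mod_rc normr_gt0 gt_eqF.
move=> H; apply: (mulfI r0'); rewrite H.
by apply: eqC; rewrite ?ReM ?ImM/= ?ReM ?ImM/=; ring.
Qed.

End DiscParts.

End CauchyCircle.

(** * Peaking kernels on the circle *)

Section FourierUniqueness.
Context {R : realType}.
Implicit Types (u : R -> R).

Lemma cos_le_far (d x : R) : 0 <= d <= pi -> d <= x <= 2 * pi - d -> cos x <= cos d.
Proof.
move=> /andP[d0 dpi] /andP[dx xd].
have mono (y : R) : d <= y <= pi -> cos y <= cos d.
  move=> /andP[dy ypi]; move: dy; rewrite le_eqVlt => /predU1P[->//|dy].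
  apply: ltW; rewrite ltr_cos ?in_itv/= ?d0 ?dpi//.
  by rewrite ypi (le_trans d0 (ltW dy)).
have [xpi|pix] := leP x pi; first by apply: mono; rewrite dx.
have -> : cos x = cos (2 * pi - x).
  by have := @cosD2pi R (- x); rewrite cosN addrC -(mulr_natl pi) => ->.
by apply: mono; apply/andP; split; lra.
Qed.

(** The powers of [1 + cos (t - t0)] concentrate at [t0]: away from [t0] they are
exponentially smaller than near [t0]. If [u t0] were positive, the integrals
against large powers would eventually be positive. *)
Lemma peak_unique u t0 : 0 < t0 < 2 * pi -> (forall x, {for x, continuous u}) ->
  (forall m, rint (fun t => u t * (1 + cos (t - t0)) ^+ m) 0 (2 * pi) = 0) -> u t0 <= 0.
Proof.
move=> /andP[t00 t02] cu u0; rewrite leNgt; apply/negP => up.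
set K := u t0 in up.
have /cvgrPdist_lt/(_ (K / 2) (divr_gt0 up (ltr0n _ 2)))[d0 /= d00 Hd0] := cu t0.
have pp := @pi_gt0 R.
(* the arc of half-length [d] around [t0] stays inside the period, and [cos d]
   is positive *)
pose d := Num.min (d0 / 2) (Num.min (Num.min t0 (2 * pi - t0)) (pi / 4)).
have d_gt0 : 0 < d by rewrite !lt_min t00 subr_gt0 t02 !divr_gt0.
have dd0 : d < d0.
  by apply: (@le_lt_trans _ _ (d0 / 2)); rewrite ?ge_min ?lexx// ltr_pdivrMr// ltr_pMr// ltr1n.
have [dt0 dt2 dp] : [/\ d <= t0, d <= 2 * pi - t0 & d <= pi / 4].
  by rewrite /d !ge_min !lexx !orbT.
have near x : `|x - t0| <= d -> K / 2 < u x.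
  move=> xt; have := Hd0 x; rewrite /= distrC => /(_ (le_lt_trans xt dd0)).
  by rewrite ltr_norml => /andP[_]; rewrite -/K; lra.
pose q t := 1 + cos (t - t0).
have q0 t : 0 <= q t by rewrite /q; have := cos_geN1 (t - t0); lra.
pose al := 1 + cos (d / 2); pose be := 1 + cos d.
have be0 : 0 < be.
  have : 0 < cos d by apply: cos_gt0_pihalf; apply/andP; split; lra.
  by rewrite /be; lra.
have albe : be < al.
  by rewrite /al /be ltrD2l ltr_cos ?in_itv/=; [lra|apply/andP; split; lra..].
have qfar t : 0 <= t <= 2 * pi -> d <= `|t - t0| -> q t <= be.
  move=> /andP[ta tb] dt; rewrite /q /be lerD2l -(cos_norm (t - t0)).
  apply: cos_le_far; first by apply/andP; split; lra.
  rewrite dt/= ler_norml; apply/andP; split; lra.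
have qnear t : `|t - t0| <= d / 2 -> al <= q t.
  move=> dt; rewrite /q /al lerD2l -(cos_norm (t - t0)).
  move: dt; rewrite le_eqVlt => /predU1P[->//|dt].
  by apply: ltW; rewrite ltr_cos// in_itv/= ?normr_ge0; apply/andP; split; lra.
have [U HU] : exists U, forall t, 0 <= t <= 2 * pi -> `|u t| <= U.
  have [|c _ Hc] := @EVT_max R (fun t => `|u t|) 0 (2 * pi) twopi_ge0.
    by apply: continuous_subspaceT => x; apply: cvg_norm; exact: cu.
  by exists `|u c| => t tt; apply: Hc; rewrite in_itv.
have U0 : 0 <= U by apply: le_trans (HU 0 _); rewrite ?normr_ge0// lexx twopi_ge0.
pose p m t := u t * (1 + cos (t - t0)) ^+ m.
have cp m a b : cont_on a b (p m).
  apply: cont_onM; first by move=> x _; exact: cu.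
  elim: m => [|m IH]; first by under eq_fun do rewrite expr0; exact: cont_on_cst.
  under eq_fun do rewrite exprS; apply: cont_onM; last exact: IH.
  move=> x _; apply: continuousD; first exact: cst_continuous.
  apply: (@continuous_comp _ _ _ (fun t => t - t0)); last exact: continuous_cos.
  by apply: continuousB; [exact: cvg_id|exact: cst_continuous].
have far m t : 0 <= t <= 2 * pi -> - (U * be ^+ m) <= p m t.
  move=> tt; have [td|dt] := leP `|t - t0| d.
    have := near _ td => ut.
    apply: (@le_trans _ _ 0); first by rewrite oppr_le0 mulr_ge0// exprn_ge0// ltW.
    by rewrite mulr_ge0 ?exprn_ge0 ?q0//; lra.
  have := HU _ tt; rewrite ler_norml => /andP[Ul _].
  have qb := qfar t tt (ltW dt).
  rewrite /p -mulNr.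
  apply: (@le_trans _ _ (- U * q t ^+ m)).
    by rewrite ler_wnM2l ?oppr_le0// lerXn2r ?nnegrE// ltW.
  by rewrite ler_wpM2r// exprn_ge0.
have key m : d * (K / 2 * al ^+ m) <= 2 * pi * (U * be ^+ m).
  have := u0 m; rewrite -/(p m).
  rewrite (@rint_split R _ 0 (2 * pi) (t0 - d / 2)); last exact: cp; last by apply/andP; split; lra.
  rewrite (@rint_split R _ (t0 - d / 2) (2 * pi) (t0 + d / 2)); last exact: cp;
    last by apply/andP; split; lra.
  have far_int a b : 0 <= a -> a <= b -> b <= 2 * pi -> - (U * be ^+ m) * (b - a) <= rint (p m) a b.
    move=> a0 ab b2; rewrite -rint_cst//; apply: rint_le => //; first exact: cont_on_cst.
    by move=> x /andP[ax xb]; apply: far; rewrite (le_trans a0)//= (le_trans xb).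
  have I1 := far_int 0 (t0 - d / 2) (lexx _).
  have I3 := far_int (t0 + d / 2) (2 * pi).
  have I2 : K / 2 * al ^+ m * d <= rint (p m) (t0 - d / 2) (t0 + d / 2).
    have -> : K / 2 * al ^+ m * d = K / 2 * al ^+ m * ((t0 + d / 2) - (t0 - d / 2)).
      by congr (_ * _); lra.
    rewrite -rint_cst; last by lra.
    apply: rint_le => //; first exact: cont_on_cst.
    move=> x /andP[xa xb]; have xd : `|x - t0| <= d / 2.
      by rewrite ler_norml; apply/andP; split; lra.
    have ux : K / 2 < u x by apply: near; apply: (le_trans xd); lra.
    apply: ler_pM; [lra| |lra|].
      by rewrite exprn_ge0//; apply: ltW; exact: lt_trans albe.
    rewrite lerXn2r ?nnegrE ?q0//; last exact: qnear.
    by apply: ltW; exact: lt_trans albe.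
  have {}I1 : - (U * be ^+ m) * (t0 - d / 2 - 0) <= rint (p m) 0 (t0 - d / 2) by apply: I1; lra.
  have {}I3 : - (U * be ^+ m) * (2 * pi - (t0 + d / 2)) <= rint (p m) (t0 + d / 2) (2 * pi).
    by apply: I3; lra.
  move=> H0.
  set W := U * be ^+ m in I1 I3 *.
  have W0 : 0 <= W by rewrite mulr_ge0// exprn_ge0// ltW.
  have : W * (2 * pi - d) <= W * (2 * pi) by rewrite ler_wpM2l//; lra.
  move: I1 I2 I3 H0; rewrite (mulrC d) [2 * pi * W]mulrC; lra.
have := @cvg_expr R (be / al); rewrite ger0_norm; last first.
  by rewrite divr_ge0 ?ltW// (lt_trans be0).
have al0 : 0 < al := lt_trans be0 albe.
rewrite ltr_pdivrMr// mul1r => /(_ albe) /cvgrPdist_lt.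
have P : 0 < d * (K / 2) by rewrite mulr_gt0// divr_gt0.
have Q : 0 < 2 * pi * U + 1 by rewrite ltr_wpDl// mulr_ge0// twopi_ge0.
move=> /(_ _ (divr_gt0 P Q)) [N _ /(_ N (leqnn N))] /=.
rewrite sub0r normrN ger0_norm; last by rewrite exprn_ge0// divr_ge0// ltW.
rewrite expr_div_n ltr_pdivrMr ?exprn_gt0// mulrAC ltr_pdivlMr// => H.
have : d * (K / 2 * al ^+ N) <= 2 * pi * (U * be ^+ N) := key N.
have : 2 * pi * (U * be ^+ N) <= be ^+ N * (2 * pi * U + 1).
  have : 0 < be ^+ N by rewrite exprn_gt0.
  by lra.
by move: H; lra.
Qed.

End FourierUniqueness.

(** * Uniqueness of Fourier and Taylor coefficients *)

Section FourierHolo.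
Context {R : realType}.

Lemma derivable_near (F : cplane R -> cplane R) (z : cplane R) (e : R) : 0 < e ->
  derivable F z 1 -> exists2 d : R, 0 < d &
  forall w, modulus (w - z) < d -> modulus (F w - F z) < e.
Proof.
move=> e0 /derivable_cplane_cvg /(@cvg_near_lt R _ (nbhs z) (nbhs_filter z) F _ _ e0).
by move=> /nbhs_cplaneP.
Qed.

Lemma cis_int (n : int) : cis (n%:~R * (2 * pi)) = 1 :> cplane R.
Proof.
have nat_case m : cis (m%:R * (2 * pi)) = 1 :> cplane R by rewrite -cisX cis2pi expr1n.
case: n => n; first exact: nat_case.
rewrite NegzE mulrNz mulNr cisN nat_case.
by apply: eqC; rewrite ?ReJ ?ImJ/= ?oppr0.
Qed.

(** Multiplying by [1 + cos (t - t0)] combines the coefficients of orders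
[n - 1], [n] and [n + 1], so all the functions [H (1 + cos (t - t0)) ^ m] have
zero coefficients too. Then [peak_unique], applied to the real part of
[conj (H t0) H], gives [|H t0| ^ 2 <= 0]. *)
Lemma fourier_unique (H : R -> cplane R) t0 : 0 < t0 < 2 * pi ->
  (forall x, H y @[y --> x] --> H x) ->
  (forall n : int, cint (fun t => H t * cis (- (n%:~R * t))) 0 (2 * pi) = 0) ->
  H t0 = 0.
Proof.
move=> t0b cH H0.
have cc (k : R) : ccont_on 0 (2 * pi) (fun t => cis (- (k * t)) : cplane R).
  by apply: ccont_onP => t _; exact: (cder_cont (cder_cisN k t)).
have cHo : ccont_on 0 (2 * pi) H by apply: ccont_onP => t _; exact: cH.
pose q t : cplane R := rc (1 + cos (t - t0)).
have qE t : q t = 1 + rc (1 / 2) * cis (- t0) * cis (- ((-1)%:~R * t)) +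
    rc (1 / 2) * cis t0 * cis (- (1%:~R * t)).
  have -> : (1%:~R : R) = 1 by [].
  have -> : ((- 1)%:~R : R) = - 1 by [].
  rewrite mulN1r mul1r opprK /q; apply: eqC; rewrite !(ReD, ReM, ImD, ImM)/= ?cosB !cosN ?sinN ?mul1r ?mul0r ?mulr0; lra.
have Z m : forall n : int, cint (fun t => H t * q t ^+ m * cis (- (n%:~R * t))) 0 (2 * pi) = 0
    /\ ccont_on 0 (2 * pi) (fun t => H t * q t ^+ m).
  elim: m => [|m IH] n.
    split; first by under eq_fun do rewrite expr0 mulr1; exact: H0.
    by under eq_fun do rewrite expr0 mulr1.
  have cm := (IH 0).2.
  have cmk (k : int) : ccont_on 0 (2 * pi) (fun t => H t * q t ^+ m * cis (- (k%:~R * t))).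
    exact: (ccont_onM cm (cc _)).
  have E x : H x * q x ^+ m.+1 * cis (- (n%:~R * x)) =
      H x * q x ^+ m * cis (- (n%:~R * x)) +
      rc (1 / 2) * cis (- t0) * (H x * q x ^+ m * cis (- ((n - 1)%:~R * x))) +
      rc (1 / 2) * cis t0 * (H x * q x ^+ m * cis (- ((n + 1)%:~R * x))).
    have -> : cis (- ((n - 1)%:~R * x)) = cis (- ((-1)%:~R * x)) * cis (- (n%:~R * x)) :> cplane R.
      by rewrite -cisD; congr cis; rewrite intrD; ring.
    have -> : cis (- ((n + 1)%:~R * x)) = cis (- (1%:~R * x)) * cis (- (n%:~R * x)) :> cplane R.
      by rewrite -cisD; congr cis; rewrite intrD; ring.
    by rewrite exprS {1}qE; ring.
  split.
    have c1 := ccont_onM (ccont_on_cst 0 (2 * pi) (rc (1 / 2) * cis (- t0))) (cmk (n - 1)).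
    have c2 := ccont_onM (ccont_on_cst 0 (2 * pi) (rc (1 / 2) * cis t0)) (cmk (n + 1)).
    rewrite (eq_cint (fun t _ => E t)) cintD; [|exact: (ccont_onD (cmk n) c1)|exact: c2].
    rewrite cintD; [|exact: cmk|exact: c1].
    rewrite (cintZ _ (cmk (n - 1))) (cintZ _ (cmk (n + 1))).
    by rewrite (IH n).1 (IH (n - 1)).1 (IH (n + 1)).1; ring.
  have c1 := ccont_onM (ccont_on_cst 0 (2 * pi) (rc (1 / 2) * cis (- t0))) (cmk (- 1)).
  have c2 := ccont_onM (ccont_on_cst 0 (2 * pi) (rc (1 / 2) * cis t0)) (cmk 1).
  have := ccont_onD (ccont_onD cm c1) c2.
  congr ccont_on; apply/funext => t.
  have -> : q t ^+ m.+1 = (1 + rc (1 / 2) * cis (- t0) * cis (- ((-1)%:~R * t)) +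
    rc (1 / 2) * cis t0 * cis (- (1%:~R * t))) * q t ^+ m by rewrite exprS {1}qE.
  ring.
pose k := conjc (H t0).
pose u t := complex.Re (k * H t).
have cu x : {for x, continuous u}.
  have -> : u = (fun t => complex.Re k * complex.Re (H t) - complex.Im k * complex.Im (H t)).
    by apply/funext => t; rewrite /u ReM.
  apply: continuousB; apply: continuousM; try exact: cst_continuous.
    exact: (cvg_Re (cH x)).
  exact: (cvg_Im (cH x)).
have u0 m : rint (fun t => u t * (1 + cos (t - t0)) ^+ m) 0 (2 * pi) = 0.
  have [I c] := Z m 0.
  have I0 : cint (fun t => H t * q t ^+ m) 0 (2 * pi) = 0.
    rewrite -[RHS]I; apply: eq_cint => t _.
    by rewrite mulr0z mul0r oppr0 cis0 mulr1.
  have := cintZ k c; rewrite I0 mulr0 => /(congr1 (@complex.Re R)) E.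
  rewrite -[RHS]E; apply: eq_rint => t _; rewrite /u.
  have qm : q t ^+ m = rc ((1 + cos (t - t0)) ^+ m) :> cplane R.
    elim: (m) => [|j IH]; first by rewrite !expr0.
    by rewrite !exprS IH; apply: eqC; rewrite ?ReM ?ImM/=; ring.
  by rewrite qm mulrA ReM/= mulr0 subr0.
have := peak_unique t0b cu u0.
have -> : u t0 = modulus (H t0) ^+ 2 by rewrite /u /k mod_sqr ReM ReJ ImJ; ring.
move=> h; apply: mod_eq0; apply/eqP; rewrite -sqrf_eq0; apply/eqP/le_anti.
by rewrite h sqr_ge0.
Qed.

Lemma arg_exists (z : cplane R) : modulus z = 1 -> exists2 t : R, 0 <= t <= 2 * pi & z = cis t.
Proof.
move=> z1; have zz := mod_sqr z; rewrite z1 expr1n in zz.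
have xr : -1 <= complex.Re z <= 1 by have := Re_le z; rewrite z1 ler_norml.
have a0 := acos_ge0 xr; have api := acos_lepi xr.
have pp := @pi_gt0 R.
have ca : cos (acos (complex.Re z)) = complex.Re z by apply: acosK; rewrite in_itv.
have sa := sin_acos xr.
have s2 : Num.sqrt (1 - complex.Re z ^+ 2) = `|complex.Im z|.
  by rewrite -sqrtr_sqr; congr Num.sqrt; lra.
have [y0|y0] := leP 0 (complex.Im z).
  exists (acos (complex.Re z)); first by rewrite a0/=; lra.
  by apply: eqC; rewrite /cis/= ?ca// sa s2 ger0_norm.
exists (2 * pi - acos (complex.Re z)); first by apply/andP; split; lra.
have E : cis (2 * pi - acos (complex.Re z)) = conjc (cis (acos (complex.Re z))) :> cplane R.
  by rewrite cisD cis2pi mul1r cisN.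
by rewrite E; apply: eqC; rewrite ?ReJ ?ImJ/= ?ca// sa s2 ltr0_norm// opprK.
Qed.

(** The coefficients of nonpositive order are multiplied by a factor that is at
least 1 when the radius shrinks, while [g] becomes uniformly small; hence they
vanish when [g 0 = 0]. *)
Lemma circ_npos (g : cplane R -> cplane R) (rho r k : R) :
  (forall z, modulus (z - 0) < rho -> derivable g z 1) -> g 0 = 0 ->
  0 < r < rho -> k <= 0 -> cis (k * (2 * pi)) = 1 :> cplane R -> circ g 0 r k = 0.
Proof.
move=> hg g0 /andP[r0 rr] k0 kp.
apply: mod_eq0; apply/le_anti; rewrite mod_ge0 andbT.
apply/ler_addgt0Pr => e e0; rewrite add0r.
have P : 0 < 4 * pi :> R by rewrite mulr_gt0// pi_gt0.
have d0 : derivable g 0 1 by apply: hg; rewrite subrr mod0 (lt_trans r0).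
have := derivable_near (divr_gt0 e0 P) d0; rewrite g0 => -[d dp Hd].
pose q := Num.min r (d / 2).
have q0 : 0 < q by rewrite lt_min r0 divr_gt0.
have qr : q <= r by rewrite ge_min lexx.
have qd : q < d by rewrite gt_min [d / 2 < _]gtr_pMr// invf_lt1// ltr1n orbT.
have := circ_scale hg q0 qr rr kp => /(congr1 modulus).
rewrite !modM !mod_rc !ger0_norm ?expR_ge0// => S.
have B : modulus (circ g 0 q k) <= e.
  have E (p : R) : 0 < p -> e = 2 * (e / (4 * p)) * (2 * p - 0).
    by move=> p0; rewrite subr0; field; rewrite gt_eqF.
  rewrite (E pi (pi_gt0 R)).
  apply: cint_bound; first exact: twopi_ge0.
    by apply: (ccont_circle hg); rewrite ltW//= (le_lt_trans qr).
  move=> t _; rewrite modM mod_cis mulr1; apply: ltW.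
  have := Hd (0 + rc q * cis t); rewrite /= [g _ - 0]subr0; apply.
  by rewrite mod_circle// ltW.
rewrite -(ler_pM2l (expR_gt0 (- (k * ln r)))) -S.
apply: ler_pM; rewrite ?expR_ge0 ?mod_ge0// ler_expR lerN2.
by rewrite ler_wnM2l// ler_ln ?posrE.
Qed.

(** On each circle, all Fourier coefficients of [f - f 0] vanish: those of
positive order by hypothesis, the others by [circ_npos]. Uniqueness gives the
claim off the angle 0, and continuity at that angle. *)
Lemma holomorphic_const (f : cplane R -> cplane R) : holomorphic f ->
  (forall n r, (0 < n)%N -> 0 < r < 1 -> circ f 0 r n%:R = 0) ->
  forall z, unit_disc z -> f z = f 0.
Proof.
move=> hf f0 z zD.
have hf' w : modulus (w - 0) < 1 -> derivable f w 1 by rewrite subr0; exact: hf.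
have [->//|z0] := eqVneq z 0.
set r := modulus z.
have r0 : 0 < r by rewrite mod_gt0.
have rr : 0 < r < 1 by rewrite r0.
have z1 : modulus (rc r^-1 * z) = 1.
  by rewrite modM mod_rc ger0_norm ?invr_ge0 ?mod_ge0// mulVf// gt_eqF.
have [t tb zt] := arg_exists z1.
pose g (w : cplane R) := f w - f 0.
have hg w : modulus (w - 0) < 1 -> derivable g w 1.
  move=> /hf' /derivable_cderiv d.
  exact: (cderiv_derivable (cderivD d (cderiv_cst w (- f 0)))).
have g0 : g 0 = 0 by exact: subrr.
pose H (t : R) := g (0 + rc r * cis t).
have cH x : H y @[y --> x] --> H x.
  have d : derivable g (0 + rc r * cis x) 1 by apply: hg; rewrite mod_circle// ltW.
  exact: (cder_cont (cder_comp (cder_circle 0 r x) (derivable_cderiv d))).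
have coef (n : int) : cint (fun t => H t * cis (- (n%:~R * t))) 0 (2 * pi) = 0.
  rewrite -/(circ g 0 r n%:~R).
  have [n0|n0] := leP n 0.
    by apply: (circ_npos hg g0 rr); [rewrite lerz0|exact: cis_int].
  case: n n0 => // n n0; rewrite -/(n%:R : R).
  have rr' : 0 <= r < 1 by rewrite ltW.
  have c1 := @ccont_circle R f 0 1 hf' r n%:R 0 (2 * pi) rr'.
  have c2 : ccont_on 0 (2 * pi) (fun t : R => cis (- n%:R * t) : cplane R).
    by apply: ccont_onP => x _; exact: (cder_cont (cder_cis (- n%:R) x)).
  have := cintD c1 (ccont_onM (ccont_on_cst 0 (2 * pi) (- f 0)) c2).
  rewrite -/(circ f 0 r n%:R) f0// (cintZ _ c2) cint_cis; last 2 first.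
  - by rewrite oppr_eq0 pnatr_eq0 -lt0n.
  - by rewrite mulNr cisN -cisX cis2pi expr1n; apply: eqC; rewrite ?ReJ ?ImJ/= ?oppr0.
  rewrite mulr0 addr0 => E; rewrite -[RHS]E; apply: eq_cint => x _.
  by rewrite /g mulNr; ring.
have H0 x : 0 < x < 2 * pi -> H x = 0 by move=> xx; exact: (fourier_unique xx cH coef).
have Hz : f z - f 0 = H t.
  rewrite /H /g add0r; congr (f _ - f 0); rewrite -zt mulrA.
  have -> : rc r * rc r^-1 = 1 :> cplane R.
    by apply: eqC; rewrite ?ReM ?ImM/= ?mulfV ?gt_eqF//; ring.
  by rewrite mul1r.
suff : H t = 0 by rewrite -Hz => /eqP; rewrite subr_eq0 => /eqP.
have edge (s : R) : s = 0 \/ s = 2 * pi -> H s = 0.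
  move=> hs; apply: mod_eq0; apply/le_anti; rewrite mod_ge0 andbT.
  apply/ler_addgt0Pr => e e0; rewrite add0r.
  have [d /= dp Hd] := @cvg_near_lt R R (nbhs s) _ _ _ _ e0 (cH s).
  have pp := @pi_gt0 R.
  pose y := Num.min (d / 2) pi.
  have y0 : 0 < y by rewrite lt_min pp divr_gt0.
  have ypi : y <= pi by rewrite ge_min lexx orbT.
  have yd : y < d by rewrite gt_min [d / 2 < _]gtr_pMr// invf_lt1// ltr1n.
  have [x xb xs] : exists2 x, 0 < x < 2 * pi & `|s - x| < d.
    case: hs => ->; [exists y|exists (2 * pi - y)].
    - by apply/andP; split; lra.
    - by rewrite sub0r normrN gtr0_norm.
    - by apply/andP; split; lra.
    - by rewrite opprB addrC subrK gtr0_norm.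
  by have := Hd x xs; rewrite /= H0// sub0r modN => /ltW.
case/andP: tb; rewrite !le_eqVlt => /predU1P[<- _|t0]; first by apply: edge; left.
move=> /predU1P[->|t2]; first by apply: edge; right.
by apply: H0; rewrite t0.
Qed.

End FourierHolo.

(** * Lebesgue measure in the plane: shears, dilations, rotations *)

Section PlaneMeasurability.
Context {R : realType}.
Implicit Types (F : cplane R -> R) (p : R * R).

(** An open set is a countable union of squares with rational centre and
rational size. *)
Lemma open2_measurable (O : set (R * R)) :
  (forall p, O p -> exists2 e : R, 0 < e &
     forall q, `|q.1 - p.1| < e -> `|q.2 - p.2| < e -> O q) -> measurable O.
Proof.
move=> oO.
pose B (a b c : rat) : set (R * R) :=
  `](ratr a - ratr c), (ratr a + ratr c)[%classic `*`
  `](ratr b - ratr c), (ratr b + ratr c)[%classic.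
rewrite (_ : O = \bigcup_(a in [set: rat]) \bigcup_(b in [set: rat])
   \bigcup_(c in [set: rat]) (if `[< B a b c `<=` O >] then B a b c else set0)).
  apply: bigcupT_measurable_rat => a; apply: bigcupT_measurable_rat => b.
  apply: bigcupT_measurable_rat => c; case: ifPn => _; last exact: measurable0.
  by apply: measurableX; exact: measurable_itv.
apply/seteqP; split => [p Op|p [a _ [b _ [c _]]]]; last first.
  by case: ifPn => // /asboolP; apply.
have [e e0 He] := oO p Op.
have e4 : 0 < e / 4 by rewrite divr_gt0.
have [c /andP[c1 c2]] : exists c : rat, (e / 4 < ratr c) && (ratr c < e / 2).
  have [|q] := @rat_in_itvoo R (e / 4) (e / 2); first by lra.
  by rewrite in_itv/=; exists q.
have near x : exists a : rat, (x - e / 4 < ratr a) && (ratr a < x + e / 4).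
  have [|q] := @rat_in_itvoo R (x - e / 4) (x + e / 4); first by lra.
  by rewrite in_itv/=; exists q.
have [a /andP[a1 a2]] := near p.1; have [b /andP[b1 b2]] := near p.2.
exists a => //; exists b => //; exists c => //.
have -> : `[< B a b c `<=` O >].
  apply/asboolP => q; rewrite /B /= !in_itv/= => -[/andP[q1 q2] /andP[q3 q4]].
  by apply: He; rewrite ltr_norml; apply/andP; split; lra.
by rewrite /B /= !in_itv/=; split; apply/andP; split; lra.
Qed.

Lemma dist_of_pair (p q : R * R) (e : R) : `|q.1 - p.1| < e -> `|q.2 - p.2| < e ->
  modulus (of_pair q - of_pair p) < 2 * e.
Proof.
move=> h1 h2; apply: le_lt_trans (mod_le _) _.
by rewrite ReD ImD ReN ImN/=; lra.
Qed.

Lemma plane_open_measurable (O : set (cplane R)) :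
  (forall z, O z -> exists2 e : R, 0 < e & forall w, modulus (w - z) < e -> O w) ->
  measurable [set p | O (of_pair p)].
Proof.
move=> oO; apply: open2_measurable => p /= /oO[e e0 He].
exists (e / 2); first by rewrite divr_gt0.
move=> q h1 h2; apply: He; have := dist_of_pair h1 h2.
by rewrite mulrC divfK.
Qed.

Lemma disc_open z : unit_disc z -> exists2 e : R, 0 < e &
  forall w, modulus (w - z) < e -> unit_disc w.
Proof.
move=> zD; exists (1 - modulus z); first by rewrite subr_gt0.
move=> w; rewrite ltrBrDr; apply: le_lt_trans.
by apply: le_trans (modD _ _); rewrite subrK.
Qed.

Lemma measurable_disc_pair : measurable (@disc_pair R).
Proof. by apply: (plane_open_measurable (O := unit_disc)); exact: disc_open. Qed.

Definition dmeas F := measurable_fun (@disc_pair R) (fun p => F (of_pair p)).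

Lemma continuous_dmeas F :
  (forall z, unit_disc z -> F w @[w --> z] --> F z) -> dmeas F.
Proof.
move=> cF mD; apply: (measurability _ (RGenOInfty.measurableE R)) => //.
move=> /= _ [_ [x ->] <-].
rewrite (_ : _ `&` _ = [set p | (unit_disc `&` [set z | x < F z]) (of_pair p)]).
  apply: plane_open_measurable => z [zD xF].
  have [e1 e10 H1] := disc_open zD.
  have N : nbhs (F z) [set y | x < y] by exact: lt_nbhsr.
  have : nbhs z [set w | x < F w] := cF z zD _ N.
  move=> /nbhs_cplaneP[e2 e20 H2].
  exists (Num.min e1 e2); first by rewrite lt_min e10.
  by move=> w; rewrite lt_min => /andP[/H1 ? /H2 ?]; split.
by apply/seteqP; split => p /=; rewrite ?in_itv/= ?andbT.
Qed.

Lemma dmeas_cplane (f : cplane R -> cplane R) :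
  (forall z, unit_disc z -> f w @[w --> z] --> f z) ->
  [/\ dmeas (fun z => complex.Re (f z)), dmeas (fun z => complex.Im (f z)) &
      dmeas (fun z => modulus (f z) ^+ 2)].
Proof.
move=> cf.
have H1 : dmeas (fun z => complex.Re (f z)).
  by apply: continuous_dmeas => z /cf H; exact: (@cvg_Re R _ (nbhs z) (nbhs_filter z) f _ H).
have H2 : dmeas (fun z => complex.Im (f z)).
  by apply: continuous_dmeas => z /cf H; exact: (@cvg_Im R _ (nbhs z) (nbhs_filter z) f _ H).
split => //.
rewrite /dmeas; under eq_fun do rewrite mod_sqr.
exact: (measurable_funD (measurable_funX 2 H1) (measurable_funX 2 H2)).
Qed.

End PlaneMeasurability.

Section PlaneInvariance.
Context {R : realType}.
Local Notation leb := (@lebesgue_measure R).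
Local Open Scope ereal_scope.

Lemma measurable_affine (c d : R) : measurable_fun [set: R] (fun x : R => c * x + d)%R.
Proof.
apply: measurable_funD; last exact: measurable_cst.
exact: (@mulrl_measurable R setT c).
Qed.

(** The scaled image of Lebesgue measure gives every half-open interval its
length, which characterizes Lebesgue measure. *)
Lemma lebesgue_affine (c d : R) (F : R -> \bar R) : (0 < c)%R ->
  measurable_fun setT F -> (forall x, 0 <= F x) ->
  \int[leb]_x F x = c%:E * \int[leb]_x F (c * x + d)%R.
Proof.
move=> c0 mF F0.
have mf : @measurable_fun _ _ (measurableTypeR R) (measurableTypeR R) setT
  (fun x : R => c * x + d)%R by exact: measurable_affine.
have c0' : (0 <= c)%R by apply: ltW.
pose k : {nonneg R} := NngNum c0'.
pose pf : {measure set (measurableTypeR R) -> \bar R} :=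
  measure_function_pushforward__canonical__measure_function_Measure leb mf.
pose nu : {measure set (measurableTypeR R) -> \bar R} := mscale k pf.
have E A : measurable A -> leb A = nu A.
  apply: lebesgue_measure_unique => X [[a b] _ <-] /=.
  rewrite /nu /mscale/= /pf/= /pushforward.
  have -> : ((fun x : R => c * x + d)%R @^-1` `]a, b]%classic) = `]((a - d) / c)%R, ((b - d) / c)%R]%classic.
    apply/seteqP; split => x /=; rewrite !in_itv/=.
      by move=> /andP[ax xb]; rewrite ltr_pdivrMr// ler_pdivlMr// [(x * c)%R]mulrC ltrBlDr lerBrDr ax.
    by rewrite ltr_pdivrMr// ler_pdivlMr// [(x * c)%R]mulrC ltrBlDr lerBrDr.
  rewrite !lebesgue_measure_itv/= !lte_fin ltr_pM2r ?invr_gt0// ltrD2r.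
  case: ifPn => _; last by rewrite mule0.
  by rewrite -!EFinD -EFinM; congr EFin; field; rewrite gt_eqF.
have := @eq_measure_integral _ _ R setT nu leb F (fun A mA _ => E A mA).
move=> ->; rewrite ge0_integral_mscale//.
by congr (_ * _); rewrite ge0_integral_pushforward.
Qed.

Definition plane_fun_meas (F : R * R -> \bar R) := measurable_fun setT F /\ forall p, 0 <= F p.

Lemma plane_fun_comp (F : R * R -> \bar R) (T : R * R -> R * R) :
  measurable_fun setT T -> plane_fun_meas F -> plane_fun_meas (fun p => F (T p)).
Proof.
by move=> mT [mF F0]; split; [exact: (measurableT_comp mF mT)|move=> p; exact: F0].
Qed.

Lemma measurable_lin (a b c : R) :
  measurable_fun [set: R * R] (fun p : R * R => a * p.1 + b * p.2 + c)%R.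
Proof.
apply: measurable_funD; last exact: measurable_cst.
by apply: measurable_funD; apply: measurable_funM => //; exact: measurable_cst.
Qed.

Lemma plane_shear1 (t : R) F : plane_fun_meas F ->
  \int[@plane_measure R]_p F (p.1 + t * p.2, p.2)%R = \int[@plane_measure R]_p F p.
Proof.
move=> FF.
have mT : measurable_fun [set: R * R] (fun p : R * R => (p.1 + t * p.2, p.2)%R).
  apply: measurable_fun_pair => //.
  have := measurable_lin 1 t 0; apply: eq_measurable_fun => p _.
  by rewrite mul1r addr0.
have [m0 p0] := FF; have [m1 p1] := plane_fun_comp mT FF.
rewrite /plane_measure !fubini_tonelli2//; apply: eq_integral => y _.
rewrite /fubini_G/= [RHS](@lebesgue_affine 1 (t * y)) ?mul1e//.
  by apply: eq_integral => x _; rewrite mul1r.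
exact: (measurableT_comp m0 (measurable_pair2 y)).
Qed.

Lemma plane_shear2 (t : R) F : plane_fun_meas F ->
  \int[@plane_measure R]_p F (p.1, p.2 + t * p.1)%R = \int[@plane_measure R]_p F p.
Proof.
move=> FF.
have mT : measurable_fun [set: R * R] (fun p : R * R => (p.1, p.2 + t * p.1)%R).
  apply: measurable_fun_pair => //.
  have := measurable_lin t 1 0; apply: eq_measurable_fun => p _.
  by rewrite mul1r addr0 addrC.
have [m0 p0] := FF; have [m1 p1] := plane_fun_comp mT FF.
rewrite /plane_measure !fubini_tonelli1//; apply: eq_integral => x _.
rewrite /fubini_F/= [RHS](@lebesgue_affine 1 (t * x)) ?mul1e//.
  by apply: eq_integral => y _; rewrite mul1r.
exact: (measurableT_comp m0 (measurable_pair1 x)).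
Qed.

Lemma plane_affine (c d e : R) F : (0 < c)%R -> plane_fun_meas F ->
  \int[@plane_measure R]_p F p =
  (c ^+ 2)%:E * \int[@plane_measure R]_p F (c * p.1 + d, c * p.2 + e)%R.
Proof.
move=> c0 FF.
have mT : measurable_fun [set: R * R] (fun p : R * R => (c * p.1 + d, c * p.2 + e)%R).
  apply: measurable_fun_pair.
    have := measurable_lin c 0 d; apply: eq_measurable_fun => p _.
    by rewrite mul0r addr0.
  have := measurable_lin 0 c e; apply: eq_measurable_fun => p _.
  by rewrite mul0r add0r.
have [m0 p0] := FF; have [m1 p1] := plane_fun_comp mT FF.
rewrite /plane_measure !fubini_tonelli1//.
pose g x := \int[leb]_y F (x, y).
have mg : measurable_fun setT g by exact: measurable_fun_fubini_tonelli_F.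
have g0 x : 0 <= g x by apply: integral_ge0 => y _; exact: p0.
rewrite -/g (@lebesgue_affine c d g c0 mg g0) expr2 EFinM -muleA; congr (_ * _).
pose h x := \int[leb]_y F (c * x + d, c * y + e)%R.
have mh : measurable_fun setT h.
  exact: (@measurable_fun_fubini_tonelli_F _ _ _ _ R leb
    (fun p : R * R => F (c * p.1 + d, c * p.2 + e)%R) m1 p1).
have h0 x : 0 <= h x by apply: integral_ge0 => y _; exact: (p1 (x, y)).
have c0E : 0 <= c%:E by rewrite lee_fin ltW.
rewrite -[RHS](@ge0_integralZl _ _ _ leb setT measurableT h mh c%:E (fun x _ => h0 x) c0E).
apply: eq_integral => x _; rewrite /g /h.
apply: lebesgue_affine => //.
exact: (measurableT_comp m0 (measurable_pair1 _)).
Qed.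

Definition rot (u : cplane R) (p : R * R) : R * R :=
  (complex.Re u * p.1 - complex.Im u * p.2, complex.Re u * p.2 + complex.Im u * p.1)%R.

Lemma rotE u p : of_pair (rot u p) = (u * of_pair p)%R :> cplane R.
Proof. by apply: eqC; rewrite ?ReM ?ImM/=. Qed.

Lemma measurable_rot u : measurable_fun setT (rot u).
Proof.
apply: measurable_fun_pair.
  have := measurable_lin (complex.Re u) (- complex.Im u) 0; apply: eq_measurable_fun => p _.
  by rewrite addr0 mulNr.
have := measurable_lin (complex.Im u) (complex.Re u) 0; apply: eq_measurable_fun => p _.
by rewrite addr0 addrC.
Qed.

(** A rotation of angle different from [pi] is a product of three shears, with
parameters built from the tangent of the half angle, and shears preserve the
plane measure by the theorem of Tonelli. The half turn is the square of a
quarter turn. *)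
Lemma plane_rotation (u : cplane R) F : modulus u = 1%R -> plane_fun_meas F ->
  \int[@plane_measure R]_p F (rot u p) = \int[@plane_measure R]_p F p.
Proof.
move=> u1.
have key (v : cplane R) G : modulus v = 1%R -> complex.Re v != (- 1)%R -> plane_fun_meas G ->
    \int[@plane_measure R]_p G (rot v p) = \int[@plane_measure R]_p G p.
  move=> v1 vn FG.
  set c := complex.Re v in vn; set s := complex.Im v.
  have cs : (c ^+ 2 + s ^+ 2 = 1)%R by rewrite -mod_sqr v1 expr1n.
  have c1 : (1 + c != 0)%R by rewrite addrC addr_eq0.
  (* the tangent of half the angle *)
  pose t := (s / (1 + c))%R.
  have ts : (t * s = 1 - c)%R.
    by apply: (mulIf c1); rewrite /t; transitivity (s ^+ 2)%R; [field|rewrite -(addKr (c ^+ 2)%R (s ^+ 2)%R) cs; ring].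
  have tc : (t * (1 + c) = s)%R by rewrite /t divfK.
  have mT1 : measurable_fun [set: R * R] (fun p : R * R => (p.1 + - t * p.2, p.2)%R).
    apply: measurable_fun_pair => //.
    by have := measurable_lin 1 (- t) 0; apply: eq_measurable_fun => p _; rewrite mul1r addr0.
  have mT2 : measurable_fun [set: R * R] (fun p : R * R => (p.1, p.2 + s * p.1)%R).
    apply: measurable_fun_pair => //.
    by have := measurable_lin s 1 0; apply: eq_measurable_fun => p _; rewrite mul1r addr0 addrC.
  rewrite -(plane_shear1 (- t) FG) -(plane_shear2 s (plane_fun_comp mT1 FG)).
  rewrite -(plane_shear1 (- t) (plane_fun_comp mT2 (plane_fun_comp mT1 FG))).
  apply: eq_integral => -[x y] _ /=; congr G; rewrite /rot/= -/c -/s; congr pair.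
    have -> : (x + - t * y + - t * (y + s * (x + - t * y)) =
      (1 - t * s) * x - t * (2 - t * s) * y)%R by ring.
    rewrite ts; have -> : (t * (2 - (1 - c)) = s)%R by rewrite -tc; ring.
    by ring.
  have -> : (y + s * (x + - t * y) = (1 - t * s) * y + s * x)%R by ring.
  by rewrite ts; ring.
move=> FF; have [cn|] := eqVneq (complex.Re u) (- 1)%R; last by move=> h; exact: key.
have s0 : complex.Im u = 0%R.
  have := mod_sqr u; rewrite u1 cn expr1n sqrrN expr1n -[LHS]addr0 => /addrI /esym/eqP.
  by rewrite sqrf_eq0 => /eqP.
have i1 : complex.Re (@ii R) != (- 1)%R by rewrite /= eq_sym oppr_eq0 oner_eq0.
have Fi := plane_fun_comp (measurable_rot ii) FF.
rewrite -(key _ _ (@mod_ii R) i1 FF) -(key _ _ (@mod_ii R) i1 Fi).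
apply: eq_integral => p _; congr F; rewrite /rot/= cn s0; congr pair; ring.
Qed.

End PlaneInvariance.

(** * Integrals over the disc and moments of monomials *)

Section DiscIntegral.
Context {R : realType}.
Implicit Types (F G L : cplane R -> R) (u w z : cplane R).
Local Notation leb := (@lebesgue_measure R).

Definition dint F : \bar R := (\int[@plane_measure R]_(p in @disc_pair R) (F (of_pair p))%:E)%E.

(** Extension by zero outside the disc, so that the changes of variables on the
whole plane apply. *)
Definition disc_ext F : R * R -> \bar R := (fun p => (F (of_pair p))%:E) \_ (@disc_pair R).

Definition nonneg_on F := forall z, unit_disc z -> 0 <= F z.

Lemma dint_ext F : dint F = (\int[@plane_measure R]_p disc_ext F p)%E.
Proof. by rewrite /dint integral_mkcond. Qed.

Lemma disc_ext_in F p : unit_disc (of_pair p) -> disc_ext F p = (F (of_pair p))%:E.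
Proof. by move=> pD; rewrite /disc_ext patchE mem_set. Qed.

Lemma disc_ext_out F p : ~ unit_disc (of_pair p) -> disc_ext F p = 0%E.
Proof. by move=> pD; rewrite /disc_ext patchE memNset. Qed.

Lemma dmeas_EFin F : dmeas F ->
  measurable_fun (@disc_pair R) (fun p => (F (of_pair p))%:E).
Proof. by move=> mF; apply/measurable_EFinP. Qed.

Lemma EFin_nonneg_on F : nonneg_on F ->
  forall p, @disc_pair R p -> (0 <= (F (of_pair p))%:E)%E.
Proof. by move=> F0 p pD; rewrite lee_fin F0. Qed.

Lemma disc_ext_meas F : dmeas F -> nonneg_on F -> plane_fun_meas (disc_ext F).
Proof.
move=> mF F0; split.
  exact: ((measurable_restrictT _ measurable_disc_pair).1 (dmeas_EFin mF)).
move=> p; have [pD|pD] := pselect (unit_disc (of_pair p)).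
  by rewrite disc_ext_in// lee_fin F0.
by rewrite disc_ext_out.
Qed.

Lemma dint_ge0 F : nonneg_on F -> (0 <= dint F)%E.
Proof. by move=> F0; apply: integral_ge0 => p pD; rewrite lee_fin F0. Qed.

Lemma eq_dint F G : (forall z, unit_disc z -> F z = G z) -> dint F = dint G.
Proof. by move=> FG; apply: eq_integral => p; rewrite inE => pD; rewrite FG. Qed.

Lemma dint_le F G : dmeas F -> dmeas G -> nonneg_on F ->
  (forall z, unit_disc z -> F z <= G z) -> (dint F <= dint G)%E.
Proof.
move=> mF mG F0 FG.
apply: (@ge0_le_integral _ _ _ (@plane_measure R) _ measurable_disc_pair _ _
  (EFin_nonneg_on F0) (dmeas_EFin mF) (dmeas_EFin mG)).
by move=> p pD; rewrite lee_fin FG.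
Qed.

Lemma dintD F G : dmeas F -> dmeas G -> nonneg_on F -> nonneg_on G ->
  dint (fun z => F z + G z) = (dint F + dint G)%E.
Proof.
move=> mF mG F0 G0; rewrite /dint.
rewrite -[RHS](@ge0_integralD _ _ _ (@plane_measure R) _ measurable_disc_pair _ _
  (EFin_nonneg_on F0) (dmeas_EFin mF) (EFin_nonneg_on G0) (dmeas_EFin mG)).
exact: eq_integral.
Qed.

Lemma dintZ (k : R) F : dmeas F -> nonneg_on F -> 0 <= k ->
  dint (fun z => k * F z) = (k%:E * dint F)%E.
Proof.
move=> mF F0 k0; rewrite /dint.
have k0' : (0 <= k%:E)%E by rewrite lee_fin.
rewrite -[RHS](@ge0_integralZl _ _ _ (@plane_measure R) _ measurable_disc_pair _
  (dmeas_EFin mF) _ (EFin_nonneg_on F0) k0').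
exact: eq_integral.
Qed.

Lemma unit_disc_rot u z : modulus u = 1 -> unit_disc (u * z) <-> unit_disc z.
Proof. by move=> u1; rewrite /unit_disc/= modM u1 mul1r. Qed.

Lemma dint_rot u F : modulus u = 1 -> dmeas F -> nonneg_on F ->
  dint (fun z => F (u * z)) = dint F.
Proof.
move=> u1 mF F0; rewrite !dint_ext -(plane_rotation u1 (disc_ext_meas mF F0)).
apply: eq_integral => p _.
have [pD|pD] := pselect (unit_disc (of_pair p)).
  by rewrite !disc_ext_in// rotE// unit_disc_rot.
by rewrite !disc_ext_out// rotE unit_disc_rot.
Qed.

Lemma of_pair_affine w (rho : R) p :
  of_pair (rho * p.1 + complex.Re w, rho * p.2 + complex.Im w) = w + rc rho * of_pair p.
Proof. by apply: eqC; rewrite ?ReD ?ImD ?ReM ?ImM/=; ring. Qed.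

Lemma dint_ball w (rho : R) F : 0 < rho -> dmeas F -> nonneg_on F ->
  (forall z, unit_disc z -> unit_disc (w + rc rho * z)) ->
  dmeas (fun z => F (w + rc rho * z)) ->
  ((rho ^+ 2)%:E * dint (fun z => F (w + rc rho * z)%R) <= dint F)%E.
Proof.
move=> rho0 mF F0 ball mFw.
have FF := disc_ext_meas mF F0.
rewrite [leRHS]dint_ext (plane_affine (complex.Re w) (complex.Im w) rho0 FF).
apply: lee_wpmul2l; first by rewrite lee_fin sqr_ge0.
rewrite dint_ext; apply: ge0_le_integral => //.
- by move=> p _; apply: (disc_ext_meas mFw _).2 => z /ball; exact: F0.
- by apply: (disc_ext_meas mFw _).1 => z /ball; exact: F0.
- have mT : measurable_fun [set: R * R]
      (fun p : R * R => (rho * p.1 + complex.Re w, rho * p.2 + complex.Im w)).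
    apply: measurable_fun_pair.
      have := measurable_lin rho 0 (complex.Re w); apply: eq_measurable_fun => p _.
      by rewrite mul0r addr0.
    have := measurable_lin 0 rho (complex.Im w); apply: eq_measurable_fun => p _.
    by rewrite mul0r add0r.
  exact: (plane_fun_comp mT FF).1.
- move=> p _; have [pD|pD] := pselect (unit_disc (of_pair p)).
    rewrite disc_ext_in//= disc_ext_in of_pair_affine//; exact: ball.
  rewrite disc_ext_out//; exact: FF.2.
Qed.

Lemma in_ball_dmeas (rho : R) : dmeas (fun z => if modulus z < rho then 1 else 0).
Proof.
have -> : (fun z : cplane R => if modulus z < rho then 1 else 0) =
    \1_[set z | modulus z < rho] :> (cplane R -> R).
  apply/funext => z; rewrite indicE.
  by case: ifPn => h; [rewrite mem_set|rewrite memNset//; apply/negP].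
suff mS : measurable [set p : R * R | modulus (of_pair p) < rho].
  have H : measurable_fun (@disc_pair R)
    (\1_[set p : R * R | modulus (of_pair p) < rho] : R * R -> R) by exact: measurable_indic.
  exact: H.
apply: (plane_open_measurable (O := [set z | modulus z < rho])) => z /= zr.
exists (rho - modulus z); first by rewrite subr_gt0.
move=> w wz; have -> : w = (w - z) + z by rewrite subrK.
by apply: le_lt_trans (modD _ _) _; rewrite -ltrBrDr.
Qed.

(** Dilating the disc by [rho] multiplies areas by [rho ^ 2]. *)
Lemma dint_scale (rho : R) F : 0 < rho <= 1 -> dmeas F -> nonneg_on F ->
  ((rho ^+ 2)%:E * dint (fun z => F (rc rho * z)%R))%E =
   dint (fun z => if modulus z < rho then F z else 0).
Proof.
move=> /andP[rho0 rho1] mF F0.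
pose G z := if modulus z < rho then F z else 0.
have mG : dmeas G.
  have -> : G = fun z => F z * (if modulus z < rho then 1 else 0).
    by apply/funext => z; rewrite /G; case: ifP; rewrite ?mulr1 ?mulr0.
  exact: (measurable_funM mF (in_ball_dmeas rho)).
have G0 : nonneg_on G by move=> z /F0 Fz; rewrite /G; case: ifP.
have FF := disc_ext_meas mG G0.
rewrite [RHS](dint_ext G) (plane_affine 0 0 rho0 FF); congr (_ * _)%E.
rewrite dint_ext; apply: eq_integral => p _.
have E : of_pair (rho * p.1 + 0, rho * p.2 + 0) = rc rho * of_pair p.
  by apply: eqC; rewrite ?ReM ?ImM/=; ring.
have [pD|pD] := pselect (unit_disc (of_pair p)).
  have lt : modulus (rc rho * of_pair p) < rho.
    by rewrite modM mod_rc gtr0_norm// gtr_pMr.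
  rewrite disc_ext_in// disc_ext_in E; first by rewrite /G lt.
  exact: lt_le_trans rho1.
rewrite disc_ext_out//; have [qD|qD] := pselect (unit_disc (rc rho * of_pair p)); last first.
  by rewrite disc_ext_out// E.
rewrite disc_ext_in E// /G modM mod_rc gtr0_norm// gtr_pMr// ifN//.
by apply/negP.
Qed.

Definition area : \bar R := dint (fun=> 1).

Lemma cst_dmeas (k : R) : dmeas (fun=> k).
Proof. exact: measurable_cst. Qed.

Lemma area_box : (4^-1%:E <= area)%E /\ (area <= 4%:E)%E.
Proof.
have E : area = @plane_measure R (@disc_pair R).
  rewrite /area /dint integral_cst ?mul1e//; exact: measurable_disc_pair.
have box (a b c d : R) : a < b -> c < d ->
    @plane_measure R (`[a, b]%classic `*` `[c, d]%classic) = ((b - a) * (d - c))%:E.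
  move=> ab cd; rewrite /plane_measure.
  rewrite (product_measure1E leb leb (measurable_itv _) (measurable_itv _)).
  transitivity (leb `[a, b]%classic * leb `[c, d]%classic)%E; first by [].
  by rewrite !lebesgue_measure_itv/= !lte_fin ab cd -!EFinD -EFinM.
rewrite E; split.
  have -> : 4^-1%:E = @plane_measure R (`[0, 2^-1]%classic `*` `[0, 2^-1]%classic).
    by rewrite box ?invr_gt0// subr0; congr EFin; field.
  apply: le_measure; rewrite ?inE; [by apply: measurableX; exact: measurable_itv|exact: measurable_disc_pair|].
  move=> [x y] /=; rewrite !in_itv/= => -[/andP[x0 x1] /andP[y0 y1]].
  rewrite /disc_pair/= /unit_disc/= -(ltr_sqr (mod_ge0 _) ler01) mod_sqr/= expr1n.
  have : x ^+ 2 <= 2^-1 ^+ 2 by rewrite lerXn2r// nnegrE.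
  have : y ^+ 2 <= 2^-1 ^+ 2 by rewrite lerXn2r// nnegrE.
  by lra.
have -> : 4%:E = @plane_measure R (`[- 1, 1]%classic `*` `[- 1, 1]%classic).
  by rewrite box; [congr EFin; ring|lra|lra].
apply: le_measure; rewrite ?inE; [exact: measurable_disc_pair|by apply: measurableX; exact: measurable_itv|].
move=> [x y]; rewrite /disc_pair/= /unit_disc/= => h; rewrite !in_itv/=.
have := Re_le (of_pair (x, y)); have := Im_le (of_pair (x, y)) => /=.
by rewrite !ler_norml => /andP[? ?] /andP[? ?]; split; apply/andP; split; lra.
Qed.

(** The area of the disc is kept as an unevaluated positive constant: it cancels
in the normalization of the basis, and only its finiteness and positivity
matter. *)
Definition areaR : R := fine area.

Lemma areaE : area = areaR%:E.
Proof.
rewrite /areaR fineK// ge0_fin_numE; first exact: (le_lt_trans area_box.2 (ltry _)).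
by apply: le_trans area_box.1; rewrite lee_fin invr_ge0.
Qed.

Lemma areaR_gt0 : 0 < areaR.
Proof. by have := area_box.1; rewrite areaE lee_fin; apply: lt_le_trans; rewrite invr_gt0. Qed.

Lemma monomial_dmeas n : dmeas (fun z : cplane R => modulus (z ^+ n) ^+ 2).
Proof.
have [_ _] := @dmeas_cplane R (fun z => z ^+ n) (fun z _ => cderiv_cvg (cderivX z n)).
exact.
Qed.

Lemma bernoulli_le (x : R) k : 0 <= x <= 1 -> 1 - k%:R * (1 - x) <= x ^+ k.
Proof.
move=> /andP[x0 x1]; elim: k => [|k IH]; first by rewrite expr0 mul0r subr0.
have := ler_wpM2l x0 IH; rewrite -exprS; apply: le_trans.
rewrite -natr1; have : 0 <= k%:R * (1 - x) * (1 - x) :> R by rewrite !mulr_ge0// subr_ge0.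
lra.
Qed.

Lemma EFin_addl (a t : R) (b : \bar R) : (t%:E = a%:E + b)%E -> b = (t - a)%:E.
Proof. by case: b => [b||]//= [->]; congr EFin; ring. Qed.

(** Let [m] be the integral. Scaling by [x < 1] shows that the annulus
[x <= |z| < 1] carries the mass [m (1 - x ^ (2n + 2))]; on it the integrand lies
between [x ^ (2n)] and 1, and its area is [a (1 - x ^ 2)]. Dividing by
[1 - x ^ 2] and letting [x] tend to 1 gives [(n + 1) m = a]. *)
Lemma moment n : dint (fun z => modulus (z ^+ n) ^+ 2) = (areaR / n.+1%:R)%:E.
Proof.
pose F z : R := modulus (z ^+ n) ^+ 2.
have F0 : nonneg_on F by move=> z _; exact: sqr_ge0.
have mF : dmeas F := monomial_dmeas n.
have F1 z : unit_disc z -> F z <= 1.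
  by move=> zD; rewrite /F modX -exprM exprn_ile1 ?mod_ge0// ltW.
have a0 := areaR_gt0.
have fin : dint F = (fine (dint F))%:E.
  rewrite fineK// ge0_fin_numE; last exact: dint_ge0.
  apply: (@le_lt_trans _ _ area); last by rewrite areaE ltry.
  by apply: dint_le => //; exact: cst_dmeas.
rewrite -/F fin; set m := fine _; congr EFin.
have m0 : 0 <= m by rewrite -lee_fin -fin; exact: dint_ge0.
(* the mass of the annulus [x <= |z| < 1] *)
have key (x : R) : 0 < x < 1 ->
    areaR * (x ^+ 2) ^+ n * (1 - x ^+ 2) <= m * (1 - (x ^+ 2) ^+ n.+1) /\
    m * (1 - (x ^+ 2) ^+ n.+1) <= areaR * (1 - x ^+ 2).
  move=> /andP[x0 x1].
  have x01 : 0 < x <= 1 by rewrite x0 ltW.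
  have one0 : nonneg_on (fun=> 1) by [].
  have S1 := dint_scale x01 (cst_dmeas 1) one0.
  have S2 := dint_scale x01 mF F0.
  have FE z : F (rc x * z) = (x ^+ 2) ^+ n * F z.
    by rewrite /F !modX modM mod_rc gtr0_norm// !exprMn -!exprM -exprD addnn -muln2.
  have xn0 : 0 <= (x ^+ 2) ^+ n by rewrite exprn_ge0// sqr_ge0.
  rewrite (eq_dint (G := fun z => (x ^+ 2) ^+ n * F z)) ?dintZ// in S2.
  pose in1 z : R := if modulus z < x then 1 else 0.
  pose inF z : R := if modulus z < x then F z else 0.
  pose out1 z : R := if modulus z < x then 0 else 1.
  pose outF z : R := if modulus z < x then 0 else F z.
  have mind : dmeas in1 := in_ball_dmeas x.
  have mout : dmeas out1.
    have -> : out1 = fun z => 1 - in1 z.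
      by apply/funext => z; rewrite /out1 /in1; case: ifP; rewrite ?subrr ?subr0.
    exact: (measurable_funB (cst_dmeas 1) mind).
  have minF : dmeas inF.
    have -> : inF = fun z => F z * in1 z.
      by apply/funext => z; rewrite /inF /in1; case: ifP; rewrite ?mulr1 ?mulr0.
    exact: (measurable_funM mF mind).
  have moutF : dmeas outF.
    have -> : outF = fun z => F z * out1 z.
      by apply/funext => z; rewrite /outF /out1; case: ifP; rewrite ?mulr1 ?mulr0.
    exact: (measurable_funM mF mout).
  have i0 : nonneg_on in1 by move=> z _; rewrite /in1; case: ifP.
  have o0 : nonneg_on out1 by move=> z _; rewrite /out1; case: ifP.
  have iF0 : nonneg_on inF by move=> z zD; rewrite /inF; case: ifP => // _; exact: F0.
  have oF0 : nonneg_on outF by move=> z zD; rewrite /outF; case: ifP => // _; exact: F0.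
  have D1 : area = (dint in1 + dint out1)%E.
    by rewrite -dintD//; apply: eq_dint => z _; rewrite /in1 /out1; case: ifP; rewrite ?addr0 ?add0r.
  have DF : dint F = (dint inF + dint outF)%E.
    by rewrite -dintD//; apply: eq_dint => z _; rewrite /inF /outF; case: ifP; rewrite ?addr0 ?add0r.
  have Din : dint in1 = (x ^+ 2 * areaR)%:E by rewrite -S1 -/area areaE EFinM.
  have DinF : dint inF = ((x ^+ 2) ^+ n.+1 * m)%:E.
    by rewrite -S2 fin -/m -!EFinM; congr EFin; rewrite [_ ^+ n.+1]exprS mulrA.
  have Dout : dint out1 = (areaR * (1 - x ^+ 2))%:E.
    move: D1; rewrite Din areaE => /EFin_addl ->; congr EFin; ring.
  have DoutF : dint outF = (m * (1 - (x ^+ 2) ^+ n.+1))%:E.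
    move: DF; rewrite DinF fin => /EFin_addl ->; rewrite -/m; congr EFin; ring.
  split; last first.
    rewrite -lee_fin -DoutF -Dout; apply: dint_le => // z zD.
    by rewrite /outF /out1; case: ifP => // _; exact: F1.
  rewrite -lee_fin -DoutF.
  have -> : (areaR * (x ^+ 2) ^+ n * (1 - x ^+ 2))%:E = dint (fun z => (x ^+ 2) ^+ n * out1 z).
    by rewrite dintZ// Dout -EFinM; congr EFin; ring.
  apply: dint_le => //.
  - exact: (measurable_funM (cst_dmeas _) mout).
  - by move=> z zD; rewrite mulr_ge0// o0.
  move=> z zD; rewrite /outF /out1; case: ifPn; rewrite ?mulr0// mulr1 -leNgt => xz.
  have -> : F z = (modulus z ^+ 2) ^+ n by rewrite /F modX -!exprM mulnC.
  apply: lerXn2r; rewrite ?nnegrE ?sqr_ge0//.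
  by apply: lerXn2r; rewrite ?nnegrE ?mod_ge0 ?(ltW x0).
have geo (x : R) : 1 - x ^+ n.+1 = (1 - x) * \sum_(i < n.+1) x ^+ i.
  by rewrite -opprB subrX1 -mulNr opprB.
have key2 (x : R) : 0 < x < 1 -> areaR * (1 - n%:R * (1 - x)) <= m * n.+1%:R /\
    m * (n.+1%:R * (1 - n.+1%:R * (1 - x))) <= areaR.
  move=> /andP[x0 x1].
  pose y := Num.sqrt x.
  have y2 : y ^+ 2 = x by rewrite sqr_sqrtr// ltW.
  have y01 : 0 < y < 1.
    by rewrite sqrtr_gt0 x0/= -sqrtr1 ltr_sqrt.
  have [K1 K2] := key y y01.
  rewrite y2 geo in K1 K2.
  have x1' : 0 < 1 - x by rewrite subr_gt0.
  have S1 : \sum_(i < n.+1) x ^+ i <= n.+1%:R.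
    have -> : n.+1%:R = \sum_(i < n.+1) (1 : R) by rewrite sumr_const card_ord.
    by apply: ler_sum => i _; apply: exprn_ile1; exact: ltW.
  have S2 : n.+1%:R * (1 - n.+1%:R * (1 - x)) <= \sum_(i < n.+1) x ^+ i.
    have -> : n.+1%:R * (1 - n.+1%:R * (1 - x)) = \sum_(i < n.+1) (1 - n.+1%:R * (1 - x)).
      by rewrite sumr_const card_ord mulr_natl.
    apply: ler_sum => i _.
    apply: le_trans (bernoulli_le i _); last by rewrite !ltW.
    apply: lerB => //; apply: ler_wpM2r; first exact: ltW.
    by rewrite ler_nat; exact: ltnW (ltn_ord i).
  split.
    have : areaR * x ^+ n <= m * \sum_(i < n.+1) x ^+ i.
      rewrite -(ler_pM2r x1'); apply: (le_trans K1).
      by rewrite le_eqVlt; apply/orP; left; apply/eqP; ring.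
    have : areaR * (1 - n%:R * (1 - x)) <= areaR * x ^+ n.
      by rewrite ler_wpM2l ?(ltW a0)//; apply: bernoulli_le; rewrite !ltW.
    have : m * \sum_(i < n.+1) x ^+ i <= m * n.+1%:R by rewrite ler_wpM2l.
    by lra.
  have : m * \sum_(i < n.+1) x ^+ i <= areaR.
    rewrite -(ler_pM2r x1'); apply: le_trans K2.
    by rewrite le_eqVlt; apply/orP; left; apply/eqP; ring.
  have : m * (n.+1%:R * (1 - n.+1%:R * (1 - x))) <= m * \sum_(i < n.+1) x ^+ i by rewrite ler_wpM2l.
  by lra.
have small (C e : R) : 0 <= C -> 0 < e -> exists2 t, 0 < t < 1 & C * t <= e.
  move=> C0 e0; have C1 : 0 < C + 1 by rewrite ltr_wpDl.
  exists (Num.min (1 / 2) (e / (C + 1))).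
    by rewrite lt_min gt_min !divr_gt0//= ltr_pdivrMr// mul1r ltr1n.
  apply: (@le_trans _ _ (C * (e / (C + 1)))); first by rewrite ler_wpM2l// ge_min lexx orbT.
  by rewrite mulrCA ler_piMr ?ltW// ltr_pdivrMr// mul1r ltrDl.
have n0 : (0 : R) < n.+1%:R by [].
suff : m * n.+1%:R = areaR by move=> <-; rewrite mulfK// gt_eqF.
apply/le_anti/andP; split; apply/ler_addgt0Pr => e e0.
  have [|t /andP[t0 t1] ht] := small (m * n.+1%:R * n.+1%:R) e _ e0; first by rewrite !mulr_ge0.
  have [|_ K] := key2 (1 - t); first by apply/andP; split; lra.
  have E : 1 - (1 - t) = t by ring.
  rewrite E in K.
  have -> : m * n.+1%:R = m * (n.+1%:R * (1 - n.+1%:R * t)) + m * n.+1%:R * n.+1%:R * t by ring.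
  exact: lerD.
have [|t /andP[t0 t1] ht] := small (areaR * n%:R) e _ e0; first by rewrite !mulr_ge0// ltW.
have [|K _] := key2 (1 - t); first by apply/andP; split; lra.
have E : 1 - (1 - t) = t by ring.
  rewrite E in K.
have -> : areaR = areaR * (1 - n%:R * t) + areaR * n%:R * t by ring.
exact: lerD.
Qed.

End DiscIntegral.

(** * Rotation averages and the Bergman estimate *)

Section PlaneSigmaFinite.
Context {R : realType}.
Local Notation leb := (@lebesgue_measure R).

(** The plane measure as a constant of its own, to which sigma-finiteness can be
attached: the theorem of Tonelli with a third variable, the angle, needs it. *)
Definition plane2 : set (measurableTypeR R * measurableTypeR R) -> \bar R :=
  (leb \x leb)%E.

HB.instance Definition _ := Measure.copy plane2 (leb \x leb)%E.

Lemma plane2_sigma_finite : sigma_finite setT plane2.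
Proof.
exists (fun n => `[(- n%:R)%R, n%:R%R]%classic `*` `[(- n%:R)%R, n%:R%R]%classic).
  apply/esym/seteqP; split => // -[x y] _.
  have := archi_boundP (addr_ge0 (normr_ge0 x) (normr_ge0 y)).
  set n := Num.bound _ => xyn; exists n => //=; rewrite !in_itv/=.
  have := normr_ge0 x; have := normr_ge0 y => y0 x0.
  by split; rewrite -ler_norml; lra.
move=> n; split; first by apply: measurableX; exact: measurable_itv.
rewrite /plane2 (product_measure1E leb leb (measurable_itv _) (measurable_itv _)).
rewrite [ltLHS](_ : _ = (leb `[(- n%:R)%R, n%:R%R]%classic * leb `[(- n%:R)%R, n%:R%R]%classic)%E)//.
have -> : (leb `[(- n%:R)%R, n%:R%R]%classic = (n%:R - (- n%:R))%:E)%E.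
  rewrite lebesgue_measure_itv/= lte_fin; case: ltP => // h.
  by congr EFin; have : (0 : R) <= n%:R by []; lra.
by rewrite -EFinM ltry.
Qed.

HB.instance Definition _ := Measure_isSigmaFinite.Build _ _ _ plane2 plane2_sigma_finite.

End PlaneSigmaFinite.

Section Averages.
Context {R : realType}.
Implicit Types (F G L : cplane R -> R) (f g : cplane R -> cplane R) (u w z : cplane R).
Local Notation leb := (@lebesgue_measure R).

Lemma rint_translate (f : R -> R) (s a b : R) : (forall x, {for x, continuous f}) -> a <= b ->
  rint (fun x => f (x + s)) a b = rint f (a + s) (b + s).
Proof.
move=> cf ab.
have cs : forall x, {for x, continuous (fun x => f (x + s))}.
  move=> x; apply: (@continuous_comp _ _ _ (fun x => x + s) f); last exact: cf.
  by apply: continuousD; [exact: cvg_id|exact: cst_continuous].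
have pos (g : R -> R) : (forall x, {for x, continuous g}) ->
    (forall x, a + s <= x <= b + s -> 0 <= g x) ->
    rint (fun x => g (x + s)) a b = rint g (a + s) (b + s).
  move=> cg g0; rewrite /rint /Rintegral; congr fine.
  have mg : measurable_fun [set: R] (fun x => (g x)%:E).
    by apply/measurable_EFinP; exact: continuous_measurable_fun.
  pose k : R -> \bar R := (fun x => (g x)%:E) \_ `[a + s, b + s]%classic.
  have mk : measurable_fun setT k.
    apply: ((measurable_restrictT _ (measurable_itv _)).1).
    exact: (measurable_funTS mg).
  have k0 x : (0 <= k x)%E.
    rewrite /k patchE; case: ifPn => //; rewrite inE/= in_itv/= => /g0.
    by rewrite lee_fin.
  rewrite [RHS]integral_mkcond -/k (@lebesgue_affine R 1 s k ltr01 mk k0) mul1e.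
  rewrite [LHS]integral_mkcond; apply: eq_integral => x _.
  rewrite mul1r /k !patchE; congr (if _ then _ else _).
  by apply/idP/idP; rewrite !inE/= !in_itv/= !lerD2r.
have abs : a + s <= b + s by rewrite lerD2r.
have [c _ Hc] : exists2 c, c \in `[a + s, b + s] &
    forall x, x \in `[a + s, b + s] -> `|f x| <= `|f c|.
  apply: (@EVT_max R (fun t => `|f t|) _ _ abs).
  by apply: continuous_subspaceT => x; apply: cvg_norm; exact: cf.
have cc : forall x : R, {for x, continuous (fun _ : R => `|f c|)} by move=> x; exact: cst_continuous.
have cfc : forall x, {for x, continuous (fun x => f x + `|f c|)}.
  by move=> x; apply: continuousD; [exact: cf|exact: cc].
have := pos (fun x => f x + `|f c|) cfc.
rewrite !rintD ?rint_cst//; try by move=> x _; (exact: cf || exact: cs || exact: cc).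
have -> : b + s - (a + s) = b - a by ring.
move=> H; apply: (addIr (`|f c| * (b - a))); apply: H => x xab.
have := Hc x; rewrite in_itv/= => /(_ xab); rewrite ler_norml -lerBlDr sub0r.
by case/andP.
Qed.

Lemma rint_shift_periodic (f : R -> R) (s : R) : (forall x, {for x, continuous f}) ->
  (forall x, f (x + 2 * pi) = f x) -> 0 <= s <= 2 * pi ->
  rint (fun x => f (x + s)) 0 (2 * pi) = rint f 0 (2 * pi).
Proof.
move=> cf per /andP[s0 s2]; have pp := @pi_gt0 R.
rewrite (rint_translate s cf twopi_ge0) add0r.
have co a b : cont_on a b f by move=> x _; exact: cf.
rewrite (@rint_split R f s (2 * pi + s) (2 * pi)); [|by apply/andP; split; lra|exact: co].
rewrite (@rint_split R f 0 (2 * pi) s); [|by apply/andP; split; lra|exact: co].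
rewrite [RHS]addrC; congr (_ + _).
have := rint_translate (2 * pi) cf s0; rewrite add0r [s + _]addrC => <-.
by apply: eq_rint => x _; rewrite per.
Qed.

Lemma cint_shift_periodic (f : R -> cplane R) (s : R) :
  (forall x, f y @[y --> x] --> f x) ->
  (forall x, f (x + 2 * pi) = f x) -> 0 <= s <= 2 * pi ->
  cint (fun x => f (x + s)) 0 (2 * pi) = cint f 0 (2 * pi).
Proof.
move=> cf per s2; rewrite /cint; congr Complex.
  apply: (rint_shift_periodic (f := fun x => complex.Re (f x))) => // x; last by rewrite per.
  exact: (cvg_Re (cf x)).
apply: (rint_shift_periodic (f := fun x => complex.Im (f x))) => // x; last by rewrite per.
exact: (cvg_Im (cf x)).
Qed.

Lemma measurable_cos : measurable_fun [set: R] (@cos R).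
Proof. by apply: continuous_measurable_fun; exact: continuous_cos. Qed.

Lemma measurable_sin : measurable_fun [set: R] (@sin R).
Proof. by apply: continuous_measurable_fun; exact: continuous_sin. Qed.

Lemma measurable_rotation :
  measurable_fun [set: R * (R * R)] (fun q : R * (R * R) => rot (cis q.1) q.2).
Proof.
have mx : measurable_fun [set: R * (R * R)] (fun q : R * (R * R) => q.2.1).
  exact: (measurableT_comp measurable_fst measurable_snd).
have my : measurable_fun [set: R * (R * R)] (fun q : R * (R * R) => q.2.2).
  exact: (measurableT_comp measurable_snd measurable_snd).
have mc : measurable_fun [set: R * (R * R)] (fun q : R * (R * R) => cos q.1).
  exact: (measurableT_comp measurable_cos measurable_fst).
have ms : measurable_fun [set: R * (R * R)] (fun q : R * (R * R) => sin q.1).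
  exact: (measurableT_comp measurable_sin measurable_fst).
apply: measurable_fun_pair.
  exact: (measurable_funB (measurable_funM mc mx) (measurable_funM ms my)).
exact: (measurable_funD (measurable_funM mc my) (measurable_funM ms mx)).
Qed.

(** Averaging over all rotations does not change the integral over the disc, by
rotation invariance and the theorem of Tonelli. So a lower bound for the means
of [G] over circles becomes a lower bound for its integral. *)
Lemma dint_mean G L : (forall z, unit_disc z -> G w @[w --> z] --> G z) -> nonneg_on G ->
  dmeas L -> nonneg_on L ->
  (forall z, unit_disc z -> 2 * pi * L z <= rint (fun t => G (cis t * z)) 0 (2 * pi)) ->
  (dint L <= dint G)%E.
Proof.
move=> cG G0 mL L0 GL.
have mG := continuous_dmeas cG.
have FF := disc_ext_meas mG G0.
have pp := @pi_gt0 R.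
pose H (q : R * (R * R)) : \bar R :=
  ((fun q : R * (R * R) => disc_ext G (rot (cis q.1) q.2)) \_ (`[0, 2 * pi]%classic `*` setT)) q.
have mD : measurable (`[0, 2 * pi]%classic `*` setT : set (R * (R * R))).
  by apply: measurableX => //; exact: measurable_itv.
have mH : measurable_fun setT H.
  apply: ((measurable_restrictT _ mD).1).
  apply: measurable_funTS; exact: (measurableT_comp FF.1 measurable_rotation).
have H0 q : (0 <= H q)%E.
  by rewrite /H patchE; case: ifPn => // _; exact: FF.2.
have HE t p : H (t, p) = ((fun t => disc_ext G (rot (cis t) p)) \_ `[0, 2 * pi]%classic) t.
  rewrite /H !patchE; congr (if _ then _ else _).
  by apply/idP/idP; rewrite !inE/= ; [case|split].
have FT : (\int[leb]_t \int[@plane_measure R]_p H (t, p) =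
    \int[@plane_measure R]_p \int[leb]_t H (t, p))%E.
  exact: (@fubini_tonelli _ _ _ _ R leb (@plane2 R) H mH H0).
have LHS_E : (\int[leb]_t \int[@plane_measure R]_p H (t, p) = dint G * (2 * pi)%:E)%E.
  transitivity (\int[leb]_(t in `[0%R, (2 * pi)%R]%classic) dint G)%E.
    rewrite [RHS]integral_mkcond; apply: eq_integral => t _.
    rewrite patchE; case: ifPn => tt.
      rewrite -[RHS](dint_rot (mod_cis t) mG G0).
      have mGr : dmeas (fun z => G (cis t * z)).
        apply: continuous_dmeas => z zD.
        have d := cderivM (cderiv_cst z (cis t)) (cderiv_id z).
        apply: (cvg_comp _ _ (cderiv_cvg d)); apply: cG.
        by rewrite unit_disc_rot// mod_cis.
      rewrite dint_ext; apply: eq_integral => p _.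
      rewrite HE patchE tt; have [pD|pD] := pselect (unit_disc (of_pair p)).
        by rewrite !disc_ext_in// rotE// unit_disc_rot// mod_cis.
      by rewrite !disc_ext_out// rotE unit_disc_rot// mod_cis.
    rewrite -[RHS](integral0 (@plane_measure R) setT); apply: eq_integral => p _.
    by rewrite HE patchE ifN.
  rewrite integral_cst//.
  have LM : leb `[0%R, (2 * pi)%R]%classic = (2 * pi)%:E.
    by rewrite lebesgue_measure_itv/= lte_fin mulr_gt0// -EFinB subr0.
  by congr (_ * _)%E.
have RHS_E : (\int[@plane_measure R]_p disc_ext (fun z => 2 * pi * L z)%R p <=
    \int[@plane_measure R]_p \int[leb]_t H (t, p))%E.
  have m2L : dmeas (fun z => 2 * pi * L z) := measurable_funM (cst_dmeas _) mL.
  have L20 : nonneg_on (fun z => 2 * pi * L z).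
    by move=> z zD; rewrite mulr_ge0 ?twopi_ge0// L0.
  have LL := disc_ext_meas m2L L20.
  have mR : measurable_fun [set: R * R] (fun p => (\int[leb]_t H (t, p))%E).
    exact: (@measurable_fun_fubini_tonelli_G _ _ _ _ R leb H mH H0).
  apply: (@ge0_le_integral _ _ _ (@plane_measure R) setT measurableT _ _
    (fun p _ => LL.2 p) LL.1 mR).
  move=> p _; have [pD|pD] := pselect (unit_disc (of_pair p)); last first.
    by rewrite disc_ext_out//; apply: integral_ge0 => t _; exact: H0.
  rewrite disc_ext_in//.
  have -> : (\int[leb]_t H (t, p) = (rint (fun t => G (cis t * of_pair p)%R) 0%R (2 * pi)%R)%:E)%E.
    have cGc : cont_on 0 (2 * pi) (fun t => G (cis t * of_pair p)).
      move=> t _; have d := cder_cont (cderM (cder_cis1 t) (cder_cst (of_pair p) t)).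
      apply: (cvg_comp _ _ d); apply: cG.
      by rewrite unit_disc_rot// mod_cis.
    rewrite /rint /Rintegral fineK; last first.
      apply: integrable_fin_num; first exact: measurable_itv.
      exact: cont_on_integrable.
    rewrite [RHS]integral_mkcond; apply: eq_integral => t _.
    rewrite HE !patchE; case: ifPn => // _.
    by rewrite disc_ext_in rotE// unit_disc_rot// mod_cis.
  by rewrite lee_fin; exact: GL.
rewrite -FT LHS_E -dint_ext dintZ ?twopi_ge0// in RHS_E.
have P : 0 < 2 * pi :> R by rewrite mulr_gt0.
by move: RHS_E; rewrite [leRHS]muleC lee_pmul2l.
Qed.

(** The Cauchy-Schwarz inequality for the mean, from
[|X - k| ^ 2 >= 0] integrated over the period. *)
Lemma mean_sq_ge (X : R -> cplane R) (k : cplane R) : ccont_on 0 (2 * pi) X ->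
  cint X 0 (2 * pi) = rc (2 * pi) * k ->
  2 * pi * modulus k ^+ 2 <= rint (fun t => modulus (X t) ^+ 2) 0 (2 * pi).
Proof.
move=> cX Xk.
have cY := ccont_onM (ccont_on_cst 0 (2 * pi) (conjc k)) cX.
have E : rint (fun t => 2 * complex.Re (conjc k * X t) + - modulus k ^+ 2) 0 (2 * pi) =
    2 * pi * modulus k ^+ 2.
  have c1 : cont_on 0 (2 * pi) (fun t => complex.Re (conjc k * X t)) := cY.1.
  have c2 : cont_on 0 (2 * pi) (fun t => 2 * complex.Re (conjc k * X t)).
    by apply: cont_onM => //; exact: cont_on_cst.
  rewrite rintD//; last exact: cont_on_cst.
  rewrite rintZ// rint_cst ?twopi_ge0//.
  have := cintZ (conjc k) cX; rewrite Xk => /(congr1 (@complex.Re R)) Z.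
  have -> : rint (fun t => complex.Re (conjc k * X t)) 0 (2 * pi) =
    complex.Re (conjc k * (rc (2 * pi) * k)) by rewrite -Z.
  by rewrite !ReM !ImM ReJ ImJ mod_sqr [complex.Re (rc _)]/= [complex.Im (rc _)]/=; ring.
rewrite -E; apply: rint_le.
- apply: cont_onD; last exact: cont_on_cst.
  by apply: cont_onM; [exact: cont_on_cst|exact: cY.1].
- under eq_fun do rewrite mod_sqr.
  by apply: cont_onD; apply: cont_onM; (exact: cX.1 || exact: cX.2).
- move=> t _; rewrite -subr_ge0.
  have -> : modulus (X t) ^+ 2 - (2 * complex.Re (conjc k * X t) + - modulus k ^+ 2) =
     modulus (X t - k) ^+ 2.
    by rewrite !mod_sqr ReD ImD ReN ImN ReM ReJ ImJ; ring.
  exact: sqr_ge0.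
Qed.

Lemma holomorphic_derive1_cvg f : holomorphic f ->
  forall z, unit_disc z -> derive1 f w @[w --> z] --> derive1 f z.
Proof.
move=> hf z zD; apply: (@derive1_cvg_in R f 0 1); last by rewrite subr0.
by move=> w; rewrite subr0; exact: hf.
Qed.

Lemma cvg_mod_sqr f z : f w @[w --> z] --> f z -> modulus (f w) ^+ 2 @[w --> z] --> modulus (f z) ^+ 2.
Proof.
move=> /(@cvg_modulus R _ (nbhs z) (nbhs_filter z)) H.
exact: (@cvgM R _ (nbhs z) (nbhs_filter z) _ _ _ _ H H).
Qed.

Section Dilate.
Variables (f : cplane R -> cplane R) (z : cplane R).
Hypotheses (hf : holomorphic f) (zD : unit_disc z) (z0 : z != 0).

Let rho := (modulus z)^-1.

Let z_gt0 : 0 < modulus z. Proof. by rewrite mod_gt0. Qed.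

Lemma dilate_in w : modulus (w - 0) < rho -> unit_disc (w * z).
Proof.
rewrite subr0 => wr; rewrite /unit_disc/= modM -(mulVf (lt0r_neq0 z_gt0)).
by rewrite ltr_pM2r.
Qed.

Lemma dilate_cderiv w : modulus (w - 0) < rho ->
  cderiv (fun v : cplane R => f (v * z)) w (derive1 f (w * z) * z).
Proof.
move=> wr; have d := cderivM (cderiv_id w) (cderiv_cst w z).
rewrite mul1r mulr0 addr0 in d.
exact: (cderiv_comp d (derivable_cderiv (hf (dilate_in wr)))).
Qed.

Lemma dilate_derivable w : modulus (w - 0) < rho -> derivable (fun v : cplane R => f (v * z)) w 1.
Proof. by move=> /dilate_cderiv/cderiv_derivable. Qed.

Lemma one_lt_rho : 0 < (1 : R) < rho.
Proof. by rewrite ltr01/= invf_gt1. Qed.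

(** The circle of radius [|z|] through [z] is seen as the unit circle for the
dilated function [w |-> f (w z)], holomorphic on a disc of radius [1 / |z| > 1].
Working with orbits [e^{it} z] matches the rotation averages of [dint_mean]. *)
Lemma circle_dilate (k : R) :
  circ (derive1 (fun v : cplane R => f (v * z))) 0 1 k =
  z * cint (fun t => derive1 f (cis t * z) * cis (- (k * t))) 0 (2 * pi).
Proof.
rewrite /circ -cintZ.
  apply: eq_cint => t _; rewrite add0r -[rc 1]/(1 : cplane R) mul1r.
  have cr : modulus (cis t - 0 : cplane R) < rho.
    by rewrite subr0 mod_cis; case/andP: one_lt_rho.
  by rewrite (cderiv_derive1 (dilate_cderiv cr)); ring.
apply: ccont_onM; apply: ccont_onP => t _; last exact: (cder_cont (cder_cisN k t)).
have d := cder_cont (cderM (cder_cis1 t) (cder_cst z t)).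
apply: (cvg_comp _ _ d); apply: (holomorphic_derive1_cvg hf).
by rewrite /unit_disc/= modM mod_cis mul1r.
Qed.

Lemma circle_dilate_parts (k : R) : cis (k * (2 * pi)) = 1 :> cplane R ->
  z * cint (fun t => derive1 f (cis t * z) * cis (- ((k - 1) * t))) 0 (2 * pi) =
  rc k * cint (fun t => f (cis t * z) * cis (- (k * t))) 0 (2 * pi).
Proof.
move=> kp; rewrite -circle_dilate.
have := circ_parts dilate_derivable one_lt_rho kp; rewrite -[rc 1]/(1 : cplane R) mul1r => ->.
congr (_ * _); apply: eq_cint => t _.
by rewrite add0r mul1r.
Qed.

Lemma circle_mean_derive : cint (fun t => derive1 f (cis t * z)) 0 (2 * pi) =
  rc (2 * pi) * derive1 f 0.
Proof.
have := mean_derive1 dilate_derivable one_lt_rho; rewrite circle_dilate.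
have c0 : modulus ((0 : cplane R) - 0) < rho.
  by rewrite subrr mod0 invr_gt0.
rewrite (cderiv_derive1 (dilate_cderiv c0)) mul0r => H.
apply: (mulfI z0); rewrite [RHS]mulrCA [z * derive1 f 0]mulrC -H; congr (_ * _).
by apply: eq_cint => t _; rewrite mul0r oppr0 cis0 mulr1.
Qed.

End Dilate.

Lemma ccont_dilate f z a b : holomorphic f -> unit_disc z ->
  ccont_on a b (fun t => derive1 f (cis t * z)).
Proof.
move=> hf zD; apply: ccont_onP => t _.
have d := cder_cont (cderM (cder_cis1 t) (cder_cst z t)).
apply: (cvg_comp _ _ d); apply: (holomorphic_derive1_cvg hf).
by rewrite /unit_disc/= modM mod_cis mul1r.
Qed.

(** The mean of [f'] over every circle around 0 is [f' 0], so that of [|f'| ^ 2]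
is at least [|f' 0| ^ 2]. *)
Lemma bergman0 f : holomorphic f ->
  ((areaR * modulus (derive1 f 0) ^+ 2)%:E <= dint (fun z => modulus (derive1 f z) ^+ 2)%R)%E.
Proof.
move=> hf.
have -> : (areaR * modulus (derive1 f 0) ^+ 2)%:E = dint (fun=> modulus (derive1 f 0) ^+ 2).
  have E := dintZ (F := fun=> 1) (cst_dmeas 1) (fun=> fun=> ler01) (sqr_ge0 (modulus (derive1 f 0))).
  have -> : dint (fun=> modulus (derive1 f 0) ^+ 2) = dint (fun=> modulus (derive1 f 0) ^+ 2 * 1).
    by apply: eq_dint => z _; rewrite mulr1.
  by rewrite E -/area areaE -EFinM mulrC.
apply: dint_mean => //.
- by move=> z zD; apply: (cvg_mod_sqr (f := derive1 f)); exact: holomorphic_derive1_cvg.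
- by move=> z _; exact: sqr_ge0.
- exact: cst_dmeas.
- by move=> z _; exact: sqr_ge0.
move=> z zD; have [->|z0] := eqVneq z 0.
  rewrite (eq_rint (g := fun=> modulus (derive1 f 0) ^+ 2)).
    by rewrite rint_cst ?twopi_ge0// subr0 mulrC.
  by move=> t _; rewrite mulr0.
apply: (mean_sq_ge (X := fun t => derive1 f (cis t * z))); first exact: ccont_dilate.
exact: circle_mean_derive.
Qed.

(** The estimate at 0 for the restriction of [f] to the disc of centre [w] and
radius [1 - |w|]. *)
Lemma bergman f w : holomorphic f -> unit_disc w ->
  ((areaR * (1 - modulus w) ^+ 2 * modulus (derive1 f w) ^+ 2)%:E <=
   dint (fun z => modulus (derive1 f z) ^+ 2)%R)%E.
Proof.
move=> hf wD; set rho := 1 - modulus w.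
have rho0 : 0 < rho by rewrite subr_gt0.
have inD z : unit_disc z -> unit_disc (w + rc rho * z).
  move=> zD; rewrite /unit_disc/=; apply: le_lt_trans (modD _ _) _.
  by rewrite modM mod_rc gtr0_norm// -ltrBrDl -/rho gtr_pMr.
pose g z := f (w + rc rho * z).
have dg z : unit_disc z -> cderiv g z (derive1 f (w + rc rho * z) * rc rho).
  move=> zD.
  have d := cderivD (cderiv_cst z w) (cderivM (cderiv_cst z (rc rho)) (cderiv_id z)).
  rewrite mul0r mulr1 !add0r in d.
  exact: (cderiv_comp d (derivable_cderiv (hf _ (inD z zD)))).
have hg : holomorphic g by move=> z /dg/cderiv_derivable.
have D0 : unit_disc (0 : cplane R) by rewrite /unit_disc/= mod0.
have := bergman0 hg; rewrite (cderiv_derive1 (dg 0 D0)) mulr0 addr0.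
have mF : dmeas (fun z => modulus (derive1 f z) ^+ 2).
  by have [_ _] := dmeas_cplane (holomorphic_derive1_cvg hf).
have cw z : unit_disc z -> derive1 f (w + rc rho * v) @[v --> z] --> derive1 f (w + rc rho * z).
  move=> zD.
  have d := cderivD (cderiv_cst z w) (cderivM (cderiv_cst z (rc rho)) (cderiv_id z)).
  exact: (cvg_comp _ _ (cderiv_cvg d) (holomorphic_derive1_cvg hf (inD z zD))).
have mFw : dmeas (fun z => modulus (derive1 f (w + rc rho * z)) ^+ 2).
  by have [_ _] := dmeas_cplane cw.
have B := dint_ball rho0 mF (fun z _ => sqr_ge0 _) inD mFw.
move=> H; apply: le_trans B; apply: le_trans (le_trans H _).
  rewrite lee_fin modM mod_rc gtr0_norm//.
  by rewrite le_eqVlt; apply/orP; left; apply/eqP; ring.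
rewrite -dintZ ?sqr_ge0//; last by move=> z _; exact: sqr_ge0.
rewrite le_eqVlt; apply/orP; left; apply/eqP; apply: eq_dint => z zD.
by rewrite (cderiv_derive1 (dg z zD)) modM mod_rc gtr0_norm// exprMn mulrC.
Qed.

(** By [circ_scale] the [n]-th coefficient on the circle of radius [r] is
[r ^ n] times a constant; rotating the base point to [z], by periodicity,
multiplies it by the phase of [z ^ n]. *)
Lemma taylor_coef f n : (0 < n)%N -> holomorphic f -> exists A : cplane R,
  (forall r, 0 < r < 1 -> circ f 0 r n%:R = rc (r ^+ n) * A) /\
  forall z, unit_disc z ->
    cint (fun t => f (cis t * z) * cis (- (n%:R * t))) 0 (2 * pi) = A * z ^+ n.
Proof.
move=> n0 hf.
have hf' w : modulus (w - 0) < 1 -> derivable f w 1 by rewrite subr0; exact: hf.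
have np : cis (n%:R * (2 * pi)) = 1 :> cplane R by rewrite -cisX cis2pi expr1n.
(* any radius would do; 1/2 is taken *)
pose A : cplane R := rc (2 ^+ n) * circ f 0 2^-1 n%:R.
have EX (r : R) : 0 < r -> expR (- (n%:R * ln r)) = r ^- n.
  by move=> r0; rewrite expRN mulr_natl -lnXn// lnK// posrE exprn_gt0.
have half : 0 < (2^-1 : R) < 1 by rewrite invr_gt0 ltr0n invf_lt1// ltr1n.
have sc r : 0 < r < 1 -> rc (r ^- n) * circ f 0 r n%:R = A.
  move=> /andP[r0 r1]; rewrite /A.
  have E2 : (2^-1 : R) ^- n = 2 ^+ n by rewrite exprVn invrK.
  have [h0 h1] := andP half.
  have [rh|/ltW hr] := leP r 2^-1.
    by have := circ_scale hf' r0 rh h1 np; rewrite !EX// E2.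
  by have := circ_scale hf' h0 hr r1 np; rewrite !EX// E2 => ->.
have CA r : 0 < r < 1 -> circ f 0 r n%:R = rc (r ^+ n) * A.
  move=> rr; have r0 : 0 < r by case/andP: rr.
  rewrite -(sc r rr) mulrA.
  have -> : rc (r ^+ n) * rc (r ^- n) = 1 :> cplane R.
    by apply: eqC; rewrite ?ReM ?ImM/= ?mulfV ?gt_eqF ?exprn_gt0//; ring.
  by rewrite mul1r.
exists A; split=> // z zD.
have [->|z0] := eqVneq z 0.
  rewrite expr0n gtn_eqF// mulr0.
  rewrite (eq_cint (g := fun t => f 0 * cis (- n%:R * t))); last by move=> t _; rewrite mulr0 mulNr.
  rewrite cintZ; last by apply: ccont_onP => t _; exact: (cder_cont (cder_cis (- n%:R) t)).
  rewrite cint_cis; first exact: mulr0.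
    by rewrite oppr_eq0 pnatr_eq0 -lt0n.
  by rewrite mulNr cisN np; apply: eqC; rewrite ?ReJ ?ImJ/= ?oppr0.
set r := modulus z.
have r0 : 0 < r by rewrite mod_gt0.
have rr : 0 < r < 1 by rewrite r0.
have z1 : modulus (rc r^-1 * z) = 1.
  by rewrite modM mod_rc ger0_norm ?invr_ge0 ?mod_ge0// mulVf// gt_eqF.
have [s sb zs] := arg_exists z1.
have zE : z = rc r * cis s.
  rewrite -zs mulrA; have -> : rc r * rc r^-1 = 1 :> cplane R.
    by apply: eqC; rewrite ?ReM ?ImM/= ?mulfV ?gt_eqF//; ring.
  by rewrite mul1r.
pose H (x : R) := f (0 + rc r * cis x) * cis (- (n%:R * x)).
have cH x : H y @[y --> x] --> H x.
  have d : derivable f (0 + rc r * cis x) 1 by apply: hf'; rewrite mod_circle// ltW.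
  exact: (cder_cont (cderM (cder_comp (cder_circle 0 r x) (derivable_cderiv d)) (cder_cisN n%:R x))).
have per x : H (x + 2 * pi) = H x.
  rewrite /H cisD cis2pi mulr1 mulrDr opprD cisD [cis (- (_ * (2 * pi)))]cisN np.
  have -> : conjc 1 = 1 :> cplane R by apply: eqC; rewrite ?ReJ ?ImJ/= ?oppr0.
  by rewrite mulr1.
rewrite (eq_cint (g := fun t => cis (n%:R * s) * H (t + s))); last first.
  move=> t _.
  have e1 : cis (- (n%:R * (t + s))) = cis (- (n%:R * t)) * cis (- (n%:R * s)) :> cplane R.
    by rewrite -cisD; congr cis; ring.
  rewrite /H add0r e1.
  have -> : cis t * z = rc r * cis (t + s) by rewrite zE cisD; ring.
  have -> : cis (n%:R * s) * (f (rc r * cis (t + s)) * (cis (- (n%:R * t)) * cis (- (n%:R * s)))) =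
    (cis (- (n%:R * s)) * cis (n%:R * s)) * (f (rc r * cis (t + s)) * cis (- (n%:R * t))) by ring.
  by rewrite cisNM mul1r.
have cHs : ccont_on 0 (2 * pi) (fun t => H (t + s)).
  apply: ccont_onP => t _.
  have ct : {for t, continuous (fun x : R => x + s)}.
    by apply: continuousD; [exact: cvg_id|exact: cst_continuous].
  exact: (cvg_comp _ _ ct (cH (t + s))).
rewrite (cintZ _ cHs) (cint_shift_periodic cH per sb) -/(circ f 0 r n%:R) (CA r rr).
rewrite zE exprMn cisX.
have -> : rc r ^+ n = rc (r ^+ n) :> cplane R.
  elim: (n) => [|j IH]; first by rewrite !expr0.
  by rewrite !exprS IH; apply: eqC; rewrite ?ReM ?ImM/=; ring.
by ring.
Qed.

End Averages.

(** * The monomial basis of the Dirichlet space *)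

Section DirichletBasis.
Context {R : realType}.
Implicit Types (F G H : cplane R -> R) (f g : cplane R -> cplane R) (u w z : cplane R).

Definition dRint H : R := \int[@plane_measure R]_(p in @disc_pair R) H (of_pair p).

Definition energy f : \bar R := dint (fun z => modulus (derive1 f z) ^+ 2).

Lemma dirichlet_integralE f : dirichlet_integral f = (pi^-1%:E * energy f)%E.
Proof. by []. Qed.

Lemma energy_ge0 f : (0 <= energy f)%E.
Proof. by apply: dint_ge0 => z _; exact: sqr_ge0. Qed.

Lemma energy_dmeas f : holomorphic f -> dmeas (fun z => modulus (derive1 f z) ^+ 2).
Proof. by move=> hf; have [_ _] := dmeas_cplane (holomorphic_derive1_cvg hf). Qed.

Lemma piV_gt0 : 0 < pi^-1 :> R.
Proof. by rewrite invr_gt0 pi_gt0. Qed.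

Lemma dirichletP f : dirichlet f <-> holomorphic f /\ (energy f < +oo)%E.
Proof.
rewrite /dirichlet dirichlet_integralE; split => -[hf h]; split => //.
  case: (energy f) (energy_ge0 f) h => [r _ _|_|//]; first exact: ltry.
  by rewrite gt0_muley ?lte_fin ?piV_gt0.
case: (energy f) (energy_ge0 f) h => [r _ _|_|//]; first by rewrite -EFinM ltry.
by rewrite ltxx.
Qed.

Lemma energy_fin f : dirichlet f -> energy f = (fine (energy f))%:E.
Proof. by move=> /dirichletP[_ h]; rewrite fineK// ge0_fin_numE// energy_ge0. Qed.

(** A function changed into its opposite by a rotation has integral 0, since
its positive and negative parts are rotated into each other. *)
Lemma dRint_anti u H : modulus u = 1 -> dmeas H ->
  (forall z, unit_disc z -> H (u * z) = - H z) -> dRint H = 0.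
Proof.
move=> u1 mH anti; rewrite /dRint /Rintegral integralE.
pose P z : R := Num.max (H z) 0; pose N z : R := Num.max (- H z) 0.
have mN : dmeas N by exact: (measurable_maxr (measurableT_comp (@oppr_measurable R setT) mH) (cst_dmeas 0)).
have N0 : nonneg_on N by move=> z _; rewrite /N le_max lexx orbT.
have EP : (\int[@plane_measure R]_(p in @disc_pair R) ((fun p => (H (of_pair p))%:E)^\+ p) = dint P)%E.
  by apply: eq_integral => p _; rewrite funeposE /P EFin_max.
have EN : (\int[@plane_measure R]_(p in @disc_pair R) ((fun p => (H (of_pair p))%:E)^\- p) = dint N)%E.
  by apply: eq_integral => p _; rewrite funenegE /N EFin_max.
rewrite EP EN.
have -> : dint P = dint N.
  rewrite -(dint_rot u1 mN N0); apply: eq_dint => z zD.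
  by rewrite /P /N anti// opprK.
have := dint_ge0 N0; case: (dint N) => [r||]//= _.
by rewrite subrr.
Qed.

Lemma dRint_anti_cplane u (k : cplane R -> cplane R) : modulus u = 1 ->
  dmeas (fun z => complex.Re (k z)) -> dmeas (fun z => complex.Im (k z)) ->
  (forall z, k (u * z) = - k z) ->
  dRint (fun z => complex.Re (k z)) = 0 /\ dRint (fun z => complex.Im (k z)) = 0.
Proof.
move=> u1 mR mI kE; split.
  by apply: (dRint_anti u1 mR) => z _; rewrite kE; exact: ReN.
by apply: (dRint_anti u1 mI) => z _; rewrite kE; exact: ImN.
Qed.

Lemma dintD_fin F G (a b : R) : dmeas F -> dmeas G -> nonneg_on F -> nonneg_on G ->
  dint F = a%:E -> dint G = b%:E -> dint (fun z => F z + G z) = (a + b)%:E.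
Proof. by move=> mF mG F0 G0 Fa Gb; rewrite dintD// Fa Gb EFinD. Qed.

Lemma mul_le_sqr (x y : R) : 0 <= x -> 0 <= y -> x * y <= x ^+ 2 + y ^+ 2.
Proof. by move=> x0 y0; have := sqr_ge0 (x - y); have := mulr_ge0 x0 y0; nra. Qed.

Lemma sqr_le_add (x y v : R) : 0 <= x -> x <= y + v -> x ^+ 2 <= 2 * (y ^+ 2 + v ^+ 2).
Proof. by move=> x0 xy; have := sqr_ge0 (y - v); nra. Qed.

Definition dintegrable H := (@plane_measure R).-integrable (@disc_pair R) (fun p => (H (of_pair p))%:E).

Lemma dint_integrable F : dmeas F -> nonneg_on F -> (dint F < +oo)%E ->
  dintegrable F.
Proof.
move=> mF F0 foo; apply/integrableP; split; first exact: dmeas_EFin.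
rewrite [X in (X < _)%E](_ : _ = dint F)//; apply: eq_integral => p; rewrite inE => pD.
by rewrite gee0_abs// lee_fin F0.
Qed.

Lemma dintE F : dmeas F -> nonneg_on F -> (dint F < +oo)%E -> dint F = (dRint F)%:E.
Proof.
by move=> mF F0 foo; rewrite /dRint /Rintegral fineK// ge0_fin_numE// dint_ge0.
Qed.

Lemma integrable_le F H : dmeas H -> dmeas F -> nonneg_on F -> (dint F < +oo)%E ->
  (forall z, unit_disc z -> `|H z| <= F z) ->
  dintegrable H.
Proof.
move=> mH mF F0 foo HF.
apply/integrableP; split; first exact: dmeas_EFin.
rewrite [X in (X < _)%E](_ : _ = dint (fun z => `|H z|)); last first.
  by apply: eq_integral => p _; rewrite abse_EFin.
apply: le_lt_trans foo; apply: dint_le => //.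
exact: (measurableT_comp (@normr_measurable R setT) mH).
Qed.

Lemma dintegrableZ (q : R) H : dintegrable H -> dintegrable (fun z => q * H z).
Proof. by move=> iH; exact: (@integrableZl _ _ _ (@plane_measure R) _ measurable_disc_pair q _ iH). Qed.

Lemma dintegrableD F H : dintegrable F -> dintegrable H -> dintegrable (fun z => F z + H z).
Proof. by move=> iF iH; exact: (@integrableD _ _ _ (@plane_measure R) _ measurable_disc_pair _ _ iF iH). Qed.

Lemma dRintD F H : dintegrable F -> dintegrable H -> dRint (fun z => F z + H z) = dRint F + dRint H.
Proof. by move=> iF iH; exact: (@RintegralD _ _ _ (@plane_measure R) _ (fun p => F (of_pair p)) (fun p => H (of_pair p)) measurable_disc_pair iF iH). Qed.

Lemma dRintZ (q : R) H : dintegrable H -> dRint (fun z => q * H z) = q * dRint H.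
Proof. by move=> iH; exact: (@RintegralZl _ _ _ (@plane_measure R) _ (fun p => H (of_pair p)) q measurable_disc_pair iH). Qed.

(** Chosen so that [kap n * z ^ n] has unit norm; [pi] stays because the area of
the disc is not evaluated. *)
Definition kap (n : nat) : R := if n is 0%N then 1 else Num.sqrt (pi / (n%:R * areaR)).

Definition ebasis n : cplane R -> cplane R := fun z => rc (kap n) * z ^+ n.

Lemma kap_gt0 n : 0 < kap n.
Proof.
by case: n => [|n]//=; rewrite sqrtr_gt0 divr_gt0 ?pi_gt0// mulr_gt0 ?areaR_gt0.
Qed.

Lemma kap_sqr n : (0 < n)%N -> kap n ^+ 2 = pi / (n%:R * areaR).
Proof.
case: n => [//|n] _; rewrite /kap sqr_sqrtr// divr_ge0 ?pi_ge0// mulr_ge0//.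
exact: ltW areaR_gt0.
Qed.

Lemma ebasis_cderiv n z : cderiv (ebasis n) z (rc (kap n * n%:R) * z ^+ n.-1).
Proof.
apply: (cderiv_eq (cderivM (cderiv_cst z (rc (kap n))) (cderivX z n))).
have -> : (n%:R : cplane R) = rc n%:R.
  by elim: n => [//|n IH]; rewrite -[in LHS]natr1 IH -natr1; apply: eqC; rewrite ?ReD ?ImD/= ?addr0.
rewrite mul0r add0r mulrA; congr (_ * _).
by apply: eqC; rewrite ?ReM ?ImM/=; ring.
Qed.

Lemma ebasis_holomorphic n : holomorphic (ebasis n).
Proof. by move=> z _; exact: (cderiv_derivable (ebasis_cderiv n z)). Qed.

Lemma ebasis_derive1 n z : derive1 (ebasis n) z = rc (kap n * n%:R) * z ^+ n.-1.
Proof. exact: (cderiv_derive1 (ebasis_cderiv n z)). Qed.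

Lemma ebasis_energy n : energy (ebasis n) = (if n is 0%N then 0 else pi)%:E.
Proof.
rewrite /energy (eq_dint (G := fun z => (kap n * n%:R) ^+ 2 * modulus (z ^+ n.-1) ^+ 2)).
  rewrite dintZ ?sqr_ge0//; [|exact: monomial_dmeas|by move=> z _; exact: sqr_ge0].
  rewrite moment -EFinM; congr EFin; case: n => [|n].
    by rewrite mulr0 expr0n mul0r.
  rewrite exprMn kap_sqr// [n.+1.-1]/=.
  have a0 := areaR_gt0 (R := R); set a := areaR in a0 *.
  have n0 : (n.+1%:R : R) != 0 by rewrite pnatr_eq0.
  move: (n.+1%:R : R) n0 (pi : R) => y y0 p; field.
  by rewrite y0 gt_eqF.
by move=> z _; rewrite ebasis_derive1 modM mod_rc exprMn real_normK// num_real.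
Qed.

Lemma ebasis_dirichlet n : dirichlet (ebasis n).
Proof.
apply/dirichletP; split; first exact: ebasis_holomorphic.
by rewrite ebasis_energy ltry.
Qed.

Lemma ebasis0 n : (0 < n)%N -> ebasis n 0 = 0.
Proof. by move=> n0; rewrite /ebasis expr0n gtn_eqF// mulr0. Qed.

Lemma dirichlet_innerE f g : dirichlet_inner f g = f 0 * conjc (g 0) +
  Complex (pi^-1 * dRint (fun z => complex.Re (derive1 f z * conjc (derive1 g z))))
          (pi^-1 * dRint (fun z => complex.Im (derive1 f z * conjc (derive1 g z)))).
Proof. by []. Qed.

Lemma eq_dRint H G : (forall z, unit_disc z -> H z = G z) -> dRint H = dRint G.
Proof. by move=> HG; apply: eq_Rintegral => p; rewrite inE => pD; rewrite HG. Qed.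

Lemma dRint0 : dRint (fun=> 0) = 0.
Proof. by rewrite /dRint /Rintegral integral0. Qed.

Lemma dmeas_product f g : holomorphic f -> holomorphic g ->
  dmeas (fun z => complex.Re (derive1 f z * conjc (derive1 g z))) /\
  dmeas (fun z => complex.Im (derive1 f z * conjc (derive1 g z))).
Proof.
move=> /holomorphic_derive1_cvg/dmeas_cplane[fr fi _].
move=> /holomorphic_derive1_cvg/dmeas_cplane[gr gi _].
split; rewrite /dmeas.
  under eq_fun do rewrite ReM ReJ ImJ mulrN opprK.
  exact: (measurable_funD (measurable_funM fr gr) (measurable_funM fi gi)).
under eq_fun do rewrite ImM ReJ ImJ mulrN addrC.
exact: (measurable_funB (measurable_funM fi gr) (measurable_funM fr gi)).
Qed.

(** For [n <> m] the product of the derivatives is changed into its opposite by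
the rotation of angle [pi / (n - m)], so its integral vanishes. *)
Lemma ebasis_orthonormal n m : dirichlet_inner (ebasis n) (ebasis m) = (n == m)%:R.
Proof.
rewrite dirichlet_innerE.
have rcM (a b : R) : rc a * rc b = rc (a * b) :> cplane R.
  by apply: eqC; rewrite ?ReM ?ImM/=; ring.
have J z i : conjc (z ^+ i) = conjc z ^+ i :> cplane R.
  elim: i => [|i IH]; first by rewrite !expr0; apply: eqC; rewrite ?ReJ ?ImJ/= ?oppr0.
  by rewrite !exprS -IH; apply: eqC; rewrite ?ReJ ?ImJ ?ReM ?ImM ?ReJ ?ImJ; ring.
have [<-|nm] := eqVneq n m.
  have R1 z : complex.Re (derive1 (ebasis n) z * conjc (derive1 (ebasis n) z)) =
    modulus (derive1 (ebasis n) z) ^+ 2 by rewrite ReM ReJ ImJ mod_sqr; ring.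
  have I1 z : complex.Im (derive1 (ebasis n) z * conjc (derive1 (ebasis n) z)) = 0.
    by rewrite ImM ReJ ImJ; ring.
  rewrite (eq_dRint (fun z _ => R1 z)) (eq_dRint (fun z _ => I1 z)) dRint0 mulr0.
  have E : dRint (fun z => modulus (derive1 (ebasis n) z) ^+ 2) = (if n is 0%N then 0 else pi).
    have [_ fin] := (dirichletP _).1 (ebasis_dirichlet n).
    have := ebasis_energy n; rewrite /energy.
    by rewrite (dintE (energy_dmeas (@ebasis_holomorphic n)) (fun z _ => sqr_ge0 _) fin) => -[].
  rewrite E; case: n {R1 I1 E} => [|n].
    rewrite mulr0 /ebasis /kap expr0 mulr1 -[rc 1]/(1 : cplane R).
    rewrite -[Complex 0 0]/(0 : cplane R) addr0 mul1r.
    by apply: eqC; rewrite ?ReJ ?ImJ/= ?oppr0.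
  by rewrite ebasis0// mul0r add0r mulVf ?gt_eqF ?pi_gt0//.
have zero H : (forall z, unit_disc z -> H z = 0) -> dRint H = 0.
  by move=> h; rewrite (eq_dRint h) dRint0.
have at0 : ebasis n 0 * conjc (ebasis m 0) = 0.
  case: n nm => [|n] nm; last by rewrite ebasis0// mul0r.
  case: m nm => [//|m] _; rewrite (@ebasis0 m.+1)//.
  by apply: eqC; rewrite ?ReM ?ImM ?ReJ ?ImJ/=; ring.
suff [-> ->] : dRint (fun z => complex.Re (derive1 (ebasis n) z * conjc (derive1 (ebasis m) z))) = 0 /\
   dRint (fun z => complex.Im (derive1 (ebasis n) z * conjc (derive1 (ebasis m) z))) = 0.
  rewrite at0 mulr0 add0r; exact: erefl.
have [mR mI] := dmeas_product (@ebasis_holomorphic n) (@ebasis_holomorphic m).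
case: n m nm {at0} mR mI => [|n] [|m] nm mR mI //.
- by split; apply: zero => z _; rewrite ebasis_derive1 mulr0 ?ReM ?ImM/=; ring.
- by split; apply: zero => z _; rewrite (ebasis_derive1 0) mulr0 ?ReM ?ImM ?ReJ ?ImJ ?ReM ?ImM/=; ring.
pose th : R := pi / (n%:R - m%:R).
have nm0 : n%:R - m%:R != 0 :> R by rewrite subr_eq0 eqr_nat; move: nm; rewrite eqSS.
pose u : cplane R := cis th.
have uu : u ^+ n * conjc (u ^+ m) = - 1 :> cplane R.
  rewrite /u !cisX -cisN -cisD.
  have -> : n%:R * th + - (m%:R * th) = pi by rewrite -mulrBl mulrC /th divfK.
  by rewrite /cis cospi sinpi; apply: eqC; rewrite ?ReN ?ImN/= ?oppr0.
have kE z : derive1 (ebasis n.+1) (u * z) * conjc (derive1 (ebasis m.+1) (u * z)) =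
    - (derive1 (ebasis n.+1) z * conjc (derive1 (ebasis m.+1) z)).
  rewrite !ebasis_derive1 [n.+1.-1]/= [m.+1.-1]/= !exprMn.
  have conjM (a b : cplane R) : conjc (a * b) = conjc a * conjc b :> cplane R.
    by apply: eqC; rewrite ?ReJ ?ImJ ?ReM ?ImM ?ReJ ?ImJ; ring.
  rewrite !conjM -mulN1r -uu; ring.
exact: (dRint_anti_cplane (mod_cis th) mR mI kE).
Qed.

(** Let [b] be the coefficient of [z ^ n] in [f'] and [P] a multiple of [z ^ n].
For every constant [c] the integral of [|f' - c P| ^ 2] is at least
[|b - c kp| ^ 2] times the moment of [z ^ n], by averaging over rotations; by
orthogonality it equals the integral of [|f'| ^ 2] plus [|c kp| ^ 2] times the
same moment. Taking [c] equal to [- l b / kp] with [l] large, the difference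
of the two quadratics is linear in [l], which forces [b = 0]. *)
Lemma orthogonal_taylor0 f n A : dirichlet f ->
  dirichlet_inner f (ebasis n.+1) = 0 ->
  (forall z, unit_disc z ->
    cint (fun t => f (cis t * z) * cis (- (n.+1%:R * t))) 0 (2 * pi) = A * z ^+ n.+1) ->
  A = 0.
Proof.
move=> df inn cA; have [hf fin] := (dirichletP f).1 df.
set kp := kap n.+1 * n.+1%:R.
have kp0 : 0 < kp by rewrite mulr_gt0// kap_gt0.
pose P z : cplane R := rc kp * z ^+ n.
have pp := @pi_gt0 R.
have [IR II] : dRint (fun z => complex.Re (derive1 f z * conjc (P z))) = 0 /\
    dRint (fun z => complex.Im (derive1 f z * conjc (P z))) = 0.
  move: inn; rewrite dirichlet_innerE ebasis0//.
  have -> : f 0 * conjc (0 : cplane R) = 0.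
    by apply: eqC; rewrite ?ReM ?ImM ?ReJ ?ImJ/=; ring.
  rewrite add0r => -[/eqP + /eqP].
  rewrite !mulf_eq0 invr_eq0 gt_eqF//= => /eqP h1 /eqP h2.
  by split; [rewrite -[RHS]h1|rewrite -[RHS]h2]; apply: eq_dRint => z _; rewrite ebasis_derive1.
pose b : cplane R := rc (n.+1%:R / (2 * pi)) * A.
have rcb : rc (2 * pi) * b = rc n.+1%:R * A.
  rewrite /b mulrA; congr (_ * _).
  have p2 : 2 * pi != 0 :> R by rewrite mulf_neq0// gt_eqF.
  by move: (2 * pi : R) p2 => q q0; apply: eqC; rewrite ?ReM ?ImM/=; field.
have np : cis (n.+1%:R * (2 * pi)) = 1 :> cplane R by rewrite -cisX cis2pi expr1n.
have coef z : unit_disc z ->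
    cint (fun t => derive1 f (cis t * z) * cis (- (n%:R * t))) 0 (2 * pi) = rc (2 * pi) * (b * z ^+ n).
  have nz y : unit_disc y -> y != 0 ->
    cint (fun t => derive1 f (cis t * y) * cis (- (n%:R * t))) 0 (2 * pi) = rc (2 * pi) * (b * y ^+ n).
    move=> yD y0.
    have := circle_dilate_parts hf yD y0 np; rewrite cA//.
    have -> : n.+1%:R - 1 = n%:R :> R by rewrite -natr1 addrK.
    move=> H; apply: (mulfI y0); rewrite H mulrA -rcb exprS; ring.
  move=> zD; have [->|z0] := eqVneq z 0; last exact: nz.
  case: n {kp kp0 P IR II inn cA np} b rcb nz => [|k] b rcb nz.
    pose h : cplane R := rc 2^-1.
    have h0 : h != 0 by rewrite -mod_gt0 mod_rc gtr0_norm ?invr_gt0.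
    have hD : unit_disc h.
      by rewrite /unit_disc/= mod_rc gtr0_norm ?invr_gt0// invf_lt1// ltr1n.
    rewrite expr0 mulr1 -[RHS](_ : rc (2 * pi) * (b * h ^+ 0) = _) ?expr0 ?mulr1//.
    have := nz h hD h0; rewrite expr0 mulr1 => E.
    have Z y : unit_disc y -> y != 0 -> cint (fun t => derive1 f (cis t * y)) 0 (2 * pi) = rc (2 * pi) * derive1 f 0.
      by move=> yD y0; exact: circle_mean_derive.
    have E2 : rc (2 * pi) * b = rc (2 * pi) * derive1 f 0.
      rewrite -E -(Z h hD h0); apply: eq_cint => t _.
      by rewrite mul0r oppr0 cis0 mulr1.
    rewrite E2 (eq_cint (g := fun=> derive1 f 0)); last first.
      by move=> t _; rewrite mulr0 mul0r oppr0 cis0 mulr1.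
    by rewrite cint_cst ?twopi_ge0// subr0 mulrC.
  rewrite expr0n/= mulr0 mulr0.
  rewrite (eq_cint (g := fun t => derive1 f 0 * cis (- k.+1%:R * t))); last first.
    by move=> t _; rewrite mulr0 mulNr.
  rewrite cintZ; last by apply: ccont_onP => t _; exact: (cder_cont (cder_cis (- k.+1%:R) t)).
  rewrite cint_cis; first exact: mulr0.
    by rewrite oppr_eq0 pnatr_eq0.
  by rewrite mulNr cisN -cisX cis2pi expr1n; apply: eqC; rewrite ?ReJ ?ImJ/= ?oppr0.
have cP c z : cderiv (fun w => - c * P w) z (- c * (rc kp * (n%:R * z ^+ n.-1))).
  have d := cderivM (cderiv_cst z (- c)) (cderivM (cderiv_cst z (rc kp)) (cderivX z n)).
  by apply: (cderiv_eq d); ring.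
pose D c z := derive1 f z + - c * P z.
have cD c z : unit_disc z -> D c w @[w --> z] --> D c z.
  move=> zD.
  exact: (@cvg_cplaneD R _ (nbhs z) (nbhs_filter z) _ _ _ _ (holomorphic_derive1_cvg hf zD) (cderiv_cvg (cP c z))).
have lower c : ((modulus (b - c * rc kp) ^+ 2 * (areaR / n.+1%:R))%:E <= dint (fun z => modulus (D c z) ^+ 2)%R)%E.
  have -> : (modulus (b - c * rc kp) ^+ 2 * (areaR / n.+1%:R))%:E =
      dint (fun z => modulus (b - c * rc kp) ^+ 2 * modulus (z ^+ n) ^+ 2).
    rewrite dintZ ?sqr_ge0//; [by rewrite moment EFinM|exact: monomial_dmeas|by move=> z _; exact: sqr_ge0].
  apply: dint_mean.
  - by move=> z zD; apply: (cvg_mod_sqr (f := D c)); exact: cD.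
  - by move=> z _; exact: sqr_ge0.
  - exact: (measurable_funM (cst_dmeas _) (monomial_dmeas n)).
  - by move=> z _; rewrite mulr_ge0 ?sqr_ge0.
  move=> z zD.
  rewrite -exprMn -modM.
  pose X t := derive1 f (cis t * z) * cis (- (n%:R * t)) + - c * rc kp * z ^+ n.
  have c1 : ccont_on 0 (2 * pi) (fun t => derive1 f (cis t * z) * cis (- (n%:R * t))).
    apply: ccont_onM; first exact: ccont_dilate.
    by apply: ccont_onP => t _; exact: (cder_cont (cder_cisN n%:R t)).
  have c2 := @ccont_on_cst R 0 (2 * pi) (- c * rc kp * z ^+ n).
  have XE : cint X 0 (2 * pi) = rc (2 * pi) * ((b - c * rc kp) * z ^+ n).
    rewrite (cintD c1 c2) coef// cint_cst ?twopi_ge0// subr0 -/(rc (2 * pi)); ring.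
  apply: (le_trans (mean_sq_ge (ccont_onD c1 c2) XE)).
  rewrite le_eqVlt; apply/orP; left; apply/eqP; apply: eq_rint => t _.
  have -> : D c (cis t * z) = (derive1 f (cis t * z) * cis (- (n%:R * t)) + - c * rc kp * z ^+ n) * cis (n%:R * t).
    rewrite /D /P exprMn cisX mulrDl -[_ * cis (- _) * _]mulrA cisNM; ring.
  by rewrite modM mod_cis mulr1.
pose N := fine (energy f).
have EN : energy f = N%:E := energy_fin df.
have EN1 : dint (fun z => modulus (derive1 f z) ^+ 2) = N%:E := EN.
have upper c : dint (fun z => modulus (D c z) ^+ 2) =
    (N + modulus c ^+ 2 * (kp ^+ 2 * (areaR / n.+1%:R)))%:E.
  have m1 := energy_dmeas hf.
  have mP : dmeas (fun z => modulus (c * P z) ^+ 2).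
    by have [_ _] := @dmeas_cplane R (fun z => c * P z) (fun z _ => cderiv_cvg
      (cderivM (cderiv_cst z c) (cderivM (cderiv_cst z (rc kp)) (cderivX z n)))).
  have s0 (h : cplane R -> cplane R) : nonneg_on (fun z => modulus (h z) ^+ 2).
    by move=> z _; exact: sqr_ge0.
  have EP : dint (fun z => modulus (c * P z) ^+ 2) = (modulus c ^+ 2 * (kp ^+ 2 * (areaR / n.+1%:R)))%:E.
    rewrite (eq_dint (G := fun z => (modulus c ^+ 2 * kp ^+ 2) * modulus (z ^+ n) ^+ 2)); last first.
      by move=> z _; rewrite /P !modM mod_rc gtr0_norm// !exprMn mulrA.
    rewrite dintZ; [|exact: monomial_dmeas|exact: s0|by rewrite mulr_ge0 ?sqr_ge0].
    by rewrite moment -EFinM; congr EFin; ring.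
  have finP : (dint (fun z => modulus (c * P z) ^+ 2)%R < +oo)%E by rewrite EP ltry.
  have mD : dmeas (fun z => modulus (D c z) ^+ 2) by have [_ _] := dmeas_cplane (cD c).
  pose k z := derive1 f z * conjc (P z).
  have Pd z : P z = derive1 (ebasis n.+1) z by rewrite ebasis_derive1.
  have [mR mI] : dmeas (fun z => complex.Re (k z)) /\ dmeas (fun z => complex.Im (k z)).
    have := dmeas_product hf (@ebasis_holomorphic n.+1); rewrite /k.
    by under [X in dmeas X /\ _]eq_fun do rewrite -Pd; under [X in _ /\ dmeas X]eq_fun do rewrite -Pd.
  pose B z := modulus (derive1 f z) ^+ 2 + modulus (derive1 (ebasis n.+1) z) ^+ 2.
  have mE := energy_dmeas (@ebasis_holomorphic n.+1).
  have mB : dmeas B := measurable_funD m1 mE.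
  have B0 : nonneg_on B by move=> z _; rewrite addr_ge0 ?sqr_ge0.
  have finB : (dint B < +oo)%E.
    have EB : dint (fun z => modulus (derive1 (ebasis n.+1) z) ^+ 2) = pi%:E := ebasis_energy n.+1.
    have -> : dint B = (N + pi)%:E := dintD_fin m1 mE (s0 (derive1 f)) (s0 (derive1 (ebasis n.+1))) EN1 EB.
    exact: ltry.
  have kB z : modulus (k z) <= B z.
    rewrite /k modM modJ Pd /B.
    exact: mul_le_sqr (mod_ge0 _) (mod_ge0 _).
  have iR := integrable_le mR mB B0 finB (fun z _ => le_trans (Re_le (k z)) (kB z)).
  have iI := integrable_le mI mB B0 finB (fun z _ => le_trans (Im_le (k z)) (kB z)).
  have i1 := dint_integrable m1 (s0 (derive1 f)) fin.
  have i2 := dint_integrable mP (s0 (fun z => c * P z)) finP.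
  have DE z : modulus (D c z) ^+ 2 = (modulus (derive1 f z) ^+ 2 + modulus (c * P z) ^+ 2) +
     (- 2 * complex.Re c * complex.Re (k z) + - 2 * complex.Im c * complex.Im (k z)).
    by rewrite /D /k !mod_sqr !(ReD, ImD, ReM, ImM, ReN, ImN, ReJ, ImJ); ring.
  have finD : (dint (fun z => modulus (D c z) ^+ 2)%R < +oo)%E.
    apply: (@le_lt_trans _ _ (dint (fun z => 2 * (modulus (derive1 f z) ^+ 2 + modulus (c * P z) ^+ 2))%R)).
      apply: (dint_le mD (measurable_funM (cst_dmeas 2) (measurable_funD m1 mP)) (s0 (D c))).
      move=> z _; have -> : D c z = derive1 f z - c * P z by rewrite /D mulNr.
      have h := modD (derive1 f z) (- (c * P z)); rewrite modN in h.
      exact: sqr_le_add (mod_ge0 _) h.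
    rewrite dintZ ?ler0n//; [|exact: (measurable_funD m1 mP)|by move=> z _; rewrite addr_ge0 ?sqr_ge0].
    rewrite (dintD_fin m1 mP (s0 (derive1 f)) (s0 (fun z => c * P z)) EN1 EP).
    rewrite -EFinM; exact: ltry.
  rewrite (dintE mD (s0 (D c)) finD); congr EFin.
  have EN' : dRint (fun z => modulus (derive1 f z) ^+ 2) = N by [].
  have EP' : dRint (fun z => modulus (c * P z) ^+ 2) = modulus c ^+ 2 * (kp ^+ 2 * (areaR / n.+1%:R)).
    by have := EP; rewrite (dintE mP (s0 (fun z => c * P z)) finP) => -[].
  rewrite (eq_dRint (fun z _ => DE z)).
  rewrite (dRintD (dintegrableD i1 i2) (dintegrableD (dintegrableZ _ iR) (dintegrableZ _ iI))).
  rewrite (dRintD i1 i2) (dRintD (dintegrableZ _ iR) (dintegrableZ _ iI)).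
  rewrite (dRintZ _ iR) (dRintZ _ iI).
  have -> := IR; have -> := II; have -> := EN'; have -> := EP'.
  by rewrite !mulr0 !addr0.
set m := areaR / n.+1%:R in lower upper.
have m0 : 0 < m by rewrite divr_gt0// areaR_gt0.
(* the constant [c = - l b / kp] cancels the quadratic terms in [l] *)
have key (l : R) : 0 < l -> modulus b ^+ 2 * m * (1 + 2 * l) <= N.
  move=> l0; have := lower (- rc (l / kp) * b); rewrite upper lee_fin.
  have -> : b - - rc (l / kp) * b * rc kp = rc (1 + l) * b.
    have k0 : kp != 0 by rewrite gt_eqF.
    have lq : l = (l / kp) * kp by rewrite divfK.
    rewrite [in RHS]lq; move: (l / kp) (kp) => q x.
    by apply: eqC; rewrite !(ReD, ImD, ReM, ImM, ReN, ImN)/=; ring.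
  have e1 (q : R) : modulus (rc q * b) ^+ 2 = q ^+ 2 * modulus b ^+ 2.
    by rewrite modM mod_rc exprMn real_normK ?num_real.
  rewrite mulNr modN !e1; move: (modulus b ^+ 2) (kp) kp0 => B x x0.
  have -> : (l / x) ^+ 2 * B * (x ^+ 2 * m) = l ^+ 2 * (B * m).
    by field; rewrite gt_eqF.
  have -> : (1 + l) ^+ 2 * B * m = B * m * (1 + 2 * l) + l ^+ 2 * (B * m) by ring.
  by rewrite lerD2r.
have b0 : b = 0.
  apply: mod_eq0; apply/eqP; rewrite -sqrf_eq0; apply/negPn/negP => bn.
  have bp : 0 < modulus b ^+ 2 * m by rewrite mulr_gt0// lt_def bn sqr_ge0.
  have N0 : 0 <= N by rewrite -lee_fin -EN energy_ge0.
  have := key ((N + 1) / (2 * (modulus b ^+ 2 * m))).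
  set q := modulus b ^+ 2 * m in bp *.
  have -> : q * (1 + 2 * ((N + 1) / (2 * q))) = q + N + 1 by field; rewrite gt_eqF.
  have l0 : 0 < (N + 1) / (2 * q) by rewrite divr_gt0// ?ltr_wpDl// mulr_gt0.
  by move=> /(_ l0); lra.
move: rcb; rewrite b0 mulr0 => /esym/eqP; rewrite mulf_eq0 => /orP[|/eqP//].
by rewrite -[_ == 0]negbK -mod_gt0 mod_rc normr_gt0 pnatr_eq0.
Qed.

End DirichletBasis.

(** * A Hilbert-Schmidt criterion for composition operators *)

Section HilbertSchmidt.
Context {R : realType}.
Implicit Types (F G H : cplane R -> R) (f g phi : cplane R -> cplane R) (u w z : cplane R).

Lemma unit_disc0 : unit_disc (0 : cplane R).
Proof. by rewrite /unit_disc/= mod0. Qed.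

Lemma ebasis_const : ebasis 0 = (fun=> 1) :> (cplane R -> cplane R).
Proof. by apply/funext => z; rewrite /ebasis /kap expr0 mulr1. Qed.

Lemma orthonormal_basis_ebasis : orthonormal_basis (@ebasis R).
Proof.
split; [exact: ebasis_dirichlet|exact: ebasis_orthonormal|].
move=> f df orth; have [hf _] := (dirichletP f).1 df.
have f0 : f 0 = 0.
  have := orth 0%N; rewrite dirichlet_innerE.
  have D z : derive1 (@ebasis R 0) z = 0 by rewrite ebasis_derive1 mulr0 mul0r.
  have p0 z : derive1 f z * conjc (derive1 (@ebasis R 0) z) = 0.
    rewrite D; have -> : conjc (0 : cplane R) = 0 :> cplane R.
      by apply: eqC; rewrite ?ReJ ?ImJ/= ?oppr0.
    by rewrite mulr0.
  rewrite (eq_dRint (G := fun=> 0)) ?(eq_dRint (H := fun z => complex.Im _) (G := fun=> 0)); last 2 first.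
  - by move=> z _; rewrite p0.
  - by move=> z _; rewrite p0.
  rewrite !dRint0 mulr0 -[Complex 0 0]/(0 : cplane R) addr0 ebasis_const.
  have -> : conjc (1 : cplane R) = 1 :> cplane R by apply: eqC; rewrite ?ReJ ?ImJ/= ?oppr0.
  by rewrite mulr1.
move=> z zD; rewrite (holomorphic_const hf _ zD)//.
move=> [//|n] r n0 rr; have [A [cA tA]] := taylor_coef n0 hf.
by rewrite cA// (orthogonal_taylor0 df (orth n.+1) tA) mulr0.
Qed.

Definition maps_disc phi := forall z, unit_disc z -> unit_disc (phi z).

Lemma cderiv_comp_disc f phi z : holomorphic f -> holomorphic phi -> maps_disc phi -> unit_disc z ->
  cderiv (f \o phi) z (derive1 f (phi z) * derive1 phi z).
Proof.
move=> hf hp pD zD.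
exact: (cderiv_comp (derivable_cderiv (hp _ zD)) (derivable_cderiv (hf _ (pD _ zD)))).
Qed.

Lemma holomorphic_comp f phi : holomorphic f -> holomorphic phi -> maps_disc phi -> holomorphic (f \o phi).
Proof. by move=> hf hp pD z zD; exact: (cderiv_derivable (cderiv_comp_disc hf hp pD zD)). Qed.

Lemma energy_comp f phi : holomorphic f -> holomorphic phi -> maps_disc phi ->
  energy (f \o phi) = dint (fun z => modulus (derive1 f (phi z)) ^+ 2 * modulus (derive1 phi z) ^+ 2).
Proof.
move=> hf hp pD; apply: eq_dint => z zD.
by rewrite (cderiv_derive1 (cderiv_comp_disc hf hp pD zD)) modM exprMn.
Qed.

Lemma sum_derivative_geometric (x : R) N :
  (1 - x) ^+ 2 * \sum_(n < N.+1) n%:R * x ^+ n.-1 = 1 - N.+1%:R * x ^+ N + N%:R * x ^+ N.+1.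
Proof.
elim: N => [|N IH]; first by rewrite big_ord_recr big_ord0/= !expr0; ring.
rewrite big_ord_recr mulrDr IH [N.+2%:R]mulrSr [(ord_max : nat)]/= [N.+1.-1]/= !exprS mulrSr.
ring.
Qed.

(** The telescoped derivative of the geometric series; it sums the energies of
the basis composed with a self-map of the disc. *)
Lemma sum_derivative_geometric_le (x : R) N : 0 <= x < 1 ->
  \sum_(n < N) n%:R * x ^+ n.-1 <= (1 - x) ^- 2.
Proof.
move=> /andP[x0 x1]; have p : 0 < (1 - x) ^+ 2 by rewrite exprn_gt0// subr_gt0.
case: N => [|N]; first by rewrite big_ord0 invr_ge0 ltW.
rewrite -(ler_pM2l p) mulfV ?gt_eqF// sum_derivative_geometric.
have : N%:R * x ^+ N.+1 <= N.+1%:R * x ^+ N.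
  apply: ler_pM; rewrite ?ler0n ?exprn_ge0 ?ler_nat//.
  by rewrite exprS ler_piMl ?exprn_ge0// ltW.
lra.
Qed.

(** Uses [1 - x ^ 2 <= 2 (1 - x)] to pass from the distance to the circle
to the hyperbolic weight. *)
Lemma bergman_transfer (a x d v e : R) : 0 < a -> 0 <= x -> x < 1 -> 0 <= d -> 0 <= v ->
  a * (1 - x) ^+ 2 * d <= e -> d * v <= 4 * e / a * (v * (1 - x ^+ 2) ^- 2).
Proof.
move=> a0 x0 x1 d0 v0 H.
have y0 : 0 < (1 - x ^+ 2) ^+ 2 by rewrite exprn_gt0// subr_gt0 expr_lt1.
rewrite [v * _]mulrC mulrA ler_wpM2r// ler_pdivlMr//.
rewrite -[4 * e / a]mulrC ler_pdivlMl//.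
have : (1 - x ^+ 2) ^+ 2 <= 4 * (1 - x) ^+ 2.
  have -> : (1 - x ^+ 2) ^+ 2 = (1 - x) ^+ 2 * (1 + x) ^+ 2 by ring.
  rewrite mulrC ler_wpM2r ?sqr_ge0//; nra.
move=> le; have := ler_wpM2l (mulr_ge0 (ltW a0) d0) le.
have -> : a * d * (4 * (1 - x) ^+ 2) = 4 * (a * (1 - x) ^+ 2 * d) by ring.
rewrite -mulrA; lra.
Qed.

Lemma bounded_transfer (q b e e' K : R) : 0 < q -> 0 <= b -> 0 <= e -> 0 <= K -> e' <= K * e ->
  b + q * e' <= (1 + K) * (b + q * e).
Proof.
move=> q0 b0 e0 K0 H.
have := mulr_ge0 K0 b0; have := mulr_ge0 (ltW q0) e0.
have : q * e' <= q * (K * e) by rewrite ler_pM2l.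
have -> : (1 + K) * (b + q * e) = b + q * e + K * b + q * (K * e) by ring.
lra.
Qed.

Section Criterion.
Variables (phi : cplane R -> cplane R) (Q : R).
Let W z : R := modulus (derive1 phi z) ^+ 2 * (1 - modulus (phi z) ^+ 2) ^- 2.
Hypotheses (hp : holomorphic phi) (pD : maps_disc phi) (p0 : phi 0 = 0)
  (mW : dmeas W) (WQ : (dint W <= Q%:E)%E).

Let W0 : nonneg_on W.
Proof. by move=> z _; rewrite mulr_ge0 ?sqr_ge0// invr_ge0 sqr_ge0. Qed.

Let Q0 : 0 <= Q.
Proof. by rewrite -lee_fin; exact: le_trans (dint_ge0 W0) WQ. Qed.

Let phi1 z : unit_disc z -> 0 <= modulus (phi z) ^+ 2 < 1.
Proof.
by move=> zD; rewrite sqr_ge0 expr_lt1 ?mod_ge0//; exact: (pD zD).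
Qed.

Let a0 := @areaR_gt0 R.

(** By the Bergman estimate [|f'(phi z)| ^ 2] is at most the energy of [f] times
[4 / (a (1 - |phi z| ^ 2) ^ 2)]. *)
Lemma energy_comp_le f : dirichlet f ->
  (energy (f \o phi) <= (4 * Q / areaR)%:E * energy f)%E.
Proof.
move=> df; have [hf ffin] := (dirichletP f).1 df.
rewrite energy_comp// (energy_fin df); set e := fine (energy f).
have e0 : 0 <= e by rewrite -lee_fin -energy_fin// energy_ge0.
have k0 : 0 <= 4 * e / areaR by rewrite divr_ge0 ?mulr_ge0// ltW.
apply: (@le_trans _ _ (dint (fun z => (4 * e / areaR) * W z))).
  apply: dint_le.
  - have hc := holomorphic_comp hf hp pD.
    have := energy_dmeas hc; apply: eq_measurable_fun => p; rewrite inE => pd.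
    by rewrite (cderiv_derive1 (cderiv_comp_disc hf hp pD pd)) modM exprMn.
  - exact: (measurable_funM (cst_dmeas _) mW).
  - by move=> z _; rewrite mulr_ge0 ?sqr_ge0.
  move=> z zD; have := bergman hf (pD zD).
  rewrite -/(energy f) (energy_fin df) -/e lee_fin /W => B.
  exact: (bergman_transfer a0 (mod_ge0 _) (pD zD) (sqr_ge0 _) (sqr_ge0 _) B).
rewrite dintZ//; apply: (@le_trans _ _ ((4 * e / areaR)%:E * Q%:E)%E).
  by apply: lee_wpmul2l; rewrite ?lee_fin.
rewrite -!EFinM lee_fin.
suff -> : 4 * Q / areaR * e = 4 * e / areaR * Q by [].
ring.
Qed.

Lemma comp_dirichlet f : dirichlet f -> dirichlet (f \o phi).
Proof.
move=> df; have [hf ffin] := (dirichletP f).1 df.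
apply/dirichletP; split; first exact: holomorphic_comp.
by apply: le_lt_trans (energy_comp_le df) _; rewrite (energy_fin df) -EFinM ltry.
Qed.

Lemma comp_bounded : bounded_operator (composition_operator phi).
Proof.
split; [exact: comp_dirichlet|by move=> a f g _ _ z _; exact: erefl|].
have k0 : 0 <= 4 * Q / areaR by rewrite divr_ge0 ?mulr_ge0// ltW.
exists (Num.sqrt (1 + 4 * Q / areaR)) => f df.
rewrite sqr_sqrtr ?addr_ge0//.
have H := energy_comp_le df; have [_ fc] := (dirichletP _).1 (comp_dirichlet df).
have e0 : 0 <= fine (energy f) by rewrite -lee_fin -energy_fin// energy_ge0.
have -> : dirichlet_norm2 (composition_operator phi f) =
    (modulus (f (phi 0)) ^+ 2 + pi^-1 * fine (energy (f \o phi)))%:E.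
  by rewrite /dirichlet_norm2 dirichlet_integralE (energy_fin (comp_dirichlet df)).
have -> : dirichlet_norm2 f = (modulus (f 0) ^+ 2 + pi^-1 * fine (energy f))%:E.
  by rewrite /dirichlet_norm2 dirichlet_integralE [in LHS](energy_fin df).
rewrite (energy_fin df) (energy_fin (comp_dirichlet df)) -EFinM lee_fin in H.
rewrite p0 -EFinM lee_fin; exact: (bounded_transfer piV_gt0 (sqr_ge0 _) e0 k0 H).
Qed.

Let T n z : R := modulus (phi z) ^+ 2 ^+ n.-1 * modulus (derive1 phi z) ^+ 2.

Let T0 n : nonneg_on (T n).
Proof. by move=> z _; apply: mulr_ge0; [exact: (exprn_ge0 _ (sqr_ge0 _))|exact: sqr_ge0]. Qed.

Let mT n : dmeas (T n).
Proof.
have mc := energy_dmeas hp.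
have [_ _ m2] := dmeas_cplane (fun z zD => cderiv_cvg (derivable_cderiv (hp zD))).
apply: (measurable_funM _ mc).
exact: (measurable_funX n.-1 m2).
Qed.

Lemma norm2_ebasis_comp n : dirichlet_norm2 (ebasis n \o phi) =
  ((n == 0%N)%:R%:E + (areaR^-1)%:E * dint (fun z => n%:R * T n z)%R)%E.
Proof.
have -> : dirichlet_norm2 (ebasis n \o phi) =
    ((modulus (ebasis n (phi 0)) ^+ 2)%:E + pi^-1%:E * energy (ebasis n \o phi))%E by [].
rewrite p0 (energy_comp (@ebasis_holomorphic R n) hp pD).
rewrite (eq_dint (G := fun z => (kap n * n%:R) ^+ 2 * T n z)); last first.
  move=> z _; rewrite ebasis_derive1 modM mod_rc exprMn real_normK ?num_real//.
  by rewrite modX /T -!exprM [(_ * 2)%N]mulnC mulrA.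
rewrite (dintZ (mT n) (@T0 n) (sqr_ge0 _)) (dintZ (mT n) (@T0 n) (ler0n _ n)); case: n => [|n].
  by rewrite mulr0 expr0n !mul0e !mule0 ebasis_const mod1 expr1n.
rewrite ebasis0// mod0 expr0n/= !add0e !muleA -!EFinM; congr (_%:E * _)%E.
rewrite -/(kap n.+1) exprMn kap_sqr//.
have := @pi_gt0 R; move: (pi : R) (n.+1%:R : R) (areaR : R) a0 (ltr0Sn R n) => p x a ap.
by move=> x0 pp; field; rewrite !gt_eqF.
Qed.

Lemma sum_norm2_ebasis_comp N :
  (\sum_(n < N) dirichlet_norm2 (ebasis n \o phi) <= (1 + Q / areaR)%:E)%E.
Proof.
have nn n : nonneg_on (fun z => n%:R * T n z).
  by move=> z zD; apply: mulr_ge0; [exact: ler0n|exact: T0].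
have mS n : dmeas (fun z => n%:R * T n z) by exact: (measurable_funM (cst_dmeas _) (mT n)).
have S M : dmeas (fun z => \sum_(n < M) n%:R * T n z) /\
  (\sum_(n < M) dint (fun z => (n%:R * T n z)%R) = dint (fun z => (\sum_(n < M) n%:R * T n z)%R))%E.
  elim: M => [|M [m1 m2]].
    split; first by under eq_fun do rewrite big_ord0; exact: (cst_dmeas 0).
    rewrite big_ord0 (eq_dint (G := fun=> 0)); last by move=> z _; rewrite big_ord0.
    by rewrite /dint integral0.
  have E : (fun z => \sum_(n < M.+1) n%:R * T n z) = (fun z => \sum_(n < M) n%:R * T n z + M%:R * T M z).
    by apply/funext => z; rewrite big_ord_recr.
  rewrite big_ord_recr/= m2 E; split; first exact: (measurable_funD m1 (mS M)).
  by rewrite dintD// => z zD; apply: sumr_ge0 => i _; exact: (nn i).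
under eq_bigr do rewrite norm2_ebasis_comp.
rewrite big_split/= EFinD; apply: leeD.
  rewrite sumEFin lee_fin; case: N => [|N]; first by rewrite big_ord0.
  rewrite big_ord_recl/= big1 ?addr0//.
rewrite -ge0_sume_distrr; last by move=> n _; exact: dint_ge0.
rewrite (S N).2 [Q / _]mulrC EFinM; apply: lee_wpmul2l; first by rewrite lee_fin invr_ge0 ltW.
apply: le_trans WQ; apply: dint_le => //; first exact: (S N).1.
  by move=> z zD; apply: sumr_ge0 => i _; exact: (nn i).
move=> z zD; rewrite /W.
under eq_bigr do rewrite /T mulrA.
rewrite -mulr_suml mulrC ler_wpM2l ?sqr_ge0//.
exact: sum_derivative_geometric_le (phi1 zD).
Qed.

(** The sum over [n] of [n |phi| ^ (2 n - 2) |phi'| ^ 2] is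
[|phi'| ^ 2 / (1 - |phi| ^ 2) ^ 2], so the sum of the squared norms of the
images of the basis is controlled by the integral of the weight [W]. *)
Lemma comp_hilbert_schmidt : hilbert_schmidt (composition_operator phi).
Proof.
split; first exact: comp_bounded.
exists (@ebasis R); first exact: orthonormal_basis_ebasis.
apply: (@le_lt_trans _ _ (1 + Q / areaR)%:E); last exact: ltry.
apply: lime_le.
  apply: is_cvg_nneseries => n _ _.
  by rewrite /dirichlet_norm2 adde_ge0 ?lee_fin ?sqr_ge0// mule_ge0 ?energy_ge0// lee_fin ltW ?piV_gt0.
by apply: nearW => N; rewrite big_mkord; exact: sum_norm2_ebasis_comp.
Qed.

End Criterion.
End HilbertSchmidt.

(** * The logarithmic kernel and its smoothing along an arc *)

Section Kernel.
Context {R : realType}.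
Implicit Types (u w z c : cplane R) (eta s t r d : R) (n M p : nat).

Lemma rcM (a b : R) : rc (a * b) = rc a * rc b.
Proof. by apply: eqC; rewrite ?ReM ?ImM/=; ring. Qed.

Lemma rcD (a b : R) : rc (a + b) = rc a + rc b.
Proof. by apply: eqC; rewrite ?ReD ?ImD/= ?addr0. Qed.

Lemma rcN (a : R) : rc (- a) = - rc a.
Proof. by apply: eqC; rewrite ?ReN ?ImN/= ?oppr0. Qed.

Lemma rc_nat n : rc (n%:R : R) = n%:R.
Proof. by elim: n => [//|n IH]; rewrite -natr1 rcD IH -natr1. Qed.

Lemma rcV (a : R) : a != 0 -> rc a^-1 * rc a = 1.
Proof. by move=> a0; rewrite -rcM mulVf. Qed.

Lemma Re_rcM (a : R) z : complex.Re (rc a * z) = a * complex.Re z.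
Proof. by rewrite ReM/= mul0r subr0. Qed.

Lemma Im_rcM (a : R) z : complex.Im (rc a * z) = a * complex.Im z.
Proof. by rewrite ImM/= mul0r addr0. Qed.

Lemma mod_rcM (a : R) z : 0 <= a -> modulus (rc a * z) = a * modulus z.
Proof. by move=> a0; rewrite modM mod_rc ger0_norm. Qed.

Lemma mod_cisM t z : modulus (cis t * z) = modulus z.
Proof. by rewrite modM mod_cis mul1r. Qed.

Lemma cis_sub1 t : modulus (cis t - 1) <= 2 * `|t|.
Proof.
wlog t0 : t / 0 <= t => [H|].
  have [/H//|/ltW t0] := leP 0 t.
  have := H (- t); rewrite oppr_ge0 normrN => /(_ t0); apply: le_trans.
  rewrite cisN -[X in X <= _]modJ le_eqVlt; apply/orP; left; apply/eqP; congr modulus.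
  by apply: eqC; rewrite ?(ReJ, ImJ, ReD, ImD, ReN, ImN)/= ?(ReJ, ImJ, ReD, ImD, ReN, ImN)/=; ring.
have := @cder_MVT R (fun x => cis (1 * x)) (fun x => rc 1 * ii * cis (1 * x)) 0 t 0 1 t0.
rewrite mulr0 cis0 mul1r mul0r !subr0 mulr1 ger0_norm//; apply.
  by move=> x _; exact: cder_cis.
by move=> x _; rewrite subr0 !modM mod_rc mod_ii mod_cis normr1 !mul1r.
Qed.

Lemma ccont_cis (k : R) a b : ccont_on a b (fun v => cis (k * v)).
Proof. by apply: ccont_onP => t _; exact: (cder_cont (cder_cis k t)). Qed.

(** The [n]-th Fourier coefficient of the uniform measure on the arc
[{ e^{iv} : 0 <= v <= eta }]. *)
Definition arc_coef eta n : cplane R := cint (fun v => cis (- (n%:R * eta) * v)) 0 1.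
Definition arc_weight eta n : R := modulus (arc_coef eta n) ^+ 2.

Lemma arc_weight_ge0 eta n : 0 <= arc_weight eta n.
Proof. exact: sqr_ge0. Qed.

Lemma arc_weight_le4 eta n : arc_weight eta n <= 4.
Proof.
have : modulus (arc_coef eta n) <= 2 * 1 * (1 - 0).
  by apply: cint_bound => //; [exact: ccont_cis|move=> x _; rewrite mod_cis].
have := mod_ge0 (arc_coef eta n); rewrite /arc_weight; nra.
Qed.

Lemma arc_weight_decay eta n : 0 < eta -> (0 < n)%N -> arc_weight eta n <= 4 / (n%:R * eta) ^+ 2.
Proof.
move=> e0 n0; set k := n%:R * eta.
have k0 : 0 < k by rewrite mulr_gt0 ?ltr0n.
have E : rc (- k) * ii * arc_coef eta n = cis (- k) - 1.
  rewrite /arc_coef -cintZ; last exact: ccont_cis.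
  rewrite (@cint_FTC R (fun v => cis (- k * v))) ?mulr1 ?mulr0 ?cis0//.
    by apply: ccont_onM; [exact: ccont_on_cst|exact: ccont_cis].
  by move=> x _; exact: cder_cis.
have : k * modulus (arc_coef eta n) <= 2.
  have <- : modulus (rc (- k) * ii * arc_coef eta n) = k * modulus (arc_coef eta n).
    by rewrite !modM mod_ii mulr1 mod_rc normrN gtr0_norm.
  rewrite E; apply: le_trans (modD _ _) _; rewrite modN mod_cis mod1; lra.
rewrite ler_pdivlMr ?exprn_gt0// /arc_weight -exprMn mulrC => h.
have := mulr_ge0 (ltW k0) (mod_ge0 (arc_coef eta n)); rewrite mulrC; move: (modulus (arc_coef eta n) * k) h => y; nra.
Qed.

Lemma arc_weight_near1 eta n : 0 <= eta -> 1 - 8 * (n%:R * eta) <= arc_weight eta n.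
Proof.
move=> e0; set k := n%:R * eta; have k0 : 0 <= k by rewrite mulr_ge0.
have C := ccont_cis (- k) 0 1.
have : modulus (arc_coef eta n - 1) <= 2 * (2 * k) * (1 - 0).
  have -> : arc_coef eta n - 1 = cint (fun v => cis (- k * v) + - 1) 0 1.
    by rewrite (cintD C (ccont_on_cst 0 1 _)) cint_cst// subr0 mulr1.
  apply: cint_bound => //; first exact: (ccont_onD C (ccont_on_cst 0 1 _)).
  move=> x /andP[x0 x1]; apply: le_trans (cis_sub1 _) _.
  by rewrite ler_pM2l// normrM normrN (ger0_norm k0) (ger0_norm x0) ler_piMr.
have : 1 <= modulus (arc_coef eta n) + modulus (arc_coef eta n - 1).
  have := modD (arc_coef eta n) (1 - arc_coef eta n).
  by rewrite [arc_coef _ _ + _]addrC subrK mod1 [modulus (1 - _)]modB.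
rewrite subr0 mulr1 /arc_weight; have := mod_ge0 (arc_coef eta n).
move: (modulus (arc_coef eta n)) (modulus _) => x y x0 h1 h2; nra.
Qed.

Lemma sum_inv_sqr p M : (0 < p)%N -> (p <= M)%N ->
  \sum_(p <= i < M) (i.+1%:R ^+ 2)^-1 <= p%:R^-1 - M%:R^-1 :> R.
Proof.
move=> p0; elim: M => [|M IH]; first by rewrite leqn0 => /eqP pM; rewrite pM in p0.
rewrite leq_eqVlt => /orP[/eqP <-|]; first by rewrite big_geq// subrr.
rewrite ltnS => pM; rewrite big_nat_recr//=.
apply: le_trans (lerD (IH pM) (lexx _)) _; rewrite -addrA lerD2l.
have M0 : 0 < M%:R :> R by rewrite ltr0n (leq_trans p0).
rewrite -natr1; move: (M%:R : R) M0 => x x0.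
have x1 : 0 < x + 1 by lra.
have -> : - x^-1 + ((x + 1) ^+ 2)^-1 = - (x + 1)^-1 - (x * (x + 1) ^+ 2)^-1.
  by field; rewrite !gt_eqF.
by rewrite lerBlDr lerDl invr_ge0 mulr_ge0 ?exprn_ge0// ltW.
Qed.

(** The weights are bounded and decay like [(p / n) ^ 2], so only about [p] of
them count. This makes the smoothed kernel Lipschitz with constant [8 p]. *)
Lemma sum_arc_weight p M : (0 < p)%N -> \sum_(i < M) arc_weight p%:R^-1 i.+1 <= 8 * p%:R.
Proof.
move=> p0; have pp : 0 < p%:R :> R by rewrite ltr0n.
have [Mp|/ltnW pM] := leqP M p.
  apply: (@le_trans _ _ (\sum_(i < M) 4)); first by apply: ler_sum => i _; exact: arc_weight_le4.
  rewrite sumr_const card_ord -mulr_natr.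
  have : M%:R <= p%:R :> R by rewrite ler_nat.
  lra.
rewrite -(big_mkord xpredT (fun i => arc_weight p%:R^-1 i.+1)) (@big_cat_nat _ _ _ p 0 M)//=.
have -> : 8 * p%:R = 4 * p%:R + 4 * p%:R :> R by ring.
apply: lerD.
  apply: (@le_trans _ _ (\sum_(0 <= i < p) 4)); first by apply: ler_sum => i _; exact: arc_weight_le4.
  by rewrite big_mkord sumr_const card_ord mulr_natr.
apply: (@le_trans _ _ (\sum_(p <= i < M) 4 * p%:R ^+ 2 * (i.+1%:R ^+ 2)^-1)).
  apply: ler_sum => i _; apply: le_trans (arc_weight_decay _ _) _ => //; first by rewrite invr_gt0.
  have i0 : 0 < i.+1%:R :> R by rewrite ltr0n.
  rewrite le_eqVlt; apply/orP; left; apply/eqP.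
  by move: (i.+1%:R : R) (p%:R : R) i0 pp => x y x0 y0; field; rewrite !gt_eqF.
rewrite -mulr_sumr; apply: le_trans (ler_wpM2l _ (sum_inv_sqr p0 pM)) _.
  by rewrite mulr_ge0// sqr_ge0.
have : 0 <= M%:R^-1 :> R by rewrite invr_ge0.
have -> : 4 * p%:R = 4 * p%:R ^+ 2 * p%:R^-1 :> R by field; rewrite gt_eqF.
by move=> h; rewrite ler_wpM2l ?mulr_ge0 ?sqr_ge0// lerBlDr lerDl.
Qed.

(** The partial sums of [- log (1 - z)]. Using polynomials throughout avoids
boundary values of power series; [arc_poly] is the same sum damped by the
arc weights. *)
Definition log_poly M z : cplane R := \sum_(i < M) rc (i.+1%:R^-1) * z ^+ i.+1.
Definition arc_poly eta M z : cplane R :=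
  \sum_(i < M) rc (arc_weight eta i.+1 / i.+1%:R) * z ^+ i.+1.

(** The derivative of [log_poly M] is a geometric sum, so the product telescopes
to a single term of order [M]. This stands in for the identity
[(1 - u) exp (- log (1 - u)) = 1]. *)
Lemma cder_log_poly M u t :
  cder (fun t => (1 - rc t * u) * cexp (log_poly M (rc t * u))) t
    (- u * (rc t * u) ^+ M * cexp (log_poly M (rc t * u))).
Proof.
have l : cder (fun t => rc t * u) t u.
  have := cder_line 0 u t; under eq_fun do rewrite add0r; exact.
have pw n : cderiv (fun w => rc (n.+1%:R^-1) * w ^+ n.+1) (rc t * u) ((rc t * u) ^+ n).
  have d := cderivM (cderiv_cst (rc t * u) (rc n.+1%:R^-1)) (cderivX (rc t * u) n.+1).
  apply: (cderiv_eq d); rewrite mul0r add0r mulrA -(rc_nat n.+1) rcV ?mul1r//.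
have sm : cder (fun t => log_poly M (rc t * u)) t (\sum_(i < M) (rc t * u) ^+ i * u).
  by apply: cder_sum => i; exact: (cder_comp l (pw i)).
have sub : cder (fun t => 1 - rc t * u) t (0 + - u).
  apply: cderD; first exact: cder_cst.
  have := cderM (cder_cst (-1) t) l; rewrite mulr0 addr0 mulN1r.
  by under eq_fun do rewrite mulN1r.
apply: (cder_eq (cderM sub (cder_cexp sm))).
rewrite -mulr_suml; have := subrX1 (rc t * u) M.
set v := rc t * u; set S := \sum_(i < M) _; set e := cexp _ => g.
have -> : v ^+ M = 1 + (v - 1) * S by rewrite -g addrC subrK.
ring.
Qed.

Lemma mod_cexp_le z : modulus (cexp z) <= expR (modulus z).
Proof. by rewrite mod_cexp ler_expR; apply: le_trans (Re_le z); exact: ler_norm. Qed.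

Lemma geo_sum_le r M : 0 <= r < 1 -> \sum_(i < M) r ^+ i <= (1 - r)^-1.
Proof.
move=> /andP[r0 r1]; have p : 0 < 1 - r by rewrite subr_gt0.
rewrite -[leRHS]mul1r ler_pdivlMr// mulrC.
have := subrX1 r M; have := exprn_ge0 M r0; lra.
Qed.

Lemma mod_log_poly_le r M z : 0 <= r < 1 -> modulus z <= r -> modulus (log_poly M z) <= (1 - r)^-1.
Proof.
move=> rr zr; have /andP[r0 r1] := rr; apply: le_trans (geo_sum_le M rr).
apply: le_trans (mod_sum _ _ _) _; apply: ler_sum => i _.
rewrite mod_rcM ?invr_ge0// modX.
apply: (@le_trans _ _ (1 * r ^+ i.+1)).
  apply: ler_pM; rewrite ?invr_ge0 ?exprn_ge0 ?mod_ge0//.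
    by rewrite invf_le1 ?ltr0n// ler1n.
  by rewrite lerXn2r ?nnegrE ?mod_ge0.
by rewrite mul1r exprS ler_piMl ?exprn_ge0// ltW.
Qed.

(** Integrating [cder_log_poly] along the ray from 0 to [u]; the term
[(t u) ^ M] is uniformly small on [|u| <= r]. *)
Lemma exp_log_poly r e : 0 <= r < 1 -> 0 < e -> exists M0, forall M u, (M0 <= M)%N ->
  modulus u <= r -> forall t, 0 <= t <= 1 ->
  modulus ((1 - rc t * u) * cexp (log_poly M (rc t * u)) - 1) <= e.
Proof.
move=> rr e0; have /andP[r0 r1] := rr; set K := expR (1 - r)^-1.
have K0 : 0 < K := expR_gt0 _.
have cv : r ^+ n @[n --> \oo] --> (0 : R).
  by apply: cvg_expr; rewrite ger0_norm.
have ek : 0 < e / (2 * K) by rewrite divr_gt0// mulr_gt0.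
have [M0 _ HM] : \forall n \near \oo, `|0 - r ^+ n| < e / (2 * K).
  by move/cvgr_dist_lt : cv; exact.
exists M0 => M u MM ur t /andP[t0 t1].
have := @cder_MVT R (fun x => (1 - rc x * u) * cexp (log_poly M (rc x * u)))
  (fun x => - u * (rc x * u) ^+ M * cexp (log_poly M (rc x * u))) 0 t 0 (r ^+ M * K) t0.
rewrite mul0r !subr0.
have -> : log_poly M 0 = 0 by rewrite /log_poly big1// => i _; rewrite expr0n/= mulr0.
rewrite cexp0 mul1r mul0r subr0.
move=> H; apply: le_trans (H _ _) _.
- by move=> x _; exact: cder_log_poly.
- move=> x /andP[x0 xt]; rewrite subr0 !modM modN modX.
  have xu : modulus (rc x * u) <= r.
    by rewrite mod_rcM// (le_trans _ ur)// ler_piMl ?mod_ge0// (le_trans xt).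
  rewrite -[X in _ <= X * _]mul1r; apply: ler_pM; rewrite ?mulr_ge0 ?exprn_ge0 ?mod_ge0//.
    apply: ler_pM; rewrite ?exprn_ge0 ?mod_ge0//; first by rewrite (le_trans ur)// ltW.
    by rewrite lerXn2r ?nnegrE ?mod_ge0.
  apply: le_trans (mod_cexp_le _) _; rewrite ler_expR; exact: mod_log_poly_le.
have := HM M MM; rewrite sub0r normrN ger0_norm ?exprn_ge0// => h.
have : r ^+ M * K <= e / 2.
  have h2 : e / (2 * K) * K = e / 2 by field; rewrite gt_eqF.
  by rewrite -h2 ler_pM2r// ltW.
have := mulr_ge0 (exprn_ge0 M r0) (ltW K0); move: (r ^+ M * K) => y; nra.
Qed.

(** The values of [f] start at 0 and cannot cross [pi / 2] or [- pi / 2], where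
the cosine vanishes. *)
Lemma cos_pos_bound (f : R -> R) : {within `[0, 1], continuous f} -> f 0 = 0 ->
  (forall t, 0 <= t <= 1 -> 0 < cos (f t)) -> `|f 1| <= pi / 2.
Proof.
move=> cf f0 cp; rewrite leNgt; apply/negP => H.
have p0 := @pi_gt0 R.
have [t tt ft] : exists2 t, 0 <= t <= 1 & cos (f t) = 0.
  have [f1|f1] := leP 0 (f 1).
    rewrite ger0_norm// in H.
    have [|t] := @IVT R f 0 1 (pi / 2) ler01 cf.
      by rewrite f0 (min_idPl f1) (max_idPr f1) (ltW H) divr_ge0// ltW.
    by rewrite in_itv/= => tt ft; exists t => //; rewrite ft cos_pihalf.
  rewrite ltr0_norm// in H.
  have [|t] := @IVT R f 0 1 (- (pi / 2)) ler01 cf.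
    have f1' := ltW f1; rewrite f0 (min_idPr f1') (max_idPl f1').
    by rewrite oppr_le0 divr_ge0 ?(ltW p0)// andbT lerNr ltW.
  by rewrite in_itv/= => tt ft; exists t => //; rewrite ft cosN cos_pihalf.
by have := cp t tt; rewrite ft ltxx.
Qed.

(** On [|u| <= r], [(1 - u) exp (log_poly M u)] is close to 1. Its modulus
bounds the real part of [log_poly M u]. For the imaginary part, along the ray
the exponential is close to [1 / (1 - t u)], which has positive real part, so
the cosine of the imaginary part stays positive. *)
Lemma log_poly_bounds r : 0 <= r < 1 -> exists M0, forall M u, (M0 <= M)%N -> modulus u <= r ->
  [/\ - 2 <= complex.Re (log_poly M u), complex.Re (log_poly M u) <= 2 / modulus (1 - u) &
      `|complex.Im (log_poly M u)| <= 2].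
Proof.
move=> rr; have /andP[r0 r1] := rr.
(* small compared with the distance [1 - r] from the disc of radius [r] to 1 *)
have e0 : 0 < (1 - r) / 4 by rewrite divr_gt0// subr_gt0.
have [M0 HM] := exp_log_poly rr e0; exists M0 => M u MM ur.
have H := HM M u MM ur.
have one : rc 1 * u = u by exact: mul1r.
have d1 : 1 - r <= modulus (1 - u).
  have := modD (1 - u) u; rewrite subrK mod1; lra.
have d0 : 0 < modulus (1 - u) by apply: lt_le_trans d1; rewrite subr_gt0.
have d2 : modulus (1 - u) <= 2.
  have := modD 1 (- u); rewrite mod1 modN; lra.
have t1 : 0 <= (1 : R) <= 1 by rewrite ler01 lexx.
have := H 1 t1; rewrite one => H1.
have E : modulus (1 - u) * expR (complex.Re (log_poly M u)) =
    modulus ((1 - u) * cexp (log_poly M u)) by rewrite modM mod_cexp.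
have lo : 1 / 2 <= modulus (1 - u) * expR (complex.Re (log_poly M u)).
  rewrite E; have := modD ((1 - u) * cexp (log_poly M u)) (1 - (1 - u) * cexp (log_poly M u)).
  rewrite [_ + (1 - _)]addrC subrK mod1 [modulus (1 - _ * _)]modB; lra.
have hi : modulus (1 - u) * expR (complex.Re (log_poly M u)) <= 2.
  rewrite E; have := modD ((1 - u) * cexp (log_poly M u) - 1) 1.
  rewrite subrK mod1; lra.
split.
- rewrite leNgt; apply/negP => h.
  have e2 : expR (complex.Re (log_poly M u)) < expR (- 2) by rewrite ltr_expR.
  have e3 : expR (-2) * expR 2 = 1 :> R by rewrite -expRD addNr expR0.
  have e4 : 4 <= expR 2 :> R.
    have -> : 2 = 1 + 1 :> R by ring.
    rewrite expRD; have := @expR_ge1Dx R 1; nra.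
  have := expR_gt0 (complex.Re (log_poly M u)); have := expR_gt0 (-2 : R).
  move: (expR (complex.Re _)) (expR (-2)) (expR 2) e2 e3 e4 lo => x y q; nra.
- rewrite ler_pdivlMr// mulrC; apply: le_trans hi; rewrite ler_pM2l//.
  by apply: le_trans (expR_ge1Dx _); rewrite lerDr.
- have cf : {within `[0, 1], continuous (fun t => complex.Im (log_poly M (rc t * u)))}.
    apply: continuous_subspaceT => t.
    have l : cder (fun t => rc t * u) t u.
      have := cder_line 0 u t; under eq_fun do rewrite add0r; exact.
    have sm : cder (fun t => log_poly M (rc t * u)) t
        (\sum_(i < M) (rc i.+1%:R^-1 * (i.+1%:R * (rc t * u) ^+ i) * u)).
      apply: cder_sum => i.
      have d := cderivM (cderiv_cst (rc t * u) (rc i.+1%:R^-1)) (cderivX (rc t * u) i.+1).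
      apply: (cder_eq (cder_comp l d)); rewrite mul0r add0r//.
    exact: (cvg_Im (cder_cont sm)).
  have := cos_pos_bound cf.
  rewrite one => /(_ _ _)/le_trans; apply.
  + rewrite [rc 0 * u](mul0r u) /log_poly big1// => i _; rewrite expr0n/= mulr0//.
  + move=> t tt; have := H t tt; have /andP[t0 tle] := tt.
    set v := rc t * u; set ell := log_poly M v.
    have vr : modulus v <= r.
      by rewrite mod_rcM// (le_trans _ ur)// ler_piMl ?mod_ge0.
    move=> h; set F := (1 - v) * cexp ell in h.
    have key : (1 - complex.Re v - (1 - r) / 4 * 2) <= complex.Re (F * conjc (1 - v)).
      have -> : F * conjc (1 - v) = conjc (1 - v) + (F - 1) * conjc (1 - v) by ring.
      rewrite ReD ReJ ReD ReN/=.
      have := Re_le ((F - 1) * conjc (1 - v)); rewrite ler_norml => /andP[+ _].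
      rewrite modM modJ.
      have : modulus (F - 1) * modulus (1 - v) <= (1 - r) / 4 * 2.
        apply: ler_pM; rewrite ?mod_ge0//.
        have := modD 1 (- v); rewrite mod1 modN; lra.
      move: (modulus (F - 1) * _) (complex.Re ((F - 1) * _)) => x y; lra.
    have E2 : complex.Re (F * conjc (1 - v)) = modulus (1 - v) ^+ 2 * (expR (complex.Re ell) * cos (complex.Im ell)).
      by rewrite mod_sqr /F /cexp !(ReM, ImM, ReJ, ImJ, ReD, ImD, ReN, ImN)/=; ring.
    have pos : 0 < complex.Re (F * conjc (1 - v)).
      apply: lt_le_trans key.
      have := le_trans (le_trans (ler_norm _) (Re_le v)) vr.
      move: (complex.Re v) (r1); clear => x; lra.
    move: pos; rewrite E2; have := expR_gt0 (complex.Re ell); have := sqr_ge0 (modulus (1 - v)).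
    move: (modulus (1 - v) ^+ 2) (expR _) (cos _) => x y q x0 y0 h2.
    have {}x0 : 0 < x by rewrite lt_def x0 andbT; apply/negP => /eqP x00; move: h2; rewrite x00 mul0r ltxx.
    by rewrite (pmulr_rgt0 _ x0) (pmulr_rgt0 _ y0) in h2.
  + apply: ltW; exact: pihalf_lt2.
Qed.

End Kernel.

(** * Bounds for the smoothed kernel *)

Section Averaging.
Context {R : realType}.
Implicit Types (u w z c : cplane R) (eta s t r d : R) (n M p : nat).

Definition power_poly (b : nat -> cplane R) M z : cplane R := \sum_(i < M) b i * z ^+ i.+1.

Lemma cint_conj (f : R -> cplane R) a b : ccont_on a b f ->
  cint (fun v => conjc (f v)) a b = conjc (cint f a b).
Proof.
move=> [_ fi]; apply: eqC; rewrite ?ReJ ?ImJ/=.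
  by apply: eq_rint => x _; rewrite ReJ.
by rewrite -rintN//; apply: eq_rint => x _; rewrite ImJ.
Qed.

(** Averaging over an arc of rotations multiplies the [n]-th coefficient by the
[n]-th Fourier coefficient of the arc. *)
Lemma power_poly_average b (k : R) M z :
  ccont_on 0 1 (fun v => power_poly b M (cis (k * v) * z)) /\
  cint (fun v => power_poly b M (cis (k * v) * z)) 0 1 =
  power_poly (fun i => b i * cint (fun v => cis (i.+1%:R * k * v)) 0 1) M z.
Proof.
elim: M => [|M [c1 IH]].
  have E : (fun v => power_poly b 0 (cis (k * v) * z)) = (fun=> 0).
    by apply/funext => v; rewrite /power_poly big_ord0.
  rewrite E; split; first exact: ccont_on_cst.
  by rewrite cint_cst// mul0r /power_poly big_ord0.
have E : (fun v => power_poly b M.+1 (cis (k * v) * z)) =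
   (fun v => power_poly b M (cis (k * v) * z) + (b M * z ^+ M.+1) * cis (M.+1%:R * k * v)).
  apply/funext => v; rewrite /power_poly big_ord_recr; congr (_ + _).
  rewrite [(ord_max : nat)]/= exprMn.
  have -> : cis (k * v) ^+ M.+1 = cis (M.+1%:R * k * v) by rewrite cisX mulrA.
  ring.
have c2 : ccont_on 0 1 (fun v => (b M * z ^+ M.+1) * cis (M.+1%:R * k * v)).
  exact: (ccont_onM (ccont_on_cst 0 1 _) (ccont_cis _ 0 1)).
rewrite E; split; first exact: ccont_onD.
rewrite (cintD c1 c2) IH (cintZ _ (ccont_cis _ 0 1)) /power_poly [in RHS]big_ord_recr.
by congr (_ + _); rewrite mulrAC.
Qed.

Lemma power_poly_average_le b (k B : R) M z :
  (forall v, 0 <= v <= 1 -> complex.Re (power_poly b M (cis (k * v) * z)) <= B) ->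
  complex.Re (power_poly (fun i => b i * cint (fun v => cis (i.+1%:R * k * v)) 0 1) M z) <= B.
Proof.
move=> H; have [[cr _] <-] := power_poly_average b k M z.
have -> : B = rint (fun=> B) 0 1 by rewrite rint_cst// subr0 mulr1.
by apply: rint_le => //; exact: cont_on_cst.
Qed.

(** The arc weights are the products of the Fourier coefficients of the arc and
of its reflection, so the smoothed kernel is an average of rotations of
[log_poly M] by angles between [- eta] and [eta]; bounds on a real part survive
averaging. *)
Lemma arc_poly_average c (B eta : R) M z : 0 <= eta ->
  (forall s, `|s| <= eta -> complex.Re (c * log_poly M (cis s * z)) <= B) ->
  complex.Re (c * arc_poly eta M z) <= B.
Proof.
move=> e0 H; pose b i : cplane R := c * rc i.+1%:R^-1.
have E1 y : c * log_poly M y = power_poly b M y.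
  by rewrite /log_poly mulr_sumr; apply: eq_bigr => i _; rewrite mulrA.
pose b1 i := b i * cint (fun v => cis (i.+1%:R * - eta * v)) 0 1.
pose b2 i := b1 i * cint (fun v => cis (i.+1%:R * eta * v)) 0 1.
have E2 : c * arc_poly eta M z = power_poly b2 M z.
  rewrite /arc_poly mulr_sumr; apply: eq_bigr => i _; rewrite mulrA; congr (_ * _).
  have A1 : cint (fun v => cis (i.+1%:R * - eta * v)) 0 1 = arc_coef eta i.+1.
    by apply: eq_cint => v _; rewrite mulrN.
  have A2 : cint (fun v => cis (i.+1%:R * eta * v)) 0 1 = conjc (arc_coef eta i.+1).
    rewrite /arc_coef -cint_conj; last exact: ccont_cis.
    by apply: eq_cint => v _; rewrite -cisN mulNr opprK.
  have Hw : rc (arc_weight eta i.+1 / i.+1%:R) = rc i.+1%:R^-1 * (arc_coef eta i.+1 * conjc (arc_coef eta i.+1)).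
    rewrite /arc_weight mod_sqr.
    by apply: eqC; rewrite ?ReM ?ImM ?ReM ?ImM ?ReJ ?ImJ/=; ring.
  by rewrite Hw /b2 /b1 /b A1 A2 !mulrA.
rewrite E2; apply: power_poly_average_le => v /andP[v0 v1].
apply: power_poly_average_le => v' /andP[v0' v1'].
rewrite mulrA -cisD -E1; apply: H.
rewrite ler_norml; apply/andP; split.
  have : eta * v' <= eta by rewrite ler_piMr.
  have := mulr_ge0 e0 v0; rewrite mulNr; lra.
have : eta * v <= eta by rewrite ler_piMr.
have := mulr_ge0 e0 v0'; rewrite mulNr; lra.
Qed.

Lemma pow_lip z w n : modulus z <= 1 -> modulus w <= 1 ->
  modulus (z ^+ n - w ^+ n) <= n%:R * modulus (z - w).
Proof.
move=> z1 w1; elim: n => [|n IH]; first by rewrite !expr0 subrr mod0 mul0r.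
have -> : z ^+ n.+1 - w ^+ n.+1 = z * (z ^+ n - w ^+ n) + (z - w) * w ^+ n by rewrite !exprS; ring.
apply: le_trans (modD _ _) _.
rewrite [leRHS](_ : _ = n%:R * modulus (z - w) + modulus (z - w)); last by rewrite -natr1 mulrDl mul1r.
apply: lerD; rewrite modM.
  by apply: le_trans IH; rewrite ler_piMl ?mod_ge0.
by rewrite ler_piMr ?mod_ge0// modX exprn_ile1 ?mod_ge0.
Qed.

Lemma weighted_lip eta M (b : nat -> cplane R) z w : (forall n, modulus (b n) <= 1) ->
  modulus z <= 1 -> modulus w <= 1 ->
  modulus (\sum_(i < M) rc (arc_weight eta i.+1 / i.+1%:R) * b i.+1 * z ^+ i.+1 -
           \sum_(i < M) rc (arc_weight eta i.+1 / i.+1%:R) * b i.+1 * w ^+ i.+1) <=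
  (\sum_(i < M) arc_weight eta i.+1) * modulus (z - w).
Proof.
move=> b1 z1 w1; rewrite -sumrB mulr_suml; apply: le_trans (mod_sum _ _ _) _.
apply: ler_sum => i _; rewrite -mulrBr -mulrA mod_rcM ?divr_ge0 ?arc_weight_ge0// -mulrA.
apply: ler_wpM2l; first exact: arc_weight_ge0.
rewrite mulrC ler_pdivrMr ?ltr0n// modM mulrC.
apply: le_trans (_ : 1 * (i.+1%:R * modulus (z - w)) <= _); last by rewrite mul1r mulrC.
rewrite [leLHS]mulrC; apply: ler_pM; rewrite ?mod_ge0//; exact: pow_lip.
Qed.

Lemma arc_polyE eta M z :
  arc_poly eta M z = \sum_(i < M) rc (arc_weight eta i.+1 / i.+1%:R) * 1 * z ^+ i.+1.
Proof. by apply: eq_bigr => i _; rewrite mulr1. Qed.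

(** The bounds for [log_poly] hold inside the disc of radius
[r = 1 - 1 / (8 p)]; there the arc average inherits them. The smoothed kernel is
Lipschitz with constant [8 p], so passing from [r z] to [z] costs at most 1.
Far from the arc, [1 - u] is at least half of [1 - z] for the rotated points. *)
Lemma arc_poly_bounds p : (0 < p)%N -> exists M0, forall M z, (M0 <= M)%N -> modulus z <= 1 ->
  [/\ - 3 <= complex.Re (arc_poly p%:R^-1 M z), `|complex.Im (arc_poly p%:R^-1 M z)| <= 3 &
   forall d, 0 < d -> 6 / p%:R <= d -> d <= modulus (1 - z) ->
     complex.Re (arc_poly p%:R^-1 M z) <= 4 / d + 1].
Proof.
move=> p0; have pp : 0 < p%:R :> R by rewrite ltr0n.
have p1 : 1 <= p%:R :> R by rewrite ler1n.
set eta : R := p%:R^-1.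
have e0 : 0 < eta by rewrite invr_gt0.
have ep : eta * p%:R = 1 by rewrite mulVf// gt_eqF.
have e1 : eta <= 1 by rewrite invf_le1.
(* close enough to 1 for the Lipschitz bound [8 p] to cost only 1 *)
pose r := 1 - eta / 8.
have r0 : 0 <= r by move: e1 e0; clear; rewrite /r; lra.
have r1 : r < 1 by move: e0; clear; rewrite /r; lra.
have rr : 0 <= r < 1 by rewrite r0.
have [M0 HM] := log_poly_bounds rr; exists M0 => M z MM z1.
have inr s : modulus (cis s * (rc r * z)) <= r.
  by rewrite mod_cisM mod_rcM// ler_piMr.
have close : modulus (arc_poly eta M z - arc_poly eta M (rc r * z)) <= 1.
  rewrite !arc_polyE; apply: le_trans (weighted_lip eta M (b := fun=> 1) _ z1 _) _.
  - by move=> n; rewrite mod1.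
  - by rewrite mod_rcM//; apply: le_trans (ltW r1); rewrite ler_piMr.
  apply: le_trans (_ : 8 * p%:R * (eta / 8) <= _); last first.
    have -> : 8 * p%:R * (eta / 8) = eta * p%:R by field.
    by rewrite ep.
  apply: ler_pM; rewrite ?mod_ge0//; [by apply: sumr_ge0 => i _; exact: arc_weight_ge0|exact: sum_arc_weight|].
  have -> : z - rc r * z = rc (eta / 8) * z.
    by apply: eqC; rewrite !(ReD, ImD, ReN, ImN, ReM, ImM)/= /r; ring.
  have h8 : 0 <= eta / 8 by move: e0; clear; lra.
  by rewrite mod_rcM// ler_piMr.
have closeR c B : modulus c <= 1 ->
    (forall s, `|s| <= eta -> complex.Re (c * log_poly M (cis s * (rc r * z))) <= B) ->
    complex.Re (c * arc_poly eta M z) <= B + 1.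
  move=> c1 /(arc_poly_average (ltW e0)) H.
  have -> : c * arc_poly eta M z = c * arc_poly eta M (rc r * z) + c * (arc_poly eta M z - arc_poly eta M (rc r * z)) by ring.
  rewrite ReD; apply: lerD => //; apply: le_trans (ler_norm _) _.
  apply: le_trans (Re_le _) _; rewrite modM; apply: le_trans close.
  by rewrite ler_piMl ?mod_ge0.
have B s := HM M _ MM (inr s).
split.
- have := @closeR (rc (-1)) 2; rewrite mod_rc normrN1 Re_rcM => H.
  suff : -1 * complex.Re (arc_poly eta M z) <= 2 + 1 by clear; lra.
  apply: H => // s _; rewrite Re_rcM; have [] := B s; clear; lra.
- rewrite ler_norml; apply/andP; split.
    have := @closeR ii 2; rewrite mod_ii => H.
    have {}H : complex.Re (ii * arc_poly eta M z) <= 2 + 1.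
      apply: H => // s _; have [_ _] := B s; rewrite ler_norml ReM/= => /andP[]; clear; lra.
    move: H; rewrite ReM/=; clear; lra.
  have := @closeR (- ii) 2; rewrite modN mod_ii => H.
  have {}H : complex.Re (- ii * arc_poly eta M z) <= 2 + 1.
    apply: H => // s _; have [_ _] := B s; rewrite ler_norml ReM ReN ImN/= => /andP[]; clear; lra.
  move: H; rewrite ReM ReN ImN/=; clear; lra.
move=> d d0 dp dz.
have := @closeR 1 (4 / d); rewrite mod1 mul1r; apply=> // s se.
rewrite mul1r; have [_ + _] := B s; move/le_trans; apply.
set u := cis s * _.
have zu : modulus (z - u) <= 3 * eta.
  have -> : z - u = rc (1 - r) * z - rc r * (cis s - 1) * z.
    rewrite /u; have -> : rc (1 - r) = 1 - rc r by rewrite rcD rcN.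
    ring.
  apply: le_trans (modD _ _) _; rewrite modN !modM !mod_rc (ger0_norm r0) ger0_norm ?subr_ge0 ?(ltW r1)//.
  have s1 : modulus (cis s - 1) <= 2 * eta.
    by apply: le_trans (cis_sub1 _) _; rewrite ler_pM2l.
  have -> : 3 * eta = eta + 2 * eta by ring.
  apply: lerD.
    apply: le_trans (_ : eta / 8 * 1 <= _); last by move: e0; clear; lra.
    by apply: ler_pM; rewrite ?mod_ge0// /r; move: e0; clear; lra.
  rewrite -[leRHS]mulr1; apply: ler_pM; rewrite ?mulr_ge0 ?mod_ge0//.
  rewrite -[leRHS]mul1r; apply: ler_pM; rewrite ?mod_ge0//; exact: ltW.
have du : d / 2 <= modulus (1 - u).
  have := modD (1 - u) (u - z).
  rewrite addrA subrK [modulus (u - z)]modB => h.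
  have {}dp : 6 * eta <= d by [].
  by move: h zu dz dp; clear; lra.
have -> : 4 / d = 2 / (d / 2) by field; rewrite gt_eqF.
apply: ler_pM; rewrite ?invr_ge0 ?mod_ge0//.
rewrite lef_pV2 ?posrE ?divr_gt0//; apply: lt_le_trans du; by rewrite divr_gt0.
Qed.

End Averaging.

(** * Discrete potentials and near minimizers of the energy *)

Section PolynomialEnergy.
Context {R : realType}.
Implicit Types (u w z c : cplane R) (H : cplane R -> R) (n m M : nat).

Lemma dintegrable_bounded H (B : R) : dmeas H -> (forall z, unit_disc z -> `|H z| <= B) -> dintegrable H.
Proof.
move=> mH HB.
have B0 : 0 <= B by apply: le_trans (HB 0 unit_disc0).
have fin : (dint (fun=> B) < +oo)%E.
  rewrite (eq_dint (G := fun=> B * 1)); last by move=> z _; rewrite mulr1.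
  rewrite (dintZ (cst_dmeas 1)) //.
  by have := areaE (R := R); rewrite /area => ->; rewrite -EFinM ltry.
exact: (integrable_le mH (cst_dmeas B) (fun z _ => B0) fin HB).
Qed.

Lemma cvg_conj (f : cplane R -> cplane R) z : f w @[w --> z] --> f z ->
  conjc (f w) @[w --> z] --> (conjc (f z) : cplane R).
Proof.
move=> cf.
have r := @cvg_Re R _ (nbhs z) (nbhs_filter z) f _ cf.
have i := @cvg_Im R _ (nbhs z) (nbhs_filter z) f _ cf.
have E : (fun w => conjc (f w)) = (fun w => Complex (complex.Re (f w)) (- complex.Im (f w))).
  by apply/funext => w; case: (f w).
rewrite E; have -> : conjc (f z) = Complex (complex.Re (f z)) (- complex.Im (f z)) by case: (f z).
exact: (cvg_Complex r (cvgN i)).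
Qed.

Definition plain_poly (d : nat -> cplane R) M z : cplane R := \sum_(i < M) d i * z ^+ i.

Lemma plain_poly_recr d M z : plain_poly d M.+1 z = plain_poly d M z + d M * z ^+ M.
Proof. by rewrite /plain_poly big_ord_recr. Qed.

Lemma plain_poly_cvg d M z : plain_poly d M w @[w --> z] --> plain_poly d M z.
Proof.
elim: M => [|M IH].
  have E : plain_poly d 0 = (fun=> 0) by apply/funext => w; rewrite /plain_poly big_ord0.
  by rewrite E; exact: (cderiv_cvg (cderiv_cst z 0)).
have E : plain_poly d M.+1 = (fun w => plain_poly d M w + d M * w ^+ M).
  by apply/funext => w; rewrite plain_poly_recr.
rewrite E.
exact: (@cvg_cplaneD R _ (nbhs z) (nbhs_filter z) _ _ _ _ IH (cderiv_cvg (cderivM (cderiv_cst z (d M)) (cderivX z M)))).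
Qed.

Lemma plain_poly_bound d M z : unit_disc z -> modulus (plain_poly d M z) <= \sum_(i < M) modulus (d i).
Proof.
move=> zD; apply: le_trans (mod_sum _ _ _) _; apply: ler_sum => i _.
by rewrite modM modX ler_piMr ?mod_ge0// exprn_ile1 ?mod_ge0// ltW.
Qed.

Let crossk d c m M z : cplane R := c * plain_poly d m z * conjc (z ^+ M).

Let crossk_cvg d c m M z : crossk d c m M w @[w --> z] --> crossk d c m M z.
Proof.
apply: (@cvg_cplaneM R _ (nbhs z) (nbhs_filter z)).
  apply: (@cvg_cplaneM R _ (nbhs z) (nbhs_filter z)); last exact: plain_poly_cvg.
  exact: (cderiv_cvg (cderiv_cst z c)).
exact: (cvg_conj (cderiv_cvg (cderivX z M))).
Qed.

Let crossk_integrable d c m M : dintegrable (fun z => complex.Re (crossk d c m M z)).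
Proof.
have [mR _ _] := dmeas_cplane (fun z _ => @crossk_cvg d c m M z).
apply: (dintegrable_bounded (B := modulus c * \sum_(i < m) modulus (d i)) mR) => z zD.
apply: le_trans (Re_le _) _; rewrite !modM modJ modX.
rewrite -[leRHS]mulr1; apply: ler_pM; rewrite ?mulr_ge0 ?exprn_ge0 ?mod_ge0//.
  by apply: ler_wpM2l; [exact: mod_ge0|exact: plain_poly_bound].
by rewrite exprn_ile1 ?mod_ge0// ltW.
Qed.

(** Distinct powers are orthogonal: some rotation [u] satisfies
[u ^ m conj (u ^ M) = - 1]. *)
Lemma monomial_cross c m M : (m < M)%N -> dRint (fun z => complex.Re (c * z ^+ m * conjc (z ^+ M))) = 0.
Proof.
move=> mM; pose k z : cplane R := c * z ^+ m * conjc (z ^+ M).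
have ck z : unit_disc z -> k w @[w --> z] --> k z.
  move=> _; apply: (@cvg_cplaneM R _ (nbhs z) (nbhs_filter z)).
    exact: (cderiv_cvg (cderivM (cderiv_cst z c) (cderivX z m))).
  exact: (cvg_conj (cderiv_cvg (cderivX z M))).
have [mR mI _] := dmeas_cplane ck.
pose th : R := pi / (M%:R - m%:R).
have d0 : M%:R - m%:R != 0 :> R by rewrite subr_eq0 eqr_nat gtn_eqF.
have conjM (a b : cplane R) : conjc (a * b) = conjc a * conjc b :> cplane R.
  by apply: eqC; rewrite ?ReJ ?ImJ ?ReM ?ImM ?ReJ ?ImJ; ring.
have uu : cis th ^+ m * conjc (cis th ^+ M) = -1 :> cplane R.
  rewrite !cisX -cisN -cisD.
  have -> : m%:R * th + - (M%:R * th) = - pi.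
    by rewrite -mulrBl -[m%:R - _]opprB mulNr mulrC /th divfK.
  by rewrite /cis cosN sinN cospi sinpi; apply: eqC; rewrite ?ReN ?ImN/= ?oppr0.
have kA z : k (cis th * z) = - k z.
  rewrite /k !exprMn conjM -mulN1r -uu; ring.
by have [] := dRint_anti_cplane (mod_cis th) mR mI kA.
Qed.

Let crossk0 d c m M : (m <= M)%N -> dRint (fun z => complex.Re (crossk d c m M z)) = 0.
Proof.
elim: m => [|m IH] mM.
  rewrite (eq_dRint (G := fun=> 0)) ?dRint0// => z _.
  have -> : crossk d c 0 M z = 0 by rewrite /crossk /plain_poly big_ord0 mulr0 mul0r.
  by [].
have E z : unit_disc z -> complex.Re (crossk d c m.+1 M z) =
    complex.Re (crossk d c m M z) + complex.Re (c * d m * z ^+ m * conjc (z ^+ M)).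
  by move=> _; rewrite -ReD /crossk plain_poly_recr; congr complex.Re; ring.
pose d' i := if i == m then d m else 0.
have E2 : crossk d' c m.+1 M = (fun z => c * d m * z ^+ m * conjc (z ^+ M)).
  apply/funext => z; rewrite /crossk plain_poly_recr /d' eqxx /plain_poly big1 ?add0r ?mulrA//.
  by move=> i _; rewrite ltn_eqF ?mul0r.
have i2 : dintegrable (fun z => complex.Re (c * d m * z ^+ m * conjc (z ^+ M))).
  by have := crossk_integrable d' c m.+1 M; rewrite E2.
rewrite (eq_dRint E) (dRintD (crossk_integrable d c m M) i2) (IH (ltnW mM)) add0r.
exact: monomial_cross.
Qed.

(** The theorem of Pythagoras, adding one monomial at a time. *)
Lemma dint_plain_poly d M : dint (fun z => modulus (plain_poly d M z) ^+ 2) =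
  (areaR * \sum_(i < M) modulus (d i) ^+ 2 / i.+1%:R)%:E.
Proof.
have mP m : dmeas (fun z => modulus (plain_poly d m z) ^+ 2).
  by have [_ _] := dmeas_cplane (fun z _ => @plain_poly_cvg d m z).
have iP m : dintegrable (fun z => modulus (plain_poly d m z) ^+ 2).
  apply: (dintegrable_bounded (B := (\sum_(i < m) modulus (d i)) ^+ 2) (mP m)) => z zD.
  rewrite ger0_norm ?sqr_ge0// lerXn2r ?nnegrE ?mod_ge0 ?plain_poly_bound//.
  by apply: sumr_ge0 => i _; exact: mod_ge0.
have fin m : (dint (fun z => modulus (plain_poly d m z) ^+ 2)%R < +oo)%E.
  have := iP m => /integrableP[_].
  rewrite [X in (X < _)%E -> _](_ : _ = dint (fun z => modulus (plain_poly d m z) ^+ 2)%R)//.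
  by apply: eq_integral => p _; rewrite gee0_abs// lee_fin sqr_ge0.
rewrite (dintE (mP M) (fun z _ => sqr_ge0 _) (fin M)); congr EFin.
elim: M => [|M IH].
  rewrite big_ord0 mulr0 (eq_dRint (G := fun=> 0)) ?dRint0// => z _.
  by rewrite /plain_poly big_ord0 mod0 expr0n.
have mm : dmeas (fun z => modulus (z ^+ M) ^+ 2) := monomial_dmeas M.
have im : dintegrable (fun z => modulus (z ^+ M) ^+ 2).
  apply: (dintegrable_bounded (B := 1) mm) => z zD.
  by rewrite ger0_norm ?sqr_ge0// expr_le1 ?mod_ge0// modX exprn_ile1 ?mod_ge0// ltW.
have E z : unit_disc z -> modulus (plain_poly d M.+1 z) ^+ 2 = modulus (plain_poly d M z) ^+ 2 +
   (modulus (d M) ^+ 2 * modulus (z ^+ M) ^+ 2 + 2 * complex.Re (crossk d (conjc (d M)) M M z)).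
  move=> _; rewrite plain_poly_recr /crossk -exprMn -modM.
  move: (plain_poly d M z) (z ^+ M) (d M) => P y q.
  by rewrite !mod_sqr !(ReM, ImM, ReD, ImD, ReJ, ImJ); ring.
have ic := crossk_integrable d (conjc (d M)) M M.
rewrite (eq_dRint E) (dRintD (iP M) (dintegrableD (dintegrableZ _ im) (dintegrableZ 2 ic))).
rewrite IH (dRintD (dintegrableZ _ im) (dintegrableZ 2 ic)) (dRintZ _ im) (dRintZ _ ic) crossk0//.
rewrite mulr0 addr0 big_ord_recr/= mulrDr; congr (_ + _).
have mfin : (dint (fun z => modulus (z ^+ M) ^+ 2)%R < +oo)%E by rewrite moment ltry.
have e2 : dint (fun z => modulus (z ^+ M) ^+ 2) = (dRint (fun z => modulus (z ^+ M) ^+ 2))%:E := dintE mm (fun z _ => sqr_ge0 _) mfin.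
rewrite moment in e2; case: e2 => <-.
by rewrite mulrCA.
Qed.

End PolynomialEnergy.

Section DiscretePotential.
Context {R : realType}.
Implicit Types (u w z c : cplane R) (s t r d : R) (n M p N : nat).

Definition moment_of N (th : 'I_N -> R) n : cplane R :=
  rc N%:R^-1 * \sum_(j < N) cis (- (n%:R * th j)).

(** The potential of [N] equal point masses at the angles [th j], truncated
at degree [M] and smoothed twice along arcs of length [1 / p]; [arc_energy] is
the truncated energy of the masses smeared along these arcs. *)
Definition potential p M N (th : 'I_N -> R) z : cplane R :=
  \sum_(i < M) rc (arc_weight p%:R^-1 i.+1 / i.+1%:R) * moment_of th i.+1 * z ^+ i.+1.

Definition arc_energy p M N (th : 'I_N -> R) : R :=
  \sum_(i < M) arc_weight p%:R^-1 i.+1 / i.+1%:R * modulus (moment_of th i.+1) ^+ 2.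

Lemma sum_combine M (x w y1 y2 : 'I_M -> R) (a b : R) :
  \sum_k x k + a * (\sum_k w k * y1 k - \sum_k w k * y2 k) + b * \sum_k w k =
  \sum_k (x k + a * (w k * y1 k - w k * y2 k) + b * w k).
Proof. by rewrite -sumrB !mulr_sumr -!big_split. Qed.

Section Fixed.
Variables (p M N : nat) (th : 'I_N -> R).
Hypotheses (p0 : (0 < p)%N) (N0 : (0 < N)%N).
Let NR : 0 < N%:R :> R. Proof. by rewrite ltr0n. Qed.

Lemma average_le (f : 'I_N -> R) (B : R) : (forall j, f j <= B) -> N%:R^-1 * \sum_j f j <= B.
Proof.
move=> fB; rewrite mulrC ler_pdivrMr//.
apply: (@le_trans _ _ (\sum_(j < N) B)); first by apply: ler_sum => j _; exact: fB.
by rewrite sumr_const card_ord mulr_natr.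
Qed.

Lemma average_ge (f : 'I_N -> R) (B : R) : (forall j, B <= f j) -> B <= N%:R^-1 * \sum_j f j.
Proof.
move=> fB; rewrite mulrC ler_pdivlMr//.
apply: (@le_trans _ _ (\sum_(j < N) B)); last by apply: ler_sum => j _; exact: fB.
by rewrite sumr_const card_ord mulr_natr.
Qed.

Lemma mod_moment n : modulus (moment_of th n) <= 1.
Proof.
rewrite mod_rcM ?invr_ge0//.
apply: (@le_trans _ _ (N%:R^-1 * \sum_(j < N) 1)); last by apply: average_le.
apply: ler_wpM2l; first by rewrite invr_ge0.
apply: le_trans (mod_sum _ _ _) _; apply: ler_sum => j _; by rewrite mod_cis.
Qed.

Lemma potential_average z : potential p M th z =
  rc N%:R^-1 * \sum_(j < N) arc_poly p%:R^-1 M (cis (- th j) * z).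
Proof.
rewrite exchange_big mulr_sumr; apply: eq_bigr => i _.
rewrite /moment_of !mulr_sumr mulr_suml; apply: eq_bigr => j _.
rewrite exprMn cisX mulrN; ring.
Qed.

(** The energy is the mean of the potential over the masses that produce it. *)
Lemma arc_energy_average : arc_energy p M th = N%:R^-1 * \sum_(j < N) complex.Re (potential p M th (cis (th j))).
Proof.
have cj n : conjc (moment_of th n) = rc N%:R^-1 * \sum_(j < N) cis (n%:R * th j).
  apply: eqC; rewrite ?ReJ ?ImJ ?Re_rcM ?Im_rcM ?Re_sum ?Im_sum.
    by congr (_ * _); apply: eq_bigr => j _; rewrite cisN ReJ.
  rewrite -mulrN -sumrN; congr (_ * _); apply: eq_bigr => j _.
  by rewrite cisN ImJ opprK.
rewrite mulr_sumr; under [RHS]eq_bigr do rewrite /potential Re_sum mulr_sumr.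
rewrite exchange_big; apply: eq_bigr => i _.
under [RHS]eq_bigr do rewrite -mulrA Re_rcM cisX mulrCA.
rewrite -mulr_sumr -mulr_sumr; congr (_ * _).
rewrite -Re_sum -mulr_sumr -Re_rcM mulrCA -cj ReM ReJ ImJ mod_sqr; ring.
Qed.

Lemma Re_potential z : complex.Re (potential p M th z) =
  \sum_(i < M) arc_weight p%:R^-1 i.+1 / i.+1%:R * complex.Re (moment_of th i.+1 * z ^+ i.+1).
Proof. by rewrite /potential Re_sum; apply: eq_bigr => i _; rewrite -mulrA Re_rcM. Qed.

Lemma potential_lip z w : modulus z <= 1 -> modulus w <= 1 ->
  modulus (potential p M th z - potential p M th w) <= 8 * p%:R * modulus (z - w).
Proof.
move=> z1 w1; apply: le_trans (weighted_lip _ _ (b := moment_of th) mod_moment z1 w1) _.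
by apply: ler_wpM2r; [exact: mod_ge0|exact: sum_arc_weight].
Qed.

Lemma cderiv_potential z : cderiv (potential p M th) z
  (plain_poly (fun i => rc (arc_weight p%:R^-1 i.+1) * moment_of th i.+1) M z).
Proof.
pose b i := rc (arc_weight p%:R^-1 i.+1 / i.+1%:R) * moment_of th i.+1.
pose P m w : cplane R := \sum_(i < m) b i * w ^+ i.+1.
rewrite -[potential p M th]/(P M); elim: (M) => [|m IH].
  have -> : P 0%N = (fun=> 0) by apply/funext => w; rewrite /P big_ord0.
  by rewrite /plain_poly big_ord0; exact: cderiv_cst.
have -> : P m.+1 = (fun w => P m w + b m * w ^+ m.+1).
  by apply/funext => w; rewrite /P big_ord_recr.
rewrite plain_poly_recr.
apply: (cderivD IH); apply: (cderiv_eq (cderivM (cderiv_cst z (b m)) (cderivX z m.+1))).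
rewrite mul0r add0r /b rcM -(rc_nat m.+1) [m.+1.-1]/=.
have m1 : (m.+1%:R : R) != 0 by rewrite pnatr_eq0.
have V := rcV m1.
transitivity (rc (arc_weight p%:R^-1 m.+1) * moment_of th m.+1 * z ^+ m * (rc (m.+1%:R : R)^-1 * rc m.+1%:R)); first by ring.
by rewrite V mulr1.
Qed.

Lemma potential_energy : (energy (potential p M th) <= (4 * areaR * arc_energy p M th)%:E)%E.
Proof.
rewrite /energy (eq_dint (G := fun z => modulus (plain_poly (fun i => rc (arc_weight p%:R^-1 i.+1) * moment_of th i.+1) M z) ^+ 2)); last first.
  by move=> z _; rewrite (cderiv_derive1 (cderiv_potential z)).
rewrite dint_plain_poly lee_fin [4 * _]mulrC -mulrA; apply: ler_wpM2l; first exact: ltW areaR_gt0.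
rewrite mulr_sumr; apply: ler_sum => i _.
rewrite mod_rcM ?arc_weight_ge0// exprMn [leLHS]mulrAC mulrA; apply: ler_wpM2r; first exact: sqr_ge0.
rewrite mulrA; apply: ler_wpM2r; first by rewrite invr_ge0.
by rewrite expr2; apply: ler_wpM2r; [exact: arc_weight_ge0|exact: arc_weight_le4].
Qed.

End Fixed.

(** The potential is an average of rotated kernels, and each bound of
[arc_poly_bounds] is stable under averages. *)
Lemma potential_bounds p : (0 < p)%N -> exists M0, forall M N (th : 'I_N -> R) z,
  (M0 <= M)%N -> (0 < N)%N -> modulus z <= 1 ->
  [/\ - 3 <= complex.Re (potential p M th z), `|complex.Im (potential p M th z)| <= 3 &
   forall d, 0 < d -> 6 / p%:R <= d -> (forall j, d <= modulus (cis (th j) - z)) ->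
     complex.Re (potential p M th z) <= 4 / d + 1].
Proof.
move=> p0; have [M0 HM] := @arc_poly_bounds R p p0; exists M0 => M N th z MM N0 z1.
have B j := HM M (cis (- th j) * z) MM (eq_ind_r (fun x => x <= 1) z1 (mod_cisM (- th j) z)).
rewrite potential_average Re_rcM Im_rcM Re_sum Im_sum; split.
- by apply: average_ge => // j; have [] := B j.
- rewrite ler_norml; apply/andP; split.
    by apply: average_ge => // j; have [_ + _] := B j; rewrite ler_norml => /andP[].
  by apply: average_le => // j; have [_ + _] := B j; rewrite ler_norml => /andP[].
move=> d d0 pd dz; apply: average_le => // j; have [_ _] := B j; apply=> //.
apply: le_trans (dz j) _; rewrite -(mod_cisM (- th j) (cis (th j) - z)) mulrBr cisNM//.
Qed.

(** The variational argument of Fekete points. Moving one of the [N] masses of a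
near minimizer to another point changes the energy by [2 / N] times the
difference of the potentials, up to an error of order [p / N ^ 2]; as the
energy cannot drop by more than [1 / N], the potential anywhere on the set is at
least its value at each mass, up to a constant. The mean of the latter
is the energy. *)
Lemma near_minimizer p M N (S : set R) : (0 < p)%N -> (0 < N)%N -> (16 * p <= N)%N -> S !=set0 ->
  exists th : 'I_N -> R, (forall j, S (th j)) /\
   forall t, S t -> arc_energy p M th - 2 <= complex.Re (potential p M th (cis t)).
Proof.
move=> p0 N0 pN [t0 St0]; have NR : 0 < N%:R :> R by rewrite ltr0n.
pose A := [set arc_energy p M th | th in [set th : 'I_N -> R | forall j, S (th j)]].
pose th0 : 'I_N -> R := fun=> t0.
have A0 : A !=set0 by exists (arc_energy p M th0), th0.
have lbA : lbound A 0.
  move=> _ [th _ <-]; apply: sumr_ge0 => i _.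
  by rewrite mulr_ge0 ?sqr_ge0// divr_ge0// arc_weight_ge0.
have hA : has_inf A by split=> //; exists 0.
have e0 : 0 < N%:R^-1 :> R by rewrite invr_gt0.
have [_ [th Sth <-] thm] := inf_adherent e0 hA.
exists th; split=> // t St.
set J := arc_energy p M th in thm *.
have [P PE P2] : exists2 P : R -> R, forall s, P s = complex.Re (potential p M th (cis s)) &
    forall s, P s = \sum_(i < M) arc_weight p%:R^-1 i.+1 / i.+1%:R * complex.Re (moment_of th i.+1 * cis s ^+ i.+1).
  by exists (fun s => complex.Re (potential p M th (cis s))) => // s; exact: Re_potential.
rewrite -PE.
have step i : P (th i) - 3 / 2 <= P t.
  pose th' k := if k == i then t else th k.
  have Sth' j : S (th' j) by rewrite /th'; case: ifP.
  have J' : J - N%:R^-1 <= arc_energy p M th'.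
    apply: le_trans (_ : inf A <= _); first by move: thm; clear; lra.
    by apply: (inf_lbound hA.2); exists th'.
  pose D n : cplane R := cis (- (n%:R * t)) - cis (- (n%:R * th i)).
  have mE n : moment_of th' n = moment_of th n + rc N%:R^-1 * D n.
    rewrite /moment_of (bigD1 i)//= [in RHS](bigD1 i)//= {1}/th' eqxx.
    rewrite (eq_bigr (fun j => cis (- (n%:R * th j)))); last first.
      by move=> j /negbTE ji; rewrite /th' ji.
    rewrite /D; ring.
  have D2 n : modulus (D n) <= 2.
    by apply: le_trans (modD _ _) _; rewrite modN !mod_cis.
  have upd n : modulus (moment_of th' n) ^+ 2 <= modulus (moment_of th n) ^+ 2 +
     N%:R^-1 * 2 * complex.Re (moment_of th n * conjc (D n)) + N%:R^-1 ^+ 2 * 4.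
    rewrite mE.
    have -> : modulus (moment_of th n + rc N%:R^-1 * D n) ^+ 2 = modulus (moment_of th n) ^+ 2 +
       N%:R^-1 * 2 * complex.Re (moment_of th n * conjc (D n)) + N%:R^-1 ^+ 2 * modulus (D n) ^+ 2.
      rewrite !mod_sqr; move: (moment_of th n) (D n) => a b.
      by rewrite !(ReM, ImM, ReD, ImD, ReJ, ImJ)/=; ring.
    rewrite lerD2l; apply: ler_wpM2l; first exact: sqr_ge0.
    by have := D2 n; have := mod_ge0 (D n); move: (modulus (D n)); clear => x; nra.
  have sumE : arc_energy p M th' <= J + N%:R^-1 * 2 *
      (P t - P (th i)) +
      N%:R^-1 ^+ 2 * 4 * \sum_(k < M) arc_weight p%:R^-1 k.+1 / k.+1%:R.
    rewrite !P2.
    rewrite /J /arc_energy.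
    rewrite sum_combine.
    apply: ler_sum => k _.
    have wt0 : 0 <= arc_weight p%:R^-1 k.+1 / k.+1%:R :> R.
      by apply: divr_ge0; [exact: arc_weight_ge0|exact: ler0n].
    apply: le_trans (ler_wpM2l wt0 (upd k.+1)) _.
    move: (arc_weight p%:R^-1 k.+1 / k.+1%:R) {wt0} => wt.
    rewrite le_eqVlt; apply/orP; left; apply/eqP.
    rewrite !cisX /D !cisN.
    move: (moment_of th k.+1) (cis _) (cis _) (N%:R^-1 : R) {upd mE D2 D J' e0 thm} => a b c q.
    by rewrite !(ReM, ImM, ReD, ImD, ReN, ImN, ReJ, ImJ)/=; ring.
  have K1 : \sum_(k < M) arc_weight (p%:R^-1 : R) k.+1 / k.+1%:R <= N%:R / 2.
    apply: le_trans (_ : 8 * p%:R <= _); last first.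
      have : (16 * p)%:R <= N%:R :> R by rewrite ler_nat.
      by rewrite natrM; clear; lra.
    apply: le_trans (sum_arc_weight M p0); apply: ler_sum => k _.
    rewrite ler_pdivrMr// ler_peMr ?arc_weight_ge0// ler1n//.
  have := le_trans J' sumE.
  move: (P (th i)) (P t) (\sum_(k < M) arc_weight (p%:R^-1 : R) k.+1 / k.+1%:R) K1 => a b K1 K1N h.
  have q1 : N%:R^-1 * N%:R = 1 :> R by rewrite mulVf// gt_eqF.
  have : N%:R^-1 ^+ 2 * 4 * K1 <= N%:R^-1 * 2.
    have : N%:R^-1 ^+ 2 * 4 * K1 <= N%:R^-1 ^+ 2 * 4 * (N%:R / 2).
      by apply: ler_wpM2l => //; rewrite mulr_ge0 ?sqr_ge0.
    have -> : N%:R^-1 ^+ 2 * 4 * (N%:R / 2) = N%:R^-1 * 2 :> R by field; rewrite gt_eqF.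
    by [].
  move: (N%:R^-1 : R) e0 h => q qq h h2.
  have : 0 <= q * 2 * (b - a) + q * 3 by move: h h2; clear; lra.
  have -> : q * 2 * (b - a) + q * 3 = q * (2 * (b - a) + 3) by ring.
  by rewrite pmulr_rge0//; clear; lra.
have : J <= P t + 3 / 2.
  rewrite /J arc_energy_average//; apply: average_le => // j.
  by rewrite -PE; have := step j; clear; lra.
by clear; lra.
Qed.

End DiscretePotential.

(** * Probability measures given by angle functions *)

Section ArcMixture.
Context {R : realType}.
Local Notation leb := (@lebesgue_measure R).
Implicit Types (al : nat -> R -> R).

Lemma continuous_cis : continuous (@cis R : R -> cplane R).
Proof.
move=> t; have := cder_cont (cder_cis 1 t).
by under eq_fun do rewrite mul1r; rewrite mul1r.
Qed.

Lemma measurable_cis (f : R -> R) : measurable_fun setT f ->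
  measurable_fun [set: measurableTypeR R] (fun v => cis (f v) : borel_plane).
Proof.
move=> mf; apply: (@measurability _ _ (measurableTypeR R) (@borel_plane R) setT _ (@open (cplane R)) erefl).
move=> _ [B oB <-]; rewrite setTI.
have oO : open (@cis R @^-1` B) by apply: open_comp => // x _; exact: continuous_cis.
have := mf measurableT _ (open_measurable oO); rewrite setTI; exact.
Qed.

Lemma continuous_borel (f : cplane R -> R) : continuous f ->
  measurable_fun [set: borel_plane] (f : borel_plane -> R).
Proof.
move=> cf; apply: (measurability (@RGenOpens.G R)); first exact: RGenOpens.measurableE.
move=> _ [_ [a [b ->]] <-]; rewrite setTI.
apply: sub_gen_smallest; apply: open_comp; last exact: interval_open.
by move=> x _; exact: cf.
Qed.

Let U01 := uniform_prob (@ltr01 R).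

Section Fixed.
Variables (N : nat) (al : nat -> R -> R).
Hypotheses (N0 : (0 < N)%N) (mal : forall i, measurable_fun setT (al i)).

Let X i : measurableTypeR R -> borel_plane := fun v => cis (al i v).
Let mX i : measurable_fun setT (X i). Proof. exact: measurable_cis. Qed.

Let k0 : 0 <= N%:R^-1 :> R. Proof. by rewrite invr_ge0. Qed.
Let wN : {nonneg R} := NngNum k0.
Let pf i : {measure set (@borel_plane R) -> \bar R} :=
  measure_function_pushforward__canonical__measure_function_Measure U01 (mX i).

(** The average of the laws of [e^{i al_j(v)}], [j < N], for [v] uniform in
[[0, 1]]. *)
Definition mixture : set (@borel_plane R) -> \bar R := msum (fun i => mscale wN (pf i)) N.

HB.instance Definition _ := Measure.copy mixture (msum (fun i => mscale wN (pf i)) N).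

Lemma mixture_total (F : set (cplane R)) : (forall i v, F (cis (al i v))) -> mixture F = 1%E.
Proof.
move=> FX; rewrite /mixture /msum (eq_bigr (fun=> (N%:R^-1)%:E)); last first.
  move=> i _; transitivity ((N%:R^-1)%:E * U01 (X i @^-1` F))%E; first exact: erefl.
  have -> : X i @^-1` F = setT by apply/seteqP; split => // v _; exact: FX.
  have -> : U01 [set: measurableTypeR R] = 1%E by exact: probability_setT.
  exact: mule1.
have h : N%:R^-1 * N%:R = 1 :> R by rewrite mulVf// pnatr_eq0 -lt0n.
by rewrite sumEFin sumr_const card_ord; rewrite mulr_natr in h; rewrite h.
Qed.

HB.instance Definition _ := Measure_isProbability.Build _ _ _ mixture
  (mixture_total (F := setT) (fun _ _ => I)).

Lemma measurable_circle : measurable (@unit_circle R : set borel_plane).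
Proof.
rewrite -(setCK unit_circle); apply: measurableC; apply: sub_gen_smallest.
rewrite openC.
have -> : @unit_circle R = (@modulus R) @^-1` [set 1] by [].
apply: closed_comp; last exact: closed_eq.
move=> z _; exact: (@cvg_modulus R _ (nbhs z) (nbhs_filter z) (fun w => w) z cvg_id).
Qed.

Lemma shift_integral d (T : measurableType d) (mu : {measure set T -> \bar R}) D (f : T -> R) :
  measurable D -> mu D = 1%E -> measurable_fun D f -> (forall x, D x -> `|f x| <= 1) ->
  (\int[mu]_(x in D) (f x + 1)%:E = (Rintegral mu D f + 1)%:E)%E.
Proof.
move=> mD D1 mf f1.
have If : mu.-integrable D (EFin \o f).
  apply: measurable_bounded_integrable => //; first by rewrite D1 ltry.
  by exists 1; split; [exact: num_real|move=> M M1 x Dx; exact: le_trans (f1 x Dx) (ltW M1)].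
have I1 : mu.-integrable D (EFin \o (fun=> 1 : R)).
  apply: measurable_bounded_integrable => //; first by rewrite D1 ltry.
  by exists 1; split; [exact: num_real|move=> M M1 x Dx /=; rewrite normr1 ltW].
under eq_integral do rewrite EFinD.
rewrite (integralD mD If I1) integral_cst// D1 mule1 EFinD; congr (_ + _)%E.
by rewrite /Rintegral fineK//; exact: integrable_fin_num.
Qed.

Lemma mixture_integral (f : cplane R -> R) : continuous f ->
  (forall z, unit_circle z -> `|f z| <= 1) ->
  Rintegral mixture (@unit_circle R) f =
  N%:R^-1 * \sum_(i < N) Rintegral leb `[0, 1] (fun v => f (cis (al i v))).
Proof.
move=> cf f1; have mf := continuous_borel cf.
have mC := measurable_circle.
have XC i v : unit_circle (X i v) by exact: mod_cis.
have muC : mixture (@unit_circle R) = 1%E by exact: mixture_total.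
have mfX i : measurable_fun [set: measurableTypeR R] (fun v => f (X i v)).
  exact: (measurableT_comp mf (mX i)).
have E1 := @shift_integral _ _ mixture _ f mC muC (measurable_funS measurableT (@subsetT _ _) mf) f1.
have leb1 : leb `[0, 1] = 1%E by rewrite lebesgue_measure_itv/= lte_fin ltr01 oppr0 adde0.
have E2 i := @shift_integral _ _ leb _ (fun v => f (X i v)) (measurable_itv `[0, 1]) leb1
  (measurable_funS measurableT (@subsetT _ _) (mfX i)) (fun v _ => f1 _ (XC i v)).
have mf1 : measurable_fun [set: @borel_plane R] (fun z => (f z + 1)%:E).
  by apply/measurable_EFinP; apply: measurable_funD => //; exact: measurable_cst.
have p1 z : unit_circle z -> (0 <= (f z + 1)%:E)%E.
  by move=> /f1; rewrite ler_norml lee_fin => /andP[h _]; rewrite -lerBlDr sub0r.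
have E3 : (\int[mixture]_(x in @unit_circle R) (f x + 1)%:E =
   \sum_(i < N) (N%:R^-1)%:E * \int[leb]_(v in `[0%R, 1%R]) (f (X i v) + 1)%:E)%E.
  rewrite /mixture ge0_integral_measure_sum//; last exact: (measurable_funS measurableT).
  apply: eq_bigr => i _.
  rewrite ge0_integral_mscale//; last exact: (measurable_funS measurableT).
  congr (_ * _)%E.
  rewrite ge0_integral_pushforward//; [|exact: (measurable_funS measurableT)|by move=> z; rewrite inE; exact: p1].
  have -> : X i @^-1` unit_circle = setT by apply/seteqP; split => // v _; exact: XC.
  rewrite integral_uniform.
  - by rewrite subr0 invr1 mul1e.
  - exact: (measurableT_comp mf1 (mX i)).
  - by move=> v; exact: (p1 _ (XC i v)).
move: E3; rewrite E1.
under eq_bigr do rewrite E2 -EFinM.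
rewrite sumEFin => -[]; rewrite -mulr_sumr big_split/= sumr_const card_ord mulrDr.
have -> : N%:R^-1 * N%:R = 1 :> R by rewrite mulVf// pnatr_eq0 -lt0n.
by move/addIr.
Qed.

End Fixed.

Lemma conjX (z : cplane R) n : conjc z ^+ n = conjc (z ^+ n) :> cplane R.
Proof.
elim: n => [|n IH]; first by rewrite !expr0; apply: eqC; rewrite ?ReJ ?ImJ/= ?oppr0.
by rewrite !exprS IH; apply: eqC; rewrite ?ReJ ?ImJ ?ReM ?ImM ?ReJ ?ImJ; ring.
Qed.

(** Measures with prescribed Fourier coefficients are obtained as images of the
uniform law by angle functions; this covers both arcs and weak limits of point
masses. *)
Lemma angle_probability N al (F : set (cplane R)) : (0 < N)%N ->
  (forall i, measurable_fun setT (al i)) -> (forall i v, F (cis (al i v))) ->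
  exists2 mu : probability borel_plane R, mu F = 1%E & forall n, fourier_coef mu n =
    Complex (N%:R^-1 * \sum_(i < N) Rintegral leb `[0, 1] (fun v => cos (n%:R * al i v)))
            (N%:R^-1 * \sum_(i < N) Rintegral leb `[0, 1] (fun v => - sin (n%:R * al i v))).
Proof.
move=> N0 mal FX; exists (mixture N mal); first exact: (mixture_total N0 mal FX).
move=> n; rewrite /fourier_coef.
have cX (z : cplane R) : (fun w : cplane R => w ^+ n) w @[w --> z] --> z ^+ n := cderiv_cvg (cderivX z n).
have b1 (z : cplane R) : unit_circle z -> modulus (z ^+ n) <= 1 by move=> h; rewrite modX h expr1n.
congr Complex.
  rewrite (_ : (fun z : cplane R => complex.Re (conjc z ^+ n)) = (fun z => complex.Re (z ^+ n))); last first.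
    by apply/funext => z; rewrite conjX ReJ.
  rewrite mixture_integral//.
  - by congr (_ * _); apply: eq_bigr => i _; apply: eq_Rintegral => v _; rewrite cisX.
  - by move=> z; exact: (@cvg_Re R _ (nbhs z) (nbhs_filter z) _ _ (cX z)).
  - by move=> z zC; exact: le_trans (Re_le _) (b1 z zC).
rewrite (_ : (fun z : cplane R => complex.Im (conjc z ^+ n)) = (fun z => - complex.Im (z ^+ n))); last first.
  by apply/funext => z; rewrite conjX ImJ.
rewrite mixture_integral//.
- by congr (_ * _); apply: eq_bigr => i _; apply: eq_Rintegral => v _; rewrite cisX.
- by move=> z; exact: (cvgN (@cvg_Im R _ (nbhs z) (nbhs_filter z) _ _ (cX z))).
- by move=> z zC; rewrite normrN; exact: le_trans (Im_le _) (b1 z zC).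
Unshelve. exact: N0.
Qed.

End ArcMixture.

(** * Smeared point masses and quantile functions *)

Section ArcMeasure.
Context {R : realType}.
Local Notation leb := (@lebesgue_measure R).
Implicit Types (p M N n : nat) (F E : set (cplane R)).

(** Angle functions have to be defined for all reals; outside [[0, 1]] they are
continued by constants. *)
Definition clamp (v : R) : R := Num.max 0 (Num.min v 1).

Lemma clamp_itv v : 0 <= clamp v <= 1.
Proof. by rewrite /clamp le_max lexx/= ge_max ler01 ge_min lexx orbT. Qed.

Lemma clamp_id v : 0 <= v <= 1 -> clamp v = v.
Proof. by move=> /andP[v0 v1]; rewrite /clamp (min_idPl v1) (max_idPr v0). Qed.

Lemma clamp_le u v : u <= v -> clamp u <= clamp v.
Proof.
move=> uv; rewrite /clamp; case: (leP u 1) => hu; case: (leP v 1) => hv;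
  rewrite /Num.max; do ?case: ltP => ?; lra.
Qed.

Lemma energy_partial_le (a : nat -> R) (B : R) (mu : probability borel_plane R) :
  (forall n, modulus (fourier_coef mu n.+1) ^+ 2 / n.+1%:R = a n) ->
  (forall L, \sum_(i < L) a i <= B) -> (log_energy mu <= B%:E)%E.
Proof.
move=> aE aB; rewrite /log_energy; apply: lime_le.
  apply: is_cvg_nneseries => n _ _; by rewrite lee_fin divr_ge0 ?sqr_ge0.
apply: nearW => -[|n]; first by rewrite big_geq// lee_fin; have := aB 0%N; rewrite big_ord0.
rewrite big_add1/= sumEFin lee_fin big_mkord.
by apply: le_trans (aB n); apply: ler_sum => i _; rewrite aE.
Qed.

Lemma ler_sum_widen (a : nat -> R) L M : (forall i, 0 <= a i) -> (L <= M)%N ->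
  \sum_(i < L) a i <= \sum_(i < M) a i.
Proof.
move=> a0 LM; rewrite -!(big_mkord xpredT) (@big_cat_nat _ _ _ L 0 M)//=.
by rewrite lerDl sumr_ge0.
Qed.

(** The Fourier coefficients of the smeared masses are those of the point masses
times those of the arc. The terms of the energy beyond the truncation order
[M >= 4 p ^ 2] add at most 1, by the decay of the arc weights. *)
Lemma arc_measure p M N (th : 'I_N -> R) F : (0 < p)%N -> (0 < N)%N -> (4 * p ^ 2 <= M)%N ->
  (forall j v, 0 <= v <= 1 -> F (cis (th j + v / p%:R))) ->
  exists2 mu : probability borel_plane R, mu F = 1%E & (log_energy mu <= (arc_energy p M th + 1)%:E)%E.
Proof.
move=> p0 N0 pM FF; have pp : 0 < p%:R :> R by rewrite ltr0n.
pose j0 : 'I_N := Ordinal N0.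
pose al i v := th (odflt j0 (insub i)) + clamp v / p%:R.
have mal i : measurable_fun setT (al i).
  apply: nondecreasing_measurable => // u v uv.
  by rewrite /al lerD2l ler_pM2r ?invr_gt0// clamp_le.
have [mu muF fc] := angle_probability N0 mal (fun i v => FF _ _ (clamp_itv v)).
exists mu => //.
have fE n : fourier_coef mu n = moment_of th n * arc_coef p%:R^-1 n.
  rewrite fc /moment_of -mulrA mulr_suml.
  have E j : cis (- (n%:R * th j)) * arc_coef p%:R^-1 n =
      cint (fun v => cis (- (n%:R * (th j + v / p%:R)))) 0 1.
    rewrite /arc_coef -cintZ; last exact: ccont_cis.
    by apply: eq_cint => v _; rewrite -cisD; congr cis; ring.
  rewrite (eq_bigr _ (fun j _ => E j)).
  apply: eqC; rewrite ?Re_rcM ?Im_rcM ?Re_sum ?Im_sum.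
    rewrite -[complex.Re (Complex _ _)]/(_ : R); congr (_ * _); apply: eq_bigr => j _.
    apply: eq_Rintegral => v; rewrite inE/= in_itv/= => vv.
    by rewrite cosN /al valK /= clamp_id.
  rewrite -[complex.Im (Complex _ _)]/(_ : R); congr (_ * _); apply: eq_bigr => j _.
  apply: eq_Rintegral => v; rewrite inE/= in_itv/= => vv.
  by rewrite sinN /al valK /= clamp_id.
pose a n := arc_weight p%:R^-1 n.+1 / n.+1%:R * modulus (moment_of th n.+1) ^+ 2.
have a0 n : 0 <= a n by rewrite mulr_ge0 ?sqr_ge0// divr_ge0// arc_weight_ge0.
apply: (energy_partial_le (a := a)).
  by move=> n; rewrite fE modM exprMn /a /arc_weight; ring.
have M0 : (0 < M)%N by apply: leq_trans pM; rewrite muln_gt0/= expn_gt0 p0.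
move=> L; apply: le_trans (ler_sum_widen a0 (leq_addr M L)) _.
rewrite -(big_mkord xpredT a) (@big_cat_nat _ _ _ M 0 (L + M))//= ?leq_addl// big_mkord.
apply: lerD; first exact: lexx.
apply: (@le_trans _ _ (\sum_(M <= i < L + M) 4 * p%:R ^+ 2 * (i.+1%:R ^+ 2)^-1)).
  apply: ler_sum => i _.
  have i0 : 0 < i.+1%:R :> R by rewrite ltr0n.
  apply: (@le_trans _ _ (arc_weight p%:R^-1 i.+1 * 1 * 1)).
    rewrite /a; apply: ler_pM; rewrite ?divr_ge0 ?arc_weight_ge0 ?sqr_ge0//.
      by apply: ler_wpM2l; [exact: arc_weight_ge0|rewrite invf_le1 ?ler1n].
    by rewrite expr_le1 ?mod_ge0//; exact: mod_moment.
  rewrite !mulr1; apply: le_trans (arc_weight_decay _ _) _ => //; first by rewrite invr_gt0.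
  rewrite le_eqVlt; apply/orP; left; apply/eqP.
  by move: (i.+1%:R : R) (p%:R : R) i0 pp => x y x0 y0; field; rewrite !gt_eqF.
rewrite -mulr_sumr; apply: le_trans (ler_wpM2l _ (sum_inv_sqr M0 (leq_addl L M))) _.
  by rewrite mulr_ge0// sqr_ge0.
have MR : 0 < M%:R :> R by rewrite ltr0n.
apply: (@le_trans _ _ (4 * p%:R ^+ 2 * M%:R^-1)).
  by apply: ler_wpM2l; rewrite ?mulr_ge0 ?sqr_ge0// gerBl invr_ge0.
rewrite ler_pdivrMr// mul1r.
have : (4 * p ^ 2)%:R <= M%:R :> R by rewrite ler_nat.
by rewrite natrM natrX.
Qed.

Section MonotoneRiemann.
Variables (q f : R -> R) (B K : R).
Hypotheses (qnd : nondecreasing_fun q) (qB : forall u, 0 <= q u <= B)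
  (fK : forall x y, `|f x - f y| <= K * `|x - y|) (f1 : forall x, `|f x| <= 1)
  (cf : continuous f) (K0 : 0 <= K).

Let g u := f (q u).

Let g_int a b : leb.-integrable `[a, b] (EFin \o g).
Proof.
apply: measurable_bounded_integrable => //.
- have : (leb `[a, b] < +oo)%E; last by [].
  by rewrite lebesgue_measure_itv; case: ifP => _; rewrite ?ltry// -EFinB ltry.
- apply: (measurable_funS measurableT) => //.
  exact: (measurableT_comp (continuous_measurable_fun cf) (nondecreasing_measurable measurableT qnd)).
- by exists 1; split; [exact: num_real|move=> M M1 x Dx; exact: le_trans (f1 _) (ltW M1)].
Qed.

Let g_split a b c : a <= c <= b -> rint g a b = rint g a c + rint g c b.
Proof.
move=> /andP[ac cb].
have := @Rintegral_itvB R g (BLeft a) (BRight b) c (g_int a b).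
rewrite !bnd_simp => /(_ ac cb) H.
rewrite /rint -(@Rintegral_itv_obnd_cbnd R c (BRight b)); first by rewrite -H addrC subrK.
have := g_int a b; apply: integrableS => //.
by apply: subset_itvr; rewrite bnd_simp.
Qed.

(** On each interval of the subdivision the error is at most [K / m] times the
increment of [q], and the increments add up to at most [B]. The rate does not
depend on [q], which allows it to be used along a sequence of quantile
functions. *)
Lemma monotone_riemann m : (0 < m)%N ->
  `|rint g 0 1 - m%:R^-1 * \sum_(j < m) f (q (j%:R / m%:R))| <= K * B / m%:R.
Proof.
move=> m0; have mp : 0 < m%:R :> R by rewrite ltr0n.
have main k : (k <= m)%N ->
  `|rint g 0 (k%:R / m%:R) - m%:R^-1 * \sum_(j < k) f (q (j%:R / m%:R))| <=
    K / m%:R * (q (k%:R / m%:R) - q 0).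
  elim: k => [_|k IH km].
    rewrite big_ord0 mulr0 mul0r subrr mulr0 /rint set_itv1 Rintegral_set1 subrr normr0//.
  have {}IH := IH (ltnW km).
  have kk : k%:R / m%:R <= k.+1%:R / m%:R :> R by rewrite ler_pM2r ?invr_gt0// ler_nat.
  rewrite (g_split (c := k%:R / m%:R)); last by rewrite kk divr_ge0// ltW.
  rewrite big_ord_recr/= mulrDr.
  set S := m%:R^-1 * \sum_(_ < _) _ in IH *; clearbody S.
  set a := k%:R / m%:R in kk IH *; set b := k.+1%:R / m%:R in kk *.
  set A := rint g 0 a in IH *.
  have ba : b - a = m%:R^-1 by rewrite /a /b -mulrBl -natr1 addrAC subrr add0r mul1r.
  set d := K * (q b - q a).
  have gd x : a <= x <= b -> f (q a) - d <= g x <= f (q a) + d.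
    move=> /andP[ax xb]; rewrite -ler_distl /g distrC.
    apply: le_trans (fK _ _) _; apply: ler_wpM2l => //.
    rewrite ler0_norm ?subr_le0 ?qnd// opprB; apply: lerB => //; exact: qnd.
  have cint0 c : leb.-integrable `[a, b] (EFin \o (fun=> c : R)).
    by apply: cont_on_integrable; exact: cont_on_cst.
  have lo : (f (q a) - d) * m%:R^-1 <= rint g a b.
    rewrite -ba -rint_cst//; apply: le_Rintegral => //.
    by move=> x /=; rewrite in_itv/= => /gd/andP[].
  have hi : rint g a b <= (f (q a) + d) * m%:R^-1.
    rewrite -ba -rint_cst//; apply: le_Rintegral => //.
    by move=> x /=; rewrite in_itv/= => /gd/andP[].
  have -> : K / m%:R * (q b - q 0) = K / m%:R * (q a - q 0) + d * m%:R^-1 by rewrite /d; ring.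
  rewrite opprD addrACA; apply: le_trans (ler_normD _ _) _; apply: lerD => //.
  rewrite ler_norml; move: lo hi; rewrite mulrBl mulrDl [m%:R^-1 * _]mulrC.
  by move=> lo hi; apply/andP; split; lra.
have := main m (leqnn m); rewrite mulfV ?gt_eqF//; move/le_trans; apply.
rewrite mulrAC; apply: ler_wpM2r; first by rewrite invr_ge0 ltW.
apply: ler_wpM2l => //; have /andP[h1 _] := qB 0; have /andP[_ h2] := qB 1; lra.
Qed.

End MonotoneRiemann.

(** Limits along an ultrafilter exist for bounded sequences; they replace the
extraction of convergent subsequences, and choose the limits of all the
quantile functions at once. *)
Lemma ultra_limit (U : set_system nat) (f : nat -> R) a b : UltraFilter U ->
  (forall n, a <= f n <= b) -> exists2 l, a <= l <= b & f n @[n --> U] --> l.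
Proof.
move=> UU fab.
have [|l [lab cl]] := @segment_compact R a b (f @ U) _.
  have H : U [set n | a <= f n <= b] by apply: (filterS _ (@filterT _ U _)) => n _; exact: fab.
  change (U (f @^-1` `[a, b]%classic)); apply: filterS H => n h.
  rewrite /= in_itv/=; exact: h.
exists l; first by move: lab; rewrite /= in_itv/=.
move=> A Al; have [//|H] := in_ultra_setVsetC (f @^-1` A) UU.
by have [x []] := cl (~` A) A H Al.
Qed.

Lemma cis_lip (x y : R) : modulus (cis x - cis y) <= 2 * `|x - y|.
Proof.
have -> : cis x - cis y = cis y * (cis (x - y) - 1).
  by rewrite mulrBr mulr1 -cisD; have -> : y + (x - y) = x by ring.
by rewrite mod_cisM; exact: cis_sub1.
Qed.

(** The quantile function of the uniform measure on the points of a sorted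
sequence [s]; weak limits of measures become pointwise limits of these
nondecreasing functions. *)
Definition quantile (s : seq R) (u : R) : R :=
  nth 0 s (minn (Num.truncn ((size s)%:R * clamp u)) (size s).-1).

Lemma quantile_nd s : (0 < size s)%N -> sorted <=%R s -> nondecreasing_fun (quantile s).
Proof.
move=> s0 ss u v uv; rewrite /quantile; apply: sorted_leq_nth => //.
- exact: le_trans.
- by rewrite inE; apply: leq_ltn_trans (geq_minr _ _) _; rewrite prednK.
- by rewrite inE; apply: leq_ltn_trans (geq_minr _ _) _; rewrite prednK.
rewrite leq_min geq_minr andbT; apply: leq_trans (geq_minl _ _) _.
apply: le_truncn; apply: ler_wpM2l => //; exact: clamp_le.
Qed.

Lemma quantile_in s u : (0 < size s)%N -> quantile s u \in s.
Proof.
move=> s0; rewrite /quantile; apply: mem_nth.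
by apply: leq_ltn_trans (geq_minr _ _) _; rewrite prednK.
Qed.

Lemma quantile_grid s j : (j < size s)%N -> quantile s (j%:R / (size s)%:R) = nth 0 s j.
Proof.
move=> js; have s0 : (0 < size s)%N by apply: leq_ltn_trans js.
have sR : 0 < (size s)%:R :> R by rewrite ltr0n.
rewrite /quantile clamp_id; last first.
  by apply/andP; split; [exact: divr_ge0|rewrite ler_pdivrMr// mul1r ler_nat ltnW].
rewrite mulrC divfK ?gt_eqF// natrK.
by congr nth; apply/minn_idPl; rewrite -ltnS prednK.
Qed.

End ArcMeasure.

(** * Sets of capacity zero have large discrete energies *)

Section EnergyLarge.
Context {R : realType}.
Local Notation leb := (@lebesgue_measure R).
Implicit Types (p M N n k L : nat) (F E : set (cplane R)).

Definition angles_of E : set R := [set t | E (cis t) /\ 0 <= t <= 2 * pi].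

Lemma cvg_ord_sum (U : set_system nat) (FU : Filter U) m (a : nat -> nat -> R) (l : nat -> R) :
  (forall j, a j k @[k --> U] --> l j) -> (\sum_(j < m) a j k) @[k --> U] --> \sum_(j < m) l j.
Proof.
move=> al; elim: m => [|m IH].
  by rewrite big_ord0; under eq_fun do rewrite big_ord0; exact: cvg_cst.
rewrite big_ord_recr/=; under eq_fun do rewrite big_ord_recr/=.
by apply: cvgD.
Qed.

(** The average over the points is the Riemann sum of [f \o quantile] with as
many intervals as points; by [monotone_riemann] it is close to the Riemann sum
with a fixed number [m] of intervals, where the limit is taken termwise. *)
Lemma average_limit (U : set_system nat) (s : nat -> seq R) (q f : R -> R) (B K : R) :
  UltraFilter U -> \oo `<=` U -> 0 <= B ->
  (forall k, sorted <=%R (s k)) -> (forall k, (k < size (s k))%N) ->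
  (forall k x, x \in s k -> 0 <= x <= B) ->
  nondecreasing_fun q -> (forall u, 0 <= q u <= B) ->
  (forall u, quantile (s k) u @[k --> U] --> q u) ->
  (forall x y, `|f x - f y| <= K * `|x - y|) -> (forall x, `|f x| <= 1) ->
  continuous f -> 0 <= K ->
  ((size (s k))%:R^-1 * \sum_(x <- s k) f x) @[k --> U] --> rint (fun u => f (q u)) 0 1.
Proof.
move=> UU ooU B0 ss sk sB qnd qB qk fK f1 cf K0.
have PF : ProperFilter U := @ultra_proper _ U UU.
apply/cvgrPdist_lt => e e0.
have KB : 0 <= K * B by rewrite mulr_ge0.
pose m := (Num.truncn (K * B / (e / 4))).+1.
have m0 : (0 < m)%N by [].
have mR : 0 < m%:R :> R by rewrite ltr0n.
have e4 : 0 < e / 4 by rewrite divr_gt0.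
have dm : K * B / m%:R < e / 4.
  rewrite ltr_pdivrMr// [_ * m%:R]mulrC -ltr_pdivrMr//.
  by have /andP[_] := truncn_itv (divr_ge0 KB (ltW e4)).
pose T (qq : R -> R) : R := m%:R^-1 * \sum_(j < m) f (qq (j%:R / m%:R)).
have Tk : T (quantile (s k)) @[k --> U] --> T q.
  apply: cvgMr; apply: (@cvg_ord_sum U _ m (fun j k => f (quantile (s k) (j%:R / m%:R))) (fun j => f (q (j%:R / m%:R)))) => j.
  exact: (cvg_comp _ _ (qk _) (cf _)).
have s0 k : (0 < size (s k))%N by apply: leq_ltn_trans (sk k).
have q1 : `|rint (fun u => f (q u)) 0 1 - T q| <= K * B / m%:R by exact: monotone_riemann.
have rk n k : (0 < n)%N -> `|rint (fun u => f (quantile (s k) u)) 0 1 -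
    n%:R^-1 * \sum_(j < n) f (quantile (s k) (j%:R / n%:R))| <= K * B / n%:R.
  move=> n0; apply: monotone_riemann => //; first exact: quantile_nd.
  by move=> u; apply: (sB k); exact: quantile_in.
have avE k : (size (s k))%:R^-1 * \sum_(x <- s k) f x =
    (size (s k))%:R^-1 * \sum_(j < size (s k)) f (quantile (s k) (j%:R / (size (s k))%:R)).
  congr (_ * _); rewrite (big_nth 0) big_mkord; apply: eq_bigr => j _.
  by rewrite quantile_grid.
have near_m : U [set k | (m <= k)%N] by apply: ooU; exists m.
have near_T : U [set k | `|T q - T (quantile (s k))| < e / 4] by move/cvgr_dist_lt : Tk; exact.
apply: filterS (filterI near_m near_T) => k [/= mk dT].
rewrite avE.
have h3 := rk _ k (s0 k); have h2 := rk m k m0.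
have dk : K * B / (size (s k))%:R <= K * B / m%:R.
  apply: ler_wpM2l => //; rewrite lef_pV2 ?posrE ?ltr0n// ler_nat.
  by rewrite ltnW// (leq_ltn_trans mk).
rewrite -/(T (quantile (s k))) in h2.
move: h3 dk; set A := _^-1 * _; set I1 := rint _ 0 1 in q1 *.
set I2 := rint _ 0 1 in h2 * => h3 dk.
move: (T q) (T (quantile (s k))) q1 h2 dT h3 dk dm => t1 t2.
move: (K * B / m%:R) (K * B / _) => d1 d2.
rewrite !ler_norml !ltr_norml => /andP[? ?] /andP[? ?] /andP[? ?] /andP[? ?] ? ?.
by apply/andP; split; lra.
Qed.

Lemma sin_cos_lip n (x y : R) :
  `|cos (n%:R * x) - cos (n%:R * y)| <= 2 * n%:R * `|x - y| /\
  `|sin (n%:R * x) - sin (n%:R * y)| <= 2 * n%:R * `|x - y|.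
Proof.
have := cis_lip (n%:R * x) (n%:R * y).
rewrite -mulrBr normrM ger0_norm// mulrA => H.
split; apply: le_trans H.
  by apply: le_trans (Re_le _); rewrite ReD ReN.
by apply: le_trans (Im_le _); rewrite ImD ImN.
Qed.

(** Moments do not depend on the order of the points, so these may be sorted. *)
Lemma moment_codom N (th : 'I_N -> R) n : let s := sort <=%R (codom th) in
  modulus (moment_of th n) ^+ 2 = ((size s)%:R^-1 * \sum_(x <- s) cos (n%:R * x)) ^+ 2 +
    ((size s)%:R^-1 * \sum_(x <- s) sin (n%:R * x)) ^+ 2.
Proof.
move=> s; have sz : size s = N by rewrite size_sort size_codom card_ord.
have sE (f : R -> R) : \sum_(x <- s) f x = \sum_j f (th j).
  have pm : perm_eq s (codom th) by rewrite perm_sort.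
  by rewrite (perm_big _ pm)/= codomE big_map big_enum.
rewrite sz !sE mod_sqr /moment_of Re_rcM Im_rcM Re_sum Im_sum; congr (_ ^+ 2 + _).
  by congr (_ * _); apply: eq_bigr => j _; rewrite /= cosN.
rewrite -sqrrN -mulrN -sumrN; congr ((_ * _) ^+ 2); apply: eq_bigr => j _.
by rewrite /= sinN opprK.
Qed.

(** Otherwise there are, for every [p], at least [Nf p] points of [E] with
smeared energy at most [C]. Along an ultrafilter their sorted angles converge to
a quantile function with values in the closed set of angles of [E], which gives
a probability measure on [E]. Each arc weight tends to 1, so every partial sum
of the energy of the limit is at most [C], contrary to zero capacity. *)
Lemma energy_large E (Mf Nf : nat -> nat) (C : R) p0 : closed E -> log_capacity E = 0%E ->
  (forall p, p <= Mf p)%N -> (forall p, p <= Nf p)%N ->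
  exists2 p, (p0 < p)%N & forall N (th : 'I_N -> R), (Nf p <= N)%N ->
    (forall j, angles_of E (th j)) -> C < arc_energy p (Mf p) th.
Proof.
move=> cE capE pM pN; apply: contrapT => neg.
pose ca (s : seq R) n : R := (size s)%:R^-1 * \sum_(x <- s) cos (n%:R * x).
pose sa (s : seq R) n : R := (size s)%:R^-1 * \sum_(x <- s) sin (n%:R * x).
have Hk k : exists s : seq R, [/\ sorted <=%R s, (k < size s)%N,
    (forall x, x \in s -> angles_of E x) & forall L, (L <= k)%N ->
    \sum_(i < L) (1 - 8 * (i.+1%:R * harmonic k)) * (ca s i.+1 ^+ 2 + sa s i.+1 ^+ 2) / i.+1%:R <= C].
  pose p := (p0 + k).+1.
  have [N [th [NN Sth JC]]] : exists N, exists th : 'I_N -> R, [/\ (Nf p <= N)%N,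
     forall j, angles_of E (th j) & arc_energy p (Mf p) th <= C].
    apply: contrapT => H; apply: neg; exists p; first by rewrite ltnS leq_addr.
    move=> N th NN Sth; rewrite ltNge; apply/negP => JC; apply: H.
    by exists N, th.
  exists (sort <=%R (codom th)); split.
  - exact: sort_le_sorted.
  - rewrite size_sort size_codom card_ord; apply: leq_trans (leq_trans (pN p) NN).
    by rewrite ltnS leq_addl.
  - by move=> x; rewrite mem_sort => /codomP[j ->].
  move=> L Lk; apply: le_trans JC.
  pose a n := arc_weight p%:R^-1 n.+1 / n.+1%:R * modulus (moment_of th n.+1) ^+ 2.
  have a0 n : 0 <= a n by rewrite mulr_ge0 ?sqr_ge0// divr_ge0// arc_weight_ge0.
  have LM : (L <= Mf p)%N.
    by apply: leq_trans (pM p); rewrite (leq_trans Lk)// ltnW// ltnS leq_addl.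
  apply: le_trans (ler_sum_widen a0 LM); apply: ler_sum => i _.
  rewrite /a (moment_codom th i.+1) -/(ca _ i.+1) -/(sa _ i.+1) mulrAC.
  apply: ler_wpM2r; first by rewrite addr_ge0 ?sqr_ge0.
  apply: ler_wpM2r; first by rewrite invr_ge0.
  apply: le_trans (arc_weight_near1 i.+1 _); last by rewrite invr_ge0.
  rewrite lerD2l lerN2 ler_pM2l// ler_pM2l ?ltr0n//.
  by rewrite lef_pV2 ?posrE ?ltr0n// ler_nat ltnS leq_addl.
have [s Hs] := choice Hk.
have [U [UU ooU]] := @ultraFilterLemma nat \oo _.
have PF : ProperFilter U := @ultra_proper _ U UU.
have sS k : sorted <=%R (s k) by have [] := Hs k.
have sk k : (k < size (s k))%N by have [] := Hs k.
have s0 k : (0 < size (s k))%N by apply: leq_ltn_trans (sk k).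
have sE k x : x \in s k -> angles_of E x by have [_ _ + _] := Hs k; exact.
have sB k x : x \in s k -> 0 <= x <= 2 * pi by move=> /sE[].
have Hq u : exists l : R, 0 <= l <= 2 * pi /\ quantile (s k) u @[k --> U] --> l.
  have [|l l1 l2] := @ultra_limit R U (fun k => quantile (s k) u) 0 (2 * pi) UU.
    by move=> k; apply: (sB k); exact: quantile_in.
  by exists l.
have [q qH] := choice Hq.
have qB u : 0 <= q u <= 2 * pi by have [] := qH u.
have qk u : quantile (s k) u @[k --> U] --> q u by have [] := qH u.
have qnd : nondecreasing_fun q.
  move=> u v uv; apply: (ler_cvg_to (qk u) (qk v)).
  by apply: nearW => k; exact: quantile_nd.
have qE u : E (cis (q u)).
  have cc := cvg_comp _ _ (qk u) (@continuous_cis R (q u)).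
  apply: (@closed_cvg _ _ U _ (fun k => cis (quantile (s k) u)) E cE _ _ cc).
  by apply: nearW => k; have [] := sE k _ (quantile_in u (s0 k)).
have avl f K := @average_limit U s q f (2 * pi) K UU ooU (@twopi_ge0 R) sS sk sB qnd qB qk.
pose Ic n : R := rint (fun u => cos (n%:R * q u)) 0 1.
pose Is n : R := rint (fun u => sin (n%:R * q u)) 0 1.
have nc n : continuous (fun x : R => n%:R * x) by move=> x; exact: mulrl_continuous.
have cac n : ca (s k) n @[k --> U] --> Ic n.
  apply: (@avl (fun x => cos (n%:R * x)) (2 * n%:R)).
  - by move=> x y; have [] := sin_cos_lip n x y.
  - by move=> x; rewrite ler_norml cos_geN1 cos_le1.
  - by move=> x; apply: continuous_comp; [exact: nc|exact: continuous_cos].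
  - by rewrite mulr_ge0.
have sac n : sa (s k) n @[k --> U] --> Is n.
  apply: (@avl (fun x => sin (n%:R * x)) (2 * n%:R)).
  - by move=> x y; have [] := sin_cos_lip n x y.
  - by move=> x; rewrite ler_norml sin_geN1 sin_le1.
  - by move=> x; apply: continuous_comp; [exact: nc|exact: continuous_sin].
  - by rewrite mulr_ge0.
have harm : (harmonic k : R) @[k --> U] --> (0 : R).
  by move=> A /(@cvg_harmonic R)/ooU.
have lim i : ((1 - 8 * (i.+1%:R * harmonic k)) * (ca (s k) i.+1 ^+ 2 + sa (s k) i.+1 ^+ 2) / i.+1%:R)
    @[k --> U] --> (Ic i.+1 ^+ 2 + Is i.+1 ^+ 2) / i.+1%:R.
  apply: cvgMl.
  rewrite -[X in _ --> X]mul1r; apply: cvgM.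
    rewrite -[X in _ --> X]subr0; apply: cvgB; first exact: cvg_cst.
    have -> : (0 : R) = 8 * (i.+1%:R * 0) by rewrite !mulr0.
    by apply: cvgMr; apply: cvgMr.
  exact: (cvgD (cvgM (cac i.+1) (cac i.+1)) (cvgM (sac i.+1) (sac i.+1))).
have bound L : \sum_(i < L) (Ic i.+1 ^+ 2 + Is i.+1 ^+ 2) / i.+1%:R <= C.
  have cs := @cvg_ord_sum U _ L _ _ lim.
  apply: (ler_cvg_to (cs _) (cvg_cst C)).
  by apply: ooU; exists L => // k /= Lk; have [_ _ _] := Hs k; exact.
have [mu muE fc] := @angle_probability R 1 (fun _ => q) E (ltn0Sn 0)
  (fun _ => nondecreasing_measurable measurableT qnd) (fun _ => qE).
have leC : (log_energy mu <= C%:E)%E.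
  apply: (energy_partial_le (a := fun i => (Ic i.+1 ^+ 2 + Is i.+1 ^+ 2) / i.+1%:R)) bound => n.
  congr (_ / _); rewrite fc mod_sqr !big_ord_recl !big_ord0 !addr0 invr1 !mul1r.
  rewrite -[complex.Re (Complex _ _)]/(Ic n.+1) -[complex.Im (Complex _ _)]/(rint (fun u => - sin (n.+1%:R * q u)) 0 1).
  congr (_ + _); rewrite -sqrrN; congr (_ ^+ 2).
  have si : leb.-integrable `[0, 1] (EFin \o (fun u => sin (n.+1%:R * q u))).
    apply: measurable_bounded_integrable => //.
    - have : (leb `[0%R, 1%R] < +oo)%E; last by [].
      by rewrite lebesgue_measure_itv; case: ifP => _; rewrite ?ltry// -EFinB ltry.
    - apply: (measurable_funS measurableT) => //.
      have ms : measurable_fun setT (fun x : R => sin (n.+1%:R * x)).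
        apply: continuous_measurable_fun => x; apply: continuous_comp; [exact: nc|exact: continuous_sin].
      exact: (measurableT_comp ms (nondecreasing_measurable measurableT qnd)).
    - exists 1; split; [exact: num_real|move=> M M1 x Dx].
      by apply: le_trans (ltW M1); rewrite ler_norml sin_geN1 sin_le1.
  have := @RintegralZl _ _ _ leb _ _ (-1) (measurable_itv `[0%R, 1%R]) si.
  move=> H; rewrite /Is /rint.
  have -> : \int[leb]_(x in `[0, 1]) sin (n.+1%:R * q x) =
    - (-1 * \int[leb]_(x in `[0, 1]) sin (n.+1%:R * q x)) by rewrite mulN1r opprK.
  by rewrite -H; congr (- _); apply: eq_Rintegral => u _; rewrite mulN1r.
have : ereal_inf [set log_energy mu | mu in [set mu : probability borel_plane R | mu E = 1%E]] = +oo%E.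
  by apply/eqP; rewrite -inve_eq0; apply/eqP; exact: capE.
move=> infE.
have : (+oo <= log_energy mu)%E by rewrite -infE; apply: ereal_inf_lbound; exists mu.
by move=> /le_trans/(_ leC); rewrite leye_eq.
Qed.

End EnergyLarge.

(** * Potentials adapted to a set of capacity zero *)

Section GoodPotential.
Context {R : realType}.
Implicit Types (p M N n : nat) (E F : set (cplane R)) (G : cplane R -> cplane R) (z w : cplane R).

Definition far_from E (d : R) z := forall y, E y -> d <= modulus (y - z).

(** What the construction uses of a potential [G] of height [V] on [E]: it is
a polynomial vanishing at 0 with controlled coefficients, with real part bounded
below and bounded imaginary part; it is bounded at distance at least [rho] from
[E], at least [V - 2] on [E], and its energy is at most a multiple of [V]. By
[gp_measure], any set containing the points of the circle where [Re G] is
nearly [V] carries a probability measure of energy at most [V + 1]. *)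
Record good_potential E (rho V : R) G : Prop := GoodPotential {
  gp_poly : exists2 b : nat -> cplane R, (forall i, modulus (b i) <= 4 / i.+1%:R) &
     exists M, G = power_poly b M;
  gp_bounds : forall z, modulus z <= 1 -> - 3 <= complex.Re (G z) /\ `|complex.Im (G z)| <= 3;
  gp_far : forall z d, modulus z <= 1 -> 0 < d -> rho <= d -> far_from E d z ->
     complex.Re (G z) <= 4 / d + 1;
  gp_on : forall z, E z -> V - 2 <= complex.Re (G z);
  gp_energy : (energy G <= (4 * areaR * V)%:E)%E;
  gp_measure : forall F, (forall z, unit_circle z -> V - 18 <= complex.Re (G z) -> F z) ->
     exists2 mu : probability borel_plane R, mu F = 1%E & (log_energy mu <= (V + 1)%:E)%E }.

Lemma close_lower (x y V : R) : `|x - y| <= 16 -> V - 2 <= x -> V - 18 <= y.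
Proof. by rewrite ler_norml => /andP[_]; lra. Qed.

(** Smoothed potentials of near minimizers with [16 p] points. The energy
exceeds [C] for suitable large [p] by [energy_large]. The measure is the
smeared one: the arcs have length [1 / p] and start in [E], and the potential
is Lipschitz with constant [8 p], so it drops by at most 16 along them. *)
Lemma good_potential_exists E (C rho : R) : closed E -> E `<=` unit_circle -> E !=set0 ->
  log_capacity E = 0%E -> 0 < rho -> exists V G, C < V /\ good_potential E rho V G.
Proof.
move=> cE EC [z0 Ez0] capE rho0.
have hp p : exists M0, (0 < p)%N -> forall M N (th : 'I_N -> R) z, (M0 <= M)%N -> (0 < N)%N -> modulus z <= 1 ->
  [/\ - 3 <= complex.Re (potential p M th z), `|complex.Im (potential p M th z)| <= 3 &
   forall d, 0 < d -> 6 / p%:R <= d -> (forall j, d <= modulus (cis (th j) - z)) ->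
     complex.Re (potential p M th z) <= 4 / d + 1].
  case: p => [|p]; first by exists 0%N.
  by have [M0 H] := @potential_bounds R p.+1 isT; exists M0.
have [Mb HM] := choice hp.
(* degree large enough for the kernel bounds and for the tail of the energy;
   [16 p] points for the variation of one point *)
pose Mf p := (Mb p + 4 * p ^ 2 + p)%N; pose Nf p := (16 * p)%N.
have [p pp JC] := @energy_large R E Mf Nf C (Num.truncn (6 / rho)) cE capE
  (fun p => leq_addl _ _) (fun p => leq_pmull p (isT : 0 < 16)%N).
have p0 : (0 < p)%N by apply: leq_ltn_trans pp.
have pR : 0 < p%:R :> R by rewrite ltr0n.
have prho : 6 / p%:R <= rho.
  have /andP[_ h] := truncn_itv (divr_ge0 (ler0n R 6) (ltW rho0)).
  rewrite ler_pdivrMr// mulrC -ler_pdivrMr//; apply: (le_trans (ltW h)).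
  by rewrite ler_nat.
have S0 : angles_of E !=set0.
  have [t tt zt] := arg_exists (EC _ Ez0); exists t; split => //; by rewrite -zt.
have N0 : (0 < Nf p)%N by rewrite muln_gt0.
set M := Mf p in JC *.
have [th [Sth min]] := @near_minimizer R p M (Nf p) (angles_of E) p0 N0 (leqnn _) S0.
have {}JC := JC (Nf p) th (leqnn _) Sth.
set V := arc_energy p M th in JC min.
have MM : (Mb p <= M)%N by rewrite /M /Mf -addnA leq_addr.
have bd z (z1 : modulus z <= 1) := HM p p0 M (Nf p) th z MM N0 z1.
have onE z : E z -> V - 2 <= complex.Re (potential p M th z).
  move=> Ez; have [t tt zt] := arg_exists (EC _ Ez).
  rewrite zt; apply: min; split => //; by rewrite -zt.
exists V, (potential p M th); split => //; split.
- exists (fun i => rc (arc_weight p%:R^-1 i.+1 / i.+1%:R) * moment_of th i.+1); last by exists M.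
  move=> i; rewrite mod_rcM; last by apply: divr_ge0; [exact: arc_weight_ge0|exact: ler0n].
  rewrite -[leRHS]mulr1; apply: ler_pM; rewrite ?mod_ge0//.
  + by apply: divr_ge0; [exact: arc_weight_ge0|exact: ler0n].
  + by apply: ler_wpM2r; [rewrite invr_ge0|exact: arc_weight_le4].
  + exact: mod_moment.
- by move=> z /bd[].
- move=> z d z1 d0 rd far; have [_ _ H] := bd z z1.
  apply: H => //; first exact: le_trans rd.
  by move=> j; apply: far; have [] := Sth j.
- exact: onE.
- exact: potential_energy.
move=> F FF; apply: (arc_measure (th := th) (F := F) p0 N0).
  by rewrite /M /Mf -addnA [(4 * _ + _)%N]addnC addnA leq_addl.
move=> j v /andP[v0 v1]; have [Ej _] := Sth j.
apply: FF; first exact: mod_cis.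
have L := potential_lip M th p0 N0 (z := cis (th j)) (w := cis (th j + v / p%:R)).
rewrite !mod_cis in L.
have {}L := le_trans (Re_le _) (L (lexx 1) (lexx 1)).
have d2 : modulus (cis (th j) - cis (th j + v / p%:R)) <= 2 / p%:R.
  apply: le_trans (cis_lip _ _) _; rewrite opprD addrA subrr add0r normrN ler_pM2l//.
  rewrite ger0_norm ?divr_ge0//; first by rewrite -[leRHS]mul1r ler_wpM2r ?invr_ge0.
have {}L : `|complex.Re (potential p M th (cis (th j))) - complex.Re (potential p M th (cis (th j + v / p%:R)))| <= 16.
  rewrite -ReN -ReD; apply: le_trans L _.
  have -> : 16 = 8 * p%:R * (2 / p%:R) :> R by field; rewrite gt_eqF.
  by apply: ler_wpM2l => //; rewrite mulr_ge0.
exact: (close_lower L (onE _ Ej)).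
Qed.

End GoodPotential.

Section Series.
Context {R : realType}.
Implicit Types (a : nat -> cplane R) (z w : cplane R).

Definition half_pow (j : nat) : R := 2^-1 ^+ j.

Lemma half_powS j : half_pow j.+1 = half_pow j / 2.
Proof. by rewrite /half_pow exprSr. Qed.

Lemma half_pow_gt0 j : 0 < half_pow j.
Proof. by rewrite exprn_gt0// invr_gt0. Qed.

Lemma half_pow_le j k : (j <= k)%N -> half_pow k <= half_pow j.
Proof.
move=> /subnK <-; elim: (k - j)%N => [|n IH]; first exact: lexx.
by rewrite addSn half_powS; have := half_pow_gt0 (n + j); lra.
Qed.

Lemma half_pow_small (A e : R) : 0 < e -> exists J, forall K, (J <= K)%N -> A * half_pow K < e.
Proof.
move=> e0.
have hp n : half_pow n <= n.+1%:R^-1.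
  elim: n => [|n IH]; first by rewrite /half_pow expr0 invr1.
  rewrite half_powS; apply: le_trans (ler_wpM2r _ IH) _; first by rewrite invr_ge0.
  by rewrite -invfM lef_pV2 ?posrE ?mulr_gt0// -natrM ler_nat muln2 doubleS !ltnS -addnn leq_addr.
have A0 : 0 <= `|A| / e by rewrite divr_ge0// ltW.
exists (Num.truncn (`|A| / e)) => K JK.
have /andP[_ h] := truncn_itv A0.
apply: (@le_lt_trans _ _ (`|A| * K.+1%:R^-1)).
  apply: (@le_trans _ _ (`|A| * half_pow K)); first by rewrite ler_wpM2r ?ler_norm// ltW ?half_pow_gt0.
  by apply: ler_wpM2l; [exact: normr_ge0|exact: hp].
rewrite ltr_pdivrMr// mulrC -ltr_pdivrMr//; apply: (lt_le_trans h).
by rewrite ler_nat.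
Qed.

Lemma le_limit (x y A : R) J0 : (forall J, (J0 <= J)%N -> x <= y + A * half_pow J) -> x <= y.
Proof.
move=> H; rewrite leNgt; apply/negP => yx.
have xy0 : 0 < x - y by rewrite subr_gt0.
have [J HJ] := half_pow_small A xy0.
have := H (J0 + J)%N (leq_addr _ _); have := HJ (J0 + J)%N (leq_addl _ _); lra.
Qed.

(** The limit is taken with an explicit rate, as the supremum of the lower
bounds. *)
Lemma real_geometric_limit (u : nat -> R) (A : R) J0 : 0 <= A ->
  (forall j, (J0 <= j)%N -> `|u j.+1 - u j| <= A * half_pow j) ->
  exists l, forall J, (J0 <= J)%N -> `|u J - l| <= 2 * A * half_pow J.
Proof.
move=> A0 H.
have step J n : (J0 <= J)%N -> `|u (J + n)%N - u J| <= 2 * A * (half_pow J - half_pow (J + n)).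
  move=> JJ; elim: n => [|n IH]; first by rewrite addn0 !subrr normr0 mulr0.
  rewrite addnS; have := H (J + n)%N (leq_trans JJ (leq_addr _ _)).
  rewrite half_powS => h.
  have -> : u (J + n).+1 - u J = (u (J + n).+1 - u (J + n)%N) + (u (J + n)%N - u J) by ring.
  apply: le_trans (ler_normD _ _) _; apply: le_trans (lerD h IH) _; lra.
have bnd J K : (J0 <= J)%N -> (J0 <= K)%N -> u J - 2 * A * half_pow J <= u K + 2 * A * half_pow K.
  move=> JJ KK; have hJ := half_pow_gt0 J; have hK := half_pow_gt0 K.
  have [JK|/ltnW KJ] := leqP J K.
    have := step J (K - J)%N JJ; rewrite subnKC// ler_norml => /andP[h1 h2].
    have := mulr_ge0 A0 (ltW hK); lra.
  have := step K (J - K)%N KK; rewrite subnKC// ler_norml => /andP[h1 h2].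
  have := mulr_ge0 A0 (ltW hJ); lra.
pose S := [set u J - 2 * A * half_pow J | J in [set J | (J0 <= J)%N]].
have hS : has_sup S.
  split; first by exists (u J0 - 2 * A * half_pow J0); exists J0 => /=.
  exists (u J0 + 2 * A * half_pow J0) => _ [J /= JJ <-]; exact: bnd.
exists (sup S) => J JJ; rewrite ler_distl; apply/andP; split.
  by rewrite lerBlDr; apply: sup_le_ub; [case: hS|move=> _ [K /= KK <-]; exact: bnd].
suff : u J - 2 * A * half_pow J <= sup S by lra.
by apply: ub_le_sup; [case: hS|exists J].
Qed.

Lemma geometric_limit (s : nat -> cplane R) (A : R) J0 : 0 <= A ->
  (forall j, (J0 <= j)%N -> modulus (s j.+1 - s j) <= A * half_pow j) ->
  exists l, forall J, (J0 <= J)%N -> modulus (s J - l) <= 4 * A * half_pow J.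
Proof.
move=> A0 H.
have [|x Hx] := @real_geometric_limit (fun j => complex.Re (s j)) A J0 A0.
  by move=> j /H; apply: le_trans; apply: le_trans (Re_le _); rewrite ReD ReN.
have [|y Hy] := @real_geometric_limit (fun j => complex.Im (s j)) A J0 A0.
  by move=> j /H; apply: le_trans; apply: le_trans (Im_le _); rewrite ImD ImN.
exists (Complex x y) => J JJ; apply: le_trans (mod_le _) _.
rewrite ReD ImD ReN ImN/=; apply: le_trans (lerD (Hx J JJ) (Hy J JJ)) _; lra.
Qed.

(** The Cauchy-Schwarz inequality with geometric weights: no factor depending on
the number of terms appears. *)
Lemma sqr_sum_weighted n a :
  modulus (\sum_(j < n) a j) ^+ 2 <= \sum_(j < n) (2 ^+ j.+1) * modulus (a j) ^+ 2.
Proof.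
elim: n a => [|n IH] a; first by rewrite !big_ord0 mod0 expr0n.
rewrite !big_ord_recl/=; have h := modD (a 0%N) (\sum_(i < n) a (lift ord0 i)).
apply: le_trans (sqr_le_add (mod_ge0 _) h) _; rewrite mulrDr expr1; apply: lerD => //.
apply: le_trans (ler_wpM2l _ (IH (fun j => a j.+1))) _ => //.
by rewrite mulr_sumr; apply: ler_sum => i _; rewrite mulrA -exprS.
Qed.

End Series.

(** * Quadratic remainders of power sums *)

Section PolynomialRemainder.
Context {R : realType}.
Implicit Types (b : nat -> cplane R) (z w h : cplane R).

Definition power_poly_der b M z : cplane R := plain_poly (fun i => b i * i.+1%:R) M z.

(** By induction on [n], multiplying the remainder by [w]. *)
Lemma monomial_remainder (r : R) n z w : modulus z <= r -> modulus w <= r ->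
  modulus (w ^+ n.+1 - z ^+ n.+1 - n.+1%:R * z ^+ n * (w - z)) <=
  n.+1%:R * (n%:R * r ^+ n.-1) * modulus (w - z) ^+ 2.
Proof.
move=> zr wr; have r0 : 0 <= r := le_trans (mod_ge0 z) zr.
elim: n => [|n IH].
  have -> : w ^+ 1 - z ^+ 1 - 1%:R * z ^+ 0 * (w - z) = 0 by rewrite !expr1 expr0; ring.
  by rewrite mod0 mul0r mulr0 mul0r.
have -> : w ^+ n.+2 - z ^+ n.+2 - n.+2%:R * z ^+ n.+1 * (w - z) =
   w * (w ^+ n.+1 - z ^+ n.+1 - n.+1%:R * z ^+ n * (w - z)) + n.+1%:R * z ^+ n * (w - z) ^+ 2.
  rewrite !exprS -[n.+2%:R]natr1; ring.
apply: le_trans (modD _ _) _; rewrite [n.+1.-1]/=.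
have E1 : modulus (n.+1%:R * z ^+ n * (w - z) ^+ 2) <= n.+1%:R * r ^+ n * modulus (w - z) ^+ 2.
  rewrite !modM -rc_nat mod_rc ger0_norm// !modX; apply: ler_wpM2r; first exact: sqr_ge0.
  by apply: ler_wpM2l => //; rewrite lerXn2r ?nnegrE ?mod_ge0.
have E2 : modulus (w * (w ^+ n.+1 - z ^+ n.+1 - n.+1%:R * z ^+ n * (w - z))) <=
    n.+1%:R * (n%:R * r ^+ n) * modulus (w - z) ^+ 2.
  rewrite modM; apply: le_trans (ler_pM (mod_ge0 _) (mod_ge0 _) wr IH) _.
  case: n {IH E1} => [|n]; first by rewrite !mul0r !mulr0 !mul0r mulr0.
  rewrite [n.+1.-1]/= [r ^+ n.+1]exprS le_eqVlt; apply/orP; left; apply/eqP; ring.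
apply: le_trans (lerD E2 E1) _.
have -> : n.+1%:R * (n%:R * r ^+ n) * modulus (w - z) ^+ 2 + n.+1%:R * r ^+ n * modulus (w - z) ^+ 2 =
   n.+1%:R * (n.+1%:R * r ^+ n) * modulus (w - z) ^+ 2.
  rewrite -[in RHS]natr1; ring.
apply: ler_wpM2r; first exact: sqr_ge0.
by apply: ler_wpM2r; [rewrite mulr_ge0 ?exprn_ge0|rewrite ler_nat].
Qed.

(** The bound depends on the radius only, not on the degree; it therefore
passes to the limit of a series and gives the derivative of the limit. *)
Lemma power_poly_remainder b M (r : R) z w : (forall i, modulus (b i) <= 4 / i.+1%:R) ->
  0 <= r < 1 -> modulus z <= r -> modulus w <= r ->
  modulus (power_poly b M w - power_poly b M z - power_poly_der b M z * (w - z)) <=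
  4 * (1 - r) ^- 2 * modulus (w - z) ^+ 2.
Proof.
move=> b4 rr zr wr; rewrite /power_poly /power_poly_der /plain_poly mulr_suml -!sumrB.
apply: le_trans (mod_sum _ _ _) _.
apply: (@le_trans _ _ (\sum_(i < M) 4 * (i%:R * r ^+ i.-1) * modulus (w - z) ^+ 2)).
  apply: ler_sum => i _.
  have -> : b i * w ^+ i.+1 - b i * z ^+ i.+1 - b i * i.+1%:R * z ^+ i * (w - z) =
     b i * (w ^+ i.+1 - z ^+ i.+1 - i.+1%:R * z ^+ i * (w - z)) by ring.
  rewrite modM; apply: le_trans (ler_pM (mod_ge0 _) (mod_ge0 _) (b4 i) (monomial_remainder i zr wr)) _.
  rewrite le_eqVlt; apply/orP; left; apply/eqP.
  have i0 : (i.+1%:R : R) != 0 by rewrite pnatr_eq0.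
  by move: (i.+1%:R : R) i0 => x x0; field.
rewrite -mulr_suml -mulr_sumr; apply: ler_wpM2r; first exact: sqr_ge0.
by apply: ler_wpM2l => //; exact: sum_derivative_geometric_le.
Qed.

Lemma power_poly_der_bound b M (r : R) z : (forall i, modulus (b i) <= 4 / i.+1%:R) ->
  0 <= r < 1 -> modulus z <= r -> modulus (power_poly_der b M z) <= 4 / (1 - r).
Proof.
move=> b4 rr zr; apply: le_trans (mod_sum _ _ _) _.
apply: (@le_trans _ _ (4 * \sum_(i < M) r ^+ i)); last first.
  by apply: ler_wpM2l => //; exact: geo_sum_le.
rewrite mulr_sumr; apply: ler_sum => i _; rewrite !modM modX -rc_nat mod_rc ger0_norm//.
apply: ler_pM; rewrite ?mulr_ge0 ?exprn_ge0 ?mod_ge0//.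
  by rewrite -ler_pdivlMr ?ltr0n.
by rewrite lerXn2r ?nnegrE ?mod_ge0//; case/andP: rr.
Qed.

Lemma cderiv_quadratic (F : cplane R -> cplane R) z (l : cplane R) (K r : R) : 0 < r ->
  (forall h, modulus h < r -> modulus (F (z + h) - F z - l * h) <= K * modulus h ^+ 2) -> cderiv F z l.
Proof.
move=> r0 H e e0.
have K1 : 0 < `|K| + 1 by have := normr_ge0 K; lra.
exists (Num.min r (e / (`|K| + 1))); first by rewrite lt_min r0 divr_gt0.
move=> h; rewrite lt_min => /andP[hr he]; apply: le_trans (H h hr) _.
rewrite expr2 mulrA; apply: ler_wpM2r; first exact: mod_ge0.
have := mod_ge0 h; move: he; rewrite ltr_pdivlMr// mulrC => he h0.
apply: le_trans (ltW he); apply: ler_wpM2r => //; have := ler_norm K; lra.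
Qed.

Lemma cderiv_near (F F1 : cplane R -> cplane R) z (l : cplane R) (r : R) : 0 < r ->
  (forall h, modulus h < r -> F (z + h) = F1 (z + h)) -> cderiv F z l -> cderiv F1 z l.
Proof.
move=> r0 H dF e e0; have [d d0 Hd] := dF e e0.
exists (Num.min r d); first by rewrite lt_min r0.
move=> h; rewrite lt_min => /andP[hr hd].
have z0 : modulus (0 : cplane R) < r by rewrite mod0.
have := H 0 z0; rewrite addr0 => <-; rewrite -H//; exact: Hd.
Qed.

Lemma power_poly_cderiv b M z : cderiv (power_poly b M) z (power_poly_der b M z).
Proof.
elim: M => [|M IH].
  have -> : power_poly b 0 = (fun=> 0) by apply/funext => w; rewrite /power_poly big_ord0.
  by rewrite /power_poly_der /plain_poly big_ord0; exact: cderiv_cst.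
have -> : power_poly b M.+1 = (fun w => power_poly b M w + b M * w ^+ M.+1).
  by apply/funext => w; rewrite /power_poly big_ord_recr.
rewrite /power_poly_der plain_poly_recr; apply: (cderivD IH).
apply: (cderiv_eq (cderivM (cderiv_cst z (b M)) (cderivX z M.+1))).
by rewrite mul0r add0r mulrA.
Qed.

End PolynomialRemainder.

Section ExpReal.
Context {R : realType}.

Lemma expR_small (x : R) : 0 <= x -> x <= 3 / 128 -> expR x <= 103 / 100.
Proof.
move=> x0 x1; have h := @expR_ge1Dx R (- x).
have : expR x * expR (- x) = 1 by rewrite -expRD subrr expR0.
have := expR_gt0 x; move: (expR x) (expR (- x)) h => a c h a0 ac; nra.
Qed.

(** With [w = exp (- g)], [1 - |1 - w| ^ 2 = 2 Re w - |w| ^ 2]; as the argument of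
[w] is small and its modulus is hardly above 1, this is at least [|w| / 2]. *)
Lemma one_sub_cexp (g : cplane R) : - (3 / 128) <= complex.Re g -> `|complex.Im g| <= 3 / 128 ->
  modulus (cexp (- g)) / 2 <= 1 - modulus (1 - cexp (- g)) ^+ 2.
Proof.
move=> gr gi.
have c1 : 1 - cos (complex.Im (- g)) <= 6 / 128.
  have := cis_sub1 (complex.Im (- g)); rewrite ImN normrN => h.
  have := Re_le (cis (- complex.Im g) - 1); rewrite ReD ReN/= ler_norml => /andP[+ _].
  by move: (modulus _) h => m h; lra.
have w1 : modulus (cexp (- g)) <= 103 / 100.
  rewrite mod_cexp ReN; have [g0|g0] := leP 0 (complex.Re g).
    by apply: (@le_trans _ _ 1); [rewrite -expR0 ler_expR oppr_le0|lra].
  by apply: expR_small; lra.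
have Rw : complex.Re (cexp (- g)) = modulus (cexp (- g)) * cos (complex.Im (- g)) by rewrite mod_cexp.
have -> : 1 - modulus (1 - cexp (- g)) ^+ 2 = 2 * complex.Re (cexp (- g)) - modulus (cexp (- g)) ^+ 2.
  by rewrite !mod_sqr !(ReD, ImD, ReN, ImN)/=; ring.
rewrite Rw; have := mod_ge0 (cexp (- g)); move: (modulus _) w1 (cos _) c1 => m m1 c c1 m0; nra.
Qed.

Lemma expRN_le (x : R) : 0 < 1 + x -> expR (- x) <= (1 + x)^-1.
Proof.
move=> x0; rewrite -[leRHS]mul1r ler_pdivlMr//.
have h := @expR_ge1Dx R x.
have : expR x * expR (- x) = 1 by rewrite -expRD subrr expR0.
have := expR_gt0 (- x); move: (expR x) (expR (- x)) h => a c h a0 ac; nra.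
Qed.

End ExpReal.

(** * The peaking function *)

Lemma abs_le_shift (R : realType) (x q : R) : -3 <= x -> x <= q + 1 -> 0 <= q -> `|x| <= q + 4.
Proof. by move=> h1 h2 h3; rewrite ler_norml; apply/andP; split; lra. Qed.

Section Construction.
Context {R : realType}.
Variables (E : set (cplane R)) (V : nat -> R) (G : nat -> cplane R -> cplane R).
Hypotheses (cE : closed E) (EC : E `<=` unit_circle)
  (gp : forall j, good_potential E (half_pow j) (V j) (G j))
  (V_big : forall j, 256 * 4 ^+ j <= Num.sqrt (V j)).

Let v j := Num.sqrt (V j).
Let e j : R := half_pow j / v j.

Let v_gt0 j : 0 < v j.
Proof. by apply: lt_le_trans (V_big j); rewrite mulr_gt0// exprn_gt0. Qed.

Let V_sqr j : V j = v j ^+ 2.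
Proof. by rewrite sqr_sqrtr// ltW// -sqrtr_gt0; exact: v_gt0. Qed.

Let e_gt0 j : 0 < e j.
Proof. by rewrite divr_gt0// half_pow_gt0. Qed.

Let e_le j : e j <= half_pow j / 256.
Proof.
rewrite /e; apply: ler_wpM2l; first exact: ltW (half_pow_gt0 j).
rewrite lef_pV2 ?posrE//.
by apply: le_trans (V_big j); rewrite ler_peMr// exprn_ege1// ler1n.
Qed.

Let e_le_half j : e j <= half_pow j.
Proof. by have := e_le j; have := half_pow_gt0 (R := R) j; lra. Qed.

Let eV j : e j * V j = half_pow j * v j.
Proof. by rewrite V_sqr /e; have := v_gt0 j; move: (v j) => x x0; field; rewrite gt_eqF. Qed.

Let sum_half J : \sum_(j < J) half_pow j = 2 - 2 * half_pow J :> R.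
Proof.
elim: J => [|J IH]; first by rewrite big_ord0 /half_pow expr0; ring.
by rewrite big_ord_recr/= IH half_powS; field.
Qed.

Let sum_e J : \sum_(j < J) e j <= 1 / 128.
Proof.
apply: (@le_trans _ _ (\sum_(j < J) half_pow j / 256)); first by apply: ler_sum => j _; exact: e_le.
by rewrite -mulr_suml sum_half; have := half_pow_gt0 (R := R) J; lra.
Qed.

(** The partial sums of [g], the weighted sum of the potentials with weights
[e j = 2 ^ - j / sqrt (V j)]. The weights make the energies summable, since
[e j ^ 2 V j = 4 ^ - j], while [e j V j] still tends to infinity, so that [g]
blows up at [E]. *)
Let S J z : cplane R := \sum_(j < J) rc (e j) * G j z.

Let S_recr J z : S J.+1 z = S J z + rc (e J) * G J z.
Proof. by rewrite /S big_ord_recr. Qed.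

Let S0 J : S J 0 = 0.
Proof.
rewrite /S big1// => j _; have [[b _ [M ->]] _ _ _ _ _] := gp j.
by rewrite /power_poly big1 ?mulr0// => i _; rewrite expr0n/= mulr0.
Qed.

Let G_cvg j z : G j w @[w --> z] --> G j z.
Proof. by have [[b _ [M ->]] _ _ _ _ _] := gp j; exact: (cderiv_cvg (power_poly_cderiv b M z)). Qed.

Let S_cvg J z : S J w @[w --> z] --> S J z.
Proof.
elim: J => [|J IH].
  have -> : S 0 = (fun=> 0) by apply/funext => w; rewrite /S big_ord0.
  exact: (cderiv_cvg (cderiv_cst z 0)).
have -> : S J.+1 = (fun w => S J w + rc (e J) * G J w) by apply/funext => w; exact: S_recr.
apply: (@cvg_cplaneD R _ (nbhs z) (nbhs_filter z) _ _ _ _ IH).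
apply: (@cvg_cplaneM R _ (nbhs z) (nbhs_filter z)); last exact: G_cvg.
exact: (cderiv_cvg (cderiv_cst z _)).
Qed.

Let S_Re J z : modulus z <= 1 -> - (3 / 128) <= complex.Re (S J z).
Proof.
move=> z1; rewrite /S Re_sum.
apply: (@le_trans _ _ (\sum_(j < J) e j * -3)); first by rewrite -mulr_suml; have := sum_e J; lra.
apply: ler_sum => j _; rewrite Re_rcM; apply: ler_wpM2l; first exact: ltW (e_gt0 j).
by have [_ H _ _ _ _] := gp j; have [] := H z z1.
Qed.

Let S_Im J z : modulus z <= 1 -> `|complex.Im (S J z)| <= 3 / 128.
Proof.
move=> z1; rewrite /S Im_sum; apply: le_trans (ler_norm_sum _ _ _) _.
apply: (@le_trans _ _ (\sum_(j < J) e j * 3)); last by rewrite -mulr_suml; have := sum_e J; lra.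
apply: ler_sum => j _; rewrite Im_rcM normrM (ger0_norm (ltW (e_gt0 j))).
apply: ler_wpM2l; first exact: ltW (e_gt0 j).
by have [_ H _ _ _ _] := gp j; have [] := H z z1.
Qed.

Let S_Re_one J k z : modulus z <= 1 -> (k < J)%N ->
  e k * complex.Re (G k z) - 3 / 128 <= complex.Re (S J z).
Proof.
move=> z1 kJ; rewrite /S Re_sum (bigD1 (Ordinal kJ))//= Re_rcM lerD2l.
apply: (@le_trans _ _ (\sum_(j < J | j != Ordinal kJ) e j * -3)).
  rewrite -mulr_suml; have : \sum_(j < J | j != Ordinal kJ) e j <= 1 / 128.
    apply: le_trans (sum_e J); rewrite [leRHS](bigD1 (Ordinal kJ))//= lerDr.
    exact: ltW (e_gt0 k).
  lra.
apply: ler_sum => j _; rewrite Re_rcM; apply: ler_wpM2l; first exact: ltW (e_gt0 j).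
by have [_ H _ _ _ _] := gp j; have [] := H z z1.
Qed.

Definition off z := modulus z <= 1 /\ ~ E z.

Let far_nbhs z0 : ~ E z0 -> exists2 d : R, 0 < d & forall z, modulus (z - z0) < d -> far_from E d z.
Proof.
move=> nE; have oE : open (~` E) by rewrite openC.
have /nbhs_cplaneP[r r0 Hr] : nbhs z0 (~` E) by apply: open_nbhs_nbhs.
exists (r / 2); first by rewrite divr_gt0.
move=> z zz y Ey; rewrite leNgt; apply/negP => h.
have : modulus (y - z0) < r.
  have -> : y - z0 = (y - z) + (z - z0) by ring.
  apply: le_lt_trans (modD _ _) _; lra.
by move/Hr.
Qed.

Let rate d : R := 4 / d + 7.

Let rate_ge0 d : 0 < d -> 0 <= rate d.
Proof. by move=> d0; rewrite addr_ge0// divr_ge0// ltW. Qed.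

Let S_step d z j : 0 < d -> modulus z <= 1 -> far_from E d z -> half_pow j <= d ->
  modulus (S j.+1 z - S j z) <= rate d * half_pow j.
Proof.
move=> d0 z1 fz jd; rewrite S_recr addrC addKr mod_rcM ?(ltW (e_gt0 j))// mulrC.
apply: ler_pM; rewrite ?mod_ge0 ?(ltW (e_gt0 j)) ?e_le_half//.
have [_ H F _ _ _] := gp j; have [lo im] := H z z1; have hi := F z d z1 d0 jd fz.
apply: le_trans (mod_le _) _; rewrite /rate.
have q0 : 0 <= 4 / d by rewrite divr_ge0// ltW.
have re : `|complex.Re (G j z)| <= 4 / d + 4.
  exact: abs_le_shift lo hi q0.
move: (4 / d) re => q re; lra.
Qed.

Let half_small (d : R) : 0 < d -> exists J, forall K, (J <= K)%N -> half_pow K <= d.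
Proof.
move=> d0; have [J H] := half_pow_small 1 d0; exists J => K /H; rewrite mul1r; exact: ltW.
Qed.

Let limit_unique (s : nat -> cplane R) (l l' : cplane R) A A' J0 J1 :
  (forall J, (J0 <= J)%N -> modulus (s J - l) <= A * half_pow J) ->
  (forall J, (J1 <= J)%N -> modulus (s J - l') <= A' * half_pow J) -> l = l'.
Proof.
move=> H H'; apply/eqP; rewrite -subr_eq0; apply/eqP; apply: mod_eq0; apply/eqP.
rewrite eq_le mod_ge0 andbT; apply: (@le_limit R _ _ (A + A') (J0 + J1)%N) => J JJ.
have h := H J (leq_trans (leq_addr _ _) JJ); have h' := H' J (leq_trans (leq_addl _ _) JJ).
have -> : l - l' = (s J - l') - (s J - l) by ring.
apply: le_trans (modD _ _) _; rewrite modN; lra.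
Qed.

(** At a point at distance [d] from [E], all but finitely many of the potentials
are at most [4 / d + 1], so the series converges geometrically. The rate is
recorded for every admissible [d], as it gives local uniformity. *)
Let limit_exists z : exists l : cplane R, off z -> forall d J, 0 < d -> far_from E d z -> half_pow J <= d ->
  modulus (S J z - l) <= 4 * rate d * half_pow J.
Proof.
have [[z1 nE]|no] := EM (off z); last by exists 0 => /no.
have [d0 d00 Hd0] := far_nbhs nE.
have f0 : far_from E d0 z by apply: Hd0; rewrite subrr mod0.
have lim d (dp : 0 < d) (fd : far_from E d z) J (Jd : half_pow J <= d) :
    exists l : cplane R, forall K, (J <= K)%N -> modulus (S K z - l) <= 4 * rate d * half_pow K.
  apply: geometric_limit; first exact: rate_ge0.
  by move=> j Jj; apply: S_step => //; apply: le_trans Jd; exact: half_pow_le.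
have [J0 HJ0] := half_small d00.
have [l Hl] := lim d0 d00 f0 J0 (HJ0 _ (leqnn _)).
exists l => _ d J dp fd Jd; have [l' Hl'] := lim d dp fd J Jd.
by rewrite (limit_unique Hl Hl'); exact: Hl'.
Qed.

Let g : cplane R -> cplane R := projT1 (choice limit_exists).

Let g_rate z d J : off z -> 0 < d -> far_from E d z -> half_pow J <= d ->
  modulus (S J z - g z) <= 4 * rate d * half_pow J.
Proof. by move=> oz; apply: (projT2 (choice limit_exists) z oz). Qed.

Let g_limit z : off z -> exists A J0, forall J, (J0 <= J)%N -> modulus (S J z - g z) <= A * half_pow J.
Proof.
move=> oz; have [d d0 Hd] := far_nbhs oz.2.
have fd : far_from E d z by apply: Hd; rewrite subrr mod0.
have [J0 HJ0] := half_small d0.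
by exists (4 * rate d), J0 => J JJ; apply: g_rate => //; exact: HJ0.
Qed.

Let g_Re_ge z x J1 : off z -> (forall J, (J1 <= J)%N -> x <= complex.Re (S J z)) -> x <= complex.Re (g z).
Proof.
move=> oz H; have [A [J0 HA]] := g_limit oz.
apply: (@le_limit R _ _ A (J0 + J1)%N) => J JJ.
have h := H J (leq_trans (leq_addl _ _) JJ); have h' := HA J (leq_trans (leq_addr _ _) JJ).
have := le_trans (ler_norm _) (le_trans (Re_le _) h'); rewrite ReD ReN.
by move: (complex.Re _) (complex.Re _) h => a b; lra.
Qed.

Let g_Re z : off z -> - (3 / 128) <= complex.Re (g z).
Proof. by move=> oz; apply: (@g_Re_ge z _ 0 oz) => J _; apply: S_Re; case: oz. Qed.

Let g_Re_one z k : off z -> e k * complex.Re (G k z) - 3 / 128 <= complex.Re (g z).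
Proof. by move=> oz; apply: (@g_Re_ge z _ k.+1 oz) => J kJ; apply: S_Re_one => //; case: oz. Qed.

Let g_Im z : off z -> `|complex.Im (g z)| <= 3 / 128.
Proof.
move=> oz; have [A [J0 HA]] := g_limit oz.
apply: (@le_limit R _ _ A J0) => J JJ; have h' := le_trans (Im_le _) (HA J JJ).
have h := S_Im J oz.1; rewrite ImD ImN in h'.
apply: le_trans (lerD h h').
by rewrite -[X in `|X| <= _](subKr (complex.Im (S J z))) ler_normB.
Qed.

Let off_disc z : unit_disc z -> off z.
Proof.
move=> zD; split; first exact: ltW.
by move/EC; rewrite /unit_circle/= => z1; move: zD; rewrite /unit_disc/= z1 ltxx.
Qed.

Let g0 : g 0 = 0.
Proof.
have o0 : off 0 by apply: off_disc; exact: unit_disc0.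
have [A [J0 HA]] := g_limit o0.
apply: (@limit_unique (fun J => S J 0) _ _ A 0 J0 0%N HA) => J _.
by rewrite S0 subrr mod0 mul0r.
Qed.

(** The convergence is uniform near a point off [E]. *)
Let g_cvg z0 : off z0 -> forall ep : R, 0 < ep -> exists2 r : R, 0 < r & forall z, modulus z <= 1 ->
  modulus (z - z0) < r -> off z /\ modulus (g z - g z0) < ep.
Proof.
move=> oz ep ep0; have [d d0 Hd] := far_nbhs oz.2.
have offd z : modulus z <= 1 -> modulus (z - z0) < d -> off z.
  move=> z1 zd; split => // Ez; have := Hd z zd z Ez; rewrite subrr mod0; lra.
have [J1 HJ1] := half_small d0.
have e3 : 0 < ep / 3 by rewrite divr_gt0.
have [J2 HJ2] := half_pow_small (4 * rate d) e3.
pose J := (J1 + J2)%N.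
have h1 := HJ1 J (leq_addr _ _); have h2 := HJ2 J (leq_addl _ _).
have /nbhs_cplaneP[r r0 Hr] := @cvg_near_lt R _ (nbhs z0) (nbhs_filter z0) (S J) (S J z0) _ e3 (@S_cvg J z0).
exists (Num.min r d); first by rewrite lt_min r0.
move=> z z1; rewrite lt_min => /andP[zr zd].
have oz' := offd z z1 zd; split => //.
have fz0 : far_from E d z0 by apply: Hd; rewrite subrr mod0.
have a1 := g_rate oz' d0 (Hd z zd) h1; have a2 := g_rate oz d0 fz0 h1; have a3 := Hr z zr.
have -> : g z - g z0 = (S J z - S J z0) + (S J z0 - g z0) - (S J z - g z) by ring.
apply: le_lt_trans (modD _ _) _; rewrite modN; have := modD (S J z - S J z0) (S J z0 - g z0).
move: (modulus (S J z - g z)) (modulus (S J z0 - g z0)) (modulus (S J z - S J z0)) a1 a2 a3 h2.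
move: (4 * rate d * half_pow J) (modulus _) => c m x y t; lra.
Qed.

(** The derivatives of the potentials, with the remainder estimate. *)
Let dG j : exists D : cplane R -> cplane R, (forall z, cderiv (G j) z (D z)) /\
  forall r z, 0 <= r < 1 -> modulus z <= r -> modulus (D z) <= 4 / (1 - r) /\
    forall w, modulus w <= r -> modulus (G j w - G j z - D z * (w - z)) <= 4 * (1 - r) ^- 2 * modulus (w - z) ^+ 2.
Proof.
have [[b b4 [M ->]] _ _ _ _ _] := gp j; exists (power_poly_der b M); split.
  by move=> z; exact: power_poly_cderiv.
by move=> r z rr zr; split; [exact: power_poly_der_bound|move=> w wr; exact: power_poly_remainder].
Qed.

Let D := projT1 (choice dG).
Let DG j z : cderiv (G j) z (D j z).
Proof. by case: (projT2 (choice dG) j). Qed.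
Let D_bound j r z : 0 <= r < 1 -> modulus z <= r -> modulus (D j z) <= 4 / (1 - r) /\
    forall w, modulus w <= r -> modulus (G j w - G j z - D j z * (w - z)) <= 4 * (1 - r) ^- 2 * modulus (w - z) ^+ 2.
Proof. by case: (projT2 (choice dG) j) => _; apply. Qed.

Let SD J z : cplane R := \sum_(j < J) rc (e j) * D j z.

Let SD_limit z : exists l : cplane R, unit_disc z -> exists A J0, forall J, (J0 <= J)%N ->
  modulus (SD J z - l) <= A * half_pow J.
Proof.
have [zD|nz] := EM (unit_disc z); last by exists 0 => /nz.
have rr : 0 <= modulus z < 1 by rewrite mod_ge0.
have A0 : 0 <= 4 / (1 - modulus z) by rewrite divr_ge0// subr_ge0 ltW.
have [|l Hl] := @geometric_limit R (fun J => SD J z) (4 / (1 - modulus z)) 0 A0.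
  move=> j _; have -> : SD j.+1 z = SD j z + rc (e j) * D j z by rewrite /SD big_ord_recr.
  rewrite addrC addKr mod_rcM ?(ltW (e_gt0 j))// mulrC.
  apply: ler_pM; rewrite ?mod_ge0 ?(ltW (e_gt0 j))//.
  by have [] := D_bound j rr (lexx _).
by exists l => _; exists (4 * (4 / (1 - modulus z))), 0%N.
Qed.

Let dg : cplane R -> cplane R := projT1 (choice SD_limit).
Let dg_limit z : unit_disc z -> exists A J0, forall J, (J0 <= J)%N ->
  modulus (SD J z - dg z) <= A * half_pow J.
Proof. exact: (projT2 (choice SD_limit) z). Qed.

(** The remainder estimate passes to the limit. *)
Let g_cderiv z : unit_disc z -> cderiv g z (dg z).
Proof.
move=> zD; set r := (1 + modulus z) / 2.
have z1 : modulus z < 1 := zD; have z0 := mod_ge0 z.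
have rr : 0 <= r < 1 by rewrite /r; apply/andP; split; lra.
have zr : modulus z <= r by rewrite /r; lra.
have q0 : 0 < (1 - modulus z) / 2 by rewrite divr_gt0// subr_gt0.
have K0 : 0 <= 4 * (1 - r) ^- 2 by rewrite mulr_ge0// invr_ge0 sqr_ge0.
apply: (@cderiv_quadratic R g z (dg z) (4 * (1 - r) ^- 2) _ q0) => h hq.
have wr : modulus (z + h) <= r by apply: le_trans (modD _ _) _; rewrite /r; lra.
have wD : unit_disc (z + h) by rewrite /unit_disc/=; apply: le_lt_trans wr _; case/andP: rr.
have [A1 [J1 H1]] := g_limit (off_disc zD).
have [A2 [J2 H2]] := g_limit (off_disc wD).
have [A3 [J3 H3]] := dg_limit zD.
have fin J : modulus (S J (z + h) - S J z - SD J z * h) <= 4 * (1 - r) ^- 2 * modulus h ^+ 2.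
  rewrite /S /SD mulr_suml -!sumrB; apply: le_trans (mod_sum _ _ _) _.
  apply: (@le_trans _ _ (\sum_(j < J) e j * (4 * (1 - r) ^- 2 * modulus h ^+ 2))).
    apply: ler_sum => j _.
    have -> : rc (e j) * G j (z + h) - rc (e j) * G j z - rc (e j) * D j z * h =
      rc (e j) * (G j (z + h) - G j z - D j z * h) by ring.
    rewrite mod_rcM ?(ltW (e_gt0 j))//; apply: ler_wpM2l; first exact: ltW (e_gt0 j).
    have [_ /(_ (z + h) wr)] := D_bound j rr zr.
    by have -> : z + h - z = h by ring.
  rewrite -mulr_suml; apply: ler_piMl; first exact: mulr_ge0 K0 (sqr_ge0 _).
  by have := sum_e J; lra.
apply: (@le_limit R _ _ (A1 + A2 + A3 * modulus h) (J1 + J2 + J3)%N) => J JJ.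
have JJ1 : (J1 <= J)%N by apply: leq_trans JJ; rewrite -addnA leq_addr.
have JJ2 : (J2 <= J)%N by apply: leq_trans JJ; rewrite -addnA addnCA leq_addr.
have JJ3 : (J3 <= J)%N by apply: leq_trans JJ; rewrite leq_addl.
have -> : g (z + h) - g z - dg z * h = (S J (z + h) - S J z - SD J z * h) +
   ((S J z - g z) - (S J (z + h) - g (z + h)) + (SD J z - dg z) * h) by ring.
apply: le_trans (modD _ _) _; apply: lerD; first exact: fin.
apply: le_trans (modD _ _) _; rewrite [(A1 + A2 + _) * _]mulrDl [(A1 + A2) * _]mulrDl; apply: lerD.
  by apply: le_trans (modD _ _) _; rewrite modN; apply: lerD; [exact: H1|exact: H2].
by rewrite modM mulrAC; apply: ler_wpM2r; [exact: mod_ge0|exact: H3].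
Qed.

(** Near [E] the real part of [g] tends to infinity, hence the value 1
on [E]. *)
Definition peak z : cplane R := if `[< E z >] then 1 else 1 - cexp (- g z).

Lemma peak_on z : E z -> peak z = 1.
Proof. by move=> Ez; rewrite /peak; case: asboolP. Qed.

Lemma peak_off z : ~ E z -> peak z = 1 - cexp (- g z).
Proof. by move=> Ez; rewrite /peak; case: asboolP. Qed.

Lemma peak_gap z : off z -> expR (- complex.Re (g z)) / 2 <= 1 - modulus (peak z) ^+ 2.
Proof.
move=> oz; rewrite (peak_off oz.2); have := one_sub_cexp (g_Re oz) (g_Im oz).
by rewrite mod_cexp ReN.
Qed.

Lemma peak_lt1 z : off z -> modulus (peak z) < 1.
Proof.
move=> oz; have := peak_gap oz; have := expR_gt0 (- complex.Re (g z)).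
have := mod_ge0 (peak z); move: (expR _) (modulus _) => x m m0 x0 h.
rewrite ltNge; apply/negP => m1; have : 1 <= m ^+ 2 by rewrite expr2; nra.
lra.
Qed.

Lemma peak_maps_disc : maps_disc peak.
Proof. by move=> z /off_disc/peak_lt1. Qed.

Lemma peak0 : peak 0 = 0.
Proof.
have o0 : off 0 by apply: off_disc; exact: unit_disc0.
by rewrite (peak_off o0.2) g0 oppr0 cexp0 subrr.
Qed.

Lemma peak_level_one : level_set peak 1 = E.
Proof.
apply/seteqP; split => z /=.
  move=> [zC h]; apply: contrapT => nE.
  have oz : off z by split => //; rewrite zC.
  by have := peak_lt1 oz; rewrite ltNge h.
move=> Ez; split; first exact: EC.
by rewrite peak_on// mod1.
Qed.

Lemma peak_cderiv z : unit_disc z -> cderiv peak z (cexp (- g z) * dg z).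
Proof.
move=> zD.
have d1 : cderiv (fun w => -1 * g w) z (-1 * dg z + 0 * g z).
  by apply: (cderiv_eq (cderivM (cderiv_cst z (-1)) (g_cderiv zD))); ring.
have d2 := cderivM (cderiv_cst z (-1)) (cderiv_comp d1 (cderiv_cexp (-1 * g z))).
have d3 := cderivD (cderiv_cst z 1) d2.
have r0 : 0 < 1 - modulus z by rewrite subr_gt0; exact: zD.
apply: (cderiv_near r0 _ (cderiv_eq d3 (l := cexp (- g z) * dg z) _)).
  move=> h hr; have hD : unit_disc (z + h).
    by rewrite /unit_disc/=; apply: le_lt_trans (modD _ _) _; lra.
  by rewrite (peak_off (off_disc hD).2) !mulN1r.
rewrite !mulN1r; ring.
Qed.

Lemma peak_holomorphic : holomorphic peak.
Proof. by move=> z /peak_cderiv/cderiv_derivable. Qed.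

Let big_at j : 256 * 2 ^+ j <= e j * V j.
Proof.
rewrite eV; apply: le_trans (ler_wpM2l (ltW (half_pow_gt0 j)) (V_big j)).
have -> : half_pow j * (256 * 4 ^+ j) = 256 * (half_pow j * 4 ^+ j) :> R by ring.
rewrite ler_pM2l// /half_pow -exprMn.
have -> : 2^-1 * 4 = 2 :> R by field.
exact: lexx.
Qed.

(** All the other terms of the series have real part bounded below by
[- 3 e j], and [e j V j] dominates the total loss. *)
Let g_Re_large j z : off z -> V j - 18 <= complex.Re (G j z) -> half_pow j * v j / 2 <= complex.Re (g z).
Proof.
move=> oz h; have := g_Re_one j oz; have := ler_wpM2l (ltW (e_gt0 j)) h.
rewrite mulrBr eV; have := big_at j; rewrite eV.
have : 1 <= 2 ^+ j :> R by rewrite exprn_ege1// ler1n.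
have := e_le j; have : half_pow j <= 1 :> R by have := half_pow_le (R := R) (leq0n j); rewrite /half_pow expr0.
have := e_gt0 j; move: (complex.Re _) (complex.Re _) (2 ^+ j : R) (half_pow j * v j) => x y t u.
move: (e j) (half_pow j) => q hp; lra.
Qed.

(** At a point of [E], a single potential with large index already forces
[exp (- g)] to be small in a whole neighbourhood, because [Re G_j] is at least
[V j - 18] there. *)
Lemma peak_continuous : {within closed_disc, continuous peak}.
Proof.
apply/subspace_continuousP => z0 z01.
apply/cvg_cplaneP => ep ep0.
suff [r r0 Hr] : exists2 r : R, 0 < r & forall z, modulus z <= 1 -> modulus (z - z0) < r ->
    modulus (peak z - peak z0) < ep.
  have nb : nbhs z0 [set z | modulus (z - z0) < r] by apply/nbhs_cplaneP; exists r.
  by apply: filterS nb => z zr z1; exact: Hr.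
have [Ez0|nE0] := EM (E z0).
  rewrite (peak_on Ez0).
  have [j Hj] := half_pow_small 1 ep0.
  have /nbhs_cplaneP[r r0 Hr] := @cvg_near_lt R _ (nbhs z0) (nbhs_filter z0) (G j) (G j z0) _ ltr01 (@G_cvg j z0).
  exists r => // z z1 zr; have [Ez|nE] := EM (E z); first by rewrite peak_on// subrr mod0.
  have oz : off z by [].
  have on : V j - 2 <= complex.Re (G j z0) by have [_ _ _ H _ _] := gp j; exact: H.
  have cl := le_lt_trans (Re_le _) (Hr z zr); rewrite ReD ReN ltr_norml in cl.
  have big : V j - 18 <= complex.Re (G j z).
    by move/andP: cl => [+ _]; move: (complex.Re _) (complex.Re _) on => a b; lra.
  have := g_Re_large oz big; rewrite -eV; have := big_at j => b1 b2.
  rewrite (peak_off nE); have -> : 1 - cexp (- g z) - 1 = - cexp (- g z) by ring.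
  rewrite modN mod_cexp ReN.
  have := Hj j (leqnn _); rewrite mul1r; apply: le_lt_trans.
  have t0 : 0 < 2 ^+ j :> R by rewrite exprn_gt0.
  apply: le_trans (expRN_le _) _; first by move: (complex.Re _) b2 => x; lra.
  rewrite /half_pow exprVn lef_pV2 ?posrE//; first by move: (complex.Re _) b2 => x; lra.
  by move: (complex.Re _) b2 => x; lra.
have oz : off z0 by [].
have c1 : (fun w => 1 - cexp (- w)) w @[w --> g z0] --> 1 - cexp (- g z0).
  have d1 : cderiv (fun w => -1 * w) (g z0) (-1 * 1 + 0 * g z0).
    by apply: (cderiv_eq (cderivM (cderiv_cst (g z0) (-1)) (cderiv_id (g z0)))); ring.
  have d2 := cderivD (cderiv_cst (g z0) 1) (cderivM (cderiv_cst (g z0) (-1)) (cderiv_comp d1 (cderiv_cexp (-1 * g z0)))).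
  have := cderiv_cvg d2; rewrite !mulN1r.
  by under eq_fun do rewrite !mulN1r.
have /nbhs_cplaneP[r1 r10 H1] := @cvg_near_lt R _ (nbhs (g z0)) (nbhs_filter (g z0)) _ _ _ ep0 c1.
have [r r0 Hr] := g_cvg oz r10.
exists r => // z z1 zr; have [oz' gz] := Hr z z1 zr.
by rewrite (peak_off oz'.2) (peak_off nE0); exact: H1.
Qed.

Lemma peak_level_large j s z : unit_circle z -> s <= 1 - expR (- (half_pow j * v j / 2)) ->
  V j - 18 <= complex.Re (G j z) -> level_set peak s z.
Proof.
move=> zC sX h; split => //; apply: le_trans sX _.
have [Ez|nE] := EM (E z).
  by rewrite peak_on// mod1 lerBlDr lerDl ltW// expR_gt0.
have oz : off z by split => //; rewrite zC.
have big := g_Re_large oz h.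
rewrite (peak_off nE); have := modD (1 - cexp (- g z)) (cexp (- g z)); rewrite subrK mod1 mod_cexp ReN.
have : expR (- complex.Re (g z)) <= expR (- (half_pow j * v j / 2)) by rewrite ler_expR lerN2.
move: (expR _) (expR _) (modulus _) => x y m; lra.
Qed.

Let DE j : derive1 (G j) = D j.
Proof. by apply/funext => z; exact: (cderiv_derive1 (DG j z)). Qed.

Let G_holomorphic j : holomorphic (G j).
Proof. by move=> z _; exact: (cderiv_derivable (DG j z)). Qed.

Let D_meas j : dmeas (fun z => modulus (D j z) ^+ 2).
Proof. by have := energy_dmeas (@G_holomorphic j); rewrite DE. Qed.

Let SD_meas J : dmeas (fun z => modulus (SD J z) ^+ 2).
Proof.
suff c z : unit_disc z -> SD J w @[w --> z] --> SD J z by have [_ _] := dmeas_cplane c.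
move=> zD; elim: J => [|J IH].
  have -> : SD 0 = (fun=> 0) by apply/funext => w; rewrite /SD big_ord0.
  exact: (cderiv_cvg (cderiv_cst z 0)).
have -> : SD J.+1 = (fun w => SD J w + rc (e J) * D J w).
  by apply/funext => w; rewrite /SD big_ord_recr.
apply: (@cvg_cplaneD R _ (nbhs z) (nbhs_filter z) _ _ _ _ IH).
apply: (@cvg_cplaneM R _ (nbhs z) (nbhs_filter z)); first exact: (cderiv_cvg (cderiv_cst z _)).
by have := holomorphic_derive1_cvg (@G_holomorphic J) zD; rewrite DE.
Qed.

Let weighted_energy J :
  dmeas (fun z => \sum_(j < J) 2 ^+ j.+1 * e j ^+ 2 * modulus (D j z) ^+ 2) /\
  (dint (fun z => \sum_(j < J) 2 ^+ j.+1 * e j ^+ 2 * modulus (D j z) ^+ 2)%R <=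
   (8 * areaR * \sum_(j < J) half_pow j)%:E)%E.
Proof.
have c0 j : 0 <= 2 ^+ j.+1 * e j ^+ 2 :> R by apply: mulr_ge0; [exact: exprn_ge0|exact: sqr_ge0].
have sq j : nonneg_on (fun z => modulus (D j z) ^+ 2) by move=> z _; exact: sqr_ge0.
elim: J => [|J [m1 IH]].
  have E0 : (fun z => \sum_(j < 0) 2 ^+ j.+1 * e j ^+ 2 * modulus (D j z) ^+ 2) = (fun=> 0).
    by apply/funext => z; rewrite big_ord0.
  rewrite E0 big_ord0 mulr0; split; first exact: cst_dmeas.
  by rewrite /dint integral0.
have E1 : (fun z => \sum_(j < J.+1) 2 ^+ j.+1 * e j ^+ 2 * modulus (D j z) ^+ 2) =
  (fun z => \sum_(j < J) 2 ^+ j.+1 * e j ^+ 2 * modulus (D j z) ^+ 2 +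
     2 ^+ J.+1 * e J ^+ 2 * modulus (D J z) ^+ 2) by apply/funext => z; rewrite big_ord_recr.
have m2 : dmeas (fun z => 2 ^+ J.+1 * e J ^+ 2 * modulus (D J z) ^+ 2).
  exact: (measurable_funM (cst_dmeas _) (D_meas J)).
rewrite E1 big_ord_recr mulrDr EFinD; split; first exact: (measurable_funD m1 m2).
rewrite dintD//; last 2 first.
- by move=> z _; apply: sumr_ge0 => j _; apply: mulr_ge0 => //; exact: sqr_ge0.
- by move=> z _; apply: mulr_ge0 => //; exact: sqr_ge0.
apply: leeD; first exact: IH.
rewrite (dintZ (D_meas J) (@sq J) (c0 J)).
have [_ _ _ _ en _] := gp J; rewrite /energy DE in en.
have c0e : (0 <= (2 ^+ J.+1 * e J ^+ 2)%:E)%E by rewrite lee_fin.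
apply: le_trans (lee_wpmul2l c0e en) _; rewrite -EFinM lee_fin.
have -> : 2 ^+ J.+1 * e J ^+ 2 * (4 * areaR * V J) = 4 * areaR * (2 ^+ J.+1 * (e J * (e J * V J))) by ring.
have -> : e J * (e J * V J) = half_pow J ^+ 2.
  by rewrite eV /e; have := v_gt0 J; move: (v J) => x x0; field; rewrite gt_eqF.
have -> : 2 ^+ J.+1 * half_pow J ^+ 2 = 2 * half_pow J :> R.
  have h1 : 2 ^+ J * half_pow J = 1 :> R by rewrite /half_pow -exprMn mulfV ?expr1n// pnatr_eq0.
  by rewrite exprS -mulrA [half_pow J ^+ 2]expr2 [2 ^+ J * _]mulrA h1 mul1r.
by rewrite le_eqVlt; apply/orP; left; apply/eqP; ring.
Qed.

Let SD_energy J : (dint (fun z => modulus (SD J z) ^+ 2)%R <= (16 * areaR)%:E)%E.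
Proof.
have [m1 b1] := weighted_energy J.
apply: (@le_trans _ _ (8 * areaR * \sum_(j < J) half_pow j)%:E).
  apply: le_trans b1; apply: (dint_le (SD_meas J) m1); first by move=> z _; exact: sqr_ge0.
  move=> z _; apply: le_trans (sqr_sum_weighted J (fun j => rc (e j) * D j z)) _; apply: ler_sum => j _.
  by rewrite mod_rcM ?(ltW (e_gt0 j))// exprMn mulrA.
rewrite lee_fin sum_half; have := @areaR_gt0 R; have := half_pow_gt0 (R := R) J.
by move: (half_pow J) (areaR : R) => x a x0 a0; nra.
Qed.

Let dgE z : unit_disc z -> derive1 g z = dg z.
Proof. by move/g_cderiv/cderiv_derive1. Qed.

Let g_holomorphic : holomorphic g.
Proof. by move=> z /g_cderiv/cderiv_derivable. Qed.

Let SD_cvg z : unit_disc z -> SD J z @[J --> \oo] --> dg z.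
Proof.
move=> zD; apply/cvg_cplaneP => ep ep0.
have [A [J0 H]] := dg_limit zD; have [J1 H1] := half_pow_small A ep0.
exists (J0 + J1)%N => // J /= JJ; apply: le_lt_trans (H J _) (H1 J _).
  exact: leq_trans (leq_addr _ _) JJ.
exact: leq_trans (leq_addl _ _) JJ.
Qed.

(** Fatou's lemma for the derivatives of the partial sums. *)
Let g_energy : (energy g <= (16 * areaR)%:E)%E.
Proof.
pose f J (p : R * R) : \bar R := (modulus (SD J (of_pair p)) ^+ 2)%:E.
have mf J : measurable_fun (@disc_pair R) (f J) by exact: (dmeas_EFin (SD_meas J)).
have f0 J p : disc_pair p -> (0 <= f J p)%E by move=> _; rewrite lee_fin sqr_ge0.
have F := @fatou _ _ _ (@plane_measure R) _ measurable_disc_pair f mf f0.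
have E1 : energy g = (\int[@plane_measure R]_(p in @disc_pair R) limn_einf (f ^~ p))%E.
  apply: eq_integral => p; rewrite inE => pD.
  have c : f J p @[J --> \oo] --> (modulus (dg (of_pair p)) ^+ 2)%:E.
    apply/fine_cvgP; split; first exact: nearW.
    have cm := @cvg_modulus R _ \oo _ _ _ (SD_cvg pD).
    exact: (cvgM (cm _) (cm _)).
  by rewrite (dgE pD); have [-> _] := cvg_limn_einf_sup c.
rewrite E1; apply: (le_trans F); rewrite limn_einf_lim.
apply: lime_le; first exact: is_cvg_einfs.
apply: nearW => J; apply: le_trans (SD_energy J).
apply: ereal_inf_lbound; exists J; [exact: leqnn|exact: erefl].
Qed.

Let ratio z : R := modulus (derive1 peak z) ^+ 2 * (1 - modulus (peak z) ^+ 2) ^- 2.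

Let ratio_meas : dmeas ratio.
Proof.
pose f z : cplane R := rc ((1 - modulus (peak z) ^+ 2)^-1) * derive1 peak z.
have cf z : unit_disc z -> f w @[w --> z] --> f z.
  move=> zD; apply: (@cvg_cplaneM R _ (nbhs z) (nbhs_filter z)); last first.
    exact: (holomorphic_derive1_cvg peak_holomorphic zD).
  have c1 := cvg_mod_sqr (cderiv_cvg (peak_cderiv zD)).
  have c2 : 1 - modulus (peak w) ^+ 2 @[w --> z] --> 1 - modulus (peak z) ^+ 2.
    by have c := cvgB (cvg_cst (1 : R)) c1; exact: (c (nbhs_filter z) (nbhs_filter z)).
  have nz : 1 - modulus (peak z) ^+ 2 != 0.
    rewrite subr_eq0 eq_sym lt_eqF// expr_lt1 ?mod_ge0//; exact: peak_lt1 (off_disc zD).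
  have c3 : (1 - modulus (peak w) ^+ 2)^-1 @[w --> z] --> (1 - modulus (peak z) ^+ 2)^-1.
    exact: (cvgV nz c2).
  exact: (@cvg_Complex R _ (nbhs z) (nbhs_filter z) (fun w => (1 - modulus (peak w) ^+ 2)^-1) (fun=> 0) _ _ c3 (cvg_cst 0)).
have [_ _] := dmeas_cplane cf.
have -> // : (fun z => modulus (f z) ^+ 2) = ratio.
apply/funext => z; rewrite /f /ratio modM mod_rc exprMn real_normK ?num_real//.
by rewrite mulrC exprVn.
Qed.

Let ratio_le z : unit_disc z -> ratio z <= 4 * modulus (derive1 g z) ^+ 2.
Proof.
move=> zD; have oz := off_disc zD; have gap := peak_gap oz.
rewrite /ratio (cderiv_derive1 (peak_cderiv zD)) (dgE zD) modM mod_cexp ReN.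
have x0 := expR_gt0 (- complex.Re (g z)).
set y := 1 - modulus (peak z) ^+ 2 in gap *.
move: (expR _) x0 gap (modulus (dg z)) => x x0 gap d.
have y0 : 0 < y by apply: lt_le_trans gap; rewrite divr_gt0.
rewrite ler_pdivrMr ?exprn_gt0//.
have h : x ^+ 2 <= 4 * y ^+ 2 by nra.
by have := ler_wpM2l (sqr_ge0 d) h; rewrite exprMn; lra.
Qed.

Let ratio_energy : (dint ratio <= (64 * areaR)%:E)%E.
Proof.
have m := energy_dmeas g_holomorphic.
apply: (@le_trans _ _ (dint (fun z => 4 * modulus (derive1 g z) ^+ 2))).
  apply: (dint_le ratio_meas (measurable_funM (cst_dmeas 4) m)); last exact: ratio_le.
  by move=> z _; apply: mulr_ge0; [exact: sqr_ge0|rewrite invr_ge0; exact: sqr_ge0].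
rewrite (dintZ m (fun z _ => sqr_ge0 _)) //.
have four : (0 <= (4 : R)%:E)%E by rewrite lee_fin.
apply: le_trans (lee_wpmul2l four g_energy) _.
by rewrite -EFinM lee_fin le_eqVlt; apply/orP; left; apply/eqP; ring.
Qed.

(** With [w = exp (- g)], [|peak'| = |w| |g'|] and [1 - |peak| ^ 2 >= |w| / 2],
so the hyperbolic weight is at most [4 |g'| ^ 2], which is integrable. *)
Lemma peak_hilbert_schmidt : hilbert_schmidt (composition_operator peak).
Proof.
exact: (comp_hilbert_schmidt peak_holomorphic peak_maps_disc peak0 ratio_meas ratio_energy).
Qed.

Lemma peak_dirichlet : dirichlet peak.
Proof.
apply/dirichletP; split; first exact: peak_holomorphic.
apply: (@le_lt_trans _ _ (dint ratio)); last exact: le_lt_trans ratio_energy (ltry _).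
apply: dint_le; [exact: energy_dmeas peak_holomorphic|exact: ratio_meas|by move=> z _; exact: sqr_ge0|].
move=> z zD; rewrite /ratio; apply: ler_peMr; first exact: sqr_ge0.
have l1 := peak_lt1 (off_disc zD); have m0 := mod_ge0 (peak z).
have y0 : 0 < 1 - modulus (peak z) ^+ 2 by rewrite subr_gt0 expr_lt1.
have y1 : 1 - modulus (peak z) ^+ 2 <= 1 by rewrite gerBl sqr_ge0.
by rewrite invf_ge1 ?exprn_gt0// exprn_ile1// ltW.
Qed.

End Construction.

(** * Divergence of the capacity integral *)

Section Divergence.
Context {R : realType}.
Implicit Types (E F : set (cplane R)).

(** The integral of a nonnegative function is a supremum over the simple
functions below it, hence monotone even for functions that are not known to be
measurable, such as the capacity of level sets. *)
Lemma ge0_le_integral_sub d (T : measurableType d) (mu : {measure set T -> \bar R})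
    (D' D : set T) (g f : T -> \bar R) :
  D' `<=` D -> (forall x, D' x -> (0 <= g x)%E) -> (forall x, D x -> (0 <= f x)%E) ->
  (forall x, D' x -> (g x <= f x)%E) -> (\int[mu]_(x in D') g x <= \int[mu]_(x in D) f x)%E.
Proof.
move=> DD g0 f0 gf; rewrite !ge0_integralE//; apply: le_ereal_sup => _ [k /= kg <-].
exists k => //= x; apply: le_trans (kg x) _; rewrite !patchE.
case: ifPn => xD'; first by rewrite mem_set; [exact: gf (set_mem xD')|exact: DD (set_mem xD')].
by case: ifPn => // xD; exact: f0 (set_mem xD).
Qed.

Lemma integral_inv_one_sub (c a b : R) : 0 <= c -> a <= b -> b < 1 ->
  ((c * (ln (1 - a) - ln (1 - b)))%:E <= \int[lebesgue_measure]_(s in `[a, b]) (c / (1 - s))%:E)%E.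
Proof.
move=> c0 ab b1.
have cf : cont_on a b (fun s => c / (1 - s)).
  move=> x /andP[_ xb]; apply: continuousM; first exact: cst_continuous.
  apply: continuousV; first by rewrite subr_eq0 gt_eqF// (le_lt_trans xb).
  by apply: continuousB; [exact: cst_continuous|exact: cvg_id].
have dF x : a <= x <= b -> is_derive x 1 (fun s => - c * ln (1 - s)) (c / (1 - x)).
  move=> /andP[_ xb]; have x1 : 0 < 1 - x by rewrite subr_gt0 (le_lt_trans xb).
  have d1 : is_derive x 1 (fun s : R => 1 - s) (0 - 1).
    exact: is_deriveB.
  have d2 := @is_derive1_comp R (@ln R) (fun s => 1 - s) x _ _ (is_derive1_ln x1) d1.
  have d3 := is_deriveZ (- c) d2.
  by apply: is_derive_eq d3 _; rewrite sub0r /GRing.scale/= mulrN1 mulrNN.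
have := rint_FTC ab cf dF.
rewrite /rint /Rintegral.
have fi := cont_on_integrable cf.
have -> : (\int[lebesgue_measure]_(s in `[a, b]) (c / (1 - s))%:E =
  (fine (\int[lebesgue_measure]_(s in `[a, b]) (c / (1 - s))%:E))%:E)%E.
  by rewrite fineK//; exact: integrable_fin_num fi.
by move=> /= ->; rewrite lee_fin; lra.
Qed.

Lemma log_energy_ge0 (mu : probability (@borel_plane R) R) : (0 <= log_energy mu)%E.
Proof. by apply: nneseries_ge0 => n _ _; rewrite lee_fin divr_ge0// sqr_ge0. Qed.

Lemma log_capacity_ge0 F : (0 <= log_capacity F)%E.
Proof. by rewrite inve_ge0; apply: le_ereal_inf_tmp => _ [mu _ <-]; exact: log_energy_ge0. Qed.

Lemma log_capacity_lower F (V : R) (mu : probability (@borel_plane R) R) :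
  0 < V -> mu F = 1%E -> (log_energy mu <= V%:E)%E -> ((V^-1)%:E <= log_capacity F)%E.
Proof.
move=> V0 muF muV.
have -> : ((V^-1)%:E = (V%:E)^-1)%E by rewrite inver gt_eqF.
rewrite /log_capacity lee_pV2.
- by apply: le_trans muV; apply: ereal_inf_lbound; exists mu.
- by rewrite inE/= lee_fin ltW.
- by rewrite inE/=; apply: le_ereal_inf_tmp => _ [nu _ <-]; exact: log_energy_ge0.
Qed.

End Divergence.

Lemma expRN_lt_inv (R : realType) (x : R) : 0 < x -> expR (- x) < x^-1.
Proof.
move=> x0; rewrite expRN ltf_pV2 ?posrE ?expR_gt0//.
by have := expR_ge1Dx x; lra.
Qed.

(** The contribution of the [j]-th stage. The length of the interval in the
variable [log (1 / (1 - s))] is [X / 2], and that variable is at least [X / 2]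
there; since [X] is [p v / 2] with [v ^ 2 = V], the factor [V] in the capacity
cancels and only [p ^ 2 = 4 ^ - j] has to be compensated by [h]. *)
Lemma stage_count (R : realType) (j : nat) (p v V X : R) : 0 < p -> 0 < v -> V = v ^+ 2 ->
  1 <= V -> X = p * v / 2 ->
  j%:R <= ((V + 1)^-1 * (X / 2 * (32 * (p ^+ 2)^-1 * j%:R))) * (X / 2).
Proof.
move=> p0 v0 -> V1 ->.
have -> : ((v ^+ 2 + 1)^-1 * (p * v / 2 / 2 * (32 * (p ^+ 2)^-1 * j%:R))) * (p * v / 2 / 2) =
  2 * (v ^+ 2 / (v ^+ 2 + 1)) * j%:R.
  by field; rewrite !gt_eqF//; have := sqr_ge0 v; lra.
rewrite ler_peMl//; rewrite mulrA ler_pdivlMr; last lra.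
lra.
Qed.

Lemma weighted_ratio_le (R : realType) (w t k l m : R) : 0 <= w -> 0 <= t -> k <= l * m ->
  w * k / t <= w * (1 / t * l * m).
Proof.
move=> w0 t0 km; have -> : w * (1 / t * l * m) = w * (l * m) / t by rewrite mul1r; ring.
by apply: ler_wpM2r; [rewrite invr_ge0|apply: ler_wpM2l].
Qed.

Theorem theorem3p6 (R : realType) (h : R -> R) (E : set (cplane R))
    (h_ge1 : forall x : R, 1 <= x -> 1 <= h x)
    (h_lim : h x @[x --> +oo] --> +oo)
    (E_closed : closed E) (E_circle : E `<=` unit_circle)
    (E_neq0 : E !=set0) (E_cap : log_capacity E = 0%E) :
  exists phi : cplane R -> cplane R,
    [/\ disc_algebra phi, dirichlet phi & phi @` unit_disc `<=` unit_disc] /\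
    [/\ level_set phi 1 = E,
        hilbert_schmidt (composition_operator phi)
      & forall s0 : R, 0 < s0 < 1 ->
          (\int[lebesgue_measure]_(s in `]s0, 1%R[)
             (log_capacity (level_set phi s) *
              (1 / (1 - s) * ln (1 / (1 - s)) * h (1 / (1 - s)))%:E) = +oo)%E].
Proof.
have /choice [A HA] : forall j, exists B : R, 1 <= B /\
    forall x, B <= x -> 32 * (half_pow j ^+ 2)^-1 * j%:R <= h x.
  move=> j; move/cvgryPge : h_lim => /(_ (32 * (half_pow j ^+ 2)^-1 * j%:R)) [M [_ HM]].
  exists (Num.max 1 (M + 1)); split; first by rewrite le_max lexx.
  by move=> x; rewrite ge_max => /andP[_ Mx]; apply: HM; lra.
(* the first summand dominates the losses in the series; the second one makes
   [exp (X_j / 2)] reach the range where [h] is large *)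
pose C j : R := (256 * 4 ^+ j + 4 * (half_pow j)^-1 * A j) ^+ 2.
have /choice [VG HVG] : forall j, exists q : R * (cplane R -> cplane R),
    C j < q.1 /\ good_potential E (half_pow j) q.1 q.2.
  move=> j; have [V0 [G0 p]] := good_potential_exists (C j) E_closed E_circle E_neq0 E_cap (half_pow_gt0 j).
  by exists (V0, G0).
pose V j := (VG j).1; pose G j := (VG j).2.
have gp j : good_potential E (half_pow j) (V j) (G j) by have [] := HVG j.
have A1 j : 1 <= A j by have [] := HA j.
have b4 j : (256 : R) <= 256 * 4 ^+ j by rewrite ler_peMr// exprn_ege1// ler1n.
have ph j : 0 <= 4 * (half_pow j)^-1 * A j.
  by rewrite !mulr_ge0// ?invr_ge0 ?ltW ?half_pow_gt0//; have := A1 j; lra.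
have rootV j : 256 * 4 ^+ j + 4 * (half_pow j)^-1 * A j <= Num.sqrt (V j).
  have s0 : 0 <= 256 * 4 ^+ j + 4 * (half_pow j)^-1 * A j by have := b4 j; have := ph j; lra.
  rewrite -(ger0_norm s0) -sqrtr_sqr ler_sqrt ?ltW//; first by have [] := HVG j.
  by apply: le_lt_trans (sqr_ge0 _) _; have [h1 _] := HVG j; exact: h1.
have V_big j : 256 * 4 ^+ j <= Num.sqrt (V j) by have := rootV j; have := ph j; lra.
exists (peak E_closed gp V_big).
split; first split.
- by split; [exact: peak_continuous|exact: peak_holomorphic].
- exact: peak_dirichlet.
- by move=> _ [z zD <-]; exact: (peak_maps_disc E_closed E_circle gp V_big zD).
split; [exact: peak_level_one|exact: peak_hilbert_schmidt|].
move=> s0 /andP[s00 s01]; apply/eqyP => B B0.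
(* a single stage beats each bound [B]; [1 / (1 - s0)] puts it inside ]s0, 1[ *)
pose J : R := Num.max B (1 - s0)^-1.
have [j jJ] : exists j : nat, J <= j%:R by exists (Num.trunc J).+1; rewrite ltW// truncnS_gt.
have jB : B <= j%:R by apply: le_trans jJ; rewrite /J le_max lexx.
have js : (1 - s0)^-1 <= j%:R by apply: le_trans jJ; rewrite /J le_max lexx orbT.
pose v := Num.sqrt (V j).
have v256 : 256 <= v by apply: le_trans (b4 j) (V_big j).
have v0 : 0 < v by lra.
have Vv : V j = v ^+ 2 by rewrite sqr_sqrtr// ltW// -sqrtr_gt0.
have p0 := half_pow_gt0 (R := R) j.
pose X := half_pow j * v / 2.
have XA : A j <= X / 2.
  have := rootV j; rewrite -/v => h1.
  have : 4 * (half_pow j)^-1 * A j <= v by have := b4 j; lra.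
  rewrite mulrAC -ler_pdivlMr ?invr_gt0// invrK => h2.
  by rewrite /X; lra.
have Xj : j%:R < X / 2.
  have h1 : 256 * 4 ^+ j <= v := V_big j.
  have h2 : half_pow j * (256 * 4 ^+ j) <= half_pow j * v by rewrite ler_pM2l.
  have h3 : half_pow j * (256 * 4 ^+ j) = 256 * 2 ^+ j :> R.
    have -> : (4 : R) = 2 * 2 by rewrite -natrM.
    rewrite exprMn mulrCA; congr (_ * _); rewrite mulrA -[RHS]mul1r; congr (_ * _).
    by rewrite /half_pow -exprMn mulVf// expr1n.
  have h4 : (j%:R : R) < 2 ^+ j by rewrite -natrX ltr_nat ltn_expl.
  by rewrite /X; lra.
have X0 : 0 < X / 2 by apply: le_lt_trans Xj; rewrite ler0n.
pose a := 1 - expR (- (X / 2)); pose b := 1 - expR (- X).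
have ab : a <= b by rewrite /a /b lerD2l lerN2 ler_expR; lra.
have b1 : b < 1 by rewrite /b gtrBl expR_gt0.
have a0 : s0 < a.
  rewrite /a ltrBrDr -ltrBrDl; apply: lt_le_trans (expRN_lt_inv X0) _.
  rewrite -[leRHS]invrK lef_pV2 ?posrE ?invr_gt0 ?subr_gt0//.
  exact: le_trans js (ltW Xj).
pose H : R := 32 * (half_pow j ^+ 2)^-1 * j%:R.
pose c := (V j + 1)^-1 * (X / 2 * H).
have H0 : 0 <= H by rewrite /H !mulr_ge0// invr_ge0 exprn_ge0// ltW.
have V1 : 1 <= V j by rewrite Vv; apply: exprn_ege1; lra.
have c0 : 0 <= c by rewrite /c; apply: mulr_ge0; [rewrite invr_ge0; lra|apply: mulr_ge0 => //; exact: ltW].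
apply: (@le_trans _ _ (c * (ln (1 - a) - ln (1 - b)))%:E).
  rewrite lee_fin; apply: le_trans jB _.
  have -> : ln (1 - a) - ln (1 - b) = X / 2.
    by rewrite /a /b !subKr !expRK; lra.
  exact: (stage_count j p0 v0 Vv V1 (erefl X)).
apply: le_trans (integral_inv_one_sub c0 ab b1) _.
apply: ge0_le_integral_sub.
- by move=> s /=; rewrite !in_itv/= => /andP[as_ sb]; rewrite (lt_le_trans a0 as_)/= (le_lt_trans sb b1).
- move=> s /=; rewrite in_itv/= => /andP[_ sb]; rewrite lee_fin divr_ge0// subr_ge0 ltW//.
  exact: le_lt_trans sb b1.
- move=> s /=; rewrite in_itv/= => /andP[s0s s1].
  have i1 : 1 <= 1 / (1 - s) by rewrite div1r invf_ge1 ?subr_gt0//; lra.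
  apply: mule_ge0; first exact: log_capacity_ge0.
  by rewrite lee_fin !mulr_ge0 ?ln_ge0//; [lra|have := h_ge1 _ i1; lra].
move=> s /=; rewrite in_itv/= => /andP[sa sb].
have s1 : 0 < 1 - s by have := le_lt_trans sb b1; lra.
have [mu muF muE] : exists2 mu : probability (@borel_plane R) R,
    mu (level_set (peak E_closed gp V_big) s) = 1%E & (log_energy mu <= (V j + 1)%:E)%E.
  apply: (gp_measure (gp j)) => z zC zG; exact: (peak_level_large E_closed gp V_big zC sb zG).
have V10 : 0 < V j + 1 by lra.
have cap := log_capacity_lower V10 muF muE.
have big : expR (X / 2) <= 1 / (1 - s).
  rewrite div1r -[leLHS]invrK lef_pV2 ?posrE ?invr_gt0 ?expR_gt0// -expRN.
  by move: sa; rewrite /a; lra.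
have lnb : X / 2 <= ln (1 / (1 - s)).
  by rewrite -[leLHS]expRK ler_ln ?posrE ?expR_gt0//; apply: lt_le_trans big; exact: expR_gt0.
have hb : H <= h (1 / (1 - s)).
  have [_] := HA j; apply; apply: le_trans big; apply: le_trans XA _.
  by have := expR_ge1Dx (X / 2); lra.
have kb : X / 2 * H <= ln (1 / (1 - s)) * h (1 / (1 - s)) by apply: ler_pM => //; exact: ltW.
apply: (@le_trans _ _ (((V j + 1)^-1)%:E * (1 / (1 - s) * ln (1 / (1 - s)) * h (1 / (1 - s)))%:E)%E).
  rewrite -EFinM lee_fin; apply: weighted_ratio_le kb; [rewrite invr_ge0; exact: ltW|exact: ltW].
apply: lee_wpmul2r => //; rewrite lee_fin -mulrA; apply: mulr_ge0.
  by rewrite div1r invr_ge0 ltW.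
by apply: le_trans kb; apply: mulr_ge0 => //; exact: ltW.
Qed.
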